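(* For every $a\in\mathbb{C}$ and all real $y_1>y_2>0$ there exists a constant $C_3>0$ such that $\widetilde\zeta(s)$ has no $a$-point in $\{s\in\mathbb{C} : -y_1\le\sigma\le -y_2,\ |t|>C_3\}$.
   Context: Fix an integer $r\ge 2$ and real numbers $a_1\ge a_2\ge\cdots\ge a_r>0$. Write $s=\sigma+it$ with $\sigma,t\in\mathbb{R}$. The Euler-Zagier multiple zeta function is $\zeta(s_1,\dots,s_r)=\sum_{1\le n_1<\cdots<n_r} n_1^{-s_1}\cdots n_r^{-s_r}$, which converges absolutely when $\Re(s_l+\cdots+s_r)>r-l+1$ for all $1\le l\le r$ and is continued meromorphically to $\mathbb{C}^r$. With $\mathfrak{S}_r$ the symmetric group of degree $r$, define the meromorphic function on $\mathbb{C}$ $$\widetilde\zeta(s):=\sum_{\tau\in\mathfrak{S}_r}\zeta(a_{\tau(1)}s,\dots,a_{\tau(r)}s).$$ Equivalently (Hoffman's identity), $\widetilde\zeta(s)=\sum_{l=1}^r\sum_{P_1,\dots,P_l}(-1)^{r-l}\prod_{j=1}^l(\#(P_j)-1)!\,\zeta\bigl(\sum_{j'\in P_j}a_{j'}s\bigr)$, where $\{P_1,\dots,P_l\}$ runs over all partitions of the set $\{1,\dots,r\}$ into $l$ nonempty blocks and $\zeta$ on the right is the Riemann zeta function. An $a$-point of $\widetilde\zeta$ is a solution $s$ of $\widetilde\zeta(s)=a$. *)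

(* Defs.v *)
From HB Require Import structures.
From mathcomp Require Import all_boot all_order all_algebra all_fingroup.
From mathcomp Require Import all_classical all_reals all_analysis.
From mathcomp Require Import complex.

Set Implicit Arguments.
Unset Strict Implicit.
Unset Printing Implicit Defensive.

Import Order.TTheory GRing.Theory Num.Theory.
Import numFieldNormedType.Exports.

Local Open Scope ring_scope.
Local Open Scope complex_scope.
Local Open Scope classical_set_scope.

(* The ascription to numClosedFieldType is what gives R[i] (and 'rV[R[i]]_r)
   the topology and the normed module structure over R[i]. *)
Definition C (R : realType) : numClosedFieldType := R[i].

Definition cexp (R : realType) (z : C R) : C R :=
  (expR (complex.Re z) * cos (complex.Im z))
    +i* (expR (complex.Re z) * sin (complex.Im z)).

Definition natpow (R : realType) (n : nat) (z : C R) : C R :=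
  cexp (z * (ln (n%:R : R))%:C).

(* Differentiability here is over the complex numbers: 'd f is C R-linear. *)
Definition holomorphic_at (R : realType) (V : normedModType (C R))
    (f : V -> C R) (p : V) : Prop :=
  \forall q \near p, differentiable f q.

(* A meromorphic function on V is represented by a total function which near
   every point is a quotient of holomorphic functions; its values where the
   local denominators vanish are irrelevant. *)
Definition meromorphic (R : realType) (V : normedModType (C R))
    (f : V -> C R) : Prop :=
  forall p : V, exists g h : V -> C R,
    [/\ holomorphic_at g p,
        holomorphic_at h p,
        ~ (\forall q \near p, h q = 0) &
        \forall q \near p, h q != 0 -> f q = g q / h q].

(* The part of the multiple zeta series with n_r <= N.  Indices are shifted:
   the l-th summation variable is (n l).+1, so that it ranges over 1..N. *)
Definition mzeta_partial (R : realType) (r : nat) (s : 'rV[C R]_r) (N : nat) :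
    C R :=
  \sum_(n : {ffun 'I_r -> 'I_N} |
        [forall i : 'I_r, forall j : 'I_r, (i < j)%N ==> (n i < n j)%N])
    \prod_(l < r) natpow (n l).+1 (- s ord0 l).

(* With l counted from 0, the bound r - l + 1 becomes r - l. *)
Definition mzeta_abscvg (R : realType) (r : nat) (s : 'rV[C R]_r) : Prop :=
  forall l : 'I_r,
    r%:R - l%:R < \sum_(j < r | (l <= j)%N) complex.Re (s ord0 j).

Definition is_mzeta (R : realType) (r : nat) (Z : 'rV[C R]_r -> C R) : Prop :=
  meromorphic Z /\
  forall s : 'rV[C R]_r, mzeta_abscvg s ->
    mzeta_partial s N @[N --> \oo] --> Z s.

Definition permuted_arg (R : realType) (r : nat) (a : 'I_r -> R) (s : C R)
    (tau : 'S_r) : 'rV[C R]_r :=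
  \row_(j < r) ((a (tau j))%:C * s).

(* F is the meromorphic function s |-> \sum_tau Z (a_(tau 1) s, .., a_(tau r) s).
   The pointwise equation makes sense only where each summand is regular; it
   determines F as a meromorphic function on the complex plane. *)
Definition is_sym_mzeta (R : realType) (r : nat) (a : 'I_r -> R)
    (F : C R -> C R) : Prop :=
  exists Z : 'rV[C R]_r -> C R,
    [/\ is_mzeta Z,
        meromorphic F &
        forall s : C R,
          (forall tau : 'S_r, holomorphic_at Z (permuted_arg a s tau)) ->
          F s = \sum_(tau : 'S_r) Z (permuted_arg a s tau)].

(* The value at s of a meromorphic function F is that of its holomorphic
   extension g across s, so that the definition is insensitive to the value
   chosen by the representative F at s itself; a pole is never an alpha-point. *)
Definition is_apoint (R : realType) (F : C R -> C R) (alpha s : C R) : Prop :=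
  exists g : C R -> C R,
    [/\ holomorphic_at g s, \forall z \near s^', F z = g z & g s = alpha].

(* Main.v *)
(** By Hoffman's recursion the symmetric sum is a polynomial G in values zeta(bs), b > 0:
    G(b, A) = zeta(bs) G(A) - sum_i G(A with b added to its i-th entry).  In a vertical
    strip in Re s < 0 the functional equation gives |zeta(s)| of exact order
    |t|^(1/2 - sigma), so the term zeta(a_1 s) ... zeta(a_r s) is of order
    |t|^(r/2 - (a_1 + ... + a_r) sigma), while every other term is smaller by a factor
    |t|^(1/2) or more.  Hence |G| tends to infinity with |t|, uniformly in the strip.
    F equals G far to the right, where the multiple series converge, and hence along
    horizontal lines by unique continuation.

    The functional equation is first proved for real s = - u, 0 < u < 1: writing n^u as an
    integral of 1 - e^(-nx) turns the trapezoidal sums of n^u into an integral against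
    coth(x/2)/2 - 1/x, whose partial fractions give zeta(1 + u).  The gamma factor is kept
    as an infinite product, from which both its holomorphy and its size are read off.  The
    identity extends to complex s by the identity theorem, and zeta(1 + u) is bounded
    below by sieving out finitely many primes. *)
Require Import Defs.
From HB Require Import structures.
From mathcomp Require Import all_boot all_order all_algebra all_fingroup.
From mathcomp Require Import all_classical all_reals all_analysis.
From mathcomp Require Import measurable_realfun complex.
From mathcomp Require Import ring lra zify.
Import Order.TTheory GRing.Theory Num.Theory.
Import numFieldNormedType.Exports.
Set Implicit Arguments.
Unset Strict Implicit.
Unset Printing Implicit Defensive.
Local Open Scope ring_scope.
Local Open Scope complex_scope.
Local Open Scope classical_set_scope.

Local Notation Re := complex.Re.
Local Notation Im := complex.Im.

(** No Cauchy integral formula is used. Primitives come from Goursat's bisection, and with the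
    maximum principle they give a Schwarz lemma whose second order remainder does the work of
    Cauchy's estimates: it yields holomorphy of bounded pointwise limits and the identity theorem.
    The functional equation starts on a real segment because every integrand is nonnegative there,
    so that monotone convergence and Tonelli's theorem apply in the extended reals without
    integrability conditions. Two features of the statement shape the end of the proof. [F] is an
    arbitrary representative of a meromorphic function, so F = G holds only off the zeros of a local
    denominator, and this weaker agreement is what is carried along lines. The sum over permutations
    is prescribed only where Z is holomorphic, which has to be proved in several variables from the
    series. Sizes are kept in logarithmic form, as bounds between exp(E - K) and exp(E + K), so that
    exponents and constants add under products. *)

Definition cmod (R : realType) (z : C R) : R := ComplexField.Normc.normc z.

(** * Complex numbers and derivatives *)

Section ComplexBasics.
Variable R : realType.
Local Notation Cx := (C R).
Implicit Types z w : Cx.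

(** The embedding of the reals with its codomain fixed as [C R], so that expressions containing it
    are typed there and not in [R[i]]. *)
Definition rc (x : R) : Cx := x%:C.

Lemma cE z : z = (Re z) +i* (Im z). Proof. by case: z. Qed.
Lemma eqC z w : Re z = Re w -> Im z = Im w -> z = w.
Proof. by case: z => a b; case: w => c d /= -> ->. Qed.
Lemma ReD z w : Re (z + w) = Re z + Re w. Proof. by case: z; case: w. Qed.
Lemma ImD z w : Im (z + w) = Im z + Im w. Proof. by case: z; case: w. Qed.
Lemma ReN z : Re (- z) = - Re z. Proof. by case: z. Qed.
Lemma ImN z : Im (- z) = - Im z. Proof. by case: z. Qed.
Lemma ReB z w : Re (z - w) = Re z - Re w. Proof. by rewrite ReD ReN. Qed.
Lemma ImB z w : Im (z - w) = Im z - Im w. Proof. by rewrite ImD ImN. Qed.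
Lemma ReM z w : Re (z * w) = Re z * Re w - Im z * Im w. Proof. by case: z; case: w. Qed.
Lemma ImM z w : Im (z * w) = Re z * Im w + Im z * Re w. Proof. by case: z; case: w. Qed.
Lemma Re0 : Re (0 : Cx) = 0. Proof. by []. Qed.
Lemma Im0 : Im (0 : Cx) = 0. Proof. by []. Qed.
Lemma Re1 : Re (1 : Cx) = 1. Proof. by []. Qed.
Lemma Im1 : Im (1 : Cx) = 0. Proof. by []. Qed.
Lemma Re_rc x : Re (rc x) = x. Proof. by []. Qed.
Lemma Im_rc x : Im (rc x) = 0. Proof. by []. Qed.
Definition ReImE := (ReB, ImB, ReD, ImD, ReN, ImN, ReM, ImM, Re0, Im0, Re1, Im1, Re_rc, Im_rc).

Lemma rcD x y : rc (x + y) = rc x + rc y. Proof. by apply: eqC; rewrite !ReImE ?addr0. Qed.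
Lemma rcN x : rc (- x) = - rc x. Proof. by apply: eqC; rewrite !ReImE ?oppr0. Qed.
Lemma rcB x y : rc (x - y) = rc x - rc y. Proof. by rewrite rcD rcN. Qed.
Lemma rcM x y : rc (x * y) = rc x * rc y.
Proof. by apply: eqC; rewrite !ReImE ?mulr0 ?mul0r ?subr0 ?addr0. Qed.
Lemma rc0 : rc 0 = 0. Proof. by []. Qed.
Lemma rc1 : rc 1 = 1. Proof. by []. Qed.
Lemma rc_eq0 x : (rc x == 0) = (x == 0).
Proof. by rewrite eq_complex /= eqxx andbT. Qed.
Lemma rcV x : rc x^-1 = (rc x)^-1.
Proof.
have [->|x0] := eqVneq x 0; first by rewrite invr0 rc0 invr0.
have xc0 : rc x != 0 by rewrite rc_eq0.
by apply: (mulfI xc0); rewrite -rcM !mulfV.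
Qed.
Lemma rc_nat n : rc n%:R = n%:R.
Proof. by elim: n => [|n ih] //; rewrite -[in LHS]natr1 rcD ih -natr1. Qed.

Lemma normC_cmod z : `|z| = rc (cmod z). Proof. by case: z. Qed.
Lemma cmodE z : cmod z = Num.sqrt (Re z ^+ 2 + Im z ^+ 2). Proof. by case: z. Qed.
Lemma cmod_ge0 z : 0 <= cmod z. Proof. by rewrite cmodE sqrtr_ge0. Qed.
Lemma cmod0 : cmod (0 : Cx) = 0. Proof. exact: ComplexField.Normc.normc0. Qed.
Lemma cmod1 : cmod (1 : Cx) = 1. Proof. exact: ComplexField.Normc.normc1. Qed.
Lemma cmodM z w : cmod (z * w) = cmod z * cmod w. Proof. exact: ComplexField.Normc.normcM. Qed.
Lemma cmodV z : cmod z^-1 = (cmod z)^-1. Proof. exact: ComplexField.Normc.normcV. Qed.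
Lemma cmodX z n : cmod (z ^+ n) = cmod z ^+ n.
Proof. by elim: n => [|n ih]; rewrite ?expr0 ?cmod1 // !exprS cmodM ih. Qed.
Lemma cmod_eq0 z : (cmod z == 0) = (z == 0).
Proof.
apply/eqP/eqP => [|->]; last exact: cmod0.
exact: ComplexField.Normc.eq0_normc.
Qed.
Lemma cmod_gt0 z : (0 < cmod z) = (z != 0).
Proof. by rewrite lt_def cmod_eq0 cmod_ge0 andbT. Qed.
Lemma cmodN z : cmod (- z) = cmod z.
Proof. by rewrite !cmodE ReN ImN !sqrrN. Qed.
Lemma cmodD z w : cmod (z + w) <= cmod z + cmod w.
Proof. by have := ler_normD z w; rewrite !normC_cmod -rcD lecR. Qed.
Lemma cmodB z w : cmod (z - w) <= cmod z + cmod w.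
Proof. by rewrite -(cmodN w) cmodD. Qed.
Lemma cmodBC z w : cmod (z - w) = cmod (w - z).
Proof. by rewrite -cmodN opprB. Qed.
Lemma cmod_rc x : cmod (rc x) = `|x|.
Proof. by rewrite cmodE !ReImE expr0n addr0 sqrtr_sqr. Qed.
Lemma cmod_nat n : cmod (n%:R : Cx) = n%:R.
Proof. by rewrite -rc_nat cmod_rc normr_nat. Qed.
Lemma cmod_sqr z : cmod z ^+ 2 = Re z ^+ 2 + Im z ^+ 2.
Proof. by rewrite cmodE sqr_sqrtr // addr_ge0 ?sqr_ge0. Qed.
Lemma Re_le z : `|Re z| <= cmod z.
Proof.
rewrite -(@ler_pXn2r _ 2) ?nnegrE ?cmod_ge0 //.
by rewrite cmod_sqr real_normK ?num_real // lerDl sqr_ge0.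
Qed.
Lemma Im_le z : `|Im z| <= cmod z.
Proof.
rewrite -(@ler_pXn2r _ 2) ?nnegrE ?cmod_ge0 //.
by rewrite cmod_sqr real_normK ?num_real // lerDr sqr_ge0.
Qed.
Lemma cmod_le_ReIm z : cmod z <= `|Re z| + `|Im z|.
Proof.
rewrite -(@ler_pXn2r _ 2) ?nnegrE ?cmod_ge0 ?addr_ge0 //.
rewrite cmod_sqr sqrrD !real_normK ?num_real //.
by rewrite -addrA lerD2l lerDr mulrn_wge0 ?mulr_ge0.
Qed.
Lemma cmod_triB z w x : cmod (z - w) <= cmod (z - x) + cmod (x - w).
Proof. by apply: le_trans (cmodD _ _); rewrite addrA subrK. Qed.
Lemma cmod_lowB z w : cmod z - cmod w <= cmod (z - w).
Proof. by rewrite lerBlDr; apply: le_trans (cmodD _ _); rewrite subrK. Qed.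
Lemma cmod_lowD z w : cmod z - cmod w <= cmod (z + w).
Proof. by have := cmod_lowB z (- w); rewrite opprK cmodN. Qed.
Lemma cmod_sum (I : Type) (s : seq I) (P : pred I) (F : I -> Cx) :
  cmod (\sum_(i <- s | P i) F i) <= \sum_(i <- s | P i) cmod (F i).
Proof.
elim/big_ind2: _ => [|x1 x2 y1 y2 h1 h2|//]; first by rewrite cmod0.
by apply: le_trans (cmodD _ _) _; exact: lerD.
Qed.
Lemma cmod_prod (I : Type) (s : seq I) (P : pred I) (F : I -> Cx) :
  cmod (\prod_(i <- s | P i) F i) = \prod_(i <- s | P i) cmod (F i).
Proof. by apply: (big_morph (@cmod R)); [exact: cmodM|exact: cmod1]. Qed.

Lemma cmod_eps0 z : (forall e : R, 0 < e -> cmod z <= e) -> z = 0.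
Proof.
move=> h; apply/eqP; rewrite -cmod_eq0 eq_le cmod_ge0 andbT.
by apply/ler_addgt0Pl => e e0; rewrite addr0 h.
Qed.

Lemma rc_sum (I : Type) (s : seq I) (P : pred I) (F : I -> R) :
  rc (\sum_(i <- s | P i) F i) = \sum_(i <- s | P i) rc (F i).
Proof. by apply: (big_morph rc); [exact: rcD|]. Qed.

Lemma Re_cexp z : Re (cexp z) = expR (Re z) * cos (Im z). Proof. by []. Qed.
Lemma Im_cexp z : Im (cexp z) = expR (Re z) * sin (Im z). Proof. by []. Qed.
Lemma cexpD z w : cexp (z + w) = cexp z * cexp w.
Proof.
by apply: eqC; rewrite !(Re_cexp, Im_cexp, ReImE) expRD ?cosD ?sinD; ring.
Qed.
Lemma cmod_cexp z : cmod (cexp z) = expR (Re z).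
Proof.
by rewrite cmodE Re_cexp Im_cexp !exprMn -mulrDr cos2Dsin2 mulr1 sqrtr_sqr ger0_norm.
Qed.
Lemma cexp0 : cexp (0 : Cx) = 1.
Proof. by apply: eqC; rewrite ?Re_cexp ?Im_cexp Re0 Im0 expR0 ?cos0 ?sin0 ?mulr1 ?mulr0. Qed.
Lemma cexp_rc x : cexp (rc x) = rc (expR x).
Proof. by apply: eqC; rewrite ?Re_cexp ?Im_cexp !ReImE ?cos0 ?sin0 ?mulr1 ?mulr0. Qed.

Lemma natpow1 z : natpow 1 z = 1.
Proof. by rewrite /natpow ln1 mulr0 cexp0. Qed.
Lemma natpowD n z w : natpow n (z + w) = natpow n z * natpow n w.
Proof. by rewrite /natpow mulrDl cexpD. Qed.
Lemma cmod_natpow n z : cmod (natpow n z) = expR (Re z * ln n%:R).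
Proof. by rewrite /natpow cmod_cexp ReM !ReImE mulr0 subr0. Qed.
Lemma natpowM m n z : (0 < m)%N -> (0 < n)%N -> natpow (m * n) z = natpow m z * natpow n z.
Proof.
move=> m0 n0; rewrite /natpow -cexpD -mulrDr natrM lnM ?posrE ?ltr0n //.
by rewrite -[(_ + _)%:C]/(rc _) rcD.
Qed.
End ComplexBasics.

(** * Derivatives of real functions in increment form *)

Section RealDerivatives.
Variable R : realType.

(** Written without division, so that [h = 0] is no exception. The same form serves for a complex
    variable ([cder]) and for curves ([cder_curve]), always with real bounds. *)
Definition rder (f : R -> R) (x l : R) := forall e, 0 < e -> exists2 d, 0 < d &
  forall h, `|h| < d -> `|f (x + h) - f x - l * h| <= e * `|h|.

Lemma rder_is_derive f x l : rder f x l -> is_derive x (1 : R) f l.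
Proof.
move=> H; have cv : (fun h => h^-1 *: ((f \o shift x) (h *: (1 : R)) - f x)) @ 0^' --> l.
  apply/cvgrPdist_le => e e0; have [d d0 Hd] := H e e0.
  exists d => // h; rewrite /ball_ /= sub0r normrN => hd hn0.
  have -> : l - h^-1 *: (f (h *: 1 + x) - f x) = - (h^-1 * (f (x + h) - f x - l * h)).
    by rewrite -[_ *: (_ - _)]/(h^-1 * (f (h * 1 + x) - f x)) mulr1 (addrC h); field.
  rewrite normrN normrM normfV mulrC ler_pdivrMr ?normr_gt0 //.
  exact: Hd.
apply: DeriveDef; first by apply/cvg_ex; exists l.
by apply/cvg_lim.
Qed.

Lemma is_derive_rder f x l : is_derive x (1 : R) f l -> rder f x l.
Proof.
move=> [df lE] e e0.
have : (fun h => h^-1 *: ((f \o shift x) (h *: (1 : R)) - f x)) @ 0^' --> l.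
  by rewrite -lE; exact: df.
move=> /cvgrPdist_le /(_ _ e0) [d /= d0 Hd]; exists d => // h hd.
have [->|hn0] := eqVneq h 0.
  by rewrite addr0 subrr mulr0 subrr normr0 mulr0.
have := Hd h; rewrite /ball_ /= sub0r normrN => /(_ hd hn0).
have -> : l - h^-1 *: (f (h *: 1 + x) - f x) = - (h^-1 * (f (x + h) - f x - l * h)).
  by rewrite -[_ *: (_ - _)]/(h^-1 * (f (h * 1 + x) - f x)) mulr1 (addrC h); field.
by rewrite normrN normrM normfV mulrC ler_pdivrMr ?normr_gt0.
Qed.

Lemma rder_cts f x l : rder f x l -> {for x, continuous f}.
Proof.
move=> /rder_is_derive [df _]; apply: differentiable_continuous.
by apply/derivable1_diffP.
Qed.

Lemma rder_mvt f df (a b : R) : a <= b ->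
  (forall x, a <= x <= b -> rder f x (df x)) ->
  exists2 c, a <= c <= b & f b - f a = df c * (b - a).
Proof.
move=> ab H; have [->|anb] := eqVneq a b.
  by exists b; rewrite ?lexx // !subrr mulr0.
have ltab : a < b by rewrite lt_neqAle anb.
have [||c cab ->] := @MVT R f df a b ltab.
- move=> x; rewrite in_itv /= => /andP[ax xb].
  by apply: rder_is_derive; apply: H; rewrite !ltW.
- apply: continuous_in_subspaceT => x; rewrite inE /= in_itv /= => /H.
  exact: rder_cts.
- by exists c => //; move: cab; rewrite in_itv /= => /andP[? ?]; rewrite !ltW.
Qed.
End RealDerivatives.

(** * Complex derivatives, mean value inequalities, the exponential *)

Section ComplexDerivatives.
Variable R : realType.
Local Notation Cx := (C R).

Definition cder (f : Cx -> Cx) (z l : Cx) := forall e : R, 0 < e -> exists2 d : R, 0 < d &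
  forall h : Cx, cmod h < d -> cmod (f (z + h) - f z - l * h) <= e * cmod h.

Definition cder_curve (f : R -> Cx) (x : R) (l : Cx) := forall e : R, 0 < e -> exists2 d : R, 0 < d &
  forall h : R, `|h| < d -> cmod (f (x + h) - f x - l * rc h) <= e * `|h|.

Definition holo (f : Cx -> Cx) z := exists l, cder f z l.

Definition cts (f : Cx -> Cx) z := forall e : R, 0 < e -> exists2 d : R, 0 < d &
  forall h : Cx, cmod h < d -> cmod (f (z + h) - f z) <= e.

Lemma cder_cts f z l : cder f z l -> cts f z.
Proof.
move=> H e e0; have [d d0 Hd] := H 1 ltr01.
have K : 0 < 1 + cmod l by rewrite ltr_wpDr ?cmod_ge0.
exists (Num.min d (e / (1 + cmod l))).
  by rewrite lt_min d0 divr_gt0.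
move=> h; rewrite lt_min => /andP[hd he].
have -> : f (z + h) - f z = (f (z + h) - f z - l * h) + l * h by rewrite subrK.
apply: le_trans (cmodD _ _) _; rewrite cmodM.
apply: (@le_trans _ _ ((1 + cmod l) * cmod h)).
  by rewrite mulrDl lerD2r; exact: Hd.
by rewrite mulrC -ler_pdivlMr // ltW.
Qed.
Lemma holo_cts f z : holo f z -> cts f z.
Proof. by move=> [l]; exact: cder_cts. Qed.

Lemma cder_local f g z l (r : R) : 0 < r ->
  (forall w, cmod (w - z) < r -> f w = g w) -> cder f z l -> cder g z l.
Proof.
move=> r0 fg H e e0; have [d d0 Hd] := H e e0.
exists (Num.min d r); first by rewrite lt_min d0.
move=> h; rewrite lt_min => /andP[hd hr].
have A : f z = g z by apply: fg; rewrite subrr cmod0.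
have B : f (z + h) = g (z + h) by apply: fg; rewrite addrAC subrr add0r.
by rewrite -A -B; exact: Hd.
Qed.

Lemma cder_eq f g z l : (forall w, f w = g w) -> cder f z l -> cder g z l.
Proof. by move=> fg; apply: (@cder_local _ _ _ _ 1). Qed.

Lemma cder_cst (c z : Cx) : cder (fun=> c) z 0.
Proof.
by move=> e e0; exists 1 => // h _; rewrite subrr mul0r subrr cmod0 mulr_ge0 ?cmod_ge0 // ltW.
Qed.
Lemma cder_id (z : Cx) : cder (fun w => w) z 1.
Proof.
move=> e e0; exists 1 => // h _.
have -> : z + h - z - 1 * h = 0 by ring.
by rewrite cmod0 mulr_ge0 ?cmod_ge0 // ltW.
Qed.
Lemma cderD f g z l m : cder f z l -> cder g z m -> cder (fun w => f w + g w) z (l + m).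
Proof.
move=> Hf Hg e e0; have e2 : 0 < e / 2 by rewrite divr_gt0.
have [d d0 Hd] := Hf _ e2; have [d' d'0 Hd'] := Hg _ e2.
exists (Num.min d d'); first by rewrite lt_min d0.
move=> h; rewrite lt_min => /andP[hd hd'].
have -> : f (z + h) + g (z + h) - (f z + g z) - (l + m) * h =
  (f (z + h) - f z - l * h) + (g (z + h) - g z - m * h) by ring.
apply: le_trans (cmodD _ _) _; rewrite [e]splitr mulrDl.
by rewrite lerD ?Hd ?Hd'.
Qed.
Lemma cder_ub f z l : cder f z l -> exists2 d : R, 0 < d & forall h, cmod h < d ->
  cmod (f (z + h) - f z) <= (1 + cmod l) * cmod h.
Proof.
move=> H; have [d d0 Hd] := H 1 ltr01; exists d => // h hd.
have -> : f (z + h) - f z = (f (z + h) - f z - l * h) + l * h by rewrite subrK.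
by apply: le_trans (cmodD _ _) _; rewrite cmodM mulrDl lerD2r; exact: Hd.
Qed.
Lemma cder_scale f z l c : cder f z l -> cder (fun w => c * f w) z (c * l).
Proof.
move=> H e e0; have K : 0 < 1 + cmod c by rewrite ltr_wpDr ?cmod_ge0.
have [|d d0 Hd] := H (e / (1 + cmod c)); first by rewrite divr_gt0.
exists d => // h hd.
have -> : c * f (z + h) - c * f z - c * l * h = c * (f (z + h) - f z - l * h) by ring.
rewrite cmodM; apply: (@le_trans _ _ ((1 + cmod c) * (e / (1 + cmod c) * cmod h))).
  by rewrite ler_pM ?cmod_ge0 ?Hd // lerDr.
by rewrite mulrA mulrCA mulfV ?mulr1 // gt_eqF.
Qed.
Lemma cderN f z l : cder f z l -> cder (fun w => - f w) z (- l).
Proof. by move=> /(@cder_scale _ _ _ (-1)); rewrite mulN1r; apply: cder_eq => w; rewrite mulN1r. Qed.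
Lemma cderB f g z l m : cder f z l -> cder g z m -> cder (fun w => f w - g w) z (l - m).
Proof. by move=> Hf /cderN; apply: cderD. Qed.

Lemma cder_comp f g z l m : cder f z l -> cder g (f z) m -> cder (fun w => g (f w)) z (m * l).
Proof.
move=> Hf Hg e e0.
have K : 0 < 1 + cmod l by rewrite ltr_wpDr ?cmod_ge0.
have M : 0 < 1 + cmod m by rewrite ltr_wpDr ?cmod_ge0.
have [|d d0 Hd] := Hf (e / 2 / (1 + cmod m)); first by rewrite !divr_gt0.
have [d1 d10 Hd1] := cder_ub Hf.
have [|d' d'0 Hd'] := Hg (e / 2 / (1 + cmod l)); first by rewrite !divr_gt0.
exists (Num.min d (Num.min d1 (d' / (1 + cmod l)))).
  by rewrite !lt_min d0 d10 divr_gt0.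
move=> h; rewrite !lt_min => /and3P[hd hd1 hd'].
set k := f (z + h) - f z; have fk : f (z + h) = f z + k by rewrite [RHS]addrC subrK.
have kb := Hd1 _ hd1; rewrite -/k in kb.
have kd' : cmod k < d'.
  by apply: le_lt_trans kb _; rewrite mulrC -ltr_pdivlMr.
have -> : g (f (z + h)) - g (f z) - m * l * h =
  (g (f z + k) - g (f z) - m * k) + m * (k - l * h) by rewrite fk; ring.
apply: le_trans (cmodD _ _) _; rewrite [e]splitr mulrDl; apply: lerD.
  apply: le_trans (Hd' _ kd') _; apply: le_trans (ler_wpM2l _ kb) _.
    by rewrite ltW // !divr_gt0.
  by rewrite mulrA divfK // gt_eqF.
rewrite cmodM; apply: (@le_trans _ _ ((1 + cmod m) * (e / 2 / (1 + cmod m) * cmod h))).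
  by rewrite ler_pM ?cmod_ge0 ?Hd // lerDr.
by rewrite mulrA mulrCA mulfV ?mulr1 // gt_eqF.
Qed.

Lemma cder_sqr (z : Cx) : cder (fun w => w ^+ 2) z (2 * z).
Proof.
move=> e e0; exists e => // h he.
have -> : (z + h) ^+ 2 - z ^+ 2 - 2 * z * h = h * h by ring.
by rewrite cmodM ler_wpM2r ?cmod_ge0 // ltW.
Qed.
Lemma cderM f g z l m : cder f z l -> cder g z m ->
  cder (fun w => f w * g w) z (l * g z + f z * m).
Proof.
move=> Hf Hg.
(* Polarization reduces the product rule to the derivative of a square. *)
have E : forall w, 4^-1 * ((f w + g w) ^+ 2 - (f w - g w) ^+ 2) = f w * g w by move=> w; field.
apply: (cder_eq E).
have -> : l * g z + f z * m = 4^-1 * (2 * (f z + g z) * (l + m) - 2 * (f z - g z) * (l - m)) by field.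
apply: cder_scale; apply: cderB.
  exact: (cder_comp (cderD Hf Hg) (cder_sqr _)).
exact: (cder_comp (cderB Hf Hg) (cder_sqr _)).
Qed.
Lemma cder_inv (z : Cx) : z != 0 -> cder (fun w => w^-1) z (- (z ^+ 2)^-1).
Proof.
move=> z0 e e0; have mz : 0 < cmod z by rewrite cmod_gt0.
exists (Num.min (cmod z / 2) (e * cmod z ^+ 3 / 2)).
  by rewrite lt_min !divr_gt0 // mulr_gt0 // exprn_gt0.
move=> h; rewrite lt_min => /andP[h1 h2].
have zh : cmod z / 2 <= cmod (z + h).
  by apply: le_trans (cmod_lowD _ _); lra.
have zh0 : z + h != 0 by rewrite -cmod_gt0; lra.
have -> : (z + h)^-1 - z^-1 - - (z ^+ 2)^-1 * h = h * (h / (z ^+ 2 * (z + h))).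
  by field; rewrite z0 zh0.
rewrite !cmodM mulrC ler_wpM2r ?cmod_ge0 // cmodV cmodM cmodX.
rewrite ler_pdivrMr ?mulr_gt0 ?exprn_gt0 //; last lra.
apply: le_trans (ltW h2) _.
have -> : e * cmod z ^+ 3 / 2 = (e * cmod z ^+ 2) * (cmod z / 2) by field.
by rewrite [leRHS]mulrA ler_wpM2l // mulr_ge0 ?exprn_ge0 ?ltW.
Qed.
Lemma cder_uniq f z l m : cder f z l -> cder f z m -> l = m.
Proof.
move=> Hl Hm; apply/eqP; rewrite -subr_eq0; apply/eqP; apply: cmod_eps0 => e e0.
have e2 : 0 < e / 2 by rewrite divr_gt0.
have [d d0 Hd] := Hl _ e2; have [d' d'0 Hd'] := Hm _ e2.
set h := rc (Num.min d d' / 2).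
have m0 : 0 < Num.min d d' by rewrite lt_min d0.
have hm : cmod h = Num.min d d' / 2 by rewrite cmod_rc ger0_norm // ltW // divr_gt0.
have h0 : 0 < cmod h by rewrite hm divr_gt0.
have : cmod h < Num.min d d' by rewrite hm; lra.
rewrite lt_min => /andP[/Hd A /Hd' B].
rewrite -(ler_pM2r h0) -cmodM.
have -> : (l - m) * h = (f (z + h) - f z - m * h) - (f (z + h) - f z - l * h) by ring.
by apply: le_trans (cmodB _ _) _; rewrite [e]splitr mulrDl lerD.
Qed.

Lemma cder_curve_comp f (p h : Cx) (x : R) l : cder f (p + rc x * h) l ->
  cder_curve (fun x => f (p + rc x * h)) x (l * h).
Proof.
move=> H e e0; have K : 0 < 1 + cmod h by rewrite ltr_wpDr ?cmod_ge0.
have [|d d0 Hd] := H (e / (1 + cmod h)); first by rewrite divr_gt0.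
exists (d / (1 + cmod h)); first by rewrite divr_gt0.
move=> k; rewrite ltr_pdivlMr // => kd.
have kh : cmod (rc k * h) <= `|k| * (1 + cmod h).
  by rewrite cmodM cmod_rc ler_wpM2l // lerDr.
have kd' := le_lt_trans kh kd.
have -> : f (p + rc (x + k) * h) - f (p + rc x * h) - l * h * rc k =
   f ((p + rc x * h) + rc k * h) - f (p + rc x * h) - l * (rc k * h).
  by rewrite rcD mulrDl addrA; ring.
apply: le_trans (Hd _ kd') _; apply: le_trans (ler_wpM2l _ kh) _.
  by rewrite ltW // divr_gt0.
by rewrite mulrCA divfK ?(gt_eqF K) // mulrC.
Qed.

Lemma cder_curve_Re f x l w : cder_curve f x l -> rder (fun x => Re (w * f x)) x (Re (w * l)).
Proof.
move=> H e e0; have K : 0 < 1 + cmod w by rewrite ltr_wpDr ?cmod_ge0.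
have [|d d0 Hd] := H (e / (1 + cmod w)); first by rewrite divr_gt0.
exists d => // h /Hd hh.
have -> : Re (w * f (x + h)) - Re (w * f x) - Re (w * l) * h = Re (w * (f (x + h) - f x - l * rc h)).
  by rewrite !ReImE; ring.
apply: le_trans (Re_le _) _; rewrite cmodM.
apply: (@le_trans _ _ ((1 + cmod w) * (e / (1 + cmod w) * `|h|))).
  by rewrite ler_pM ?cmod_ge0 // lerDr.
by rewrite mulrA mulrCA mulfV ?mulr1 // gt_eqF.
Qed.

Lemma mv_ineq f df (a b M : R) : a <= b ->
  (forall x, a <= x <= b -> cder_curve f x (df x)) ->
  (forall x, a <= x <= b -> cmod (df x) <= M) ->
  cmod (f b - f a) <= M * (b - a).
Proof.
move=> ab Hf HM; set v := f b - f a.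
have [v0|v0] := eqVneq v 0.
  rewrite v0 cmod0 mulr_ge0 ?subr_ge0 // (le_trans (cmod_ge0 (df a))) ?HM // lexx //.
have mv : 0 < cmod v by rewrite cmod_gt0.
(* Pairing [f] with the conjugate of its increment [v] makes the increment the real number
   [cmod v ^+ 2], and the real mean value theorem applies. *)
set w : Cx := (Re v +i* - Im v)%C.
have wv : Re (w * v) = cmod v ^+ 2 by rewrite ReM cmod_sqr /w; cbn [complex.Re complex.Im]; ring.
have mw : cmod w = cmod v by rewrite !cmodE /w; cbn [complex.Re complex.Im]; rewrite sqrrN.
have [|c cab] := @rder_mvt R (fun x => Re (w * f x)) (fun x => Re (w * df x)) a b ab.
  by move=> x xab; apply: cder_curve_Re; exact: Hf.
rewrite -ReB -mulrBr -/v wv => E.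
rewrite -(ler_pM2l mv) -expr2 E mulrA ler_wpM2r ?subr_ge0 //.
apply: le_trans (ler_norm _) _; apply: le_trans (Re_le _) _.
by rewrite cmodM mw ler_wpM2l ?cmod_ge0 // HM.
Qed.

Lemma mv_ineq_seg f df (z w : Cx) (M : R) :
  (forall x, 0 <= x <= 1 -> cder f (z + rc x * (w - z)) (df (z + rc x * (w - z)))) ->
  (forall x, 0 <= x <= 1 -> cmod (df (z + rc x * (w - z))) <= M) ->
  cmod (f w - f z) <= M * cmod (w - z).
Proof.
move=> H HM.
have := @mv_ineq (fun x => f (z + rc x * (w - z))) (fun x => df (z + rc x * (w - z)) * (w - z))
  0 1 (M * cmod (w - z)) ler01.
rewrite rc1 mul1r rc0 mul0r addr0 [z + _]addrC subrK subr0 mulr1; apply.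
  by move=> x x01; apply: cder_curve_comp; exact: H.
by move=> x x01; rewrite cmodM ler_wpM2r ?cmod_ge0 // HM.
Qed.

(** Real calculus along the ray through [h]. The mean value inequality on [0, 1], used twice, then
    gives the quadratic remainder of [cexp_bound2], and from it the complex derivative. *)
Lemma cder_curve_cexp (h : Cx) x : cder_curve (fun x => cexp (rc x * h)) x (cexp (rc x * h) * h).
Proof.
have A : forall x, rder (fun x => expR (x * Re h) * cos (x * Im h)) x
   (Re (cexp (rc x * h) * h)).
  move=> y; apply: is_derive_rder.
  have -> : Re (cexp (rc y * h) * h) = 
     expR (y * Re h) * (- sin (y * Im h) * Im h) + cos (y * Im h) * (expR (y * Re h) * Re h).
    by rewrite ReM Re_cexp Im_cexp !ReM !ImM !ReImE; rewrite !mul0r subr0 addr0; ring.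
  apply: is_derive_eq; rewrite /GRing.scale /=; ring.
have B : forall x, rder (fun x => expR (x * Re h) * sin (x * Im h)) x
   (Im (cexp (rc x * h) * h)).
  move=> y; apply: is_derive_rder.
  have -> : Im (cexp (rc y * h) * h) = 
     expR (y * Re h) * (cos (y * Im h) * Im h) + sin (y * Im h) * (expR (y * Re h) * Re h).
    by rewrite ImM Re_cexp Im_cexp !ReM !ImM !ReImE; rewrite !mul0r subr0 addr0; ring.
  apply: is_derive_eq; rewrite /GRing.scale /=; ring.
have cRe y : Re (cexp (rc y * h)) = expR (y * Re h) * cos (y * Im h).
  by rewrite Re_cexp !ReImE !mul0r subr0 addr0.
have cIm y : Im (cexp (rc y * h)) = expR (y * Re h) * sin (y * Im h).
  by rewrite Im_cexp !ReImE !mul0r subr0 addr0.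
move=> e e0; have e2 : 0 < e / 2 by rewrite divr_gt0.
have [d d0 Hd] := A x _ e2; have [d' d'0 Hd'] := B x _ e2.
exists (Num.min d d'); first by rewrite lt_min d0.
move=> k; rewrite lt_min => /andP[kd kd'].
apply: le_trans (cmod_le_ReIm _) _; rewrite [e]splitr mulrDl; apply: lerD.
  rewrite !ReB cRe cRe ReM Re_rc Im_rc mulr0 subr0; exact: Hd.
rewrite !ImB cIm cIm ImM Re_rc Im_rc mulr0 add0r; exact: Hd'.
Qed.

Lemma cexp_bound1 (h : Cx) : cmod (cexp h - 1) <= cmod h * expR (cmod h).
Proof.
have := @mv_ineq (fun x => cexp (rc x * h)) (fun x => cexp (rc x * h) * h) 0 1
  (cmod h * expR (cmod h)) ler01.
rewrite rc1 mul1r rc0 mul0r cexp0 subr0 mulr1; apply.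
  by move=> x _; exact: cder_curve_cexp.
move=> x /andP[x0 x1]; rewrite cmodM cmod_cexp mulrC ler_wpM2l ?cmod_ge0 //.
rewrite ler_expR ReM Re_rc Im_rc mul0r subr0.
apply: le_trans (ler_norm _) _; rewrite normrM ger0_norm //.
by apply: le_trans (Re_le h); rewrite ler_piMl.
Qed.

Lemma cexp_bound2 (h : Cx) : cmod (cexp h - 1 - h) <= cmod h ^+ 2 * expR (cmod h).
Proof.
have := @mv_ineq (fun x => cexp (rc x * h) - rc x * h) (fun x => cexp (rc x * h) * h - h) 0 1
  (cmod h ^+ 2 * expR (cmod h)) ler01.
rewrite rc1 mul1r rc0 mul0r cexp0 !subr0 mulr1 addrAC; apply.
  move=> x _; have H := @cder_curve_cexp h x; move=> e e0; have [d d0 Hd] := H e e0.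
  exists d => // k /Hd; apply: le_trans; rewrite le_eqVlt; apply/orP; left; apply/eqP.
  by congr (cmod _); rewrite rcD; ring.
move=> x /andP[x0 x1].
have -> : cexp (rc x * h) * h - h = (cexp (rc x * h) - 1) * h by ring.
have xh : cmod (rc x * h) <= cmod h by rewrite cmodM cmod_rc ger0_norm // ler_piMl ?cmod_ge0.
rewrite cmodM expr2 mulrAC ler_wpM2r ?cmod_ge0 //.
apply: le_trans (cexp_bound1 _) _.
by rewrite ler_pM ?cmod_ge0 ?expR_ge0 // ler_expR.
Qed.

Lemma cder_cexp (z : Cx) : cder (@cexp R) z (cexp z).
Proof.
move=> e e0; have K : 0 < cmod (cexp z) * expR 1 by rewrite cmod_cexp mulr_gt0 ?expR_gt0.
exists (Num.min 1 (e / (cmod (cexp z) * expR 1))); first by rewrite lt_min ltr01 divr_gt0.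
move=> h; rewrite lt_min => /andP[h1 he].
have -> : cexp (z + h) - cexp z - cexp z * h = cexp z * (cexp h - 1 - h) by rewrite cexpD; ring.
rewrite cmodM; apply: le_trans (ler_wpM2l (cmod_ge0 _) (cexp_bound2 _)) _.
apply: (@le_trans _ _ (cmod (cexp z) * (cmod h ^+ 2 * expR 1))).
  rewrite !ler_wpM2l ?cmod_ge0 ?exprn_ge0 ?cmod_ge0 // ler_expR ltW //.
have -> : cmod (cexp z) * (cmod h ^+ 2 * expR 1) = (cmod h * (cmod (cexp z) * expR 1)) * cmod h by ring.
by rewrite ler_wpM2r ?cmod_ge0 // -ler_pdivlMr // ltW.
Qed.
End ComplexDerivatives.

(** * Local theory of holomorphic functions *)

Section Goursat.
Variable R : realType.
Local Notation Cx := (C R).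

Lemma real_primitive (g : R -> R) (a b : R) : continuous g ->
  exists G : R -> R, forall x, a < x < b -> rder G x (g x).
Proof.
move=> cg; exists (fun x => (\int[lebesgue_measure]_(t in [set` `[a, x]]) (g t))%R) => x /andP[ax xb].
have ig : lebesgue_measure.-integrable `[a, b] (EFin \o g).
  apply: continuous_compact_integrable; first exact: segment_compact.
  exact: continuous_subspaceT.
have [df dE] := @continuous_FTC1_closed R g a x b xb ig ax (cg x).
by apply: is_derive_rder; apply: DeriveDef; [exact: df|rewrite derive1E in dE; exact: dE].
Qed.

Definition ctsR (g : R -> Cx) := forall x (e : R), 0 < e -> exists2 d : R, 0 < d &
  forall h, `|h| < d -> cmod (g (x + h) - g x) <= e.

Lemma continuous_eps (g : R -> R) : (forall x (e : R), 0 < e -> exists2 d : R, 0 < d &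
  forall h, `|h| < d -> `|g (x + h) - g x| <= e) -> continuous g.
Proof.
move=> H x; apply/cvgrPdist_le => e e0; have [d d0 Hd] := H x e e0.
exists d => // y; rewrite /ball_ /= => xy.
by rewrite distrC -[y](subrKC x); apply: Hd; rewrite distrC.
Qed.

Lemma curve_primitive (g : R -> Cx) (a b : R) : ctsR g ->
  exists G : R -> Cx, forall x, a < x < b -> cder_curve G x (g x).
Proof.
move=> cg.
have cR : continuous (fun x => Re (g x)).
  apply: continuous_eps => x e e0; have [d d0 Hd] := cg x e e0; exists d => // h /Hd.
  by apply: le_trans; rewrite -ReB Re_le.
have cI : continuous (fun x => Im (g x)).
  apply: continuous_eps => x e e0; have [d d0 Hd] := cg x e e0; exists d => // h /Hd.
  by apply: le_trans; rewrite -ImB Im_le.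
have [G1 H1] := real_primitive a b cR; have [G2 H2] := real_primitive a b cI.
exists (fun x => (G1 x +i* G2 x)%C) => x xab e e0.
have e2 : 0 < e / 2 by rewrite divr_gt0.
have [d d0 Hd] := H1 x xab _ e2; have [d' d'0 Hd'] := H2 x xab _ e2.
exists (Num.min d d'); first by rewrite lt_min d0.
move=> k; rewrite lt_min => /andP[/Hd kd /Hd' kd'].
apply: le_trans (cmod_le_ReIm _) _; rewrite [e]splitr mulrDl.
rewrite !ReB !ImB ReM ImM Re_rc Im_rc !mulr0 subr0 add0r; exact: lerD.
Qed.

Lemma mv_ineq_abs (f df : R -> Cx) (a b M : R) :
  (forall x, Num.min a b <= x <= Num.max a b -> cder_curve f x (df x)) ->
  (forall x, Num.min a b <= x <= Num.max a b -> cmod (df x) <= M) ->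
  cmod (f b - f a) <= M * `|b - a|.
Proof.
have [ab|ba] := leP a b => H1 H2.
  by rewrite ger0_norm ?subr_ge0 //; exact: (mv_ineq ab H1 H2).
rewrite cmodBC distrC ger0_norm ?subr_ge0; last exact: ltW.
exact: (mv_ineq (ltW ba) H1 H2).
Qed.

Lemma cder_curve_affine (e k : Cx) g (g' : Cx) x : cder_curve g x g' ->
  cder_curve (fun t => e * g t + k * rc t) x (e * g' + k).
Proof.
move=> Hg eps e0; have Kp : 0 < 1 + cmod e by rewrite ltr_wpDr ?cmod_ge0.
have [|dd dd0 Hd] := Hg (eps / (1 + cmod e)); first by rewrite divr_gt0.
exists dd => // h /Hd hh.
have -> : e * g (x + h) + k * rc (x + h) - (e * g x + k * rc x) - (e * g' + k) * rc h =
  e * (g (x + h) - g x - g' * rc h) by rewrite rcD; ring.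
rewrite cmodM; apply: (@le_trans _ _ ((1 + cmod e) * (eps / (1 + cmod e) * `|h|))).
  by rewrite ler_pM ?cmod_ge0 // lerDr.
by rewrite mulrA mulrCA mulfV ?mulr1 // gt_eqF.
Qed.
Lemma cder_curveD (g1 g2 : R -> Cx) l1 l2 x : cder_curve g1 x l1 -> cder_curve g2 x l2 ->
  cder_curve (fun t => g1 t + g2 t) x (l1 + l2).
Proof.
move=> H1 H2 eps e0; have e2 : 0 < eps / 2 by rewrite divr_gt0.
have [d1 d10 Hd1] := H1 _ e2; have [d2 d20 Hd2] := H2 _ e2.
exists (Num.min d1 d2); first by rewrite lt_min d10.
move=> h; rewrite lt_min => /andP[/Hd1 k1 /Hd2 k2].
have -> : g1 (x + h) + g2 (x + h) - (g1 x + g2 x) - (l1 + l2) * rc h = 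
  (g1 (x + h) - g1 x - l1 * rc h) + (g2 (x + h) - g2 x - l2 * rc h) by ring.
by apply: le_trans (cmodD _ _) _; rewrite [eps]splitr mulrDl lerD.
Qed.
Lemma cder_curve_eq (g1 g2 : R -> Cx) l1 l2 x : g1 =1 g2 -> l1 = l2 ->
  cder_curve g1 x l1 -> cder_curve g2 x l2.
Proof.
by move=> e1 <- Hg eps e0; have [d1 d10 Hd] := Hg eps e0; exists d1 => // h /Hd; rewrite !e1.
Qed.

Lemma segment_in (lo hi a b t : R) : lo <= a <= hi -> lo <= b <= hi ->
  Num.min a b <= t <= Num.max a b -> lo <= t <= hi.
Proof.
move=> /andP[la ah] /andP[lb bh] /andP[h1 h2]; apply/andP; split.
  by apply: le_trans h1; rewrite le_min la.
by apply: le_trans h2 _; rewrite ge_max ah.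
Qed.
Lemma shift_in (lo hi x k c : R) : c < x - lo -> c < hi - x -> - c <= k -> k <= c -> lo <= x + k <= hi.
Proof. by move=> *; lra. Qed.
Lemma midpoint_in (lo hi : R) : lo < hi -> lo <= (lo + hi) / 2 <= hi.
Proof. by move=> *; lra. Qed.
Lemma segment_dist (x k t : R) : Num.min x (x + k) <= t <= Num.max x (x + k) -> `|t - x| <= `|k|.
Proof.
rewrite ler_norml; have := ler_norm k; have := ler_norm (- k); rewrite normrN.
by have [xk|xk] := leP x (x + k) => h1 h2 /andP[t1 t2]; lra.
Qed.

(** The four alternatives say that [P] passes from a rectangle to one of its quarters. Repeated
    halving gives nested rectangles, and the suprema of their left and lower ends lie in all of
    them. *)
Lemma bisection (P : R -> R -> R -> R -> Prop) (x0 x1 y0 y1 : R) :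
  (forall a b c d, a <= b -> c <= d -> P a b c d -> 
    let m := (a + b) / 2 in let n := (c + d) / 2 in
    [\/ P a m c n, P m b c n, P a m n d | P m b n d]) ->
  x0 <= x1 -> y0 <= y1 -> P x0 x1 y0 y1 ->
  exists p q, [/\ x0 <= p <= x1, y0 <= q <= y1 & forall e : R, 0 < e -> exists a b c d,
    [/\ P a b c d, (x0 <= a /\ b <= x1), (y0 <= c /\ d <= y1),
        (a <= p <= b /\ c <= q <= d) & (b - a) + (d - c) < e]].
Proof.
move=> H x01 y01 P0.
pose T := (R * R * (R * R))%type.
pose good (Q : T) := [/\ Q.1.1 <= Q.1.2, Q.2.1 <= Q.2.2 & P Q.1.1 Q.1.2 Q.2.1 Q.2.2].
pose sub (Q Q' : T) := [/\ Q.1.1 <= Q'.1.1, Q'.1.2 <= Q.1.2, Q.2.1 <= Q'.2.1, Q'.2.2 <= Q.2.2 &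
  (Q'.1.2 - Q'.1.1 = (Q.1.2 - Q.1.1) / 2 /\ Q'.2.2 - Q'.2.1 = (Q.2.2 - Q.2.1) / 2)].
have [f Hf] : {f : T -> T & forall Q, good Q -> good (f Q) /\ sub Q (f Q)}.
  apply: (@choice _ _ (fun Q Q' => good Q -> good Q' /\ sub Q Q')) => -[[a b] [c d]].
  (* The choice function has to be total: a rectangle that is not [good] is sent to itself. *)
  case: (pselect (good (a, b, (c, d)))) => [g|ng]; last by exists (a, b, (c, d)).
  have [/= ab cd Pq] := g.
  case: (H a b c d ab cd Pq) => Pq'.
  - exists (a, (a + b) / 2, (c, (c + d) / 2)); rewrite /good /sub /= => _; split; split => //; try lra; split; lra.
  - exists ((a + b) / 2, b, (c, (c + d) / 2)); rewrite /good /sub /= => _; split; split => //; try lra; split; lra.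
  - exists (a, (a + b) / 2, ((c + d) / 2, d)); rewrite /good /sub /= => _; split; split => //; try lra; split; lra.
  - exists ((a + b) / 2, b, ((c + d) / 2, d)); rewrite /good /sub /= => _; split; split => //; try lra; split; lra.
pose Q n := iter n f (x0, x1, (y0, y1)).
have gQ n : good (Q n).
  elim: n => [|n ih]; first by split.
  by have [] := Hf _ ih.
have sQ n : sub (Q n) (Q n.+1) by have [] := Hf _ (gQ n).
have mono m n : [/\ (Q n).1.1 <= (Q (m + n)%N).1.1, (Q (m + n)%N).1.2 <= (Q n).1.2,
   (Q n).2.1 <= (Q (m + n)%N).2.1 & (Q (m + n)%N).2.2 <= (Q n).2.2].
  elim: m => [|m [h1 h2 h3 h4]]; first by rewrite add0n !lexx.
  have [k1 k2 k3 k4 _] := sQ (m + n)%N; rewrite addSn.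
  split; [exact: le_trans k1|exact: le_trans h2|exact: le_trans k3|exact: le_trans h4].
have cross m n : (Q m).1.1 <= (Q n).1.2 /\ (Q m).2.1 <= (Q n).2.2.
  have [h1 _ h3 _] := mono n m; have [_ k2 _ k4] := mono m n.
  have [g1 g2 _] := gQ (m + n)%N.
  rewrite addnC in h1 h3; split.
    exact: le_trans h1 (le_trans g1 k2).
  exact: le_trans h3 (le_trans g2 k4).
pose p := sup (range (fun n => (Q n).1.1)).
pose q := sup (range (fun n => (Q n).2.1)).
have pP n : (Q n).1.1 <= p <= (Q n).1.2.
  apply/andP; split.
    apply: ub_le_sup; last by exists n.
    by exists (Q 0%N).1.2 => _ [m _ <-]; have [] := cross m 0%N.
  by apply: ge_sup; [exists (Q 0%N).1.1; exists 0%N|move=> _ [m _ <-]; have [] := cross m n].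
have qP n : (Q n).2.1 <= q <= (Q n).2.2.
  apply/andP; split.
    apply: ub_le_sup; last by exists n.
    by exists (Q 0%N).2.2 => _ [m _ <-]; have [] := cross m 0%N.
  by apply: ge_sup; [exists (Q 0%N).2.1; exists 0%N|move=> _ [m _ <-]; have [] := cross m n].
exists p, q; split; [exact: (pP 0%N)|exact: (qP 0%N)|move=> e e0].
have size n : ((Q n).1.2 - (Q n).1.1) + ((Q n).2.2 - (Q n).2.1) = ((x1 - x0) + (y1 - y0)) / 2 ^+ n.
  elim: n => [|n ih]; first by rewrite expr0 divr1.
  have [_ _ _ _ [-> ->]] := sQ n; rewrite -mulrDl ih exprS; field.
  by rewrite expf_neq0.
have [n hn] : exists n, ((x1 - x0) + (y1 - y0)) / 2 ^+ n < e.
  set L := (x1 - x0) + (y1 - y0).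
  exists (Num.truncn (L / e)).+1.
  rewrite ltr_pdivrMr ?exprn_gt0 // mulrC -ltr_pdivrMr //.
  apply: lt_le_trans (truncnS_gt _) _.
  rewrite -natrX ler_nat; exact/ltnW/ltn_expl.
have [m1 m2 m3 m4] := mono n 0%N; rewrite addn0 in m1 m2 m3 m4.
have [g1 g2 g3] := gQ n.
by exists (Q n).1.1, (Q n).1.2, (Q n).2.1, (Q n).2.2; split => //; rewrite size.
Qed.

Variables (f : Cx -> Cx) (X0 X1 Y0 Y1 : R).
Hypotheses (X01 : X0 < X1) (Y01 : Y0 < Y1).
Hypothesis fh : forall z : Cx, X0 <= Re z <= X1 -> Y0 <= Im z <= Y1 -> holo f z.

(** Clamping both coordinates to the rectangle extends [f] continuously to the plane, so that its
    slices are continuous on the whole line, as [curve_primitive] asks. *)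
Let clamp a b (x : R) := Num.max a (Num.min b x).
Let clamp_in a b x : a <= b -> a <= clamp a b x <= b.
Proof. by move=> ab; rewrite /clamp le_max lexx ge_max ab ge_min lexx. Qed.
Let clamp_id a b x : a <= x <= b -> clamp a b x = x.
Proof. by move=> /andP[ax xb]; rewrite /clamp min_r // max_r. Qed.
Let clamp_lip a b x y : `|clamp a b x - clamp a b y| <= `|x - y|.
Proof.
rewrite /clamp; case: (leP b x) => h1; case: (leP b y) => h2;
  [set u := b; set v := b|set u := b; set v := y|set u := x; set v := b|set u := x; set v := y];
  case: (leP a u) => h3; case: (leP a v) => h4; rewrite ler_norml; apply/andP; split;
  have := ler_norm (x - y); have := ler_norm (y - x); rewrite (distrC y x); rewrite /u /v in h3 h4 *; lra.
Qed.
Let pt (x y : R) : Cx := (x +i* y)%C.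
Let clampC (z : Cx) := pt (clamp X0 X1 (Re z)) (clamp Y0 Y1 (Im z)).
Let fc z := f (clampC z).
Let cts_fc z : cts fc z.
Proof.
move=> e e0.
have : holo f (clampC z) by apply: fh; apply: clamp_in; exact: ltW.
move=> /holo_cts /(_ e e0) [d d0 Hd]; exists (d / 2); first by rewrite divr_gt0.
move=> h hd; rewrite /fc -[clampC (z + h)](subrKC (clampC z)); apply: Hd.
apply: le_lt_trans (cmod_le_ReIm _) _; rewrite ReB ImB.
apply: (@le_lt_trans _ _ (`|Re (z + h) - Re z| + `|Im (z + h) - Im z|)).
  by apply: lerD; exact: clamp_lip.
rewrite -ReB -ImB addrAC subrr add0r.
have := Re_le h; have := Im_le h; lra.
Qed.
Let fcE x y : X0 <= x <= X1 -> Y0 <= y <= Y1 -> fc (pt x y) = f (pt x y).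
Proof. by move=> hx hy; rewrite /fc /clampC clamp_id // clamp_id. Qed.

Let ptDx x y k : pt (x + k) y = pt x y + rc k.
Proof. by apply: eqC; rewrite !ReImE ?addr0. Qed.
Let ptDy x y k : pt x (y + k) = pt x y + 'i%C * rc k.
Proof. by apply: eqC; rewrite ?ReD ?ImD ?ReM ?ImM !ReImE /=; ring. Qed.
Let cmod_i : cmod ('i%C : Cx) = 1.
Proof. by rewrite cmodE /= expr0n expr1n add0r sqrtr1. Qed.

Let exH y : exists G : R -> Cx, forall x, X0 - 1 < x < X1 + 1 -> cder_curve G x (fc (pt x y)).
Proof.
apply: curve_primitive => x e e0; have [d d0 Hd] := cts_fc (pt x y) e0.
by exists d => // h hd; rewrite ptDx; apply: Hd; rewrite cmod_rc.
Qed.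
Let exV x : exists G : R -> Cx, forall y, Y0 - 1 < y < Y1 + 1 -> cder_curve G y (fc (pt x y)).
Proof.
apply: curve_primitive => y e e0; have [d d0 Hd] := cts_fc (pt x y) e0.
by exists d => // h hd; rewrite ptDy; apply: Hd; rewrite cmodM cmod_i mul1r cmod_rc.
Qed.

(** The boundary integral of [f] is expressed through primitives of the slices. It is additive under
    quartering and small of second order near a point of differentiability, hence zero; integrating
    from the centre along two sides then gives the primitive. *)
Lemma box_primitive_exists : exists P : Cx -> Cx, forall z : Cx,
  X0 < Re z < X1 -> Y0 < Im z < Y1 -> cder P z (f z).
Proof.
have [H HH'] := choice exH; have [V HV'] := choice exV.
have HH x y : X0 <= x <= X1 -> Y0 <= y <= Y1 -> cder_curve (H y) x (f (pt x y)).
  by move=> hx hy; rewrite -fcE //; apply: HH'; lra.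
have HV x y : X0 <= x <= X1 -> Y0 <= y <= Y1 -> cder_curve (V x) y (f (pt x y)).
  by move=> hx hy; rewrite -fcE //; apply: HV'; lra.
(* The integral of [f] around the boundary of [a, b] x [c, d]. *)
pose I a b c d := (H c b - H c a) + 'i%C * (V b d - V b c) - (H d b - H d a) - 'i%C * (V a d - V a c).
have Ibound a b c d A B z0 M : X0 <= a -> a <= b -> b <= X1 -> Y0 <= c -> c <= d -> d <= Y1 ->
  (forall x y, a <= x <= b -> c <= y <= d -> cmod (f (pt x y) - A - B * (pt x y - z0)) <= M) ->
  cmod (I a b c d) <= 2 * M * ((b - a) + (d - c)).
  move=> hXa ab hXb hYc cd hYd hM.
  (* Subtracting a primitive of the affine function A + B (z - z0) leaves [I] unchanged, since its
     increments cancel around the boundary. *)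
  pose K y x := H y x - (A * rc x + B / 2 * (pt x y - z0) ^+ 2).
  pose W x y := 'i%C * V x y - (A * 'i%C * rc y + B / 2 * (pt x y - z0) ^+ 2).
  have sq_der (u : Cx) (w : Cx) x : cder_curve (fun x => (u + rc x * w) ^+ 2) x (2 * (u + rc x * w) * w).
    by have := cder_curve_comp (cder_sqr (u + rc x * w)).
  have derK y x : a <= x <= b -> c <= y <= d -> cder_curve (K y) x (f (pt x y) - A - B * (pt x y - z0)).
    move=> hx hy.
    have hd := HH x y; have {}hd := hd ltac:(lra) ltac:(lra).
    have h1 := cder_curve_affine 1 (- A) hd.
    have h2 := cder_curve_affine (- (B / 2)) 0 (sq_der (pt 0 y - z0) 1 x).
    have ptE t : pt t y = pt 0 y + rc t by rewrite -ptDx add0r.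
    apply: cder_curve_eq (cder_curveD h1 h2) => [t|].
      by rewrite /K (ptE t); ring.
    by rewrite (ptE x); field.
  have derW x y : a <= x <= b -> c <= y <= d -> cder_curve (W x) y ('i%C * (f (pt x y) - A - B * (pt x y - z0))).
    move=> hx hy.
    have hd := HV x y; have {}hd := hd ltac:(lra) ltac:(lra).
    have h1 := cder_curve_affine 'i%C (- (A * 'i%C)) hd.
    have h2 := cder_curve_affine (- (B / 2)) 0 (sq_der (pt x 0 - z0) 'i%C y).
    have ptE t : pt x t = pt x 0 + rc t * 'i%C by rewrite mulrC -ptDy add0r.
    apply: cder_curve_eq (cder_curveD h1 h2) => [t|].
      by rewrite /W (ptE t); ring.
    by rewrite (ptE y); field.
  have bK y : c <= y <= d -> cmod (K y b - K y a) <= M * (b - a).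
    move=> hy; apply: (mv_ineq ab (fun x hx => derK y x hx hy)) => x hx; exact: hM.
  have bW x : a <= x <= b -> cmod (W x d - W x c) <= M * (d - c).
    move=> hx; apply: (mv_ineq cd (fun y hy => derW x y hx hy)) => y hy.
    by rewrite cmodM cmod_i mul1r; exact: hM.
  have -> : I a b c d = (K c b - K c a) + (W b d - W b c) - (K d b - K d a) - (W a d - W a c).
    by rewrite /I /K /W; ring.
  have k1 := bK c ltac:(lra). have k2 := bK d ltac:(lra).
  have k3 := bW b ltac:(lra). have k4 := bW a ltac:(lra).
  apply: le_trans (cmodB _ _) _.
  have := cmodB (K c b - K c a + (W b d - W b c)) (K d b - K d a).
  have := cmodD (K c b - K c a) (W b d - W b c).
  lra.
have I0 a b c d : X0 <= a -> a <= b -> b <= X1 -> Y0 <= c -> c <= d -> d <= Y1 -> I a b c d = 0.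
  move=> hXa ab hXb hYc cd hYd; apply: cmod_eps0.
  (* The right side of each quarter is a quarter of the whole, so a failure is inherited by some
     quarter. At the limit point, approximating [f] within [e / 4] gives the bound with [e / 2]: a
     contradiction. *)
  have key (e : R) : 0 < e -> cmod (I a b c d) <= e * ((b - a) + (d - c)) ^+ 2.
    move=> e0; rewrite leNgt; apply/negP => bad.
    pose P a' b' c' d' := e * ((b' - a') + (d' - c')) ^+ 2 < cmod (I a' b' c' d').
    have [|p [q [hp hq Hpq]]] := @bisection P a b c d _ ab cd bad.
      move=> a' b' c' d' ab' cd' P' m n.
      case: (ltP (e * ((m - a') + (n - c')) ^+ 2) (cmod (I a' m c' n))) => h1; first by constructor 1.
      case: (ltP (e * ((b' - m) + (n - c')) ^+ 2) (cmod (I m b' c' n))) => h2; first by constructor 2.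
      case: (ltP (e * ((m - a') + (d' - n)) ^+ 2) (cmod (I a' m n d'))) => h3; first by constructor 3.
      case: (ltP (e * ((b' - m) + (d' - n)) ^+ 2) (cmod (I m b' n d'))) => h4; first by constructor 4.
      exfalso; move: P'; rewrite /P; apply/negP; rewrite -leNgt.
      have -> : I a' b' c' d' = (I a' m c' n + I m b' c' n) + (I a' m n d' + I m b' n d').
        by rewrite /I; ring.
      apply: le_trans (cmodD _ _) _.
      have E : e * ((b' - a') + (d' - c')) ^+ 2 = 4 * (e * (((b' - a') + (d' - c')) / 2) ^+ 2) by field.
      have E1 : (m - a') + (n - c') = ((b' - a') + (d' - c')) / 2 by rewrite /m /n; field.
      have E2 : (b' - m) + (n - c') = ((b' - a') + (d' - c')) / 2 by rewrite /m /n; field.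
      have E3 : (m - a') + (d' - n) = ((b' - a') + (d' - c')) / 2 by rewrite /m /n; field.
      have E4 : (b' - m) + (d' - n) = ((b' - a') + (d' - c')) / 2 by rewrite /m /n; field.
      rewrite E; rewrite E1 in h1; rewrite E2 in h2; rewrite E3 in h3; rewrite E4 in h4.
      have := cmodD (I a' m c' n) (I m b' c' n); have := cmodD (I a' m n d') (I m b' n d'); lra.
    have [l fl] : holo f (pt p q) by apply: fh; rewrite /pt /=; lra.
    have e4 : 0 < e / 4 by rewrite divr_gt0.
    have [dl dl0 Hdl] := fl _ e4.
    have [a' [b' [c' [d' [Pbad [ha hb] [hc hd] [hp' hq'] small]]]]] := Hpq _ dl0.
    set L := (b' - a') + (d' - c') in small.
    have : cmod (I a' b' c' d') <= 2 * (e / 4 * L) * L.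
      apply: (Ibound a' b' c' d' (f (pt p q)) l (pt p q)); try lra.
      move=> x y hx hy; have E : pt x y = pt p q + (pt x y - pt p q) by rewrite subrKC.
      have hL : cmod (pt x y - pt p q) <= L.
        apply: le_trans (cmod_le_ReIm _) _; rewrite ReB ImB /pt /=; rewrite /L; apply: lerD.
          by rewrite ler_norml; lra.
        by rewrite ler_norml; lra.
      rewrite {1}E; apply: le_trans (Hdl _ _) _; first exact: le_lt_trans small.
      by rewrite ler_wpM2l // ltW.
    move: Pbad; rewrite /P -/L => /lt_le_trans h /h.
    have -> : 2 * (e / 4 * L) * L = e / 2 * L ^+ 2 by field.
    by rewrite ltNge ler_wpM2r ?sqr_ge0 //; lra.
  set L := (b - a) + (d - c) in key => e e0.
  have K0 : 0 < 1 + L ^+ 2 by rewrite ltr_wpDr ?sqr_ge0.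
  apply: le_trans (key _ (divr_gt0 e0 K0)) _.
  rewrite mulrAC ler_pdivrMr // ler_wpM2l ?ltW //; lra.
(* Every orientation occurs, because z and z + h may lie on any side of each other and of the
   centre. *)
have I0' a b c d : X0 <= a <= X1 -> X0 <= b <= X1 -> Y0 <= c <= Y1 -> Y0 <= d <= Y1 -> I a b c d = 0.
  move=> /andP[? ?] /andP[? ?] /andP[? ?] /andP[? ?].
  have s1 a' b' c' d' : I b' a' c' d' = - I a' b' c' d' by rewrite /I; ring.
  have s2 a' b' c' d' : I a' b' d' c' = - I a' b' c' d' by rewrite /I; ring.
  case: (leP a b) => ab; case: (leP c d) => cd.
  - exact: I0.
  - by rewrite s2 I0 ?oppr0 // ltW.
  - by rewrite s1 I0 ?oppr0 // ltW.
  - by rewrite s1 s2 I0 ?oppr0 // ltW.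
pose x' := (X0 + X1) / 2; pose y' := (Y0 + Y1) / 2.
pose P (z : Cx) := (H y' (Re z) - H y' x') + 'i%C * (V (Re z) (Im z) - V (Re z) y').
exists P => z hx hy e e0.
have e3 : 0 < e / 2 by rewrite divr_gt0.
have : holo f z by apply: fh; lra.
move=> /holo_cts /(_ _ e3) [d d0 Hd].
pose rho := Num.min (Num.min (Re z - X0) (X1 - Re z)) (Num.min (Im z - Y0) (Y1 - Im z)).
have rho0 : 0 < rho by rewrite /rho !lt_min; lra.
exists (Num.min (d / 2) rho); first by rewrite lt_min rho0 divr_gt0.
move=> h; rewrite lt_min /rho !lt_min => /andP[hd /andP[/andP[h1 h2] /andP[h3 h4]]].
have hk := Re_le h; have hl := Im_le h.
move: (hk) (hl); rewrite !ler_norml => /andP[hk1 hk2] /andP[hl1 hl2].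
set x := Re z in hx h1 h2 *; set y := Im z in hy h3 h4 *.
set k := Re h in hk hk1 hk2 *; set l := Im h in hl hl1 hl2 *.
have zE : z = pt x y by rewrite [LHS]cE.
have hx' : X0 <= x <= X1 by case/andP: hx => *; rewrite !ltW.
have hy' : Y0 <= y <= Y1 by case/andP: hy => *; rewrite !ltW.
have hxk : X0 <= x + k <= X1 by apply: (shift_in h1 h2).
have hyl : Y0 <= y + l <= Y1 by apply: (shift_in h3 h4).
have hym : Y0 <= y' <= Y1 by apply: midpoint_in.
(* The vanishing of this integral moves the vertical path from abscissa [x] to [x + k], so that only
   the two short sides next to [z] remain in the increment of [P]. *)
have I1 := I0' x (x + k) y' y hx' hxk hym hy'.
have PE : P (z + h) - P z = (H y (x + k) - H y x) + 'i%C * (V (x + k) (y + l) - V (x + k) y).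
  have J : I x (x + k) y' y = P (z + h) - P z - ((H y (x + k) - H y x) + 'i%C * (V (x + k) (y + l) - V (x + k) y)).
    by rewrite /I /P ReD ImD -/x -/y -/k -/l; ring.
  by move: J; rewrite I1 => /eqP; rewrite eq_sym subr_eq0 => /eqP.
have hE : h = rc k + 'i%C * rc l by rewrite [LHS]complexE.
have -> : P (z + h) - P z - f z * h = (H y (x + k) - H y x - f z * rc k) +
    'i%C * (V (x + k) (y + l) - V (x + k) y - f z * rc l).
  by rewrite PE {1}hE; ring.
have close x2 y2 : `|x2 - x| <= `|k| -> `|y2 - y| <= `|l| -> cmod (f (pt x2 y2) - f z) <= e / 2.
  move=> hx2 hy2; have -> : pt x2 y2 = z + (pt x2 y2 - z) by rewrite subrKC.
  apply: Hd; apply: le_lt_trans (cmod_le_ReIm _) _; rewrite ReB ImB -/x -/y /pt /=; lra.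
have lin g g' (t : R) (w : Cx) : cder_curve g t g' -> cder_curve (fun s => g s - w * rc s) t (g' - w).
  by move=> /(cder_curve_affine 1 (- w)); apply: cder_curve_eq => [s|]; ring.
apply: le_trans (cmodD _ _) _; rewrite cmodM cmod_i mul1r [e]splitr mulrDl; apply: lerD.
  have -> : H y (x + k) - H y x - f z * rc k = (H y (x + k) - f z * rc (x + k)) - (H y x - f z * rc x).
    by rewrite rcD; ring.
  have := @mv_ineq_abs (fun t => H y t - f z * rc t) (fun t => f (pt t y) - f z) x (x + k) (e / 2).
  rewrite [X in `|X|]addrAC subrr add0r => Hm; apply: le_trans (Hm _ _) _.
  - by move=> t ht; apply: lin; apply: HH => //; apply: segment_in ht.
  - by move=> t ht; apply: close; [exact: segment_dist|rewrite subrr normr0].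
  - by rewrite ler_wpM2l // ltW.
have -> : V (x + k) (y + l) - V (x + k) y - f z * rc l = (V (x + k) (y + l) - f z * rc (y + l)) - (V (x + k) y - f z * rc y).
  by rewrite rcD; ring.
have := @mv_ineq_abs (fun t => V (x + k) t - f z * rc t) (fun t => f (pt (x + k) t) - f z) y (y + l) (e / 2).
rewrite [X in `|X|]addrAC subrr add0r => Hm; apply: le_trans (Hm _ _) _.
- by move=> t ht; apply: lin; apply: HV => //; apply: segment_in ht.
- by move=> t ht; apply: close; [rewrite [X in `|X|]addrAC subrr add0r|exact: segment_dist].
- by rewrite ler_wpM2l // ltW.
Qed.
End Goursat.

(** * The maximum principle and Schwarz's lemma *)

Section MaximumPrinciple.
Variable R : realType.
Local Notation Cx := (C R).

Definition ctsr (u : Cx -> R) z := forall e : R, 0 < e -> exists2 d : R, 0 < d &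
  forall h : Cx, cmod h < d -> `|u (z + h) - u z| <= e.

Let pt (p : R * R) : Cx := (p.1 +i* p.2)%C.

Lemma ctsr_continuous (u : Cx -> R) (p : R * R) : ctsr u (pt p) ->
  {for p, continuous (u \o pt)}.
Proof.
move=> H; apply/cvgrPdist_le => e e0; have [d d0 Hd] := H e e0.
have d2 : 0 < d / 2 by rewrite divr_gt0.
apply: (filterS _ (nbhsx_ballx p (d / 2) d2)) => q [/= q1 q2].
rewrite /ball /= in q1 q2.
rewrite distrC -[pt q](subrKC (pt p)); apply: Hd.
apply: le_lt_trans (cmod_le_ReIm _) _; rewrite ReB ImB /=.
by rewrite distrC [`|q.2 - _|]distrC [d]splitr ltrD.
Qed.

Lemma ctsr_cmod (a z : Cx) : ctsr (fun w => cmod (w - a)) z.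
Proof.
move=> e e0; exists e => // h he.
have -> : z + h - a = (z - a) + h by ring.
rewrite ler_norml; apply/andP; split.
  have := cmod_lowD (z - a) h; lra.
have := cmodD (z - a) h; lra.
Qed.

(** The case [rho = r], a circle, is included; [holo_zero_disc] uses it to bound a function
    there. *)
Lemma annulus_max (u : Cx -> R) (a : Cx) (rho r : R) :
  (exists z : Cx, rho <= cmod (z - a) <= r) ->
  (forall z, rho <= cmod (z - a) <= r -> ctsr u z) ->
  exists z, rho <= cmod (z - a) <= r /\ forall w, rho <= cmod (w - a) <= r -> u w <= u z.
Proof.
move=> [z0 hz0] cu.
pose A : set (R * R) := [set p | rho <= cmod (pt p - a) <= r].
have A0 : A !=set0 by exists (Re z0, Im z0); rewrite /A /= /pt -cE.
have cA : compact A.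
  apply: (@subclosed_compact _ A (`[Re a - r, Re a + r] `*` `[Im a - r, Im a + r])).
  - have -> : A = (fun p => cmod (pt p - a)) @^-1` `[rho, r].
      by apply/seteqP; split => p; rewrite /A /= in_itv.
    apply: closed_comp; last exact: itv_closed.
    by move=> p _; apply: (ctsr_continuous (u := fun w => cmod (w - a))); exact: ctsr_cmod.
  - by apply: compact_setX; exact: segment_compact.
  - move=> p /andP[_ pr]; split; rewrite /= in_itv /=.
      have := le_trans (Re_le _) pr; rewrite ReB /= ler_norml; lra.
    have := le_trans (Im_le _) pr; rewrite ImB /= ler_norml; lra.
have [|c cA' Hc] := @compact_EVT_max _ R (u \o pt) A A0 cA.
  apply: continuous_in_subspaceT => p; rewrite inE => pA.
  by apply: ctsr_continuous; exact: cu.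
rewrite inE in cA'; exists (pt c); split => // w hw.
have := Hc (Re w, Im w); rewrite inE /= /pt -cE; apply.
by rewrite /A /= /pt -cE.
Qed.

(** Two derivatives at [z] are what the Taylor argument in the maximum principle consumes. For a
    function that is only holomorphic, [holo_schwarz] supplies them through difference quotients of
    a primitive. *)
Definition holo2 (f : Cx -> Cx) z := exists f1 : Cx -> Cx,
  (exists2 d : R, 0 < d & forall w, cmod (w - z) < d -> cder f w (f1 w)) /\ holo f1 z.

Lemma taylor2 f (f1 : Cx -> Cx) z f2 : (exists2 d : R, 0 < d & forall w, cmod (w - z) < d -> cder f w (f1 w)) ->
  cder f1 z f2 -> forall e : R, 0 < e -> exists2 d : R, 0 < d & forall h, cmod h < d ->
  cmod (f (z + h) - f z - f1 z * h - f2 / 2 * h ^+ 2) <= e * cmod h ^+ 2.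
Proof.
move=> [d1 d10 H1] H2 e e0; have [d2 d20 Hd2] := H2 e e0.
exists (Num.min d1 d2); first by rewrite lt_min d10.
move=> h; rewrite lt_min => /andP[hd1 hd2].
pose g w := f w - f1 z * (w - z) - f2 / 2 * (w - z) ^+ 2.
have -> : f (z + h) - f z - f1 z * h - f2 / 2 * h ^+ 2 = g (z + h) - g z.
  by rewrite /g subrr; ring.
have gder w : cmod (w - z) < d1 -> cder g w (f1 w - f1 z - f2 * (w - z)).
  move=> hw.
  have h1 : cder (fun w => w - z) w 1 by have := cderB (cder_id w) (cder_cst z w); rewrite subr0.
  have h2 := cder_comp h1 (cder_sqr _).
  have h3 := cderB (cderB (H1 w hw) (cder_scale (f1 z) h1)) (cder_scale (f2 / 2) h2).
  have -> : f1 w - f1 z - f2 * (w - z) = f1 w - f1 z * 1 - f2 / 2 * (2 * (w - z) * 1) by field.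
  exact: h3.
have seg x : 0 <= x <= 1 -> cmod (z + rc x * (z + h - z) - z) <= cmod h.
  move=> /andP[x0 x1]; have -> : z + rc x * (z + h - z) - z = rc x * h by ring.
  by rewrite cmodM cmod_rc ger0_norm // ler_piMl ?cmod_ge0.
have := @mv_ineq_seg R g (fun w => f1 w - f1 z - f2 * (w - z)) z (z + h) (e * cmod h).
have -> : cmod (z + h - z) = cmod h by congr cmod; ring.
rewrite -mulrA -expr2; apply.
  by move=> x hx; apply: gder; apply: le_lt_trans (seg x hx) _.
move=> x hx; set w := z + rc x * (z + h - z).
have hw := seg x hx; rewrite -/w in hw.
rewrite -[in f1 w](subrKC z w); apply: le_trans (Hd2 _ _) _; first exact: le_lt_trans hw _.
by rewrite ler_wpM2l // ltW.
Qed.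

Lemma holo2_holo f z : holo2 f z -> holo f z.
Proof. by move=> [f1 [[d d0 H] _]]; exists (f1 z); apply: H; rewrite subrr cmod0. Qed.

Lemma ctsr_cmod_sqr f z : cts f z -> ctsr (fun w => cmod (f w) ^+ 2) z.
Proof.
move=> H e e0; set K := 2 * cmod (f z) + 1.
have K0 : 0 < K by rewrite /K; have := cmod_ge0 (f z); lra.
have m0 : 0 < Num.min 1 (e / K) by rewrite lt_min ltr01 divr_gt0.
have [d d0 Hd] := H _ m0; exists d => // h /Hd.
rewrite le_min => /andP[h1 h2].
set X := f (z + h) in h1 h2 *; pose Y := f z.
rewrite -/Y -/K in h1 h2 *.
have -> : cmod X ^+ 2 - cmod Y ^+ 2 = (cmod X - cmod Y) * (cmod X + cmod Y) by ring.
have a1 : `|cmod X - cmod Y| <= cmod (X - Y).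
  rewrite ler_norml; have := cmod_lowB X Y; have := cmod_lowB Y X; rewrite (cmodBC Y X); lra.
rewrite normrM; apply: le_trans (_ : e / K * K <= _); last by rewrite divfK // gt_eqF.
apply: ler_pM => //; first exact: le_trans a1 h2.
rewrite ger0_norm ?addr_ge0 ?cmod_ge0 // /K -/Y.
have := cmod_lowB X Y; lra.
Qed.

Lemma cmod_four (c B D : Cx) : cmod (c + B + D) ^+ 2 + cmod (c - B + D) ^+ 2 +
  (cmod (c + 'i%C * B - D) ^+ 2 + cmod (c - 'i%C * B - D) ^+ 2) =
  4 * (cmod c ^+ 2 + cmod B ^+ 2 + cmod D ^+ 2).
Proof.
have ReiM (w : Cx) : Re ('i%C * w) = - Im w by rewrite ReM /= mul0r mul1r sub0r.
have ImiM (w : Cx) : Im ('i%C * w) = Re w by rewrite ImM /= mul0r mul1r add0r.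
by rewrite !cmod_sqr !(ReD, ImD, ReN, ImN, ReiM, ImiM); ring.
Qed.

Lemma cmodi : cmod ('i%C : Cx) = 1.
Proof. by rewrite cmodE /= expr0n expr1n add0r sqrtr1. Qed.

(* The average of the left-hand side over z + h i^k, k = 0, .., 3, exceeds its value
   at z: the first and second order terms of f contribute only squares (cmod_four). *)
Lemma not_local_max f a z (eps : R) : 0 < eps -> holo2 f z ->
  ~ exists2 d : R, 0 < d & forall w, cmod (w - z) < d ->
     cmod (f w) ^+ 2 + eps * cmod (w - a) ^+ 2 <= cmod (f z) ^+ 2 + eps * cmod (z - a) ^+ 2.
Proof.
move=> e0 [f1 [Hf1 [f2 Hf2]]] [d d0 Hd].
(* [K] bounds the Taylor polynomial for |h| <= 1. After squaring, a Taylor error of eps / (4 K) t^2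
   costs at most eps / 2 t^2, half of what the penalty term gains. *)
set K := cmod (f z) + cmod (f1 z) + cmod (f2 / 2) + 1.
have K0 : 0 < K by rewrite /K ltr_wpDl ?ltr01 // !addr_ge0 ?cmod_ge0.
have [|d1 d10 Hd1] := @taylor2 f f1 z f2 Hf1 Hf2 (eps / (4 * K)); first by rewrite divr_gt0 // mulr_gt0.
set t := Num.min (Num.min d d1) 1 / 2.
have t0 : 0 < t by rewrite divr_gt0 // !lt_min d0 d10 ltr01.
have : t < Num.min (Num.min d d1) 1 by rewrite /t ltr_pdivrMr // ltr_pMr ?lt_min ?d0 ?d10 ?ltr01 // ltr1n.
rewrite !lt_min -andbA => /and3P[td td1 t1].
set e' := eps / (4 * K) in Hd1.
have e'0 : 0 < e' by rewrite divr_gt0 // mulr_gt0.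
pose c := f z.
have low (h : Cx) : cmod h = t -> cmod (c + f1 z * h + f2 / 2 * h ^+ 2) ^+ 2 - 2 * K * e' * t ^+ 2 <= cmod (f (z + h)) ^+ 2.
  move=> ht; set X := c + f1 z * h + f2 / 2 * h ^+ 2.
  have XK : cmod X <= K.
    apply: le_trans (cmodD _ _) _; apply: (@le_trans _ _ (cmod c + cmod (f1 z) + cmod (f2 / 2))).
      apply: lerD; last by rewrite cmodM cmodX ht ler_piMr ?cmod_ge0 // expr_le1 // ltW.
      apply: le_trans (cmodD _ _) _; rewrite lerD2l cmodM ht.
      by rewrite ler_piMr ?cmod_ge0 // ltW.
    by rewrite /K lerDl.
  have := Hd1 h; rewrite ht => /(_ td1) He.
  have diff : cmod X - cmod (f (z + h)) <= e' * t ^+ 2.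
    apply: le_trans (cmod_lowB _ _) _; rewrite cmodBC; apply: le_trans He.
    by rewrite le_eqVlt; apply/orP; left; apply/eqP; congr cmod; rewrite /X /c; ring.
  have A := cmod_ge0 X; have B := cmod_ge0 (f (z + h)).
  have t2 : 0 <= e' * t ^+ 2 by rewrite mulr_ge0 ?exprn_ge0 ?ltW.
  set x := cmod X in XK diff A *; set y := cmod (f (z + h)) in diff B *.
  set q := e' * t ^+ 2 in diff t2.
  have -> : 2 * K * e' * t ^+ 2 = 2 * K * q by rewrite /q; ring.
  have KK : 0 <= 2 * K * q by apply: mulr_ge0 => //; apply: mulr_ge0 => //; exact: ltW.
  have [xy|yx] := leP x y.
    have : x ^+ 2 <= y ^+ 2 by rewrite ler_pXn2r.
    lra.
  have E : x ^+ 2 = (x - y) * (x + y) + y ^+ 2 by ring.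
  have : (x - y) * (x + y) <= q * (2 * K) by apply: ler_pM => //; lra.
  rewrite E; lra.
have i2 : 'i%C ^+ 2 = -1 :> Cx by exact: sqr_i.
have L1 := low (rc t); have L2 := low (- rc t); have L3 := low ('i%C * rc t); have L4 := low (- ('i%C * rc t)).
rewrite ?cmodN ?cmodM ?cmodi ?cmod_rc ?mul1r (ger0_norm (ltW t0)) in L1 L2 L3 L4.
have {}L1 := L1 erefl; have {}L2 := L2 erefl; have {}L3 := L3 erefl; have {}L4 := L4 erefl.
have M1 := Hd (z + rc t); have M2 := Hd (z - rc t); have M3 := Hd (z + 'i%C * rc t); have M4 := Hd (z - 'i%C * rc t).
have N (k : Cx) : cmod (z + k - z) = cmod k by congr cmod; ring.
rewrite !N ?cmodN ?cmodM ?cmodi ?cmod_rc ?mul1r (ger0_norm (ltW t0)) in M1 M2 M3 M4.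
have {}M1 := M1 td; have {}M2 := M2 td; have {}M3 := M3 td; have {}M4 := M4 td.
set B := f1 z * rc t; set D := f2 / 2 * rc t ^+ 2.
have F1 : cmod (c + f1 z * rc t + f2 / 2 * rc t ^+ 2) = cmod (c + B + D) by [].
have F2 : cmod (c + f1 z * - rc t + f2 / 2 * (- rc t) ^+ 2) = cmod (c - B + D) by congr cmod; rewrite /B /D; ring.
have F3 : cmod (c + f1 z * ('i%C * rc t) + f2 / 2 * ('i%C * rc t) ^+ 2) = cmod (c + 'i%C * B - D).
  by congr cmod; rewrite /B /D exprMn i2; ring.
have F4 : cmod (c + f1 z * - ('i%C * rc t) + f2 / 2 * (- ('i%C * rc t)) ^+ 2) = cmod (c - 'i%C * B - D).
  by congr cmod; rewrite /B /D sqrrN exprMn i2; ring.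
have S1 := cmod_four c B D.
have S2 := cmod_four (z - a) (rc t) 0.
rewrite !(addr0, subr0) cmod0 cmod_rc (ger0_norm (ltW t0)) in S2.
have G1 : z + rc t - a = z - a + rc t by ring.
have G2 : z - rc t - a = z - a - rc t by ring.
have G3 : z + 'i%C * rc t - a = z - a + 'i%C * rc t by ring.
have G4 : z - 'i%C * rc t - a = z - a - 'i%C * rc t by ring.
rewrite F1 in L1; rewrite F2 in L2; rewrite F3 in L3; rewrite F4 in L4.
rewrite G1 in M1; rewrite G2 in M2; rewrite G3 in M3; rewrite G4 in M4.
have Ke : 2 * K * e' * t ^+ 2 = eps / 2 * t ^+ 2 by rewrite /e'; field; rewrite gt_eqF.
rewrite Ke in L1 L2 L3 L4.
have T : 0 < eps * t ^+ 2 by rewrite mulr_gt0 ?exprn_gt0.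
have PB := exprn_ge0 2 (cmod_ge0 B); have PD := exprn_ge0 2 (cmod_ge0 D).
have S2' : eps * (cmod (z - a + rc t) ^+ 2) + eps * cmod (z - a - rc t) ^+ 2 +
   (eps * cmod (z - a + 'i%C * rc t) ^+ 2 + eps * cmod (z - a - 'i%C * rc t) ^+ 2) =
   4 * (eps * cmod (z - a) ^+ 2) + 4 * (eps * t ^+ 2).
  rewrite -!mulrDr S2; ring.
rewrite /c in L1 L2 L3 L4 S1.
move: L1 L2 L3 L4 M1 M2 M3 M4 S1 S2' T PB PD; clear.
have E : eps / 2 * t ^+ 2 = (eps * t ^+ 2) / 2 by ring.
rewrite E.
set a1 := cmod (f z + B + D) ^+ 2; set a2 := cmod (f z - B + D) ^+ 2.
set a3 := cmod (f z + _ - D) ^+ 2; set a4 := cmod (f z - _ - D) ^+ 2.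
set b1 := cmod (f _) ^+ 2; set b2 := cmod (f _) ^+ 2; set b3 := cmod (f _) ^+ 2; set b4 := cmod (f _) ^+ 2.
set q1 := eps * cmod (z - a + rc t) ^+ 2; set q2 := eps * cmod (z - a - rc t) ^+ 2.
set q3 := eps * cmod (z - a + 'i%C * _) ^+ 2; set q4 := eps * cmod (z - a - 'i%C * _) ^+ 2.
set q0 := eps * cmod (z - a) ^+ 2; set f0 := cmod (f z) ^+ 2; set tt := eps * t ^+ 2.
set bb := cmod B ^+ 2; set dd := cmod D ^+ 2.
clearbody a1 a2 a3 a4 b1 b2 b3 b4 q1 q2 q3 q4 q0 f0 tt bb dd.
lra.
Qed.

(** By [not_local_max] the penalized function |f|^2 + eps |z - a|^2 attains its maximum over the
    annulus on the boundary, where it is at most M^2 + eps r^2; then eps tends to 0. *)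
Lemma max_principle f (a : Cx) (rho r M : R) :
  (forall z, rho <= cmod (z - a) <= r -> holo2 f z) -> 0 <= M ->
  (forall z, cmod (z - a) = rho -> cmod (f z) <= M) ->
  (forall z, cmod (z - a) = r -> cmod (f z) <= M) ->
  forall z, rho <= cmod (z - a) <= r -> cmod (f z) <= M.
Proof.
move=> Hf M0 Mrho Mr w hw.
have r0 : 0 <= r by case/andP: hw => h1 h2; apply: le_trans h2; exact: cmod_ge0.
have key eps : 0 < eps -> cmod (f w) ^+ 2 <= M ^+ 2 + eps * r ^+ 2.
  move=> e0; pose u z := cmod (f z) ^+ 2 + eps * cmod (z - a) ^+ 2.
  have [||z [hz Hz]] := @annulus_max u a rho r; first by exists w.
    move=> z hz e ep.
    have c1 := ctsr_cmod_sqr (holo_cts (holo2_holo (Hf z hz))).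
    have c2 : ctsr (fun w => cmod (w - a) ^+ 2) z.
      by apply: ctsr_cmod_sqr; apply: holo_cts; exists (1 - 0); exact: cderB (cder_id _) (cder_cst _ _).
    have [d1 d10 Hd1] := c1 _ (divr_gt0 ep (ltr0Sn R 1)).
    have [d2 d20 Hd2] := c2 _ (divr_gt0 (divr_gt0 ep (ltr0Sn R 1)) e0).
    exists (Num.min d1 d2); first by rewrite lt_min d10.
    move=> h; rewrite lt_min => /andP[/Hd1 k1 /Hd2 k2].
    have -> : u (z + h) - u z = (cmod (f (z + h)) ^+ 2 - cmod (f z) ^+ 2) +
      eps * (cmod (z + h - a) ^+ 2 - cmod (z - a) ^+ 2) by rewrite /u; ring.
    apply: le_trans (ler_normD _ _) _; rewrite [e]splitr; apply: lerD => //.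
    rewrite normrM gtr0_norm // mulrC -ler_pdivlMr //.
  have Hw := Hz w hw.
  apply: (@le_trans _ _ (u z)).
    by apply: le_trans Hw; rewrite /u lerDl mulr_ge0 ?exprn_ge0 ?cmod_ge0 // ltW.
  case/andP: (hz) => h1 h2.
  have bd : cmod (f z) <= M.
    have [e1|n1] := eqVneq (cmod (z - a)) rho; first exact: Mrho.
    have [e2|n2] := eqVneq (cmod (z - a)) r; first exact: Mr.
    exfalso; apply: (not_local_max e0 (Hf z hz)).
    have l1 : rho < cmod (z - a) by rewrite lt_neqAle eq_sym n1.
    have l2 : cmod (z - a) < r by rewrite lt_neqAle n2.
    exists (Num.min (cmod (z - a) - rho) (r - cmod (z - a))); first by rewrite lt_min !subr_gt0 l1.
    move=> v; rewrite lt_min => /andP[k1 k2]; apply: Hz.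
    have := cmod_triB v a z; have := cmod_triB z a v; rewrite (cmodBC z v); lra.
  rewrite /u; apply: lerD.
    by rewrite ler_pXn2r // nnegrE ?cmod_ge0.
  apply: ler_wpM2l; first exact: ltW.
  by rewrite ler_pXn2r // nnegrE ?cmod_ge0.
rewrite -(@ler_pXn2r _ 2) ?nnegrE ?cmod_ge0 //.
apply/ler_addgt0Pr => e e0.
have K0 : 0 < 1 + r ^+ 2 by rewrite ltr_wpDr ?sqr_ge0.
apply: le_trans (key _ (divr_gt0 e0 K0)) _; rewrite lerD2l.
by rewrite mulrAC ler_pdivrMr // ler_wpM2l ?(ltW e0) // lerDr.
Qed.

Lemma holo2_mul f g z : holo2 f z -> holo2 g z -> holo2 (fun w => f w * g w) z.
Proof.
move=> [f1 [[d d0 H1] [f2 H2]]] [g1 [[d' d'0 H1'] [g2 H2']]].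
exists (fun w => f1 w * g w + f w * g1 w); split.
  exists (Num.min d d'); first by rewrite lt_min d0.
  by move=> w; rewrite lt_min => /andP[h1 h2]; apply: cderM; [exact: H1|exact: H1'].
have fz : cder f z (f1 z) by apply: H1; rewrite subrr cmod0.
have gz : cder g z (g1 z) by apply: H1'; rewrite subrr cmod0.
eexists; apply: cderD; [exact: cderM H2 gz|exact: cderM fz H2'].
Qed.
Lemma holo2_cst c z : holo2 (fun=> c) z.
Proof.
exists (fun=> 0); split; first by exists 1 => // w _; exact: cder_cst.
by exists 0; exact: cder_cst.
Qed.
Lemma holo2_exp f z n : holo2 f z -> holo2 (fun w => f w ^+ n) z.
Proof.
move=> H; elim: n => [|n ih].
  have -> : (fun w => f w ^+ 0) = (fun=> 1) by apply/funext => w; rewrite expr0.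
  exact: holo2_cst.
have -> : (fun w => f w ^+ n.+1) = (fun w => f w * f w ^+ n) by apply/funext => w; rewrite exprS.
exact: holo2_mul.
Qed.
Lemma holo2_inv_sub (a z : Cx) : z != a -> holo2 (fun w => (w - a)^-1) z.
Proof.
move=> za.
have D1 w : cder (fun w => w - a) w 1 by have := cderB (cder_id w) (cder_cst a w); rewrite subr0.
have D2 w : w != a -> cder (fun w => (w - a)^-1) w (- ((w - a) ^+ 2)^-1).
  move=> wa; have := cder_comp (D1 w) (cder_inv _); rewrite mulr1; apply; by rewrite subr_eq0.
exists (fun w => - ((w - a) ^+ 2)^-1); split.
  exists (cmod (z - a)); first by rewrite cmod_gt0 subr_eq0.
  move=> w hw; apply: D2; apply: contraTneq hw => ->; by rewrite cmodBC ltxx.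
have -> : (fun w => - (w - a) ^- 2) = (fun w => - (w - a)^-1 ^+ 2) by apply/funext => w; rewrite exprVn.
eexists; exact: (cderN (cder_comp (D2 z za) (cder_sqr _))).
Qed.

Lemma expr_unbounded (q L : R) : 1 < q -> exists n, (0 < n)%N /\ L < q ^+ n.
Proof.
move=> q1; have q10 : 0 < q - 1 by rewrite subr_gt0.
exists (Num.truncn (L / (q - 1))).+1; split => //; set n := _.+1.
have : L < n%:R * (q - 1) by rewrite -ltr_pdivrMr // truncnS_gt.
have : 1 + n%:R * (q - 1) <= q ^+ n.
  elim: (n) => [|m ih]; first by rewrite mul0r addr0 expr0.
  rewrite exprS -natr1; apply: le_trans (ler_wpM2l _ ih); last by lra.
  have : 0 <= m%:R * (q - 1) ^+ 2 by rewrite mulr_ge0 // sqr_ge0.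
  have -> : q * (1 + m%:R * (q - 1)) = 1 + (m%:R + 1) * (q - 1) + m%:R * (q - 1) ^+ 2 by ring.
  lra.
lra.
Qed.

(* The maximum principle is applied to g^n / (w - z)^(kn - 1) on annuli around z, where
   this function tends to 0; letting n grow removes the loss of one factor w - z, and no
   removable singularity theorem is needed. *)
Lemma schwarz_power g (z : Cx) (r N K d : R) (k : nat) : (0 < k)%N -> 0 < r -> 0 <= N -> 0 < d -> 0 <= K ->
  (forall w, cmod (w - z) <= r -> holo2 g w) ->
  (forall w, cmod (w - z) = r -> cmod (g w) <= N) ->
  (forall w, cmod (w - z) < d -> cmod (g w) <= K * cmod (w - z) ^+ k) ->
  forall w, cmod (w - z) <= r -> cmod (g w) <= N * (cmod (w - z) / r) ^+ k.
Proof.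
move=> k0 r0 N0 d0 K0 Hg HN HK w hw.
have [wz|wz] := eqVneq w z.
  have := HK w; rewrite wz subrr cmod0 expr0n; case: (k) k0 => // k' _; rewrite mulr0 => /(_ d0) h.
  by rewrite mul0r expr0n mulr0.
have cw : 0 < cmod (w - z) by rewrite cmod_gt0 subr_eq0.
apply/ler_addgt0Pr => e e0.
(* The slack makes the bound positive and contributes exactly [e] at the point [w]. *)
pose N' := N + e * r ^+ k / cmod (w - z) ^+ k.
have N'0 : 0 < N' by rewrite ltr_wpDl // divr_gt0 ?mulr_gt0 ?exprn_gt0.
suff main : cmod (g w) <= N' * (cmod (w - z) / r) ^+ k.
  apply: le_trans main _; rewrite /N' mulrDl lerD2l expr_div_n le_eqVlt; apply/orP; left; apply/eqP.
  by field; rewrite !expf_neq0 // gt_eqF.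
rewrite leNgt; apply/negP => bad.
set y := N' * (cmod (w - z) / r) ^+ k in bad.
have y0 : 0 < y by rewrite mulr_gt0 // exprn_gt0 // divr_gt0.
set q := cmod (g w) / y.
have q1 : 1 < q by rewrite ltr_pdivlMr ?mul1r.
have bound n : (0 < n)%N -> q ^+ n <= r / cmod (w - z).
  move=> n0; set m := (k * n).-1.
  have mE : (k * n)%N = m.+1 by rewrite /m prednK // muln_gt0 k0.
  pose G v := g v ^+ n * ((v - z)^-1) ^+ m.
  have Gm v : cmod (G v) = cmod (g v) ^+ n / cmod (v - z) ^+ m by rewrite cmodM !cmodX cmodV exprVn.
  pose B := N' ^+ n / r ^+ m.
  have B0 : 0 < B by rewrite divr_gt0 ?exprn_gt0.
  (* On the inner circle |G| is at most K^n rho, since g^n vanishes at z to order k n and only k n -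
     1 factors are divided out. This [rho] brings it below [B], which bounds G on the outer
     circle. *)
  pose rho := Num.min (Num.min (d / 2) (cmod (w - z))) (B / (1 + K ^+ n)).
  have Kn0 : 0 < 1 + K ^+ n by rewrite ltr_wpDr ?exprn_ge0.
  have rho0 : 0 < rho by rewrite !lt_min divr_gt0 // cw divr_gt0.
  have [rd [rw rB]] : rho <= d / 2 /\ rho <= cmod (w - z) /\ rho <= B / (1 + K ^+ n).
    by have := lexx rho; rewrite {2}/rho !le_min -andbA => /and3P[-> -> ->].
  have Gw : cmod (G w) <= B.
    apply: (@max_principle G z rho r B) => //.
    - move=> v /andP[v1 v2]; apply: holo2_mul; apply: holo2_exp; first exact: Hg.
      apply: holo2_inv_sub; rewrite -subr_eq0 -cmod_gt0; exact: lt_le_trans v1.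
    - exact: ltW.
    - move=> v vrho; rewrite Gm vrho ler_pdivrMr ?exprn_gt0 //.
      have vd : cmod (v - z) < d by rewrite vrho; lra.
      have := HK v vd; rewrite vrho => h.
      apply: (@le_trans _ _ ((K * rho ^+ k) ^+ n)).
        by rewrite ler_pXn2r ?nnegrE ?cmod_ge0 // mulr_ge0 // exprn_ge0 // ltW.
      rewrite exprMn -exprM mE exprS mulrA ler_wpM2r ?exprn_ge0 ?(ltW rho0) //.
      move: rB; rewrite ler_pdivlMr // mulrDr mulr1 mulrC => h2.
      by apply: le_trans h2; rewrite lerDr ltW.
    - move=> v vr; rewrite Gm vr /B ler_pdivrMr ?exprn_gt0 // divfK ?expf_neq0 ?gt_eqF //.
      rewrite ler_pXn2r ?nnegrE ?cmod_ge0 ?(ltW N'0) //.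
      by apply: le_trans (HN v vr) _; rewrite lerDl divr_ge0 ?mulr_ge0 ?exprn_ge0 ?ltW.
    - by rewrite rw hw.
  rewrite Gm /B ler_pdivrMr ?exprn_gt0 // in Gw.
  rewrite /q expr_div_n ler_pdivrMr ?exprn_gt0 //.
  apply: le_trans Gw _.
  rewrite /y exprMn -exprM mE expr_div_n !exprS le_eqVlt; apply/orP; left; apply/eqP.
  by field; rewrite expf_neq0 !gt_eqF.
have [n [n0]] := expr_unbounded (r / cmod (w - z)) q1.
by rewrite ltNge bound.
Qed.
End MaximumPrinciple.

(** * Estimates, limits and zeros of holomorphic functions *)

Section HolomorphicFunctions.
Variable R : realType.
Local Notation Cx := (C R).

Lemma addr_subl (z h : Cx) : z + h - z = h. Proof. by rewrite addrAC subrr add0r. Qed.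
Lemma Im_i_rc t : Im ('i%C * rc t : Cx) = t. Proof. by rewrite ImM /= mul0r mul1r add0r. Qed.

Definition ccvg (u : nat -> Cx) (l : Cx) := forall e : R, 0 < e -> exists N, forall n, (N <= n)%N -> cmod (u n - l) <= e.

Lemma real_cauchy (u : nat -> R) :
  (forall e : R, 0 < e -> exists N, forall n, (N <= n)%N -> `|u n - u N| <= e) ->
  exists l, forall e : R, 0 < e -> exists N, forall n, (N <= n)%N -> `|u n - l| <= e.
Proof.
(* [sup S] is the limit inferior of [u]. *)
move=> H; pose S : set R := [set x | exists N, forall n, (N <= n)%N -> x <= u n].
have inS e N : (forall n, (N <= n)%N -> `|u n - u N| <= e) -> S (u N - e) /\ ubound S (u N + e).
  move=> h; split.
    by exists N => n /h; rewrite ler_norml; lra.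
  move=> x [M hM]; have := hM (maxn M N) (leq_maxl _ _).
  by have := h (maxn M N) (leq_maxr _ _); rewrite ler_norml; lra.
have [N1 h1] := H 1 ltr01; have [s1 b1] := inS _ _ h1.
exists (sup S) => e e0; have [N hN] := H (e / 2) (divr_gt0 e0 (ltr0Sn R 1)).
exists N => n Nn; have [sN bN] := inS _ _ hN.
have l1 : u N - e / 2 <= sup S by apply: ub_le_sup => //; exists (u N1 + 1).
have l2 : sup S <= u N + e / 2 by apply: ge_sup => //; exists (u N1 - 1).
by have := hN n Nn; rewrite !ler_norml; lra.
Qed.

Lemma complex_cauchy (u : nat -> Cx) :
  (forall e : R, 0 < e -> exists N, forall n, (N <= n)%N -> cmod (u n - u N) <= e) ->
  exists l, ccvg u l.
Proof.
move=> H.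
have [a Ha] : exists l, forall e : R, 0 < e -> exists N, forall n, (N <= n)%N -> `|Re (u n) - l| <= e.
  apply: real_cauchy => e e0; have [N hN] := H e e0; exists N => n /hN.
  by apply: le_trans; rewrite -ReB Re_le.
have [b Hb] : exists l, forall e : R, 0 < e -> exists N, forall n, (N <= n)%N -> `|Im (u n) - l| <= e.
  apply: real_cauchy => e e0; have [N hN] := H e e0; exists N => n /hN.
  by apply: le_trans; rewrite -ImB Im_le.
exists (a +i* b)%C => e e0; have e2 : 0 < e / 2 by rewrite divr_gt0.
have [N hN] := Ha _ e2; have [M hM] := Hb _ e2; exists (maxn N M) => n; rewrite geq_max => /andP[n1 n2].
apply: le_trans (cmod_le_ReIm _) _; rewrite ReB ImB /= [e]splitr; apply: lerD; [exact: hN|exact: hM].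
Qed.

Lemma ccvg_uniq u l m : ccvg u l -> ccvg u m -> l = m.
Proof.
move=> H1 H2; apply/eqP; rewrite -subr_eq0; apply/eqP; apply: cmod_eps0 => e e0.
have e2 : 0 < e / 2 by rewrite divr_gt0.
have [N hN] := H1 _ e2; have [M hM] := H2 _ e2.
apply: le_trans (cmod_triB _ _ (u (maxn N M))) _; rewrite [e]splitr cmodBC; apply: lerD.
  by apply: hN; exact: leq_maxl.
by apply: hM; exact: leq_maxr.
Qed.

Lemma ccvg_le u l (M : R) : ccvg u l -> (forall n, cmod (u n) <= M) -> cmod l <= M.
Proof.
move=> H hM; apply/ler_addgt0Pr => e e0; have [N hN] := H e e0.
have := hN N (leqnn _); have := hM N; have := cmod_lowB l (u N); rewrite cmodBC; lra.
Qed.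

Lemma cder_quot P w c : cder P w c -> forall e : R, 0 < e -> exists2 d : R, 0 < d & forall t : R,
  0 < t -> t < d -> cmod ((P (w + rc t) - P w) / rc t - c) <= e.
Proof.
move=> H e e0; have [d d0 Hd] := H e e0; exists d => // t t0 td.
have tn0 : rc t != 0 :> Cx by rewrite rc_eq0 gt_eqF.
have -> : (P (w + rc t) - P w) / rc t - c = (P (w + rc t) - P w - c * rc t) / rc t by field.
rewrite cmodM cmodV cmod_rc gtr0_norm // ler_pdivrMr //.
by have := Hd (rc t); rewrite cmod_rc gtr0_norm //; apply.
Qed.

Lemma cder_shift (a w : Cx) : cder (fun w => w - a) w 1.
Proof. by have := cderB (cder_id w) (cder_cst a w); rewrite subr0. Qed.
Lemma holo2_shift (a w : Cx) : holo2 (fun w => w - a) w.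
Proof.
exists (fun=> 1); split; last by exists 0; exact: cder_cst.
by exists 1 => // v _; exact: cder_shift.
Qed.
Lemma holo2_sub (g1 g2 : Cx -> Cx) w : holo2 g1 w -> holo2 g2 w -> holo2 (fun v => g1 v - g2 v) w.
Proof.
move=> [p [[d d0 H1] [p' H2]]] [q [[d' d'0 H1'] [q' H2']]].
exists (fun v => p v - q v); split; last by exists (p' - q'); exact: cderB.
exists (Num.min d d'); first by rewrite lt_min d0.
by move=> v; rewrite lt_min => /andP[h1 h2]; apply: cderB; [exact: H1|exact: H1'].
Qed.

(** [schwarz_power] with exponent 1 for f - f z bounds the derivative; with exponent 2 for f - f z -
    l (w - z) it bounds the remainder, by a constant that depends only on [M] and [r]. *)
Lemma holo2_schwarz f (z l : Cx) (r M : R) : 0 < r ->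
  (forall w, cmod (w - z) <= r -> holo2 f w) -> (forall w, cmod (w - z) <= r -> cmod (f w) <= M) ->
  cder f z l -> cmod l <= 2 * M / r /\ forall w, cmod (w - z) <= r ->
  cmod (f w - f z - l * (w - z)) <= 4 * M / r ^+ 2 * cmod (w - z) ^+ 2.
Proof.
move=> r0 Hf HM fl.
have zz : cmod (z - z) <= r by rewrite subrr cmod0 ltW.
have M0 : 0 <= M by apply: le_trans (HM z zz); exact: cmod_ge0.
have S1 w : cmod (w - z) <= r -> cmod (f w - f z) <= 2 * M * (cmod (w - z) / r) ^+ 1.
  have [d d0 Hd] := cder_ub fl.
  apply: (@schwarz_power R (fun w => f w - f z) z r (2 * M) (1 + cmod l) d 1) => //.
  - by rewrite mulr_ge0.
  - by rewrite addr_ge0 ?cmod_ge0.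
  - by move=> v hv; apply: holo2_sub; [exact: Hf|exact: holo2_cst].
  - move=> v hv; apply: le_trans (cmodB _ _) _; have := HM v; rewrite hv lexx => /(_ isT).
    by have := HM z zz; lra.
  - by move=> v /Hd; rewrite subrKC expr1.
have Ll : cmod l <= 2 * M / r.
  apply/ler_addgt0Pr => e e0; have [d d0 Hd] := cder_quot fl e0.
  set t := Num.min (d / 2) r.
  have t0 : 0 < t by rewrite lt_min r0 divr_gt0.
  have td : t < d by rewrite gt_min; apply/orP; left; lra.
  have tr : t <= r by rewrite ge_min lexx orbT.
  have := Hd t t0 td; set k := _ / rc t.
  have hk : cmod k <= 2 * M / r.
    rewrite /k cmodM cmodV cmod_rc (gtr0_norm t0) ler_pdivrMr //.
    have N : cmod (z + rc t - z) = t by rewrite addr_subl cmod_rc gtr0_norm.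
    have := S1 (z + rc t); rewrite N expr1 => /(_ tr) /le_trans; apply.
    by rewrite le_eqVlt; apply/orP; left; apply/eqP; ring.
  have := cmod_lowB l k; rewrite (cmodBC l); lra.
split => // w hw.
have [f1 [Hf1 [f2 Hf2]]] := Hf z zz.
have lE : f1 z = l.
  by case: Hf1 => d d0 H; apply: cder_uniq (H z _) fl; rewrite subrr cmod0.
have [d d0 Hd] := taylor2 Hf1 Hf2 ltr01.
have -> : 4 * M / r ^+ 2 * cmod (w - z) ^+ 2 = 4 * M * (cmod (w - z) / r) ^+ 2 by rewrite expr_div_n; ring.
apply: (@schwarz_power R (fun w => f w - f z - l * (w - z)) z r (4 * M) (1 + cmod (f2 / 2)) d 2) => //.
- by rewrite mulr_ge0.
- by rewrite addr_ge0 ?cmod_ge0.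
- move=> v hv; apply: holo2_sub; last by apply: holo2_mul; [exact: holo2_cst|exact: holo2_shift].
  by apply: holo2_sub; [exact: Hf|exact: holo2_cst].
- move=> v hv; apply: le_trans (cmodB _ _) _; have := HM v; rewrite hv lexx => /(_ isT).
  have := HM z zz; have := cmodB (f v) (f z); rewrite cmodM hv.
  have : cmod l * r <= 2 * M by rewrite -ler_pdivlMr.
  lra.
- move=> v hv; have := Hd _ hv; rewrite subrKC lE mul1r.
  set u := f v - f z - l * (v - z) => h.
  have -> : u = (u - f2 / 2 * (v - z) ^+ 2) + f2 / 2 * (v - z) ^+ 2 by rewrite subrK.
  by apply: le_trans (cmodD _ _) _; rewrite cmodM cmodX mulrDl mul1r lerD2r.
Qed.

(** The square of half side 2 r contains the disc of radius 2 r and lies in the disc of radius 3 r,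
    because 8 < 9. *)
Lemma disc_primitive f (z : Cx) (r : R) : 0 < r ->
  (forall w, cmod (w - z) <= 3 * r -> holo f w) ->
  exists P : Cx -> Cx, forall w, cmod (w - z) < 2 * r -> cder P w (f w).
Proof.
move=> r0 Hf.
have [||w h1 h2|P HP] := @box_primitive_exists R f (Re z - 2 * r) (Re z + 2 * r) (Im z - 2 * r) (Im z + 2 * r).
- by lra.
- by lra.
- apply: Hf; rewrite -(@ler_pXn2r _ 2) ?nnegrE ?cmod_ge0 //; last by lra.
  rewrite cmod_sqr ReB ImB.
  have a1 : (Re w - Re z) ^+ 2 <= (2 * r) ^+ 2.
    rewrite -real_normK ?num_real // ler_pXn2r ?nnegrE //; last lra.
    by rewrite ler_norml; lra.
  have a2 : (Im w - Im z) ^+ 2 <= (2 * r) ^+ 2.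
    rewrite -real_normK ?num_real // ler_pXn2r ?nnegrE //; last lra.
    by rewrite ler_norml; lra.
  have r2 : 0 < r ^+ 2 by rewrite exprn_gt0.
  rewrite !exprMn in a1 a2 *; lra.
exists P => w hw; apply: HP.
  have := le_lt_trans (Re_le _) hw; rewrite ReB ltr_norml; lra.
have := le_lt_trans (Im_le _) hw; rewrite ImB ltr_norml; lra.
Qed.

(** The difference quotients [k t] of a primitive of [f] are twice differentiable and bounded by
    [M], so [holo2_schwarz] applies to them; letting [t] tend to 0 gives the estimates for [f]. *)
Lemma holo_schwarz f (z l : Cx) (r M : R) : 0 < r ->
  (forall w, cmod (w - z) <= 3 * r -> holo f w) -> (forall w, cmod (w - z) < 2 * r -> cmod (f w) <= M) ->
  cder f z l -> cmod l <= 2 * M / r /\ forall w, cmod (w - z) <= r ->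
  cmod (f w - f z - l * (w - z)) <= 4 * M / r ^+ 2 * cmod (w - z) ^+ 2.
Proof.
move=> r0 Hf HM fl; have [P HP] := disc_primitive r0 Hf.
pose k (t : R) w := (P (w + rc t) - P w) / rc t.
have shift (t : R) (w : Cx) : cder (fun w => w + rc t) w 1.
  by have := cderD (cder_id w) (cder_cst (rc t) w); rewrite addr0.
have kder (t : R) w : 0 < t -> cmod (w - z) + t < 2 * r -> cder (k t) w ((f (w + rc t) - f w) / rc t).
  move=> t0 hw.
  have h1 : cmod (w + rc t - z) < 2 * r.
    apply: le_lt_trans hw; rewrite addrAC; apply: le_trans (cmodD _ _) _.
    by rewrite cmod_rc gtr0_norm.
  have H1 := cder_comp (shift t w) (HP _ h1).
  have h2 : cmod (w - z) < 2 * r by lra.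
  have H2 := cder_scale (rc t)^-1 (cderB H1 (HP w h2)).
  rewrite mulr1 mulrC in H2; apply: cder_eq H2 => v; by rewrite mulrC.
have fin3 w : cmod (w - z) < 2 * r -> holo f w by move=> h; apply: Hf; lra.
have hk t : 0 < t -> t < r -> forall w, cmod (w - z) <= r -> holo2 (k t) w.
  move=> t0 tr w hw; exists (fun w => (f (w + rc t) - f w) / rc t); split.
    exists (r - t); first by rewrite subr_gt0.
    move=> v hv; apply: kder => //; have := cmod_triB v z w; lra.
  have [m1 H1] : holo f (w + rc t).
    apply: fin3; rewrite addrAC; apply: le_lt_trans (cmodD _ _) _; rewrite cmod_rc gtr0_norm //; lra.
  have [m2 H2] : holo f w by apply: fin3; lra.
  have H3 := cder_scale (rc t)^-1 (cderB (cder_comp (shift t w) H1) H2).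
  by eexists; apply: cder_eq H3 => v; rewrite mulrC.
have kM t : 0 < t -> t < r -> forall w, cmod (w - z) <= r -> cmod (k t w) <= M.
  move=> t0 tr w hw; rewrite /k cmodM cmodV cmod_rc (gtr0_norm t0) ler_pdivrMr //.
  have seg x : 0 <= x <= 1 -> cmod (w + rc x * (w + rc t - w) - z) < 2 * r.
    move=> /andP[x0 x1]; have -> : w + rc x * (w + rc t - w) - z = (w - z) + rc x * rc t by ring.
    apply: le_lt_trans (cmodD _ _) _; rewrite -rcM cmod_rc ger0_norm; last by rewrite mulr_ge0 // ltW.
    have : x * t <= t by rewrite ler_piMl // ltW.
    lra.
  have := @mv_ineq_seg R P f w (w + rc t) M.
  have E : cmod (w + rc t - w) = t by rewrite addr_subl cmod_rc gtr0_norm.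
  rewrite E; apply.
    by move=> x hx; apply: HP; exact: seg.
  by move=> x hx; apply: HM; exact: seg.
have ks' t : 0 < t -> t < r -> cmod ((f (z + rc t) - f z) / rc t) <= 2 * M / r /\ forall w, cmod (w - z) <= r ->
  cmod (k t w - k t z - (f (z + rc t) - f z) / rc t * (w - z)) <= 4 * M / r ^+ 2 * cmod (w - z) ^+ 2.
  move=> t0 tr; apply: (holo2_schwarz r0 (hk t t0 tr) (kM t t0 tr)).
  by apply: kder => //; rewrite subrr cmod0; lra.
split.
  apply/ler_addgt0Pr => e e0; have [d d0 Hd] := cder_quot fl e0.
  set t := Num.min d r / 2.
  have m0 : 0 < Num.min d r by rewrite lt_min d0.
  have t0 : 0 < t by rewrite divr_gt0.
  have : t < Num.min d r by rewrite /t; lra.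
  rewrite lt_min => /andP[td tr].
  have [h1 _] := ks' t t0 tr; have := Hd t t0 td.
  set q := _ / rc t in h1 *; have := cmod_lowB l q; rewrite (cmodBC l); lra.
move=> w hw; apply/ler_addgt0Pr => e e0.
have e3 : 0 < e / 3 by rewrite divr_gt0.
have e4 : 0 < e / 3 / r by rewrite divr_gt0.
have [d1 d10 Hd1] := cder_quot fl e4.
have hz : cmod (z - z) < 2 * r by rewrite subrr cmod0; lra.
have hw2 : cmod (w - z) < 2 * r by lra.
have [d2 d20 Hd2] := cder_quot (HP z hz) e3; have [d3 d30 Hd3] := cder_quot (HP w hw2) e3.
set t := Num.min (Num.min d1 d2) (Num.min d3 r) / 2.
have m0 : 0 < Num.min (Num.min d1 d2) (Num.min d3 r) by rewrite !lt_min d10 d20 d30.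
have t0 : 0 < t by rewrite divr_gt0.
have : t < Num.min (Num.min d1 d2) (Num.min d3 r) by rewrite /t; lra.
rewrite !lt_min => /andP[/andP[t1 t2] /andP[t3 tr]].
have [_ h1] := ks' t t0 tr.
have {}h1 := h1 w hw; have a1 := Hd1 t t0 t1; have a2 := Hd2 t t0 t2; have a3 := Hd3 t t0 t3.
rewrite -[(P (z + _) - _) / _]/(k t z) in a2; rewrite -[(P (w + _) - _) / _]/(k t w) in a3.
set q := (f (z + rc t) - f z) / rc t in h1 a1.
have -> : f w - f z - l * (w - z) = (k t w - k t z - q * (w - z)) +
  ((k t z - f z) - (k t w - f w) + (q - l) * (w - z)) by ring.
apply: le_trans (cmodD _ _) _; apply: lerD => //.
apply: le_trans (cmodD _ _) _; rewrite cmodM.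
have b1 := cmodB (k t z - f z) (k t w - f w).
have : cmod (q - l) * cmod (w - z) <= e / 3 / r * r by apply: ler_pM => //; exact: cmod_ge0.
rewrite divfK ?gt_eqF //; lra.
Qed.

(* Only boundedness and pointwise convergence are needed, because the second
   order estimate is uniform in [n]. *)
Lemma holo_limit (f_ : nat -> Cx -> Cx) f (z : Cx) (r M : R) : 0 < r ->
  (forall n w, cmod (w - z) <= 3 * r -> holo (f_ n) w) ->
  (forall n w, cmod (w - z) < 2 * r -> cmod (f_ n w) <= M) ->
  (forall w, cmod (w - z) <= r -> ccvg (f_ ^~ w) (f w)) ->
  holo f z.
Proof.
move=> r0 Hf HM Hc.
have hz n : exists l, cder (f_ n) z l by apply: Hf; rewrite subrr cmod0; lra.
have [l_ Hl] := choice hz.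
set K := 4 * M / r ^+ 2.
have hz2 : cmod (z - z) < 2 * r by rewrite subrr cmod0; lra.
have hz1 : cmod (z - z) <= r by rewrite subrr cmod0; lra.
have M0 : 0 <= M by apply: le_trans (HM 0%N z hz2); exact: cmod_ge0.
have K0 : 0 <= K by rewrite divr_ge0 ?mulr_ge0 ?exprn_ge0 // ltW.
have S n w : cmod (w - z) <= r -> cmod (f_ n w - f_ n z - l_ n * (w - z)) <= K * cmod (w - z) ^+ 2.
  by move=> hw; have [_ h] := holo_schwarz r0 (Hf n) (HM n) (Hl n); exact: h.
have [l ll] : exists l, ccvg l_ l.
  apply: complex_cauchy => e e0.
  (* The values converge at z and at z + t, so t (l_n - l_N) is small up to two second order errors
     K t^2; this [t] makes K t at most e / 4. *)
  pose t := Num.min r (e / (4 * (K + 1))).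
  have K1 : 0 < K + 1 by lra.
  have t0 : 0 < t by rewrite lt_min r0 divr_gt0 // mulr_gt0.
  have tr : t <= r by rewrite ge_min lexx.
  have te : t * (4 * (K + 1)) <= e by rewrite -ler_pdivlMr ?mulr_gt0 // ge_min lexx orbT.
  have Kt : K * t <= e / 4.
    have : 0 <= t by exact: ltW.
    lra.
  pose w := z + rc t.
  have wz : w - z = rc t by rewrite /w; ring.
  have cw : cmod (w - z) = t by rewrite wz cmod_rc gtr0_norm.
  have hw : cmod (w - z) <= r by rewrite cw.
  have et : 0 < e * t / 8 by rewrite divr_gt0 // mulr_gt0.
  have [N1 h1] := Hc w hw _ et; have [N2 h2] := Hc z hz1 _ et.
  exists (maxn N1 N2) => n hn; set N := maxn N1 N2 in hn *.
  have n1 : (N1 <= n)%N by apply: leq_trans hn; exact: leq_maxl.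
  have n2 : (N2 <= n)%N by apply: leq_trans hn; exact: leq_maxr.
  rewrite -(ler_pM2r t0) -{1}cw -cmodM.
  have -> : (l_ n - l_ N) * (w - z) =
    ((f_ n w - f w) - (f_ N w - f w)) + ((f_ N z - f z) - (f_ n z - f z)) +
    ((f_ N w - f_ N z - l_ N * (w - z)) - (f_ n w - f_ n z - l_ n * (w - z))) by ring.
  apply: le_trans (cmodD _ _) _.
  have a1 := cmodD ((f_ n w - f w) - (f_ N w - f w)) ((f_ N z - f z) - (f_ n z - f z)).
  have a2 := cmodB (f_ n w - f w) (f_ N w - f w); have a3 := cmodB (f_ N z - f z) (f_ n z - f z).
  have a4 := cmodB (f_ N w - f_ N z - l_ N * (w - z)) (f_ n w - f_ n z - l_ n * (w - z)).
  have b1 := h1 n n1; have b2 := h1 N (leq_maxl _ _); have b3 := h2 n n2; have b4 := h2 N (leq_maxr _ _).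
  have c1 := S n w hw; have c2 := S N w hw; rewrite cw in c1 c2.
  have : K * t ^+ 2 <= e / 4 * t by rewrite expr2 mulrA ler_wpM2r // ltW.
  lra.
exists l => e e0.
have K1 : 0 < K + 1 by lra.
exists (Num.min r (e / (K + 1))); first by rewrite lt_min r0 divr_gt0.
move=> h; rewrite lt_min => /andP[hr he].
have hzh : cmod (z + h - z) <= r by rewrite addr_subl ltW.
apply: (@le_trans _ _ (K * cmod h ^+ 2)); last first.
  rewrite expr2 mulrA ler_wpM2r ?cmod_ge0 //.
  apply: (@le_trans _ _ ((K + 1) * cmod h)); first by rewrite ler_wpM2r ?cmod_ge0 // lerDl.
  by rewrite mulrC -ler_pdivlMr // ltW.
apply/ler_addgt0Pr => eps eps0.
have e3 : 0 < eps / 3 by rewrite divr_gt0.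
have h1 : 0 < 1 + cmod h by rewrite ltr_wpDr ?cmod_ge0.
have [N1 k1] := Hc (z + h) hzh _ e3; have [N2 k2] := Hc z hz1 _ e3.
have [N3 k3] := ll _ (divr_gt0 e3 h1).
set n := maxn N1 (maxn N2 N3).
have {}k1 := k1 n (leq_maxl _ _).
have {}k2 := k2 n (leq_trans (leq_maxl _ _) (leq_maxr _ _)).
have {}k3 := k3 n (leq_trans (leq_maxr _ _) (leq_maxr _ _)).
have s1 := S n (z + h) hzh; have E : z + h - z = h by ring.
rewrite E in s1.
have -> : f (z + h) - f z - l * h = (f_ n (z + h) - f_ n z - l_ n * h) +
  ((f_ n z - f z) - (f_ n (z + h) - f (z + h)) + (l_ n - l) * h) by ring.
apply: le_trans (cmodD _ _) _; apply: lerD => //.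
apply: le_trans (cmodD _ _) _; rewrite cmodM.
have b1 := cmodB (f_ n z - f z) (f_ n (z + h) - f (z + h)).
have : cmod (l_ n - l) * cmod h <= eps / 3 / (1 + cmod h) * (1 + cmod h).
  by apply: ler_pM => //; rewrite ?cmod_ge0 // lerDr.
rewrite divfK ?gt_eqF //; lra.
Qed.

(** A primitive of [f] that vanishes near z vanishes there to every order n, so [schwarz_power]
    bounds it by N (|w - z| / r)^n for all n, and it is zero on the disc. *)
Lemma holo_zero_disc f (z : Cx) (r d : R) : 0 < r -> 0 < d ->
  (forall w, cmod (w - z) <= 3 * r -> holo f w) ->
  (forall w, cmod (w - z) < d -> f w = 0) -> forall w, cmod (w - z) < r -> f w = 0.
Proof.
move=> r0 d0 Hf fz; have [P HP] := disc_primitive r0 Hf.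
pose g w := P w - P z.
have Hg w : cmod (w - z) < 2 * r -> cder g w (f w).
  by move=> /HP H; have := cderB H (cder_cst (P z) w); rewrite subr0.
have g2 w : cmod (w - z) <= r -> holo2 g w.
  move=> hw; exists f; split; last by apply: Hf; lra.
  by exists r => // v hv; apply: Hg; have := cmod_triB v z w; lra.
have [N [N0 HN]] : exists N : R, 0 <= N /\ forall w, cmod (w - z) = r -> cmod (g w) <= N.
  have [||c [hc Hc]] := @annulus_max R (fun w => cmod (g w)) z r r.
  - by exists (z + rc r); rewrite addr_subl cmod_rc gtr0_norm // lexx.
  - move=> w /andP[_ hw] e e0; have [dd dd0 Hd] := holo_cts (holo2_holo (g2 w hw)) e0.
    exists dd => // h /Hd; apply: le_trans; rewrite ler_norml.
    by have := cmod_lowB (g (w + h)) (g w); have := cmod_lowB (g w) (g (w + h)); rewrite (cmodBC (g w)); lra.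
  by exists (cmod (g c)); split; [exact: cmod_ge0|move=> w hw; apply: Hc; rewrite hw lexx].
have gz w : cmod (w - z) < Num.min d (2 * r) -> g w = 0.
  rewrite lt_min => /andP[h1 h2]; apply/eqP; rewrite -cmod_eq0 eq_le cmod_ge0 andbT.
  have seg x : 0 <= x <= 1 -> cmod (z + rc x * (w - z) - z) <= cmod (w - z).
    move=> /andP[x0 x1]; have -> : z + rc x * (w - z) - z = rc x * (w - z) by ring.
    by rewrite cmodM cmod_rc ger0_norm // ler_piMl ?cmod_ge0.
  have := @mv_ineq_seg R P f z w 0; rewrite mul0r; apply.
    by move=> x hx; apply: HP; apply: le_lt_trans (seg x hx) _.
  by move=> x hx; rewrite fz ?cmod0 //; apply: le_lt_trans (seg x hx) _.
have g0 w : cmod (w - z) < r -> g w = 0.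
  move=> hw; have [->|wz] := eqVneq w z; first by rewrite /g subrr.
  have cw : 0 < cmod (w - z) by rewrite cmod_gt0 subr_eq0.
  apply/eqP/negPn/negP => gw; have gw0 : 0 < cmod (g w) by rewrite cmod_gt0.
  have q1 : 1 < r / cmod (w - z) by rewrite ltr_pdivlMr ?mul1r.
  have [n [n0]] := expr_unbounded (N / cmod (g w)) q1.
  rewrite ltNge => /negP; apply.
  have dm : 0 < Num.min d (2 * r) by rewrite lt_min d0 mulr_gt0.
  have gk v : cmod (v - z) < Num.min d (2 * r) -> cmod (g v) <= 0 * cmod (v - z) ^+ n.
    by move=> hv; rewrite gz // cmod0 mul0r.
  have h := schwarz_power n0 r0 N0 dm (lexx 0) g2 HN gk (ltW hw).
  rewrite ler_pdivlMr // mulrC; apply: le_trans (ler_wpM2r _ h) _.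
    by rewrite exprn_ge0 // divr_ge0 ?cmod_ge0 // ltW.
  by rewrite -mulrA -exprMn mulf_div [r * _]mulrC divff ?expr1n ?mulr1 // mulf_neq0 ?gt_eqF.
move=> w hw; apply: (cder_uniq (f := g) (z := w)); first by apply: Hg; lra.
apply: (@cder_local _ (fun=> 0) g w 0 (r - cmod (w - z))); last exact: cder_cst.
  by rewrite subr_gt0.
by move=> v hv; rewrite g0 //; have := cmod_triB v z w; lra.
Qed.

(** Carries a locally constant property along a segment: vanishing near the point in
    [holo_zero_segment], and [agree] in [agree_segment]. *)
Lemma segment_connected (E : R -> Prop) : E 0 ->
  (forall x, 0 <= x <= 1 -> exists2 d : R, 0 < d & forall y, 0 <= y <= 1 -> `|y - x| < d -> (E y <-> E x)) ->
  E 1.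
Proof.
move=> E0 H.
pose S : set R := [set x | 0 <= x <= 1 /\ forall y, 0 <= y <= x -> E y].
have S0 : S 0 by split; [rewrite lexx ler01|move=> y h; have -> : y = 0 by apply/le_anti; rewrite andbC].
have ubS : ubound S 1 by move=> x [/andP[]].
set s := sup S.
have s0 : 0 <= s by apply: ub_le_sup => //; exists 1.
have s1 : s <= 1 by apply: ge_sup => //; exists 0.
have [|d d0 Hd] := H s; first by rewrite s0.
have [y [yS sy]] : exists y, S y /\ s - d < y.
  have [|y yS hy] := @sup_adherent R S d d0; first by split; [exists 0|exists 1].
  by exists y.
have ys : y <= s by apply: ub_le_sup => //; exists 1.
have [y01 yE] := yS; case/andP: (y01) => y0 y1.
have Ey : E y by apply: yE; rewrite y0 lexx.
have Es : E s by apply/(Hd y y01) => //; rewrite ltr_norml; lra.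
have ext x : 0 <= x <= 1 -> x < s + d -> E x.
  move=> x01 xs; have [xy|yx] := leP x y; first by apply: yE; lra.
  by apply/(Hd x x01) => //; rewrite ltr_norml; lra.
have [s1'|] := ltP s 1; last by move=> h; apply: ext; lra.
exfalso; set x := Num.min 1 (s + d / 2).
have xs : s < x by rewrite lt_min s1'; lra.
have x1 : x <= 1 by rewrite ge_min lexx.
have xd : x <= s + d / 2 by rewrite ge_min lexx orbT.
have : x <= s.
  apply: ub_le_sup; first by exists 1.
  by split; [lra|move=> v hv; apply: ext; lra].
lra.
Qed.

(** The disc of radius 3 r / 4 about [w] stays in the disc of radius r about [z], and the disc of
    radius r / 4 about [w] covers the disc of radius r / 8 about [z]. *)
Lemma holo_zero_near f (z w : Cx) (r d : R) : 0 < r -> 0 < d -> cmod (w - z) < r / 8 ->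
  (forall v, cmod (v - z) < r -> holo f v) ->
  (forall v, cmod (v - w) < d -> f v = 0) -> forall v, cmod (v - z) < r / 8 -> f v = 0.
Proof.
move=> r0 d0 wz Hf fw v hv.
apply: (@holo_zero_disc f w (r / 4) d) => //; first by rewrite divr_gt0.
  by move=> u hu; apply: Hf; have := cmod_triB u z w; lra.
by have := cmod_triB v w z; rewrite (cmodBC z w); lra.
Qed.

Lemma holo_zero_segment f (p s : Cx) (d : R) : 0 < d ->
  (forall x : R, 0 <= x <= 1 -> exists2 r : R, 0 < r & forall w, cmod (w - (p + rc x * (s - p))) < r -> holo f w) ->
  (forall w, cmod (w - p) < d -> f w = 0) -> exists2 d' : R, 0 < d' & forall w, cmod (w - s) < d' -> f w = 0.
Proof.
move=> d0 Hf fp.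
pose E x := exists2 d' : R, 0 < d' & forall w, cmod (w - (p + rc x * (s - p))) < d' -> f w = 0.
suff : E 1 by rewrite /E rc1 mul1r subrKC.
apply: segment_connected; first by exists d; rewrite // rc0 mul0r addr0.
move=> x hx; have [r r0 Hr] := Hf x hx.
have L : 0 < 1 + cmod (s - p) by rewrite ltr_wpDr ?cmod_ge0.
exists (r / 8 / (1 + cmod (s - p))); first by rewrite !divr_gt0.
move=> y hy yx.
have dist : cmod (p + rc y * (s - p) - (p + rc x * (s - p))) < r / 8.
  have -> : p + rc y * (s - p) - (p + rc x * (s - p)) = rc (y - x) * (s - p) by rewrite rcB; ring.
  rewrite cmodM cmod_rc; rewrite ltr_pdivlMr // in yx; apply: le_lt_trans yx.
  by rewrite ler_wpM2l // lerDr.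
have r8 : 0 < r / 8 by rewrite divr_gt0.
split=> [[d1 d10 H1]|[d1 d10 H1]].
  by exists (r / 8) => // v hv; apply: (holo_zero_near r0 d10 dist Hr H1).
have zz : cmod ((p + rc x * (s - p)) - (p + rc x * (s - p))) < r / 8 by rewrite subrr cmod0.
exists (r / 8 - cmod (p + rc y * (s - p) - (p + rc x * (s - p)))); first by rewrite subr_gt0.
move=> v hv; apply: (holo_zero_near r0 d10 zz Hr H1).
by have := cmod_triB v (p + rc x * (s - p)) (p + rc y * (s - p)); lra.
Qed.

(* Extending [f] by zero below the real axis keeps it holomorphic. *)
Lemma holo_zero_real f (x0 r : R) : 0 < r ->
  (forall w : Cx, cmod (w - rc x0) < r -> holo f w) ->
  (forall x : R, `|x - x0| < r -> f (rc x) = 0) ->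
  exists2 d : R, 0 < d & forall w, cmod (w - rc x0) < d -> f w = 0.
Proof.
move=> r0 Hf fr.
pose g (w : Cx) := if 0 <= Im w then f w else 0.
have Hg w : cmod (w - rc x0) < r -> holo g w.
  move=> hw; have [wpos|wneg|w0] := ltgtP 0 (Im w).
  - have [l fl] := Hf w hw; exists l; apply: cder_local wpos _ fl => v hv.
    rewrite /g ifT //; have := le_lt_trans (Im_le _) hv; rewrite ImB ltr_norml; lra.
  - exists 0; apply: (@cder_local _ (fun=> 0) _ _ _ (- Im w)); [lra| |exact: cder_cst] => v hv.
    rewrite /g ifF //; apply/negbTE; rewrite -ltNge.
    have := le_lt_trans (Im_le _) hv; rewrite ImB ltr_norml; lra.
  - have wE : w = rc (Re w) by apply: eqC; rewrite ?Re_rc ?Im_rc.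
    have [l fl] := Hf w hw.
    (* [f] has zero derivative along the real axis, so it matches the zero function below the axis
       to first order. *)
    have l0 : l = 0.
      apply: cmod_eps0 => e e0; have [d d0 Hd] := cder_quot fl e0.
      have rw : 0 < r - cmod (w - rc x0) by rewrite subr_gt0.
      set t := Num.min d (r - cmod (w - rc x0)) / 2.
      have m0 : 0 < Num.min d (r - cmod (w - rc x0)) by rewrite lt_min d0.
      have t0 : 0 < t by rewrite divr_gt0.
      have : t < Num.min d (r - cmod (w - rc x0)) by rewrite /t; lra.
      rewrite lt_min => /andP[td tr].
      have hx : `|Re w - x0| <= cmod (w - rc x0) by have := Re_le (w - rc x0); rewrite ReB Re_rc.
      have := Hd t t0 td; rewrite wE -rcD !fr ?subrr ?mul0r ?sub0r ?cmodN //.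
        lra.
      apply: (@le_lt_trans _ _ (`|Re w - x0| + `|t|)); last by rewrite (gtr0_norm t0); lra.
      by apply: le_trans (ler_normD _ _); rewrite addrAC.
    exists 0 => e e0; have [d d0 Hd] := fl e e0.
    exists d => // h hd; have gw : g w = 0.
      rewrite /g -w0 lexx wE fr //; apply: le_lt_trans hw; by have := Re_le (w - rc x0); rewrite ReB Re_rc.
    have fw : f w = 0 by move: gw; rewrite /g -w0 lexx.
    have := Hd h hd; rewrite l0 gw fw !mul0r !subr0 => hh.
    by rewrite /g; case: ifP => // _; rewrite cmod0 mulr_ge0 ?cmod_ge0 // ltW.
(* [g] vanishes near [p], below the axis, hence near [rc x0]. Just above the axis, near [q], it
   coincides with [f]; so [f] vanishes near [q], and hence near [rc x0]. *)
pose p : Cx := rc x0 - 'i%C * rc (r / 2).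
have cp : cmod ('i%C * rc (r / 2) : Cx) = r / 2 by rewrite cmodM cmodi mul1r cmod_rc gtr0_norm // divr_gt0.
have inside (q : Cx) (x : R) : cmod (q - rc x0) <= r / 2 -> 0 <= x <= 1 -> exists2 r' : R, 0 < r' & 
  forall w, cmod (w - (q + rc x * (rc x0 - q))) < r' -> cmod (w - rc x0) < r.
  move=> hq /andP[x0' x1']; exists (r / 2); first by rewrite divr_gt0.
  move=> w hw; have := cmod_triB w (rc x0) (q + rc x * (rc x0 - q)).
  have -> : q + rc x * (rc x0 - q) - rc x0 = rc (1 - x) * (q - rc x0) by rewrite rcB rc1; ring.
  rewrite cmodM cmod_rc ger0_norm ?subr_ge0 //.
  have : (1 - x) * cmod (q - rc x0) <= 1 * cmod (q - rc x0) by apply: ler_wpM2r; [exact: cmod_ge0|lra].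
  lra.
have Imp : Im (p) = - (r / 2) by rewrite /p ImB Im_rc Im_i_rc sub0r.
have hp : cmod (p - rc x0) <= r / 2.
  by rewrite /p addr_subl cmodN cp.
have r2 : 0 < r / 2 by rewrite divr_gt0.
have [||d d0 Hd] := @holo_zero_segment g p (rc x0) (r / 2) r2.
- by move=> x hx; have [r' r'0 H'] := inside p x hp hx; exists r' => // w /H'; exact: Hg.
- move=> w hw; rewrite /g ifF //; apply/negbTE; rewrite -ltNge.
  by have := le_lt_trans (Im_le _) hw; rewrite ImB Imp ltr_norml; lra.
set t := Num.min (d / 2) (r / 2).
have t0 : 0 < t by rewrite lt_min !divr_gt0.
have td : t <= d / 2 by rewrite ge_min lexx.
have tr : t <= r / 2 by rewrite ge_min lexx orbT.
pose q : Cx := rc x0 + 'i%C * rc t.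
have qx : q - rc x0 = 'i%C * rc t by rewrite /q; ring.
have cq : cmod (q - rc x0) = t by rewrite qx cmodM cmodi mul1r cmod_rc gtr0_norm.
have Imq : Im q = t by rewrite /q ImD Im_rc Im_i_rc add0r.
apply: (@holo_zero_segment f q (rc x0) t) => //.
  by move=> x hx; have [|r' r'0 H'] := inside q x _ hx; [rewrite cq|exists r' => // w /H'; exact: Hf].
move=> w hw; have := Hd w; rewrite /g ifT; last first.
  have := le_lt_trans (Im_le _) hw; rewrite ImB Imq ltr_norml; lra.
by apply; have := cmod_triB w (rc x0) q; rewrite cq; lra.
Qed.
End HolomorphicFunctions.

(** * The functional equation on the real segment *)

Section CothPartialFractions.
Variable R : realType.
Implicit Types (x y t : R).

(* sinh y / (cosh y - cos t); the partial fractions of coth come from iterating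
   pkernel_double. *)
Definition pkernel y t : R := (expR y - expR (- y)) / (expR y + expR (- y) - 2 * cos t).

Lemma exp_sum_gt2 y : 0 < y -> 2 < expR y + expR (- y).
Proof.
move=> y0; have E : 1 < expR y by rewrite expR_gt1.
have E0 := expR_gt0 y.
rewrite expRN -subr_gt0.
have -> : expR y + (expR y)^-1 - 2 = (expR y - 1) ^+ 2 / expR y by field; rewrite gt_eqF.
by rewrite divr_gt0 // exprn_gt0 // subr_gt0.
Qed.

Lemma pkernel_den_gt0 y t : 0 < y -> 0 < expR y + expR (- y) - 2 * cos t.
Proof. by move=> y0; have := exp_sum_gt2 y0; have := cos_le1 t; lra. Qed.

Lemma pkernel_double y t : 0 < y ->
  2 * pkernel (2 * y) (2 * t) = pkernel y t + pkernel y (t + pi).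
Proof.
move=> y0; have y20 : 0 < 2 * y by rewrite mulr_gt0.
have d1 := pkernel_den_gt0 t y0; have d2 := pkernel_den_gt0 (t + pi) y0.
have d3 := pkernel_den_gt0 (2 * t) y20.
have E0 := expR_gt0 y.
have e2 : expR (2 * y) = expR y ^+ 2 by rewrite expRM_natl.
have c2 : cos (2 * t) = 2 * cos t ^+ 2 - 1 by rewrite mulr_natl cos_mulr2n mulr_natl.
rewrite /pkernel in d1 d2 d3 *; rewrite !expRN e2 c2 cosDpi in d1 d2 d3 *.
set E := expR y in E0 d1 d2 d3 *; set c := cos t in d1 d2 d3 *.
have En0 : E != 0 by rewrite gt_eqF.
have h1 : E ^+ 2 + 1 - 2 * c * E != 0.
  have -> : E ^+ 2 + 1 - 2 * c * E = E * (E + E^-1 - 2 * c) by field.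
  by rewrite mulf_neq0 // gt_eqF.
have h2 : E ^+ 2 + 1 + 2 * c * E != 0.
  have -> : E ^+ 2 + 1 + 2 * c * E = E * (E + E^-1 - 2 * - c) by field.
  by rewrite mulf_neq0 // gt_eqF.
have h3 : E ^+ 4 + 1 - 2 * (2 * c ^+ 2 - 1) * E ^+ 2 != 0.
  have -> : E ^+ 4 + 1 - 2 * (2 * c ^+ 2 - 1) * E ^+ 2 = (E ^+ 2 + 1 - 2 * c * E) * (E ^+ 2 + 1 + 2 * c * E) by ring.
  by rewrite mulf_neq0.
have -> : E - E^-1 = (E ^+ 2 - 1) / E by field.
have -> : E + E^-1 - 2 * c = (E ^+ 2 + 1 - 2 * c * E) / E by field.
have -> : E + E^-1 - 2 * - c = (E ^+ 2 + 1 + 2 * c * E) / E by field.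
have -> : E ^+ 2 - (E ^+ 2)^-1 = (E ^+ 4 - 1) / E ^+ 2 by field.
have -> : E ^+ 2 + (E ^+ 2)^-1 - 2 * (2 * c ^+ 2 - 1) = ((E ^+ 2 + 1 - 2 * c * E) * (E ^+ 2 + 1 + 2 * c * E)) / E ^+ 2 by field.
have q : E ^+ 2 + 1 + 2 * c * E = 2 * (E ^+ 2 + 1) - (E ^+ 2 + 1 - 2 * c * E) by ring.
rewrite q in h2 *; move: h1 h2; set p := E ^+ 2 + 1 - 2 * c * E => h1 h2.
set v := 2 * (E ^+ 2 + 1) - p in h2 *.
have pE : p = 2 * (E ^+ 2 + 1) - v by rewrite /v; ring.
rewrite pE in h1 *; clearbody v; field; by rewrite En0 h1 h2.
Qed.

Lemma sum_even_odd (f : nat -> R) n : \sum_(0 <= k < n.*2) f k = \sum_(0 <= k < n) (f k.*2 + f k.*2.+1).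
Proof.
elim: n => [|n ih]; first by rewrite !big_geq.
by rewrite doubleS !big_nat_recr //= ih addrA.
Qed.

(** At y = x / 2^j and t = 0 the left side is 2^j coth(x / 2), and the right side has 2^j summands
    that become the partial fractions as j grows. *)
Lemma pkernel_pow2 j y t : 0 < y ->
  2 ^+ j * pkernel (2 ^+ j * y) (2 ^+ j * t) = \sum_(0 <= k < 2 ^ j) pkernel y (t + 2 * pi * k%:R / 2 ^+ j).
Proof.
move=> y0; elim: j t => [|j ih] t.
  by rewrite expr0 expn0 !mul1r big_nat1 mulr0 mul0r addr0.
have jy : 0 < 2 ^+ j * y by rewrite mulr_gt0 // exprn_gt0.
have -> : 2 ^+ j.+1 * pkernel (2 ^+ j.+1 * y) (2 ^+ j.+1 * t) =
   2 ^+ j * (2 * pkernel (2 * (2 ^+ j * y)) (2 * (2 ^+ j * t))) by rewrite exprS !mulrA [2 * 2 ^+ j]mulrC.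
rewrite pkernel_double // mulrDr ih.
have -> : 2 ^+ j * t + pi = 2 ^+ j * (t + pi / 2 ^+ j) by field; rewrite expf_neq0.
rewrite ih -big_split expnS mul2n sum_even_odd; apply: eq_bigr => k _.
congr (pkernel y _ + pkernel y _).
  by rewrite -mul2n natrM exprS; field; rewrite expf_neq0.
have -> : k.*2.+1%:R = 2 * k%:R + 1 :> R by rewrite -addn1 natrD -muln2 natrM mulrC.
by rewrite exprS; field; rewrite expf_neq0.
Qed.

Lemma pkernel_sym y t : pkernel y (2 * pi - t) = pkernel y t.
Proof. have -> : 2 * pi = pi *+ 2 :> R by rewrite mulr_natl.
by rewrite /pkernel cosB cos2pi sin2pi mul1r mul0r addr0. Qed.

Lemma sum_symmetric (f : nat -> R) m : (0 < m)%N -> (forall k, (k <= m.*2)%N -> f (m.*2 - k)%N = f k) ->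
  \sum_(0 <= k < m.*2) f k = f 0%N + f m + 2 * \sum_(1 <= k < m) f k.
Proof.
move=> m0 H; rewrite (big_cat_nat (n := m)) //=; last by rewrite -addnn leq_addr.
rewrite big_ltn //.
have -> : \sum_(m <= k < m.*2) f k = f m + \sum_(1 <= k < m) f k.
  rewrite big_ltn; last by rewrite -addnn -[X in (X < _)%N]addn0 ltn_add2l.
  congr (_ + _); rewrite [in RHS]big_nat_rev /=.
  have -> : \sum_(m.+1 <= k < m.*2) f k = \sum_(1 <= k < m) f (k + m)%N.
    by rewrite -add1n big_addn -addnn addnK.
  apply: eq_big_nat => k /andP[k1 km].
  rewrite -H; last by rewrite -addnn; lia.
  by congr f; rewrite -addnn; lia.
ring.
Qed.

Lemma seq_diff0 (f : R -> R) (a c : R) (u : nat -> R) : f 0 = 0 -> rder f 0 a ->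
  (forall n, 0 < u n) -> (u n)^-1 @[n --> \oo] --> (0 : R) ->
  u n * f (c / u n) @[n --> \oo] --> a * c.
Proof.
move=> f0 fd u0 ul; apply/cvgrPdist_le => e e0.
have c1 : 0 < 1 + `|c| by rewrite ltr_wpDr.
have [d d0 Hd] := fd _ (divr_gt0 e0 c1).
have ul' : (fun n => (u n)^-1) @ \oo --> (0 : R) by exact: ul.
move/cvgrPdist_lt: ul' => /(_ _ (divr_gt0 d0 c1)); apply: filterS => n /=.
rewrite sub0r normrN gtr0_norm ?invr_gt0 // => hn.
have hc : `|c / u n| < d.
  rewrite normrM (gtr0_norm (_ : 0 < (u n)^-1)) ?invr_gt0 //.
  apply: (@le_lt_trans _ _ ((1 + `|c|) * (u n)^-1)).
    by rewrite ler_wpM2r ?invr_ge0 ?ltW // ltrDr.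
  by rewrite mulrC -ltr_pdivlMr.
have := Hd _ hc; rewrite add0r f0 subr0 => h.
have un0 : u n != 0 by rewrite gt_eqF.
have -> : a * c - u n * f (c / u n) = - (u n * (f (c / u n) - a * (c / u n))) by field.
rewrite normrN normrM (gtr0_norm (u0 n)).
apply: le_trans (ler_wpM2l (ltW (u0 n)) h) _.
rewrite normrM normfV (gtr0_norm (u0 n)) mulrCA [X in _ * X]mulrCA mulfV // mulr1.
rewrite mulrAC ler_pdivrMr // ler_wpM2l ?(ltW e0) //.
by rewrite lerDr.
Qed.

Lemma cvg_sqr (u : nat -> R) (l : R) : u n @[n --> \oo] --> l -> u n ^+ 2 @[n --> \oo] --> l ^+ 2.
Proof.
move=> h; rewrite expr2.
have -> : (fun n => u n ^+ 2) = (fun n => u n * u n) by apply/funext => n; rewrite expr2.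
exact: cvgM.
Qed.

Lemma cvg_sum_nat (f : nat -> nat -> R) (l : nat -> R) a b : (forall k, f n k @[n --> \oo] --> l k) ->
  \sum_(a <= k < b) f n k @[n --> \oo] --> \sum_(a <= k < b) l k.
Proof.
move=> H; elim: (index_iota a b) => [|k s ih].
  rewrite big_nil; have -> : (fun n => \sum_(k <- [::]) f n k) = (fun=> 0) by apply/funext => n; rewrite big_nil.
  exact: cvg_cst.
rewrite big_cons; have -> : (fun n => \sum_(i <- k :: s) f n i) = (fun n => f n k + \sum_(i <- s) f n i).
  by apply/funext => n; rewrite big_cons.
exact: cvgD.
Qed.

Lemma inv_pow2_cvg0 : ((2 ^+ n : R)^-1) @[n --> \oo] --> (0 : R).
Proof.
have := @cvg_geometric R 1 (2^-1); rewrite ger0_norm ?invr_ge0 // => /(_ _) H.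
have {}H : geometric 1 (2^-1) @ \oo --> (0 : R) by apply: H; rewrite invf_lt1 ?ltr1n.
apply: cvg_trans H; apply: near_eq_cvg; near=> n.
by rewrite /geometric /= mul1r exprVn.
Unshelve. all: by end_near. Qed.

Lemma cos_half t : 2 - 2 * cos t = 4 * sin (t / 2) ^+ 2.
Proof.
have -> : cos t = cos ((t / 2) *+ 2) by congr cos; rewrite -mulr_natl; field.
by rewrite cos_mulr2n cos2sin2; ring.
Qed.

Lemma pkernel_den y t : expR y + expR (- y) - 2 * cos t =
  (expR (y / 2) - expR (- (y / 2))) ^+ 2 + 4 * sin (t / 2) ^+ 2.
Proof.
rewrite -cos_half {1 2}(_ : y = y / 2 + y / 2); last by field.
rewrite opprD !expRD !expRN; field; by rewrite gt_eqF ?expR_gt0.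
Qed.

(** [term n k x] is the [k]-th summand of [pkernel_pow2] at y = x / 2^n and t = 0, divided by 2^n.
    [termE] rewrites it through [num] and a scaled sine, whose limits are first derivatives at 0. *)
Let num n x := 2 ^+ n * (expR (x / 2 ^+ n) - expR (- (x / 2 ^+ n))).
Let term n k x := pkernel (x / 2 ^+ n) (2 * pi * k%:R / 2 ^+ n) / 2 ^+ n.

Lemma num_cvg x : num n x @[n --> \oo] --> 2 * x.
Proof.
apply: (@seq_diff0 (fun y => expR y - expR (- y)) 2 x (fun n => 2 ^+ n)).
- by rewrite oppr0 subrr.
- apply: is_derive_rder; apply: is_derive_eq; rewrite oppr0 expR0 /GRing.scale /=; ring.
- by move=> n; rewrite exprn_gt0.
- exact: inv_pow2_cvg0.
Qed.

Lemma sin_cvg k : 2 ^+ n * sin (pi * k%:R / 2 ^+ n) @[n --> \oo] --> (pi * k%:R : R).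
Proof.
rewrite -[X in _ --> X]mul1r.
apply: (@seq_diff0 sin 1 (pi * k%:R) (fun n => 2 ^+ n)).
- exact: sin0.
- by apply: is_derive_rder; apply: is_derive_eq; rewrite cos0.
- by move=> n; rewrite exprn_gt0.
- exact: inv_pow2_cvg0.
Qed.

Lemma termE n k x : term n k x = num n x / (num n (x / 2) ^+ 2 + 4 * (2 ^+ n * sin (pi * k%:R / 2 ^+ n)) ^+ 2).
Proof.
rewrite /term /pkernel pkernel_den.
have -> : 2 * pi * k%:R / 2 ^+ n / 2 = pi * k%:R / 2 ^+ n :> R by field; rewrite expf_neq0.
have -> : x / 2 ^+ n / 2 = x / 2 / 2 ^+ n by field; rewrite expf_neq0.
set q := 2 ^+ n; have q0 : q != 0 :> R by rewrite expf_neq0.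
rewrite /num -/q !exprMn; set A := _ - _; set B := _ - _; set s := sin _.
have -> : q ^+ 2 * B ^+ 2 + 4 * (q ^+ 2 * s ^+ 2) = q ^+ 2 * (B ^+ 2 + 4 * s ^+ 2) by ring.
rewrite invfM; set D := (_ + _)^-1; by field.
Qed.

Lemma term_cvg k x : 0 < x -> term n k x @[n --> \oo] --> 2 * x / (x ^+ 2 + 4 * pi ^+ 2 * k%:R ^+ 2).
Proof.
move=> x0; have -> : (fun n => term n k x) = (fun n => num n x / (num n (x / 2) ^+ 2 + 4 * (2 ^+ n * sin (pi * k%:R / 2 ^+ n)) ^+ 2)).
  by apply/funext => n; exact: termE.
have -> : x ^+ 2 + 4 * pi ^+ 2 * k%:R ^+ 2 = (2 * (x / 2)) ^+ 2 + 4 * (pi * k%:R) ^+ 2 by field.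
apply: cvgM; first exact: num_cvg.
apply: cvgV.
  rewrite gt_eqF //; apply: ltr_wpDr; first by rewrite mulr_ge0 // sqr_ge0.
  by rewrite exprn_gt0 //; lra.
apply: cvgD; first by apply: cvg_sqr; exact: num_cvg.
by apply: cvgMr; apply: cvg_sqr; exact: sin_cvg.
Qed.

(** Doubling s cos s <= sin s gives sin t >= t cos^2(t / 2) = t (1 + cos t) / 2, and cos t >= 0
    here. *)
Lemma sin_lower t : 0 <= t <= pi / 2 -> t / 2 <= sin t.
Proof.
have base (s : R) : 0 <= s <= pi / 2 -> s * cos s <= sin s.
  move=> /andP[s0 s1]; have [|c /andP[c0 cs] E] := @rder_mvt R (fun s => sin s - s * cos s) (fun s => s * sin s) 0 s s0.
    move=> y _; apply: is_derive_rder; apply: is_derive_eq; rewrite /GRing.scale /=; ring.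
  rewrite sin0 mul0r !subr0 in E; rewrite -subr_ge0 E mulr_ge0 // mulr_ge0 // sin_ge0_pi //.
  have := pi_gt0 R; lra.
move=> /andP[t0 t1]; have p0 := pi_gt0 R.
have h := base (t / 2); have {}h := h ltac:(lra).
have c0 : 0 <= cos (t / 2) by apply: cos_ge0_pihalf; lra.
have ct : 0 <= cos t by apply: cos_ge0_pihalf; lra.
have E1 : sin t = 2 * (cos (t / 2) * sin (t / 2)).
  by rewrite mulr_natl -sin_mulr2n -mulr_natl; congr sin; field.
have E2 : cos t = 2 * cos (t / 2) ^+ 2 - 1.
  by rewrite mulr_natl -cos_mulr2n -mulr_natl; congr cos; field.
rewrite E1; apply: (@le_trans _ _ (2 * (cos (t / 2) * (t / 2 * cos (t / 2))))); last by rewrite !ler_wpM2l.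
have -> : 2 * (cos (t / 2) * (t / 2 * cos (t / 2))) = t * cos (t / 2) ^+ 2 by field.
apply: ler_wpM2l => //; lra.
Qed.

Lemma num_bound n x : 0 < x -> 0 < num n x <= 2 * x * expR x.
Proof.
move=> x0; have q0 : 0 < 2 ^+ n :> R by rewrite exprn_gt0.
have q1 : 1 <= 2 ^+ n :> R by rewrite -natrX ler1n expn_gt0.
set h := x / 2 ^+ n; have h0 : 0 < h by rewrite divr_gt0.
have hx : h <= x by rewrite ler_pdivrMr // ler_peMr // ltW.
have xE : x = 2 ^+ n * h by rewrite /h; field; rewrite gt_eqF.
rewrite /num -/h; apply/andP; split.
  by rewrite mulr_gt0 // subr_gt0 ltr_expR; lra.
have A : expR h - expR (- h) <= 2 * h * expR x.
  have -> : expR h - expR (- h) = expR h * (1 - expR (- (2 * h))).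
    rewrite mulrBr mulr1 -expRD; congr (_ - expR _); ring.
  apply: (@le_trans _ _ (expR h * (2 * h))).
    rewrite ler_wpM2l ?expR_ge0 //; have := expR_ge1Dx (- (2 * h)); lra.
  by rewrite mulrC ler_wpM2l ?ler_expR // mulr_ge0 // ltW.
apply: le_trans (ler_wpM2l (ltW q0) A) _; rewrite {2}xE le_eqVlt; apply/orP; left; apply/eqP; ring.
Qed.

(** The majorant does not depend on n, which is what allows the limit in n to be taken under the sum
    over k. *)
Lemma term_bound n k x : 0 < x -> (0 < k)%N -> (k.*2 <= 2 ^ n)%N ->
  0 <= term n k x <= 2 * x * expR x / k%:R ^+ 2.
Proof.
move=> x0 k0 kn; have p0 := pi_gt0 R; have p1 : 2 <= pi := pi_ge2 R.
have q0 : 0 < 2 ^+ n :> R by rewrite exprn_gt0.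
have kr : 0 < k%:R :> R by rewrite ltr0n.
have /andP[N0 N1] := num_bound n x0.
have S : (k%:R : R) <= 2 ^+ n * sin (pi * k%:R / 2 ^+ n).
  have h : (pi * k%:R / 2 ^+ n / 2 : R) <= sin (pi * k%:R / 2 ^+ n).
    apply: sin_lower; apply/andP; split.
      by rewrite divr_ge0 ?mulr_ge0 // ?(ltW p0) ?(ltW q0).
    rewrite ler_pdivrMr //.
    have : k%:R * 2 <= 2 ^+ n :> R by rewrite -natrX -natrM ler_nat muln2.
    have -> : pi / 2 * 2 ^+ n = pi * (2 ^+ n / 2) :> R by field.
    move=> hh; rewrite ler_wpM2l ?(ltW p0) //; lra.
  apply: le_trans (ler_wpM2l (ltW q0) h).
  have -> : 2 ^+ n * (pi * k%:R / 2 ^+ n / 2) = k%:R * (pi / 2) :> R by field; rewrite gt_eqF.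
  by rewrite ler_peMr ?(ltW kr) //; lra.
rewrite termE; set D := _ + _.
have D1 : k%:R ^+ 2 <= D.
  apply: (@le_trans _ _ (4 * (2 ^+ n * sin (pi * k%:R / 2 ^+ n)) ^+ 2)); last by rewrite /D lerDr sqr_ge0.
  apply: (@le_trans _ _ ((2 ^+ n * sin (pi * k%:R / 2 ^+ n)) ^+ 2)).
    by rewrite ler_pXn2r ?nnegrE ?(ltW kr) // (le_trans (ltW kr)).
  by rewrite ler_peMl ?sqr_ge0 // ler1n.
have D0 : 0 < D by apply: lt_le_trans D1; rewrite exprn_gt0.
apply/andP; split; first by rewrite divr_ge0 // ltW.
apply: ler_pM => //; first exact: ltW.
  by rewrite invr_ge0 ltW.
by rewrite lef_pV2 ?posrE ?exprn_gt0.
Qed.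

Lemma sum_inv_sqr M m : (0 < M)%N -> \sum_(M.+1 <= k < m) (k%:R ^+ 2)^-1 <= M%:R^-1 :> R.
Proof.
(* The subtracted term makes the induction telescope; the maximum covers the empty sum. *)
move=> M0; suff : \sum_(M.+1 <= k < m) (k%:R ^+ 2)^-1 <= M%:R^-1 - (maxn M m.-1)%:R^-1 :> R.
  by move=> /le_trans; apply; rewrite gerBl invr_ge0.
elim: m => [|m ih]; first by rewrite big_geq // maxn0 subrr.
have [mM|Mm] := leqP m M.
  by rewrite big_geq ?subrr.
rewrite big_nat_recr //=.
have m0 : (0 < m.-1)%N by case: m Mm {ih} => // m'; rewrite ltnS; exact: leq_trans.
have E : maxn M m.-1 = m.-1 by apply/maxn_idPr; case: m Mm {ih m0}.
rewrite E in ih; apply: le_trans (lerD ih (lexx _)) _.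
have -> : m = m.-1.+1 by rewrite prednK // (leq_ltn_trans _ Mm).
move: m0; set p := m.-1 => p0; rewrite -pred_Sn.
have pr : 0 < p%:R :> R by rewrite ltr0n.
rewrite -addrA lerD2l -natr1.
rewrite -subr_ge0.
have -> : - (p%:R + 1)^-1 - (- p%:R^-1 + ((p%:R + 1) ^+ 2)^-1) = (p%:R * (p%:R + 1) ^+ 2)^-1 :> R.
  by field; rewrite !gt_eqF //; lra.
by rewrite invr_ge0 mulr_ge0 ?exprn_ge0 //; lra.
Qed.

(* coth (x / 2) / 2 - 1 / x *)
Definition kfun x : R := (1 + expR (- x)) / (1 - expR (- x)) / 2 - x^-1.

(** Folding the 2^n summands by the symmetry of k and 2^n - k writes coth(x / 2) / 2 as half the
    term at 0, half the middle term and the terms between. The first tends to 1 / x, the second to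
    0, and the terms beyond [M] are summed by [term_bound] and [sum_inv_sqr]. *)
Lemma kfun_partial x M : 0 < x -> (0 < M)%N ->
  0 <= kfun x - \sum_(1 <= k < M.+1) 2 * x / (x ^+ 2 + 4 * pi ^+ 2 * k%:R ^+ 2) <= 2 * x * expR x / M%:R.
Proof.
move=> x0 M0.
have E n : (0 < n)%N -> kfun x = term n 0 x / 2 - x^-1 + term n (2 ^ n.-1) x / 2 + \sum_(1 <= k < 2 ^ n.-1) term n k x.
  move=> n0; have q0 : 0 < 2 ^+ n :> R by rewrite exprn_gt0.
  have nE : (2 ^ n = (2 ^ n.-1).*2)%N by rewrite -mul2n -expnS prednK.
  have h := @pkernel_pow2 n (x / 2 ^+ n) 0 (divr_gt0 x0 q0).
  have E1 : 2 ^+ n * (x / 2 ^+ n) = x by field; rewrite gt_eqF.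
  rewrite mulr0 E1 nE in h.
  have {}h : 2 ^+ n * pkernel x 0 = \sum_(0 <= k < (2 ^ n.-1).*2) pkernel (x / 2 ^+ n) (2 * pi * k%:R / 2 ^+ n).
    by rewrite h; apply: eq_bigr => k _; rewrite add0r.
  rewrite sum_symmetric in h; last 2 first.
  - by rewrite expn_gt0.
  - move=> k kn; rewrite -pkernel_sym; congr pkernel; rewrite -nE natrB ?nE // -nE natrX.
    by field; rewrite gt_eqF.
  have E0 : expR (- x) < 1 by rewrite expR_lt1 oppr_lt0.
  have En := expR_gt0 (- x).
  have kE : pkernel x 0 = (1 + expR (- x)) / (1 - expR (- x)).
    rewrite /pkernel cos0 -[in expR x](opprK x) [expR (- - x)]expRN.
    have a1 : 1 - expR (- x) != 0 by rewrite gt_eqF // subr_gt0.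
    set e := expR (- x) in En a1 *.
    have a2 : 1 + e ^+ 2 - 2 * e != 0.
      have -> : 1 + e ^+ 2 - 2 * e = (1 - e) ^+ 2 by ring.
      by rewrite expf_neq0.
    have -> : e^-1 + e - 2 * 1 = (1 - e) ^+ 2 / e by field; rewrite gt_eqF.
    by field; rewrite a1 gt_eqF.
  rewrite /kfun -kE.
  have -> : pkernel x 0 = 2 ^+ n * pkernel x 0 / 2 ^+ n by field; rewrite gt_eqF.
  rewrite h /term -[in RHS]mulr_suml; field; by rewrite !gt_eqF.
set T := \sum_(1 <= k < M.+1) _; set Cc := 2 * x * expR x.
have C0 : 0 <= Cc by rewrite /Cc !mulr_ge0 ?expR_ge0 // ltW.
pose v n := kfun x - (term n 0 x / 2 - x^-1 + term n (2 ^ n.-1) x / 2) - \sum_(1 <= k < M.+1) term n k x.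
have vcvg : v n @[n --> \oo] --> kfun x - T.
  have -> : kfun x - T = kfun x - (2 * x / (x ^+ 2 + 4 * pi ^+ 2 * 0%:R ^+ 2) / 2 - x^-1 + 0) - T.
    by congr (_ - _); rewrite [in RHS]expr0n mulr0 addr0 addr0; field; rewrite gt_eqF.
  apply: cvgB; last first.
    by apply: cvg_sum_nat => k; exact: term_cvg.
  apply: cvgB; first exact: cvg_cst.
  apply: cvgD; first by apply: cvgB; [apply: cvgMl; exact: term_cvg|exact: cvg_cst].
  apply: (@squeeze_cvgr _ _ _ _ (fun=> 0) (fun n => Cc * (2 ^+ n)^-1)).
  - near=> n; have n0 : (0 < n)%N by near: n; exists 1%N.
    have nE : (2 ^ n = (2 ^ n.-1).*2)%N by rewrite -mul2n -expnS prednK.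
    have p0 : (0 < 2 ^ n.-1)%N by rewrite expn_gt0.
    have /andP[t0 t1] := @term_bound n _ x x0 p0 (eq_leq (esym nE)).
    rewrite divr_ge0 //= ler_pdivrMr //; apply: le_trans t1 _.
    rewrite -/Cc; have -> : Cc / 2 ^+ n * 2 = Cc * ((2 ^+ n)^-1 * 2) by rewrite mulrA.
    apply: ler_wpM2l => //.
    have -> : 2 ^+ n = (2 ^ n.-1)%:R * 2 :> R by rewrite -natrX nE -muln2 natrM.
    set w := (2 ^ n.-1)%:R.
    have w1 : 1 <= w :> R by rewrite ler1n.
    have w0 : 0 < w by apply: lt_le_trans w1.
    have -> : (w * 2)^-1 * 2 = w^-1 by field; rewrite gt_eqF.
    rewrite lef_pV2 ?posrE ?exprn_gt0 // expr2 ler_peMl //; exact: ltW.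
  - exact: cvg_cst.
  - by rewrite -[X in _ --> X](mulr0 Cc); apply: cvgMr; exact: inv_pow2_cvg0.
have vb : \forall n \near \oo, 0 <= v n <= Cc / M%:R.
  near=> n; have n0 : (0 < n)%N by near: n; exists 1%N.
  have Mn : (M.+1 <= 2 ^ n.-1)%N.
    have nM : (M.+1 <= n)%N by near: n; exists M.+1.
    by apply: leq_trans (ltn_expl n.-1 _) => //; rewrite prednK.
  rewrite /v (E n n0) [X in X - _ - _]addrC addrK.
  rewrite (big_cat_nat _ (n := M.+1)) //= addrAC subrr add0r.
  have nE : (2 ^ n = (2 ^ n.-1).*2)%N by rewrite -mul2n -expnS prednK.
  have tb k : (M.+1 <= k < 2 ^ n.-1)%N -> 0 <= term n k x <= Cc * (k%:R ^+ 2)^-1.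
    move=> /andP[k1 k2]; apply: term_bound => //; first exact: leq_ltn_trans k1.
    by rewrite nE leq_double ltnW.
  apply/andP; split.
    rewrite big_nat_cond sumr_ge0 // => k; rewrite andbT => /tb /andP[]; done.
  apply: (@le_trans _ _ (\sum_(M.+1 <= k < 2 ^ n.-1) Cc * (k%:R ^+ 2)^-1)).
    rewrite big_nat_cond [in leRHS]big_nat_cond ler_sum // => k; rewrite andbT => /tb /andP[]; done.
  by rewrite -mulr_sumr ler_wpM2l // sum_inv_sqr.
have <- : lim (v n @[n --> \oo]) = kfun x - T by apply/cvg_lim.
apply/andP; split.
  by apply: limr_ge; [exact: (cvgP _ vcvg)|apply: filterS vb => n /andP[]].
by apply: limr_le; [exact: (cvgP _ vcvg)|apply: filterS vb => n /andP[]].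
Unshelve. all: by end_near. Qed.

Lemma kfun_ge0 x : 0 < x -> 0 <= kfun x.
Proof.
move=> x0; have /andP[h _] := kfun_partial x0 (ltn0Sn 0).
apply: le_trans h _; rewrite gerBl big_nat1; apply: divr_ge0; first by rewrite mulr_ge0 // ltW.
apply: addr_ge0; first exact: sqr_ge0.
by apply: mulr_ge0; [apply: mulr_ge0 => //; exact: sqr_ge0|exact: sqr_ge0].
Qed.

Lemma kfun_series x : 0 < x ->
  \sum_(0 <= k < M) 2 * x / (x ^+ 2 + 4 * pi ^+ 2 * k.+1%:R ^+ 2) @[M --> \oo] --> kfun x.
Proof.
move=> x0; apply/cvgrPdist_le => e e0.
set Cc := 2 * x * expR x; have C0 : 0 <= Cc by rewrite /Cc !mulr_ge0 ?expR_ge0 // ltW.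
exists (Num.truncn (Cc / e)).+1 => // M /= hM.
have M0 : (0 < M)%N by exact: leq_trans hM.
have := kfun_partial x0 M0; rewrite big_add1 /= -/Cc => /andP[h1 h2].
rewrite ger0_norm //; apply: le_trans h2 _.
rewrite ler_pdivrMr ?ltr0n // mulrC -ler_pdivrMr //.
apply: ltW; apply: lt_le_trans (truncnS_gt _) _; by rewrite ler_nat.
Qed.
End CothPartialFractions.

(** * Integrals of nonnegative continuous functions over the line *)

Section LineIntegrals.
Variable R : realType.
Local Notation mu := (@lebesgue_measure R).

(** Extended-valued, so that nonnegative integrands need no integrability; finiteness is recovered
    afterwards from identities such as [gammaI_fin01]. *)
Definition lint (f : R -> R) : \bar R := (\int[mu]_x (f x)%:E)%E.

Lemma lint_eq (f g : R -> R) : f =1 g -> lint f = lint g.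
Proof. by move=> fg; apply: eq_integral => x _; rewrite fg. Qed.

Lemma continuous_EFin_measurable (f : R -> R) : continuous f -> measurable_fun setT (fun x : R => (f x)%:E).
Proof. by move=> cf; apply/measurable_EFinP; exact: continuous_measurable_fun. Qed.

Lemma lintD (f g : R -> R) : continuous f -> continuous g -> (forall x, 0 <= f x) -> (forall x, 0 <= g x) ->
  lint (fun x => f x + g x) = (lint f + lint g)%E.
Proof.
move=> cf cg f0 g0; rewrite /lint -ge0_integralD //.
- by move=> x _; rewrite lee_fin.
- exact: continuous_EFin_measurable.
- by move=> x _; rewrite lee_fin.
- exact: continuous_EFin_measurable.
Qed.

Lemma lintZ (c : R) (f : R -> R) : 0 <= c -> continuous f -> (forall x, 0 <= f x) ->
  lint (fun x => c * f x) = (c%:E * lint f)%E.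
Proof.
move=> c0 cf f0; rewrite /lint -ge0_integralZl_EFin //.
- by move=> x _; rewrite lee_fin.
- exact: continuous_EFin_measurable.
Qed.

Lemma lint_ge0 (f : R -> R) : (forall x, 0 <= f x) -> (0 <= lint f)%E.
Proof. by move=> f0; apply: integral_ge0 => x _; rewrite lee_fin. Qed.

Lemma lint_le (f g : R -> R) : continuous f -> continuous g -> (forall x, 0 <= f x <= g x) ->
  (lint f <= lint g)%E.
Proof.
move=> cf cg fg; apply: ge0_le_integral => //.
- by move=> x _; rewrite lee_fin; case/andP: (fg x).
- exact: continuous_EFin_measurable.
- exact: continuous_EFin_measurable.
- by move=> x _; rewrite lee_fin; case/andP: (fg x).
Qed.

Lemma lint_affine (f : R -> R) (a b : R) : 0 < a -> continuous f -> (forall x, 0 <= f x) ->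
  lint f = lint (fun x => a * f (a * x + b)).
Proof.
move=> a0 cf f0.
have dF x : is_derive x (1 : R) (fun x => a * x + b) a.
  apply: is_derive_eq; rewrite /GRing.scale /=; ring.
have F' : (fun x : R => a * x + b)^`() = fun=> a.
  by apply/funext => x; rewrite derive1E; exact: derive_val.
rewrite /lint (@increasing_ge0_integration_by_substitutionT R (fun x => a * x + b)) //.
- apply: eq_integral => x _; rewrite F' /=; congr EFin; by rewrite mulrC.
- by move=> x y xy; rewrite ltrD2r ltr_pM2l.
- rewrite F' => x; exact: cvg_cst.
- rewrite F'; exact: is_cvg_cst.
- rewrite F'; exact: is_cvg_cst.
- apply/cvgrNyPle => A; exists ((A - b) / a); split; first exact: num_real.
  by move=> x; rewrite ltr_pdivlMr // => h; lra.
- apply/cvgryPge => A; exists ((A - b) / a); split; first exact: num_real.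
  by move=> x; rewrite ltr_pdivrMr // => h; lra.
Qed.

Lemma lint_translate (f : R -> R) (b : R) : continuous f -> (forall x, 0 <= f x) ->
  lint f = lint (fun x => f (x + b)).
Proof.
move=> cf f0; rewrite (@lint_affine f 1 b) //.
by apply: lint_eq => x; rewrite !mul1r.
Qed.

Lemma itv_FTC (h G : R -> R) (a b : R) : a < b -> continuous h -> (forall x, a <= x <= b -> rder G x (h x)) ->
  (\int[mu]_(x in `[a, b]) (h x)%:E = (G b)%:E - (G a)%:E)%E.
Proof.
move=> ab ch dG; apply: continuous_FTC2 => //.
- exact: continuous_subspaceT.
- split.
  + by move=> x; rewrite in_itv /= => /andP[h1 h2]; have [] := rder_is_derive (dG x _); rewrite ?(ltW h1) ?(ltW h2).
  + apply: cvg_at_right_filter; apply: (rder_cts (dG a _)); by rewrite lexx ltW.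
  + apply: cvg_at_left_filter; apply: (rder_cts (dG b _)); by rewrite lexx ltW.
- move=> x; rewrite in_itv /= => /andP[h1 h2].
  have xab : a <= x <= b by rewrite !ltW.
  by have [_] := rder_is_derive (dG x xab); rewrite derive1E.
Qed.

Lemma lint_exhaust (h : R -> R) : continuous h -> (forall x, 0 <= h x) ->
  (\int[mu]_(x in `[(- n%:R)%R, n%:R]) (h x)%:E)%E @[n --> \oo] --> lint h.
Proof.
move=> ch h0.
have E : \bigcup_n `[(- n%:R)%R, (n%:R : R)] = [set: R].
  apply/seteqP; split => // x _; exists (Num.truncn `|x|).+1 => //=.
  rewrite in_itv /=; have := truncnS_gt `|x|; rewrite ltr_norml; lra.
rewrite /lint -E; apply: ge0_nondecreasing_set_cvg_integral.
- move=> m n mn; rewrite subsetEset => x /=; rewrite !in_itv /=.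
  have : m%:R <= n%:R :> R by rewrite ler_nat.
  lra.
- by move=> n; exact: measurable_itv.
- move=> n; apply: (measurable_funS measurableT) => //; exact: continuous_EFin_measurable.
- by move=> n x _; rewrite lee_fin.
Qed.

(** Integration by parts without subtraction of integrals: it stays meaningful when both sides are
    infinite. *)
Lemma lint_derivative (h1 h2 H : R -> R) (L : R) :
  continuous h1 -> continuous h2 -> (forall x, 0 <= h1 x) -> (forall x, 0 <= h2 x) ->
  (forall x, rder H x (h1 x - h2 x)) ->
  H n%:R - H (- n%:R) @[n --> \oo] --> L ->
  lint h1 = (lint h2 + L%:E)%E.
Proof.
move=> c1 c2 p1 p2 dH HL.
have e1 := lint_exhaust c1 p1; have e2 := lint_exhaust c2 p2.
have step n : (0 < n)%N -> (\int[mu]_(x in `[(- n%:R)%R, (n%:R : R)]) (h1 x)%:E =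
   \int[mu]_(x in `[(- n%:R)%R, n%:R]) (h2 x)%:E + (H n%:R - H (- n%:R))%:E)%E.
  move=> n0; have nr : 0 < n%:R :> R by rewrite ltr0n.
  have [G2 HG2] := real_primitive (- n%:R - 1) (n%:R + 1) c2.
  have nn : - n%:R < n%:R :> R by lra.
  have d2 x : - n%:R <= x <= n%:R -> rder G2 x (h2 x) by move=> hx; apply: HG2; lra.
  have d1 x : - n%:R <= x <= n%:R -> rder (fun x => G2 x + H x) x (h1 x).
    move=> hx; apply: is_derive_rder.
    have i2 := rder_is_derive (d2 x hx); have i3 := rder_is_derive (dH x).
    have -> : h1 x = h2 x + (h1 x - h2 x) by ring.
    exact: (is_deriveD i2 i3).
  rewrite (itv_FTC nn c1 d1) (itv_FTC nn c2 d2) -!EFinB -EFinD; congr EFin; ring.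
have e3 : (\int[mu]_(x in `[(- n%:R)%R, n%:R]) (h2 x)%:E + (H n%:R - H (- n%:R))%:E)%E @[n --> \oo] --> (lint h2 + L%:E)%E.
  apply: cvgeD => //; first by rewrite fin_num_adde_defl.
  by apply: cvg_EFin; [near=> n|exact: HL].
have e4 : (\int[mu]_(x in `[(- n%:R)%R, n%:R]) (h1 x)%:E)%E @[n --> \oo] --> (lint h2 + L%:E)%E.
  apply: cvg_trans e3; apply: near_eq_cvg; near=> n.
  by rewrite step //; near: n; exists 1%N.
exact: (cvg_unique _ e1 e4).
Unshelve. all: by end_near. Qed.

Lemma lint_swap (f : R -> R -> R) : measurable_fun [set: R * R] (fun p => f p.1 p.2) ->
  (forall x y, 0 <= f x y) ->
  (\int[mu]_x lint (f x) = \int[mu]_y lint (f ^~ y))%E.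
Proof.
move=> mf f0.
apply: (@fubini_tonelli _ _ _ _ _ mu mu (fun p => (f p.1 p.2)%:E)).
  by apply/measurable_EFinP.
by move=> p; rewrite lee_fin.
Qed.

Lemma lint_monotone (g : nat -> R -> R) (f : R -> R) : (forall n, continuous (g n)) ->
  (forall n x, 0 <= g n x) -> (forall x m n, (m <= n)%N -> g m x <= g n x) ->
  (forall x, g n x @[n --> \oo] --> f x) ->
  lint (g n) @[n --> \oo] --> lint f.
Proof.
move=> cg g0 gm gf.
have -> : lint f = (\int[mu]_x limn (fun n => (g n x)%:E))%E.
  by apply: eq_integral => x _; apply/esym/cvg_lim => //; apply: cvg_EFin; [near=> n|exact: gf].
apply: cvg_monotone_convergence => //.
- by move=> n; exact: continuous_EFin_measurable.
- by move=> n x _; rewrite lee_fin.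
- by move=> x _ m n mn; rewrite lee_fin; exact: gm.
Unshelve. all: by end_near. Qed.

Lemma continuous_add (f g : R -> R) : continuous f -> continuous g -> continuous (fun x => f x + g x).
Proof. by move=> cf cg x; apply: cvgD; [exact: cf|exact: cg]. Qed.
Lemma continuous_opp (f : R -> R) : continuous f -> continuous (fun x => - f x).
Proof. by move=> cf x; apply: cvgN; exact: cf. Qed.
Lemma continuous_mul (f g : R -> R) : continuous f -> continuous g -> continuous (fun x => f x * g x).
Proof. by move=> cf cg x; apply: cvgM; [exact: cf|exact: cg]. Qed.
Lemma continuous_expR_comp (f : R -> R) : continuous f -> continuous (fun x => expR (f x)).
Proof. by move=> cf x; apply: (continuous_comp (cf x)); exact: continuous_expR. Qed.
Lemma continuous_inv (f : R -> R) : (forall x, f x != 0) -> continuous f -> continuous (fun x => (f x)^-1).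
Proof. by move=> f0 cf x; apply: cvgV; [exact: f0|exact: cf]. Qed.
Lemma continuous_const (c : R) : continuous (fun _ : R => c).
Proof. by move=> x; exact: cvg_cst. Qed.
Lemma continuous_var : continuous (fun x : R => x).
Proof. by move=> x; exact: cvg_id. Qed.
End LineIntegrals.

(** Follows the syntax of the function; the goals it leaves are the nonvanishing of inverted
    subterms. *)
Ltac prove_continuous := repeat match goal with |- continuous ?f => lazymatch f with
  | (fun z => z) => exact: continuous_var
  | (fun z => expR (@?g z)) => apply: (@continuous_expR_comp _ g)
  | (fun z => @?g z + @?h z) => first [exact: continuous_const | apply: (@continuous_add _ g h)]
  | (fun z => @?g z * @?h z) => first [exact: continuous_const | apply: (@continuous_mul _ g h)]
  | (fun z => - (@?g z)) => first [exact: continuous_const | apply: (@continuous_opp _ g)]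
  | (fun z => (@?g z)^-1) => first [exact: continuous_const | apply: (@continuous_inv _ g)]
  | _ => exact: continuous_const
  end end.

(** * The gamma integral for positive arguments *)

Section GammaIntegral.
Variable R : realType.

(* Integrals over (0, oo) are carried to the line by x = exp y; this is Gamma(p). *)
Definition gammaI (p : R) : \bar R := lint (fun y => expR (p * y - expR y)).

Lemma cvg_expR_nat_opp (c : R) : 0 < c -> expR (- (c * n%:R)) @[n --> \oo] --> (0 : R).
Proof.
move=> c0; apply/cvgrPdist_le => e e0; exists (Num.truncn (c * e)^-1).+1 => // n /= hn.
rewrite sub0r normrN ger0_norm ?expR_ge0 // expRN.
have n0 : 0 < n%:R :> R by rewrite ltr0n; exact: leq_trans hn.
have h : (c * e)^-1 <= n%:R.
  by apply/ltW/(lt_le_trans (truncnS_gt _)); rewrite ler_nat.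
have cn : e^-1 <= c * n%:R.
  have -> : e^-1 = c * (c * e)^-1 by field; rewrite !gt_eqF.
  by rewrite ler_wpM2l // ltW.
rewrite -[leRHS]invrK lef_pV2 ?posrE ?expR_gt0 ?invr_gt0 //.
by apply: le_trans cn _; have := expR_ge1Dx (c * n%:R); lra.
Qed.

Lemma cvg_exp_exp (a : R) : expR (a * n%:R - expR n%:R) @[n --> \oo] --> (0 : R).
Proof.
(* The majorant comes from exp n >= n^2 / 2 and (n - (a + 1))^2 >= 0. *)
apply: (@squeeze_cvgr _ _ _ _ (fun=> 0) (fun n => expR ((a + 1) ^+ 2 / 2) * expR (- (1 * n%:R)))).
- near=> n; rewrite expR_ge0 /= -expRD ler_expR.
  have := @expR_ge1Dxn R n%:R 1 (ler0n _ _); rewrite (_ : 2`! = 2)%N //.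
  have := sqr_ge0 (n%:R - (a + 1) : R).
  have -> : (n%:R - (a + 1)) ^+ 2 = n%:R ^+ 2 - 2 * (a + 1) * n%:R + (a + 1) ^+ 2 :> R by ring.
  lra.
- exact: cvg_cst.
- rewrite -[X in _ --> X](mulr0 (expR ((a + 1) ^+ 2 / 2))); apply: cvgMr; exact: cvg_expR_nat_opp.
Unshelve. all: by end_near. Qed.

Lemma gammaI_ge0 p : (0 <= gammaI p)%E.
Proof. by apply: lint_ge0 => x; exact: expR_ge0. Qed.

Lemma gammaI_succ (p : R) : 0 < p -> (p%:E * gammaI p)%E = gammaI (p + 1).
Proof.
move=> p0; have cont (q : R) : continuous (fun y : R => expR (q * y - expR y)) by prove_continuous.
rewrite /gammaI -lintZ //; last by exact: ltW.
rewrite (@lint_derivative R (fun y => p * expR (p * y - expR y)) (fun y => expR ((p + 1) * y - expR y))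
  (fun y => expR (p * y - expR y)) 0) ?adde0 //.
- by prove_continuous.
- by move=> x; rewrite mulr_ge0 ?expR_ge0 // ltW.
- move=> x; apply: is_derive_rder.
  have -> : expR ((p + 1) * x - expR x) = expR x * expR (p * x - expR x) by rewrite -expRD; congr expR; ring.
  by apply: is_derive_eq; rewrite /GRing.scale /=; ring.
- rewrite -[X in _ --> X](subr0 0); apply: cvgB; first exact: cvg_exp_exp.
  apply: (@squeeze_cvgr _ _ _ _ (fun=> 0) (fun n => expR (- (p * n%:R)))).
  + near=> n; rewrite expR_ge0 /= ler_expR; have := expR_ge0 (- n%:R : R); lra.
  + exact: cvg_cst.
  + exact: cvg_expR_nat_opp.
Unshelve. all: by end_near. Qed.

Lemma gammaI1 : gammaI 1 = 1%E.
Proof.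
rewrite /gammaI (@lint_derivative R (fun y => expR (1 * y - expR y)) (fun=> 0) (fun y => - expR (- expR y)) 1).
- by rewrite /lint integral0 add0e.
- by prove_continuous.
- exact: continuous_const.
- by move=> x; exact: expR_ge0.
- by [].
- move=> x; apply: is_derive_rder; rewrite subr0 mul1r expRD.
  by apply: is_derive_eq; rewrite /GRing.scale /=; ring.
- have -> : (fun n => - expR (- expR n%:R) - - expR (- expR (- n%:R))) =
    (fun n => expR (- expR (- (1 * n%:R))) - expR (0 * n%:R - expR n%:R)) :> (nat -> R).
    by apply/funext => n; rewrite mul0r sub0r mul1r opprK addrC.
  rewrite -[X in _ --> X](subr0 1); apply: cvgB; last exact: cvg_exp_exp.
  rewrite -[X in _ --> X]expR0 -[X in expR X]oppr0.
  apply: (@cvg_comp _ _ _ (fun n => - expR (- (1 * n%:R))) expR _ (nbhs (- 0 : R))); last exact: continuous_expR.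
  by apply: cvgN; exact: cvg_expR_nat_opp.
Qed.

(** Convexity of exp: the tangent inequalities at th t, evaluated at 0 and at t, are averaged with
    weights 1 - th and th. *)
Lemma weighted_exp_mean (th t : R) : 0 <= th <= 1 -> expR (th * t) <= 1 - th + th * expR t.
Proof.
move=> /andP[t0 t1]; set A := expR (th * t).
have A0 : 0 <= A by exact: expR_ge0.
have h1 : A * (1 - th * t) <= 1.
  have := expR_ge1Dx (- (th * t)); rewrite expRN -/A => h.
  apply: le_trans (ler_wpM2l A0 h) _; by rewrite mulfV // gt_eqF ?expR_gt0.
have h2 : A * (1 + (1 - th) * t) <= expR t.
  have -> : expR t = A * expR ((1 - th) * t) by rewrite -expRD; congr expR; ring.
  by rewrite ler_wpM2l // expR_ge1Dx.
have k1 : (1 - th) * (A * (1 - th * t)) <= (1 - th) * 1 by rewrite ler_wpM2l // subr_ge0.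
have k2 : th * (A * (1 + (1 - th) * t)) <= th * expR t by rewrite ler_wpM2l.
have -> : A = (1 - th) * (A * (1 - th * t)) + th * (A * (1 + (1 - th) * t)) by ring.
lra.
Qed.

(** Logarithmic convexity of Gamma between a and a + 1. With x = exp y, the pointwise bound x^th <=
    a^th (1 - th + th x / a) is integrated, and Gamma(a + 1) = a Gamma(a) collapses the result. *)
Lemma gammaI_add_le (a th : R) : 0 < a -> 0 <= th <= 1 ->
  (gammaI (a + th) <= (a `^ th)%:E * gammaI a)%E.
Proof.
move=> a0 hth; have /andP[t0 t1] := hth.
have cont (q : R) : continuous (fun y : R => expR (q * y - expR y)) by prove_continuous.
have p0 q x : 0 <= expR (q * x - expR x) by exact: expR_ge0.
set w := a `^ th; have w0 : 0 <= w by exact: powR_ge0.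
have a1 : 0 <= w * (1 - th) by rewrite mulr_ge0 // subr_ge0.
have a2 : 0 <= w * (th / a) by rewrite mulr_ge0 // divr_ge0 // ltW.
apply: (@le_trans _ _ (lint (fun y => w * (1 - th) * expR (a * y - expR y) + w * (th / a) * expR ((a + 1) * y - expR y)))).
  apply: lint_le => //.
    by prove_continuous.
  move=> y; rewrite expR_ge0 /=.
  have wE : w = expR (th * ln a) by rewrite /w /powR gt_eqF.
  have aE : a = expR (ln a) by rewrite lnK.
  have h := weighted_exp_mean (y - ln a) hth.
  have -> : expR ((a + th) * y - expR y) = expR (a * y - expR y) * (w * expR (th * (y - ln a))).
    by rewrite wE -!expRD; congr expR; ring.
  have -> : w * (1 - th) * expR (a * y - expR y) + w * (th / a) * expR ((a + 1) * y - expR y) =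
    expR (a * y - expR y) * (w * (1 - th + th * expR (y - ln a))).
    have -> : expR ((a + 1) * y - expR y) = expR (a * y - expR y) * expR y by rewrite -expRD; congr expR; ring.
    rewrite expRB -aE; field; by rewrite gt_eqF.
  by rewrite !ler_wpM2l ?expR_ge0.
rewrite lintD; last 4 first.
- by prove_continuous.
- by prove_continuous.
- by move=> x; rewrite mulr_ge0.
- by move=> x; rewrite mulr_ge0.
rewrite !lintZ // -/(gammaI a) -/(gammaI (a + 1)) -gammaI_succ // muleA -EFinM.
rewrite -ge0_muleDl ?lee_fin //; last by rewrite mulr_ge0 // ltW.
rewrite -EFinD; have -> : w * (1 - th) + w * (th / a) * a = w by field; rewrite gt_eqF.
exact: lexx.
Qed.

(** Finite because p Gamma(p) = Gamma(p + 1) <= 1; positive because 1 = Gamma(1) is at most a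
    multiple of Gamma(p). *)
Lemma gammaI_fin01 (p : R) : 0 < p <= 1 -> exists2 g : R, 0 < g & gammaI p = g%:E.
Proof.
move=> /andP[p0 p1].
have h : (gammaI (p + 1) <= 1)%E.
  have := @gammaI_add_le 1 p ltr01; rewrite gammaI1 powR1 mule1 addrC; apply; lra.
rewrite -gammaI_succ // in h.
have h2 : (1 <= (p `^ (1 - p))%:E * gammaI p)%E.
  have := @gammaI_add_le p (1 - p) p0; rewrite subrKC gammaI1; apply; lra.
case E : (gammaI p) h h2 => [g| |] /=.
- move=> _; rewrite -EFinM lee_fin => h2; exists g => //.
  rewrite ltNge; apply/negP => g0.
  have : p `^ (1 - p) * g <= 0 by rewrite mulr_ge0_le0 ?powR_ge0.
  lra.
- by rewrite gt0_muley ?lte_fin // leye_eq.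
- by have := gammaI_ge0 p; rewrite E.
Qed.

Lemma gammaI_shift (p g : R) n : 0 < p -> gammaI p = g%:E ->
  gammaI (p + n%:R) = (\prod_(0 <= k < n) (p + k%:R) * g)%:E.
Proof.
move=> p0 pg; elim: n => [|n ih]; first by rewrite addr0 big_geq // mul1r.
rewrite -natr1 addrA -gammaI_succ; last by rewrite ltr_wpDr.
by rewrite ih -EFinM big_nat_recr //=; congr EFin; ring.
Qed.

Lemma gammaI_nat n : gammaI n.+1%:R = (n`!%:R)%:E.
Proof.
elim: n => [|n ih]; first by rewrite gammaI1.
by rewrite -[in LHS]natr1 -gammaI_succ ?ltr0n // ih -EFinM -natrM factS.
Qed.

Definition gauss_den (p : R) (n : nat) := \prod_(0 <= k < n.+1) (p + k%:R).

(** [gammaI_add_le] used twice: to pass from n + 1 up to n + 1 + p, and from n + 1 + p up to n +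
    2. *)
Lemma gauss_bounds (p g : R) n : 0 < p <= 1 -> gammaI p = g%:E ->
  n.+1`!%:R * (p + n.+1%:R) `^ (p - 1) <= gauss_den p n * g <= n`!%:R * n.+1%:R `^ p.
Proof.
move=> /andP[p0 p1] pg; have S := gammaI_shift n.+1 p0 pg.
have pn : 0 < p + n.+1%:R by rewrite addr_gt0 // ltr0n.
apply/andP; split; last first.
  rewrite -lee_fin -S addrC; apply: le_trans (gammaI_add_le _ _) _; rewrite ?ltr0n //; first lra.
  by rewrite gammaI_nat -EFinM lee_fin mulrC.
have : (gammaI n.+2%:R <= ((p + n.+1%:R) `^ (1 - p))%:E * gammaI (p + n.+1%:R))%E.
  have -> : n.+2%:R = (p + n.+1%:R) + (1 - p) :> R by rewrite -[in LHS]natr1; ring.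
  by apply: gammaI_add_le => //; lra.
rewrite gammaI_nat S -EFinM lee_fin -/(gauss_den p n) => h.
have -> : p - 1 = - (1 - p) by ring.
by rewrite powRN ler_pdivrMr ?powR_gt0 // mulrC.
Qed.
End GammaIntegral.

(** * Mellin integrals attached to powers and partial fractions *)

Section MellinIntegrals.
Variable R : realType.
Local Notation mu := (@lebesgue_measure R).

Lemma lint_sum (f : nat -> R -> R) (a b : nat) : (forall k, continuous (f k)) -> (forall k x, 0 <= f k x) ->
  lint (fun x => \sum_(a <= k < b) f k x) = (\sum_(a <= k < b) lint (f k))%E.
Proof.
move=> cf f0; rewrite /lint -ge0_integral_sum //.
- by apply: eq_integral => x _; rewrite sumEFin.
- by move=> k; exact: continuous_EFin_measurable.
- by move=> k x _; rewrite lee_fin.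
Qed.

Lemma lint_parts (h1 h2 H : R -> R) (c : R) : 0 < c ->
  continuous h1 -> continuous h2 -> (forall x, 0 <= h1 x) -> (forall x, 0 <= h2 x) ->
  (forall x, rder H x (h1 x - h2 x)) ->
  (forall x : R, 0 <= x -> `|H x| <= expR (- (c * x))) ->
  (forall x : R, 0 <= x -> `|H (- x)| <= expR (- (c * x))) ->
  lint h1 = lint h2.
Proof.
move=> c0 c1 c2 p1 p2 dH b1 b2.
rewrite (@lint_derivative R h1 h2 H 0) ?adde0 //.
have z (g : nat -> R) : (forall n, `|g n| <= expR (- (c * n%:R))) -> g n @[n --> \oo] --> (0 : R).
  move=> hg; apply/norm_cvg0P; apply: (@squeeze_cvgr _ _ _ _ (fun=> 0) (fun n => expR (- (c * n%:R)))).
  - by near=> n; rewrite normr_ge0 hg.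
  - exact: cvg_cst.
  - exact: cvg_expR_nat_opp.
rewrite -[X in _ --> X](subr0 0); apply: cvgB; apply: z => n.
- by apply: b1; rewrite ler0n.
- by apply: b2; rewrite ler0n.
Unshelve. all: by end_near. Qed.

Lemma expR_opp_le1 (x : R) : 0 <= x -> expR (- x) <= 1.
Proof. by move=> x0; rewrite -expR0 ler_expR oppr_le0. Qed.

Lemma expR_subln (v D : R) : 0 < D -> expR (v - ln D) = expR v / D.
Proof. by move=> D0; rewrite expRB lnK. Qed.

Lemma expR_opp_ge (x : R) : 1 - x <= expR (- x).
Proof. exact: expR_ge1Dx. Qed.

Lemma expR_opp_le2 (x : R) : 0 <= x -> expR (- x) <= 1 - x + x ^+ 2.
Proof.
move=> x0; rewrite expRN.
have h := expR_ge1Dx x; have p : 0 < 1 + x by lra.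
apply: (@le_trans _ _ (1 + x)^-1).
  by rewrite lef_pV2 ?posrE ?expR_gt0.
rewrite -[leLHS]mul1r ler_pdivrMr //.
have -> : (1 - x + x ^+ 2) * (1 + x) = 1 + x ^+ 3 by ring.
by rewrite lerDl exprn_ge0.
Qed.

Section FixU.
Variable u : R.
Hypotheses (u0 : 0 < u) (u1 : u < 1).

(* The integrands of [1 - e^(-lx)] x^(-u-1) dx and [lx - 1 + e^(-lx)] x^(-u-2) dx, at x = exp y. *)
Definition mellin1 (l y : R) := (1 - expR (- (l * expR y))) * expR (- (u * y)).
Definition mellin2 (l y : R) := (l * expR y - 1 + expR (- (l * expR y))) * expR (- ((1 + u) * y)).

Lemma mellin1_cont l : continuous (mellin1 l).
Proof. by rewrite /mellin1; prove_continuous. Qed.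
Lemma mellin2_cont l : continuous (mellin2 l).
Proof. by rewrite /mellin2; prove_continuous. Qed.

Lemma mellin1_ge0 l y : 0 <= l -> 0 <= mellin1 l y.
Proof.
move=> l0; rewrite mulr_ge0 ?expR_ge0 // subr_ge0; apply: expR_opp_le1.
by rewrite mulr_ge0 ?expR_ge0.
Qed.

Lemma mellin2_ge0 l y : 0 <= mellin2 l y.
Proof.
rewrite mulr_ge0 ?expR_ge0 //; have := expR_opp_ge (l * expR y); lra.
Qed.

Lemma mellin1_gamma : (u%:E * lint (mellin1 1))%E = gammaI (1 - u).
Proof.
rewrite -lintZ ?(ltW u0) //; last 2 first.
- exact: mellin1_cont.
- by move=> x; exact: mellin1_ge0.
(* The boundary term decays like exp(- u y) at +oo and like exp((1 - u) y) at -oo; the smaller rate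
   serves for both ends. *)
have uu : 0 < Num.min u (1 - u) by rewrite lt_min u0 subr_gt0.
have m1 : Num.min u (1 - u) <= u by rewrite ge_min lexx.
have m2 : Num.min u (1 - u) <= 1 - u by rewrite ge_min lexx orbT.
set m := Num.min _ _ in uu m1 m2.
apply: (@lint_parts _ _ (fun y => - mellin1 1 y) m) => //.
- by apply: continuous_mul; [exact: continuous_const|exact: mellin1_cont].
- by prove_continuous.
- by move=> x; rewrite mulr_ge0 ?mellin1_ge0 ?(ltW u0).
- move=> x; apply: is_derive_rder; rewrite /mellin1.
  have -> : expR ((1 - u) * x - expR x) = expR x * expR (- (1 * expR x)) * expR (- (u * x)).
    by rewrite -!expRD; congr expR; ring.
  by apply: is_derive_eq; rewrite /GRing.scale /=; ring.
- move=> x x0; rewrite normrN ger0_norm ?mellin1_ge0 //.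
  apply: (@le_trans _ _ (1 * expR (- (u * x)))).
    by rewrite ler_wpM2r ?expR_ge0 // gerBl expR_ge0.
  by rewrite mul1r ler_expR lerN2 ler_wpM2r.
- move=> x x0; rewrite normrN ger0_norm ?mellin1_ge0 //.
  apply: (@le_trans _ _ (expR (- x) * expR (- (u * - x)))).
    rewrite ler_wpM2r ?expR_ge0 // mul1r; have := expR_opp_ge (expR (- x)); lra.
  rewrite -expRD ler_expR.
  have := ler_wpM2r x0 m2; lra.
Qed.

(** Together with [mellin2_scale] this represents N^(1 + u) / (1 + u), the integral in [trap_sum],
    with the same constant as the powers n^u. *)
Lemma mellin12 : lint (mellin1 1) = ((1 + u)%:E * lint (mellin2 1))%E.
Proof.
have u10 : 0 <= 1 + u by rewrite addr_ge0 // ltW.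
rewrite -lintZ //; last 2 first.
- exact: mellin2_cont.
- by move=> x; exact: mellin2_ge0.
have uu : 0 < Num.min u (1 - u) by rewrite lt_min u0 subr_gt0.
have m1 : Num.min u (1 - u) <= u by rewrite ge_min lexx.
have m2 : Num.min u (1 - u) <= 1 - u by rewrite ge_min lexx orbT.
set m := Num.min _ _ in uu m1 m2.
apply: (@lint_parts _ _ (mellin2 1) m) => //.
- exact: mellin1_cont.
- by apply: continuous_mul; [exact: continuous_const|exact: mellin2_cont].
- by move=> x; exact: mellin1_ge0.
- by move=> x; rewrite mulr_ge0 ?mellin2_ge0.
- move=> x; apply: is_derive_rder; rewrite /mellin2 /mellin1.
  have -> : expR (- (u * x)) = expR x * expR (- ((1 + u) * x)).
    by rewrite -!expRD; congr expR; ring.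
  by apply: is_derive_eq; rewrite /GRing.scale /=; ring.
- move=> x x0; rewrite ger0_norm ?mellin2_ge0 //.
  apply: (@le_trans _ _ (expR x * expR (- ((1 + u) * x)))).
    rewrite ler_wpM2r ?expR_ge0 // mul1r.
    have := @expR_opp_le1 (expR x) (expR_ge0 _); lra.
  rewrite -expRD ler_expR.
  have := ler_wpM2r x0 m1; lra.
- move=> x x0; rewrite ger0_norm ?mellin2_ge0 //.
  apply: (@le_trans _ _ (expR (- x) ^+ 2 * expR (- ((1 + u) * - x)))).
    rewrite ler_wpM2r ?expR_ge0 // mul1r.
    have := @expR_opp_le2 (expR (- x)) (expR_ge0 _); lra.
  rewrite expr2 -!expRD ler_expR.
  have := ler_wpM2r x0 m2; lra.
Qed.

Lemma mellin1_scale (l : R) : 0 < l -> lint (mellin1 l) = ((expR (u * ln l))%:E * lint (mellin1 1))%E.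
Proof.
move=> l0; rewrite -lintZ ?expR_ge0 //; last 2 first.
- exact: mellin1_cont.
- by move=> x; exact: mellin1_ge0.
rewrite (@lint_translate R (mellin1 l) (- ln l)); last 2 first.
- exact: mellin1_cont.
- by move=> x; apply: mellin1_ge0; exact: ltW.
apply: lint_eq => x; rewrite /mellin1 (expR_subln _ l0).
have -> : l * (expR x / l) = 1 * expR x by field; rewrite gt_eqF.
have -> : - (u * (x - ln l)) = u * ln l + - (u * x) by ring.
by rewrite expRD; ring.
Qed.

Lemma mellin2_scale (l : R) : 0 < l -> lint (mellin2 l) = ((expR ((1 + u) * ln l))%:E * lint (mellin2 1))%E.
Proof.
move=> l0; rewrite -lintZ ?expR_ge0 //; last 2 first.
- exact: mellin2_cont.
- by move=> x; exact: mellin2_ge0.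
rewrite (@lint_translate R (mellin2 l) (- ln l)); last 2 first.
- exact: mellin2_cont.
- by move=> x; exact: mellin2_ge0.
apply: lint_eq => x; rewrite /mellin2 (expR_subln _ l0).
have -> : l * (expR x / l) = 1 * expR x by field; rewrite gt_eqF.
have -> : - ((1 + u) * (x - ln l)) = (1 + u) * ln l + - ((1 + u) * x) by ring.
by rewrite expRD; ring.
Qed.

(** The integral of x^(-u) / (1 + x^2) over (0, oo), at x = exp y. A partial fraction of [kfun]
    reduces to it by scaling ([cauchy_scale]). *)
Definition cauchyI := lint (fun y => expR ((1 - u) * y) / (1 + expR (2 * y))).

Lemma cauchy_den (y : R) : 0 < 1 + expR y.
Proof. by rewrite addr_gt0 ?expR_gt0. Qed.

Lemma cauchy_scale (A : R) : 0 < A ->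
  lint (fun y => 2 * expR y / (expR y ^+ 2 + A ^+ 2) * expR (- (u * y))) =
  ((2 * expR (- ((1 + u) * ln A)))%:E * cauchyI)%E.
Proof.
move=> A0; have pA y : 0 < expR y ^+ 2 + A ^+ 2 by rewrite addr_gt0 // exprn_gt0 ?expR_gt0.
rewrite /cauchyI -lintZ; last 3 first.
- by rewrite mulr_ge0 ?expR_ge0.
- by prove_continuous => y; rewrite gt_eqF ?cauchy_den.
- by move=> y; rewrite divr_ge0 ?expR_ge0 ?(ltW (cauchy_den _)).
rewrite (@lint_translate R _ (ln A)); last 2 first.
- rewrite (_ : (fun y => _) = (fun y => 2 * expR y / (expR y * expR y + A ^+ 2) * expR (- (u * y)))); last first.
    by apply/funext => y; rewrite expr2.
  prove_continuous => y; rewrite -expr2 gt_eqF //; exact: pA.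
- by move=> y; rewrite mulr_ge0 ?expR_ge0 // divr_ge0 ?mulr_ge0 ?expR_ge0 ?(ltW (pA _)).
apply: lint_eq => y.
have -> : expR ((1 - u) * y) = expR y * expR (- (u * y)) by rewrite -expRD; congr expR; ring.
have -> : expR (- (u * (y + ln A))) = expR (- (u * y)) * A * expR (- ((1 + u) * ln A)).
  by rewrite -[X in _ * X * _](lnK A0) -!expRD; congr expR; ring.
have -> : expR (2 * y) = expR y ^+ 2 by rewrite expr2 -expRD; congr expR; ring.
rewrite expRD lnK //; field.
apply/andP; split; rewrite gt_eqF // addr_gt0 // exprn_gt0 ?mulr_gt0 ?expR_gt0 //.
Qed.

(** With x = exp y and w = exp v, 1 / (1 + x^2) is the integral of exp(- w (1 + x^2)) dw; Tonelli's
    theorem and a rescaling of x separate the two gamma integrals. The product is left as it is, so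
    no sine enters. *)
Lemma cauchy_gamma : cauchyI = ((2^-1)%:E * (gammaI ((1 - u) / 2) * gammaI ((1 + u) / 2)))%E.
Proof.
pose f (y v : R) := expR ((1 - u) * y + v - expR v - expR (v + 2 * y)).
have mf : measurable_fun [set: R * R] (fun p => f p.1 p.2).
  apply: (measurableT_comp (@measurable_expR R)).
  have m1 : measurable_fun [set: R * R] (fun p => p.1) by exact: measurable_fst.
  have m2 : measurable_fun [set: R * R] (fun p => p.2) by exact: measurable_snd.
  apply: measurable_funB; first apply: measurable_funB; first apply: measurable_funD => //.
  - by apply: measurable_funM => //; exact: measurable_cst.
  - exact: (measurableT_comp (@measurable_expR R)).
  - apply: (measurableT_comp (@measurable_expR R)); apply: measurable_funD => //.
    by apply: measurable_funM => //; exact: measurable_cst.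
have S := lint_swap mf (fun x y => expR_ge0 _).
have cg (q : R) : continuous (fun y : R => expR (q * y - expR y)) by prove_continuous.
have e1 y : lint (f y) = (expR ((1 - u) * y) / (1 + expR (2 * y)))%:E.
  have d := cauchy_den (2 * y).
  have cf : continuous (f y) by rewrite /f; prove_continuous.
  rewrite (lint_translate (- ln (1 + expR (2 * y))) cf (fun x => expR_ge0 _)).
  rewrite (@lint_eq _ _ (fun v => expR ((1 - u) * y) / (1 + expR (2 * y)) * expR (1 * v - expR v))).
    rewrite (lintZ (divr_ge0 (expR_ge0 _) (ltW d)) (cg 1) (fun x => expR_ge0 _)).
    by rewrite -/(gammaI 1) gammaI1 mule1.
  move=> v; rewrite /f.
  rewrite [expR (v - ln _ + 2 * y)]expRD (expR_subln v d).
  have -> : (1 - u) * y + (v - ln (1 + expR (2 * y))) - expR v / (1 + expR (2 * y)) -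
     expR v / (1 + expR (2 * y)) * expR (2 * y) = ((1 - u) * y - ln (1 + expR (2 * y))) + (1 * v - expR v).
    by move: d; set D := expR (2 * y) => d; field; rewrite gt_eqF.
  by rewrite [LHS]expRD (expR_subln _ d).
have e2 v : lint (f ^~ v) = ((2^-1 * expR ((1 + u) / 2 * v - expR v))%:E * gammaI ((1 - u) / 2))%E.
  have cf : continuous (f ^~ v) by rewrite /f; prove_continuous.
  have h0 : 0 < 2^-1 :> R by rewrite invr_gt0.
  rewrite (lint_affine (- (v / 2)) h0 cf (fun x => expR_ge0 _)).
  have c0 : 0 <= 2^-1 * expR ((1 + u) / 2 * v - expR v) by rewrite mulr_ge0 ?expR_ge0 ?invr_ge0.
  rewrite /gammaI -(lintZ c0 (cg _) (fun x => expR_ge0 _)).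
  apply: lint_eq => y; rewrite /f -[RHS]mulrA -[in RHS]expRD; congr (_ * expR _).
  have -> : v + 2 * (2^-1 * y - v / 2) = y by field.
  by field.
have [g1 g10 eg] : exists2 g : R, 0 < g & gammaI ((1 - u) / 2) = g%:E by apply: gammaI_fin01; have := u0; have := u1; lra.
have E1 : cauchyI = (\int[mu]_x lint (f x))%E by apply: eq_integral => y _; rewrite e1.
have E2 : (\int[mu]_y lint (f ^~ y))%E = lint (fun v => g1 / 2 * expR ((1 + u) / 2 * v - expR v)).
  by apply: eq_integral => v _; rewrite e2 eg -EFinM; congr EFin; ring.
have g2 : 0 <= g1 / 2 by exact: (divr_ge0 (ltW g10) (ler0n _ 2)).
rewrite E1 S E2 (lintZ g2 (cg _) (fun x => expR_ge0 _)) -/(gammaI _) eg muleA -EFinM.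
by congr (_%:E * _)%E; rewrite mulrC.
Qed.

(** The right side is the integral of 1 - e^(-tx) over [0, N] and the first two terms are its
    trapezoidal sum; the geometric sum brings in coth(x / 2) / 2 and the integral 1 / x, whose
    difference is [kfun]. *)
Lemma geometric_trapezoid (N : nat) (x : R) : 0 < x -> (0 < N)%N ->
  \sum_(1 <= n < N) (1 - expR (- (n%:R * x))) + (1 - expR (- (N%:R * x))) / 2 +
    (1 - expR (- (N%:R * x))) * kfun x = (N%:R * x - 1 + expR (- (N%:R * x))) / x.
Proof.
move=> x0; rewrite /kfun; case: N => // N _.
have q1 : 1 - expR (- x) != 0 by rewrite gt_eqF // subr_gt0 -expR0 ltr_expR oppr_lt0.
have E n : expR (- (n%:R * x)) = expR (- x) ^+ n by rewrite -expRM_natl mulrN.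
have S : \sum_(1 <= n < N.+1) (1 - expR (- (n%:R * x))) = N%:R - (expR (- x) - expR (- x) ^+ N.+1) / (1 - expR (- x)).
  elim: N => [|N ih]; first by rewrite big_geq // expr1 subrr mul0r subr0.
  rewrite big_nat_recr //= ih E -[in RHS]natr1 !exprS; field.
  exact: q1.
rewrite S !E -natr1; field.
by rewrite q1 gt_eqF.
Qed.

End FixU.
End MellinIntegrals.

(** * Gauss's product and the duplication formula *)

Section GaussProduct.
Variable R : realType.

Definition gauss_seq (p : R) (n : nat) : R := n`!%:R * expR (p * ln n.+1%:R) / gauss_den p n.

Lemma gauss_den_gt0 (p : R) n : 0 < p -> 0 < gauss_den p n.
Proof. by move=> p0; rewrite /gauss_den prodr_gt0 // => k _; rewrite ltr_wpDr. Qed.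

Lemma gauss_seq_cvg (p g : R) : 0 < p <= 1 -> gammaI p = g%:E -> 0 < g -> gauss_seq p n @[n --> \oo] --> g.
Proof.
move=> hp pg g0; have /andP[p0 p1] := hp.
have bd n : g <= gauss_seq p n <= g * (1 + n.+1%:R^-1).
  have /andP[h1 h2] := gauss_bounds n hp pg; have D := gauss_den_gt0 n p0.
  have n1 : 0 < n.+1%:R :> R by rewrite ltr0n.
  have n2 : 0 < p + n.+1%:R :> R by rewrite addr_gt0.
  rewrite /powR !gt_eqF // in h1 h2.
  rewrite /gauss_seq; apply/andP; split.
    by rewrite ler_pdivlMr // mulrC.
  rewrite ler_pdivrMr //.
  have k : n`!%:R * expR (p * ln n.+1%:R) <= (1 + n.+1%:R^-1) * (n.+1`!%:R * expR ((p - 1) * ln (p + n.+1%:R))).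
    rewrite factS natrM.
    have -> : (1 + n.+1%:R^-1) * (n.+1%:R * n`!%:R * expR ((p - 1) * ln (p + n.+1%:R))) =
      n`!%:R * ((n.+1%:R + 1) * expR ((p - 1) * ln (p + n.+1%:R))) by field; rewrite gt_eqF.
    rewrite ler_wpM2l ?ler0n //.
    have l1 : ln n.+1%:R <= ln (p + n.+1%:R) by rewrite ler_ln // lerDr ltW.
    have l2 : ln (p + n.+1%:R) <= ln (n.+1%:R + 1) by rewrite ler_ln ?posrE ?addr_gt0 // addrC lerD2l.
    have l3 : n.+1%:R + 1 = expR (ln (n.+1%:R + 1)) :> R by rewrite lnK // posrE addr_gt0.
    rewrite [X in _ <= X * _]l3 -expRD ler_expR.
    have k1 : (1 - p) * ln (p + n.+1%:R) <= (1 - p) * ln (n.+1%:R + 1) by rewrite ler_wpM2l // subr_ge0.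
    have k2 : p * ln n.+1%:R <= p * ln (n.+1%:R + 1) by rewrite ler_wpM2l ?(ltW p0) //; exact: le_trans l2.
    lra.
  apply: le_trans k _.
  have -> : g * (1 + n.+1%:R^-1) * gauss_den p n = (1 + n.+1%:R^-1) * (gauss_den p n * g) by ring.
  by rewrite ler_wpM2l // addr_ge0 // invr_ge0 ler0n.
apply: (@squeeze_cvgr _ _ _ _ (fun=> g) (fun n => g * (1 + n.+1%:R^-1))).
- by near=> n; exact: bd.
- exact: cvg_cst.
- rewrite -[X in _ --> X]mulr1; apply: cvgMr; rewrite -[X in _ --> X]addr0; apply: cvgD; first exact: cvg_cst.
  exact: cvg_harmonic.
Unshelve. all: by end_near. Qed.

Lemma gauss_den_double (p : R) n : gauss_den p n * gauss_den (p + 2^-1) n * 4 ^+ n.+1 = gauss_den (2 * p) n.*2.+1.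
Proof.
rewrite /gauss_den; elim: n => [|n ih].
  by rewrite !big_nat1 double0 big_nat_recr // big_nat1 /= expr1; field.
have S m (F : nat -> R) : \prod_(0 <= k < m.+1) F k = (\prod_(0 <= k < m) F k) * F m by rewrite big_nat_recr.
rewrite doubleS (S n.+1) (S n.+1 (fun k => p + 2^-1 + k%:R)) (S n.*2.+3) (S n.*2.+2) -ih [in LHS]exprS.
have E2 : n.*2.+2%:R = 2 * n.+1%:R :> R by rewrite -doubleS -mul2n natrM.
have E3 : n.*2.+3%:R = 2 * n.+1%:R + 1 :> R by rewrite -[in LHS]natr1 E2.
rewrite E2 E3; move: (\prod_(0 <= k < n.+1) (p + k%:R)) (\prod_(0 <= k < n.+1) (p + 2^-1 + k%:R)) (4 ^+ n.+1) => A B D.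
by field.
Qed.

(** The factor of the finite duplication formula that is free of p; its limit is 2 Gamma(1/2). *)
Definition dup_const (n : nat) : R := n`!%:R ^+ 2 * 4 ^+ n.+1 * expR (2^-1 * ln n.+1%:R) / n.*2.+1`!%:R.

Lemma gauss_seq_double (p : R) n : 0 < p ->
  gauss_seq p n * gauss_seq (p + 2^-1) n * expR (2 * p * ln 2) = dup_const n * gauss_seq (2 * p) n.*2.+1.
Proof.
move=> p0; have q0 : 0 < p + 2^-1 by rewrite addr_gt0 // invr_gt0.
have d1 := gauss_den_gt0 n p0; have d2 := gauss_den_gt0 n q0.
have f0 : 0 < n.*2.+1`!%:R :> R by rewrite ltr0n fact_gt0.
have e4 : 0 < 4 ^+ n.+1 :> R by rewrite exprn_gt0.
rewrite /gauss_seq /dup_const -gauss_den_double.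
have -> : n.*2.+2%:R = 2 * n.+1%:R :> R by rewrite -doubleS -mul2n natrM.
rewrite lnM ?posrE ?ltr0n //.
have -> : 2 * p * (ln 2 + ln n.+1%:R) = 2 * p * ln 2 + (p * ln n.+1%:R + p * ln n.+1%:R) by ring.
have -> : (p + 2^-1) * ln n.+1%:R = p * ln n.+1%:R + 2^-1 * ln n.+1%:R by ring.
rewrite !expRD; field.
by rewrite !gt_eqF.
Qed.

(** Since [dup_const] is free of p, its limit can be read off at p = 1/2, where the other factors
    tend to Gamma(1/2) and Gamma(1) = 1. *)
Lemma gamma_duplication (p g1 g2 g3 h : R) : 0 < p -> p < 2^-1 ->
  gammaI p = g1%:E -> gammaI (p + 2^-1) = g2%:E -> gammaI (2 * p) = g3%:E -> gammaI 2^-1 = h%:E ->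
  0 < g1 -> 0 < g2 -> 0 < g3 -> 0 < h ->
  g1 * g2 * expR (2 * p * ln 2) = 2 * h * g3.
Proof.
move=> p0 p1 e1 e2 e3 e4 k1 k2 k3 k4.
have sub (q g : R) : gauss_seq q n @[n --> \oo] --> g -> gauss_seq q n.*2.+1 @[n --> \oo] --> g.
  move=> cv; apply: cvg_comp cv; apply/cvgnyPge => A; exists A => // n /= hn.
  by rewrite -mul2n; lia.
have b1 : 0 < p <= 1 by lra.
have b2 : 0 < p + 2^-1 <= 1 by lra.
have b3 : 0 < 2 * p <= 1 by lra.
have b4 : 0 < (2^-1 : R) <= 1 by rewrite invr_gt0 ltr0n /= invf_le1 ?ler1n ?ltr0n.
have c1 := gauss_seq_cvg b1 e1 k1; have c2 := gauss_seq_cvg b2 e2 k2.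
have c3 := sub _ _ (gauss_seq_cvg b3 e3 k3); have c4 := gauss_seq_cvg b4 e4 k4.
have b5 : 0 < (1 : R) <= 1 by rewrite ltr01 lexx.
have c5 := gauss_seq_cvg b5 (gammaI1 R) ltr01; have c6 := sub _ _ c5.
have W : dup_const n @[n --> \oo] --> 2 * h.
  have -> : dup_const = fun n => gauss_seq 2^-1 n * gauss_seq 1 n * 2 / gauss_seq 1 n.*2.+1.
    apply/funext => n; have := @gauss_seq_double 2^-1 n; rewrite invr_gt0 => /(_ (ltr0n _ 2)).
    have -> : 2^-1 + 2^-1 = 1 :> R by field.
    have -> : 2 * 2^-1 = 1 :> R by field.
    rewrite mul1r lnK ?posrE // => ->; rewrite mulfK // gt_eqF // /gauss_seq divr_gt0 ?gauss_den_gt0 //.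
    by rewrite mulr_gt0 ?expR_gt0 // ltr0n fact_gt0.
  have -> : 2 * h = h * 1 * 2 / 1 by field.
  apply: cvgM; last by apply: cvgV => //; rewrite oner_eq0.
  by apply: cvgM; [exact: cvgM|exact: cvg_cst].
have L : gauss_seq p n * gauss_seq (p + 2^-1) n * expR (2 * p * ln 2) @[n --> \oo] --> g1 * g2 * expR (2 * p * ln 2).
  by apply: cvgM; [exact: cvgM|exact: cvg_cst].
have L2 : gauss_seq p n * gauss_seq (p + 2^-1) n * expR (2 * p * ln 2) @[n --> \oo] --> 2 * h * g3.
  have -> : (fun n => gauss_seq p n * gauss_seq (p + 2^-1) n * expR (2 * p * ln 2)) =
     (fun n => dup_const n * gauss_seq (2 * p) n.*2.+1) by apply/funext => n; exact: gauss_seq_double.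
  exact: cvgM.
exact: (cvg_unique _ L L2).
Qed.

(** Partial products of Gamma((1 + u)/2) / Gamma(1 - u/2); the exponent u - 1/2 is the difference of
    the two arguments. *)
Definition ratio_prod (u : R) (m : nat) : R :=
  expR ((u - 2^-1) * ln m%:R) * \prod_(0 <= k < m) ((k%:R + 1 - u / 2) / (k%:R + (1 + u) / 2)).

Lemma ratio_prod_gauss (u : R) m : 0 < u < 1 ->
  ratio_prod u m.+1 = gauss_seq ((1 + u) / 2) m / gauss_seq (1 - u / 2) m.
Proof.
move=> hu; have p1 : 0 < (1 + u) / 2 by lra.
have p2 : 0 < 1 - u / 2 by lra.
have f0 : 0 < m`!%:R :> R by rewrite ltr0n fact_gt0.
have d1 := gauss_den_gt0 m p1; have d2 := gauss_den_gt0 m p2.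
rewrite /ratio_prod prodf_div.
have -> : \prod_(0 <= k < m.+1) (k%:R + 1 - u / 2) = gauss_den (1 - u / 2) m.
  by apply: eq_bigr => k _; ring.
have -> : \prod_(0 <= k < m.+1) (k%:R + (1 + u) / 2) = gauss_den ((1 + u) / 2) m.
  by apply: eq_bigr => k _; ring.
rewrite /gauss_seq; set l := ln _.
have -> : (u - 2^-1) * l = (1 + u) / 2 * l + - ((1 - u / 2) * l) by field.
rewrite expRD expRN; field.
by rewrite !gt_eqF ?expR_gt0.
Qed.

Lemma ratio_prod_cvg (u g1 g2 : R) : 0 < u < 1 -> gammaI ((1 + u) / 2) = g1%:E -> gammaI (1 - u / 2) = g2%:E ->
  0 < g1 -> 0 < g2 -> ratio_prod u m @[m --> \oo] --> g1 / g2.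
Proof.
move=> hu e1 e2 k1 k2; rewrite -cvg_shiftS.
have -> : (fun n => ratio_prod u n.+1) = (fun m => gauss_seq ((1 + u) / 2) m / gauss_seq (1 - u / 2) m).
  by apply/funext => m; exact: ratio_prod_gauss.
apply: cvgM; first by apply: gauss_seq_cvg => //; lra.
apply: cvgV; first by rewrite gt_eqF.
by apply: gauss_seq_cvg => //; lra.
Qed.
End GaussProduct.

(** * The functional equation at s = - u with 0 < u < 1 *)

Section RealFunctionalEquation.
Variable R : realType.

(* Trapezoidal error of the integral of x^u over [0, N]; it tends to - zeta(- u). *)
Definition trap_sum (u : R) (N : nat) : R :=
  expR ((1 + u) * ln N%:R) / (1 + u) - \sum_(1 <= n < N) expR (u * ln n%:R) - expR (u * ln N%:R) / 2.

Lemma kfun_expR_cont : continuous (fun y : R => kfun (expR y)).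
Proof.
rewrite /kfun; prove_continuous => y; rewrite gt_eqF ?expR_gt0 // subr_gt0 -expR0 ltr_expR oppr_lt0 //.
exact: expR_gt0.
Qed.

Definition kernel_trunc (u : R) (N : nat) (y : R) : R :=
  (1 - expR (- (N%:R * expR y))) * kfun (expR y) * expR (- (u * y)).

Lemma kernel_trunc_cont u N : continuous (kernel_trunc u N).
Proof.
rewrite /kernel_trunc; apply: continuous_mul; last by prove_continuous.
by apply: continuous_mul; [prove_continuous|exact: kfun_expR_cont].
Qed.

Lemma kernel_trunc_ge0 u N y : 0 <= kernel_trunc u N y.
Proof.
have h : 0 <= 1 - expR (- (N%:R * expR y)) by rewrite subr_ge0 expR_opp_le1 // mulr_ge0 ?expR_ge0.
exact: (mulr_ge0 (mulr_ge0 h (kfun_ge0 (expR_gt0 y))) (expR_ge0 _)).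
Qed.

(* Since n^u is proportional to the integral of (1 - e^(-nx)) x^(-u-1), the trapezoidal sum of
   n^u is an integral of a geometric sum (geometric_trapezoid). *)
Lemma kernel_trunc_lint (u q : R) N : 0 < u -> u < 1 -> (0 < N)%N -> lint (mellin1 u 1) = q%:E ->
  lint (kernel_trunc u N) = (q * trap_sum u N)%:E.
Proof.
move=> u0 u1 N0 hq; have up : 0 < 1 + u by lra.
have hq2 : lint (mellin2 u 1) = (q / (1 + u))%:E.
  have := mellin12 u0 u1; rewrite hq; case: (lint (mellin2 u 1)) => [x| |].
  - by rewrite -EFinM => -[->]; congr EFin; field; rewrite gt_eqF.
  - by rewrite gt0_muley // lte_fin.
  - by rewrite gt0_muleNy // lte_fin.
have c1 n := @mellin1_cont R u n; have c2 := @mellin2_cont R u N%:R.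
have N1 : 0 < N%:R :> R by rewrite ltr0n.
have p1 n y : 0 <= mellin1 u n%:R y by apply: mellin1_ge0; rewrite ler0n.
have E1 n : (0 < n)%N -> lint (mellin1 u n%:R) = (expR (u * ln n%:R) * q)%:E.
  by move=> n0; rewrite mellin1_scale ?ltr0n // hq.
have cs : continuous (fun y => \sum_(1 <= n < N) mellin1 u n%:R y).
  elim: (index_iota 1 N) => [|k s ih].
    rewrite (_ : (fun y => _) = fun=> 0); first exact: continuous_const.
    by apply/funext => y; rewrite big_nil.
  rewrite (_ : (fun y => _) = fun y => mellin1 u k%:R y + \sum_(n <- s) mellin1 u n%:R y).
    exact: continuous_add.
  by apply/funext => y; rewrite big_cons.
have ps y : 0 <= \sum_(1 <= n < N) mellin1 u n%:R y by apply: sumr_ge0 => k _.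
have h2 : 0 <= 2^-1 :> R by rewrite invr_ge0.
have ch : continuous (fun y => 2^-1 * mellin1 u N%:R y) by apply: continuous_mul => //; exact: continuous_const.
have ph y : 0 <= 2^-1 * mellin1 u N%:R y by rewrite mulr_ge0.
have cA : continuous (fun y => \sum_(1 <= n < N) mellin1 u n%:R y + 2^-1 * mellin1 u N%:R y) by exact: continuous_add.
have ck := @kernel_trunc_cont u N.
have : lint (mellin2 u N%:R) = lint (fun y => (\sum_(1 <= n < N) mellin1 u n%:R y + 2^-1 * mellin1 u N%:R y) + kernel_trunc u N y).
  apply: lint_eq => y; rewrite /mellin2 /mellin1 /kernel_trunc -mulr_suml.
  have := geometric_trapezoid (expR_gt0 y) N0; set S := \sum_(_ <= _ < _) _.
  have -> : expR (- ((1 + u) * y)) = expR (- (u * y)) / expR y by rewrite -expRN -expRD; congr expR; ring.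
  move=> E; have -> (a b c : R) : a * (b / c) = (a / c) * b by ring.
  by rewrite -E; ring.
rewrite lintD // ?lintD //; last by move=> y; exact: kernel_trunc_ge0.
  2: by move=> y; rewrite addr_ge0.
rewrite lintZ // mellin2_scale // hq2 E1 //.
have -> : lint (fun y => \sum_(1 <= n < N) mellin1 u n%:R y) = (\sum_(1 <= n < N) expR (u * ln n%:R) * q)%:E.
  rewrite lint_sum // -sumEFin big_nat [RHS]big_nat; apply: eq_bigr => k /andP[k0 _]; exact: E1.
rewrite -mulr_suml /trap_sum; case: (lint (kernel_trunc u N)) => [x| |]; rewrite -?EFinM -?EFinD //.
move=> -[E]; congr EFin.
have -> : x = expR ((1 + u) * ln N%:R) * (q / (1 + u)) -
   ((\sum_(1 <= n < N) expR (u * ln n%:R)) * q + 2^-1 * (expR (u * ln N%:R) * q)) by rewrite E; ring.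
by field; rewrite gt_eqF.
Qed.

Lemma kernel_trunc_limit (u q : R) : 0 < u -> u < 1 -> lint (mellin1 u 1) = q%:E ->
  (q * trap_sum u N)%:E @[N --> \oo] --> lint (fun y => kfun (expR y) * expR (- (u * y))).
Proof.
move=> u0 u1 hq.
have H : lint (kernel_trunc u N) @[N --> \oo] --> lint (fun y => kfun (expR y) * expR (- (u * y))).
  apply: lint_monotone.
  - by move=> n; exact: kernel_trunc_cont.
  - by move=> n x; exact: kernel_trunc_ge0.
  - move=> x m n mn; rewrite /kernel_trunc !ler_wpM2r ?expR_ge0 ?kfun_ge0 ?expR_gt0 //.
    by rewrite lerD2l lerN2 ler_expR lerN2 ler_wpM2r ?expR_ge0 // ler_nat.
  - move=> x; apply: cvgM; last exact: cvg_cst.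
    rewrite -[X in _ --> X]mul1r; apply: cvgM; last exact: cvg_cst.
    rewrite -[X in _ --> X]subr0; apply: cvgB; first exact: cvg_cst.
    rewrite (_ : (fun n => _) = (fun n => expR (- (expR x * n%:R)))); first by apply: cvg_expR_nat_opp; exact: expR_gt0.
    by apply/funext => n; rewrite mulrC.
apply: cvg_trans H; apply: near_eq_cvg; near=> N.
by rewrite (@kernel_trunc_lint u q) //; near: N; exists 1%N.
Unshelve. all: by end_near. Qed.

(** The second evaluation of the integral of [kernel_trunc_limit], by partial fractions. Comparing
    the two gives the functional equation; both passages to the limit are monotone. *)
Lemma kernel_series_limit (u c : R) : 0 < u -> u < 1 -> cauchyI u = c%:E ->
  (2 * c * \sum_(0 <= k < M) expR (- ((1 + u) * ln (2 * pi * k.+1%:R))))%:E @[M --> \oo] -->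
    lint (fun y => kfun (expR y) * expR (- (u * y))).
Proof.
move=> u0 u1 hc.
have A0 k : 0 < 2 * pi * k.+1%:R :> R by rewrite !mulr_gt0 // pi_gt0.
pose t (k : nat) (y : R) := 2 * expR y / (expR y ^+ 2 + (2 * pi * k.+1%:R) ^+ 2) * expR (- (u * y)).
have ct k : continuous (t k).
  rewrite (_ : t k = (fun y => 2 * expR y / (expR y * expR y + (2 * pi * k.+1%:R) ^+ 2) * expR (- (u * y)))).
    have D (y : R) : expR y * expR y + (2 * pi * k.+1%:R) ^+ 2 != 0.
      by rewrite gt_eqF // addr_gt0 //; [rewrite mulr_gt0 ?expR_gt0|rewrite exprn_gt0].
    prove_continuous; exact: D.
  by apply/funext => y; rewrite /t [expR y ^+ 2]expr2.
have t0 k y : 0 <= t k y.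
  by rewrite /t !(mulr_ge0, expR_ge0) // invr_ge0 addr_ge0 // sqr_ge0.
have H : lint (fun y => \sum_(0 <= k < M) t k y) @[M --> \oo] --> lint (fun y => kfun (expR y) * expR (- (u * y))).
  apply: lint_monotone.
  - move=> M; elim: (index_iota 0 M) => [|k s ih].
      rewrite (_ : (fun y => _) = fun=> 0); first exact: continuous_const.
      by apply/funext => y; rewrite big_nil.
    rewrite (_ : (fun y => _) = fun y => t k y + \sum_(n <- s) t n y); first exact: continuous_add.
    by apply/funext => y; rewrite big_cons.
  - by move=> M x; apply: sumr_ge0 => k _.
  - move=> x m n mn; rewrite [X in _ <= X](big_cat_nat (n := m)) //= lerDl; apply: sumr_ge0 => k _; exact: t0.
  - move=> x; rewrite (_ : (fun M => _) = (fun M => (\sum_(0 <= k < M) 2 * expR x / (expR x ^+ 2 + 4 * pi ^+ 2 * k.+1%:R ^+ 2)) * expR (- (u * x)))).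
      by apply: cvgM; [exact: kfun_series (expR_gt0 x)|exact: cvg_cst].
    apply/funext => M; rewrite mulr_suml; apply: eq_bigr => k _.
    by rewrite /t; congr (_ / (_ + _) * _); ring.
apply: cvg_trans H; apply: near_eq_cvg; near=> M.
rewrite lint_sum // mulr_sumr -sumEFin; apply: eq_bigr => k _.
rewrite /t (cauchy_scale u (A0 k)) hc -EFinM; congr EFin; ring.
Unshelve. all: by end_near. Qed.

(** The duplication formula trades Gamma((1 - u)/2) / Gamma(1 - u) for a power of 2 over Gamma(1 -
    u/2), so that only the ratio of [ratio_prod] and a power of pi survive. *)
Lemma functional_equation_const (u z g4 h g1 g2 g3 : R) : 0 < h -> 0 < g1 -> 0 < g2 -> 0 < g3 ->
  g1 * g2 * expR ((1 - u) * ln 2) = 2 * h * g3 ->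
  h / pi / 2 * u * expR (- (u * ln pi)) * (g4 / g2) * z =
  u / g3 * (2 * (2^-1 * (g1 * g4)) * (expR (- ((1 + u) * ln (2 * pi))) * z)).
Proof.
move=> h0 k1 k2 k3 D; have p0 := @pi_gt0 R.
rewrite lnM ?posrE //.
have -> : g3 = g1 * g2 * expR ((1 - u) * ln 2) / (2 * h) by rewrite D; field; rewrite gt_eqF.
have -> : - ((1 + u) * (ln 2 + ln pi)) = (1 - u) * ln 2 + - (ln 2 + ln 2) + - (u * ln pi) + - ln pi by ring.
have e2 : expR (- (ln 2 + ln 2)) = 4^-1 :> R by rewrite expRN expRD !lnK ?posrE // -natrM.
have e3 : expR (- ln pi) = pi^-1 :> R by rewrite expRN lnK ?posrE.
rewrite 3!expRD e2 e3; move: (pi : R) p0 => P p0; have := expR_gt0 ((1 - u) * ln 2).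
move: (expR ((1 - u) * ln 2)) (expR (- (u * ln P))) => A B A0; field.
by rewrite !(gt_eqF p0, gt_eqF k1, gt_eqF k2, gt_eqF h0, gt_eqF A0).
Qed.

(** The witness [kap] is Gamma(1/2) / (2 pi); [rho] is the gamma quotient and [z] stands for zeta(1
    + u). *)
Lemma real_functional_equation : exists2 kap : R, 0 < kap & forall u z : R, 0 < u -> u < 1 ->
  \sum_(0 <= k < M) expR (- ((1 + u) * ln k.+1%:R)) @[M --> \oo] --> z ->
  exists2 rho : R, ratio_prod u m @[m --> \oo] --> rho &
    trap_sum u N @[N --> \oo] --> kap * u * expR (- (u * ln pi)) * rho * z.
Proof.
have h2 : 0 < (2^-1 : R) <= 1 by rewrite invr_gt0 ltr0n /= invf_le1 ?ler1n ?ltr0n.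
have [h h0 eh] := gammaI_fin01 h2.
have pi0 := @pi_gt0 R.
exists (h / pi / 2); first by rewrite !divr_gt0.
move=> u z u0 u1 hz; have fin p : 0 < p <= 1 -> exists2 g : R, 0 < g & gammaI p = g%:E := @gammaI_fin01 R p.
have b1 : 0 < (1 - u) / 2 <= 1 by lra.
have b2 : 0 < (1 - u / 2) <= 1 by lra.
have b3 : 0 < (1 - u) <= 1 by lra.
have b4 : 0 < (1 + u) / 2 <= 1 by lra.
have [g1 g1p e1] := fin _ b1; have [g2 g2p e2] := fin _ b2.
have [g3 g3p e3] := fin _ b3; have [g4 g4p e4] := fin _ b4.
have hu : 0 < u < 1 by rewrite u0.
exists (g4 / g2); first exact: (ratio_prod_cvg hu e4 e2 g4p g2p).
have hq : lint (mellin1 u 1) = (g3 / u)%:E.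
  have := mellin1_gamma u0 u1; rewrite e3; case: (lint (mellin1 u 1)) => [x| |].
  - by rewrite -EFinM => -[<-]; congr EFin; field; rewrite gt_eqF.
  - by rewrite gt0_muley // lte_fin.
  - by rewrite gt0_muleNy // lte_fin.
have hc : cauchyI u = (2^-1 * (g1 * g4))%:E by rewrite (cauchy_gamma u0 u1) e1 e4 -!EFinM.
have D : g1 * g2 * expR ((1 - u) * ln 2) = 2 * h * g3.
  have hh : (1 - u) = 2 * ((1 - u) / 2) by field.
  have p1 : 0 < (1 - u) / 2 by lra.
  have p2 : (1 - u) / 2 < 2^-1 by lra.
  rewrite {1}hh; apply: (gamma_duplication p1 p2 e1 _ _ eh) => //.
    by rewrite -e2; congr gammaI; field.
  by rewrite -hh.
have L1 := kernel_trunc_limit u0 u1 hq.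
have L2 := kernel_series_limit u0 u1 hc.
set T := 2 * (2^-1 * (g1 * g4)) * (expR (- ((1 + u) * ln (2 * pi))) * z).
have L3 : (2 * (2^-1 * (g1 * g4)) * \sum_(0 <= k < M) expR (- ((1 + u) * ln (2 * pi * k.+1%:R))))%:E @[M --> \oo] --> T%:E.
  apply: cvg_EFin; first by near=> n.
  apply: cvgM; first exact: cvg_cst.
  rewrite (_ : (fun M => _) = (fun M => expR (- ((1 + u) * ln (2 * pi))) * \sum_(0 <= k < M) expR (- ((1 + u) * ln k.+1%:R)))).
    by apply: cvgM; [exact: cvg_cst|exact: hz].
  apply/funext => M; rewrite mulr_sumr; apply: eq_bigr => k _.
  by rewrite -expRD lnM ?posrE ?ltr0n ?mulr_gt0 //; congr expR; ring.
have L4 : lint (fun y => kfun (expR y) * expR (- (u * y))) = T%:E by exact: (cvg_unique _ L2 L3).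
rewrite L4 in L1.
have L5 : (g3 / u) * trap_sum u N @[N --> \oo] --> T by case/fine_cvgP: L1 => _; exact.
rewrite (functional_equation_const z g4 h0 g1p g2p g3p D).
rewrite (_ : (fun N => _) = (fun N => u / g3 * (g3 / u * trap_sum u N))).
  by apply: cvgM; [exact: cvg_cst|exact: L5].
by apply/funext => N; field; rewrite !gt_eqF.
Unshelve. all: by end_near. Qed.
End RealFunctionalEquation.

(** * Dirichlet series and their continuation *)

Section HoloClosure.
Variable R : realType.
Local Notation Cx := (C R).

Lemma holo_eq (f g : Cx -> Cx) z : (forall w, f w = g w) -> holo f z -> holo g z.
Proof. by move=> fg [l Hl]; exists l; exact: cder_eq fg Hl. Qed.
Lemma holo_local (f g : Cx -> Cx) z (r : R) : 0 < r -> (forall w, cmod (w - z) < r -> f w = g w) -> holo f z -> holo g z.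
Proof. by move=> r0 fg [l Hl]; exists l; exact: cder_local r0 fg Hl. Qed.
Lemma holo_cst (c z : Cx) : holo (fun=> c) z. Proof. by exists 0; exact: cder_cst. Qed.
Lemma holo_id (z : Cx) : holo (fun w => w) z. Proof. by exists 1; exact: cder_id. Qed.
Lemma holoD (f g : Cx -> Cx) z : holo f z -> holo g z -> holo (fun w => f w + g w) z.
Proof. by move=> [l Hl] [m Hm]; exists (l + m); exact: cderD. Qed.
Lemma holoN (f : Cx -> Cx) z : holo f z -> holo (fun w => - f w) z.
Proof. by move=> [l Hl]; exists (- l); exact: cderN. Qed.
Lemma holoB (f g : Cx -> Cx) z : holo f z -> holo g z -> holo (fun w => f w - g w) z.
Proof. by move=> [l Hl] [m Hm]; exists (l - m); exact: cderB. Qed.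
Lemma holoM (f g : Cx -> Cx) z : holo f z -> holo g z -> holo (fun w => f w * g w) z.
Proof. by move=> [l Hl] [m Hm]; exists (l * g z + f z * m); exact: cderM. Qed.
Lemma holo_comp (f g : Cx -> Cx) z : holo f z -> holo g (f z) -> holo (fun w => g (f w)) z.
Proof. by move=> [l Hl] [m Hm]; exists (m * l); exact: cder_comp. Qed.
Lemma holoV (f : Cx -> Cx) z : f z != 0 -> holo f z -> holo (fun w => (f w)^-1) z.
Proof. by move=> f0 hf; apply: (@holo_comp f (fun w => w^-1)) => //; eexists; exact: cder_inv. Qed.
Lemma holo_cexp (f : Cx -> Cx) z : holo f z -> holo (fun w => cexp (f w)) z.
Proof. by move=> hf; apply: (@holo_comp f (@cexp R)) => //; eexists; exact: cder_cexp. Qed.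
Lemma holo_natpow n (f : Cx -> Cx) z : holo f z -> holo (fun w => natpow n (f w)) z.
Proof. by move=> hf; apply: holo_cexp; apply: holoM => //; exact: holo_cst. Qed.
Lemma holo_sum (I : Type) (s : seq I) (f : I -> Cx -> Cx) z : (forall i, holo (f i) z) ->
  holo (fun w => \sum_(i <- s) f i w) z.
Proof.
move=> H; elim: s => [|i s ih].
  by apply: holo_eq (holo_cst 0 z) => w; rewrite big_nil.
by apply: holo_eq (holoD (H i) ih) => w; rewrite big_cons.
Qed.
Lemma holo_prod (I : Type) (s : seq I) (f : I -> Cx -> Cx) z : (forall i, holo (f i) z) ->
  holo (fun w => \prod_(i <- s) f i w) z.
Proof.
move=> H; elim: s => [|i s ih].
  by apply: holo_eq (holo_cst 1 z) => w; rewrite big_nil.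
by apply: holo_eq (holoM (H i) ih) => w; rewrite big_cons.
Qed.
End HoloClosure.

Ltac prove_holo := repeat match goal with |- holo ?f _ => lazymatch f with
  | (fun v => v) => exact: holo_id
  | (fun v => @?g v + @?h v) => first [exact: holo_cst | apply: (@holoD _ g h)]
  | (fun v => - (@?g v)) => first [exact: holo_cst | apply: (@holoN _ g)]
  | (fun v => @?g v * @?h v) => first [exact: holo_cst | apply: (@holoM _ g h)]
  | (fun v => natpow ?n (@?g v)) => first [exact: holo_cst | apply: (@holo_natpow _ n g)]
  | (fun v => (@?g v)^-1) => first [exact: holo_cst | apply: (@holoV _ g)]
  | _ => exact: holo_cst
  end end.

(** * Limits of complex sequences *)

Section Convergence.
Variable R : realType.
Local Notation Cx := (C R).

Lemma ccvg_cst (c : Cx) : ccvg (fun=> c) c.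
Proof. by move=> e e0; exists 0%N => n _; rewrite subrr cmod0 ltW. Qed.

Lemma ccvg_eventually (u v : nat -> Cx) l N0 : (forall n, (N0 <= n)%N -> u n = v n) -> ccvg u l -> ccvg v l.
Proof.
move=> uv H e e0; have [N hN] := H e e0; exists (maxn N N0) => n; rewrite geq_max => /andP[h1 h2].
by rewrite -uv // hN.
Qed.

Lemma ccvgD (u v : nat -> Cx) l m : ccvg u l -> ccvg v m -> ccvg (fun n => u n + v n) (l + m).
Proof.
move=> H1 H2 e e0; have e2 : 0 < e / 2 by rewrite divr_gt0.
have [N1 h1] := H1 _ e2; have [N2 h2] := H2 _ e2.
exists (maxn N1 N2) => n; rewrite geq_max => /andP[k1 k2].
have -> : u n + v n - (l + m) = (u n - l) + (v n - m) by ring.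
have := cmodD (u n - l) (v n - m); have := h1 n k1; have := h2 n k2; lra.
Qed.

Lemma ccvgM (u v : nat -> Cx) l m : ccvg u l -> ccvg v m -> ccvg (fun n => u n * v n) (l * m).
Proof.
move=> H1 H2 e e0; set K := cmod l + cmod m + 2.
have K0 : 0 < K by rewrite /K; have := cmod_ge0 l; have := cmod_ge0 m; lra.
have [|N1 h1] := H1 (Num.min 1 (e / K)); first by rewrite lt_min ltr01 divr_gt0.
have [|N2 h2] := H2 (Num.min 1 (e / K)); first by rewrite lt_min ltr01 divr_gt0.
exists (maxn N1 N2) => n; rewrite geq_max => /andP[k1 k2].
have := h1 n k1; rewrite le_min => /andP[_ a1].
have := h2 n k2; rewrite le_min => /andP[b1 b2].
have -> : u n * v n - l * m = (u n - l) * v n + l * (v n - m) by ring.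
apply: le_trans (cmodD _ _) _; rewrite !cmodM.
have vb : cmod (v n) <= cmod m + 1 by have := cmod_lowB (v n) m; lra.
have c1 : cmod (u n - l) * cmod (v n) <= e / K * (cmod m + 1) by rewrite ler_pM ?cmod_ge0.
have c2 : cmod l * cmod (v n - m) <= cmod l * (e / K) by rewrite ler_wpM2l ?cmod_ge0.
have eK : e = e / K * K by rewrite divfK // gt_eqF.
have q0 : 0 < e / K by rewrite divr_gt0.
apply: le_trans (lerD c1 c2) _; rewrite [X in _ <= X]eK.
have -> : e / K * K = e / K * (cmod m + 1) + cmod l * (e / K) + e / K by rewrite {2}/K; ring.
lra.
Qed.

Lemma ccvg_scale (c : Cx) (u : nat -> Cx) l : ccvg u l -> ccvg (fun n => c * u n) (c * l).
Proof. by move=> H; apply: ccvgM => //; exact: ccvg_cst. Qed.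

Lemma ccvg_subseq (u : nat -> Cx) (phi : nat -> nat) l : (forall M, exists N, forall n, (N <= n)%N -> (M <= phi n)%N) ->
  ccvg u l -> ccvg (fun n => u (phi n)) l.
Proof.
move=> hphi H e e0; have [M hM] := H e e0; have [N hN] := hphi M.
by exists N => n /hN; exact: hM.
Qed.

Lemma ccvg_ge (u : nat -> Cx) l (M : R) N0 : ccvg u l -> (forall n, (N0 <= n)%N -> M <= cmod (u n)) -> M <= cmod l.
Proof.
move=> H hM; apply/ler_addgt0Pr => e e0; have [N hN] := H e e0.
have := hN (maxn N N0) (leq_maxl _ _); have := hM (maxn N N0) (leq_maxr _ _).
have := cmod_lowB (u (maxn N N0)) l; lra.
Qed.

Lemma ccvg_le_eventually (u : nat -> Cx) l (M : R) N0 : ccvg u l -> (forall n, (N0 <= n)%N -> cmod (u n) <= M) -> cmod l <= M.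
Proof.
move=> H hM; apply: (@ccvg_le R (fun n => u (n + N0)%N)) => [|n]; last by apply: hM; rewrite leq_addl.
by apply: ccvg_subseq H => K; exists K => n h; rewrite (leq_trans h) // leq_addr.
Qed.

(** Increments dominated by the decrements of a null sequence give a limit together with a tail
    bound. The Dirichlet series, its trapezoidal continuation and the gamma product all converge in
    this way. *)
Lemma telescoping_cvg (u : nat -> Cx) (b : nat -> R) (K : R) n0 : 0 <= K -> (forall n, 0 <= b n) ->
  (forall e : R, 0 < e -> exists N, forall n, (N <= n)%N -> b n <= e) ->
  (forall n, (n0 <= n)%N -> cmod (u n.+1 - u n) <= K * (b n - b n.+1)) ->
  exists2 l, ccvg u l & forall n, (n0 <= n)%N -> cmod (l - u n) <= K * b n.
Proof.
move=> K0 b0 bc H.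
have S n k : (n0 <= n)%N -> cmod (u (n + k)%N - u n) <= K * (b n - b (n + k)%N).
  move=> hn; elim: k => [|k ih]; first by rewrite addn0 !subrr cmod0 mulr0.
  apply: le_trans (cmod_triB _ _ (u (n + k)%N)) _; rewrite addnS.
  have := H (n + k)%N (leq_trans hn (leq_addr _ _)).
  have -> : K * (b n - b (n + k).+1) = K * (b n - b (n + k)%N) + K * (b (n + k)%N - b (n + k).+1) by ring.
  lra.
have S' n m : (n0 <= n)%N -> (n <= m)%N -> cmod (u m - u n) <= K * b n.
  move=> hn nm; rewrite -(subnKC nm); apply: le_trans (S _ _ hn) _.
  by rewrite ler_wpM2l // gerBl.
have [l Hl] : exists l, ccvg u l.
  apply: complex_cauchy => e e0; have K1 : 0 < 1 + K by lra.
  have [|N hN] := bc (e / (1 + K)); first by rewrite divr_gt0.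
  exists (maxn N n0) => n hn; apply: le_trans (S' _ _ (leq_maxr _ _) hn) _.
  apply: (@le_trans _ _ ((1 + K) * (e / (1 + K)))); last by rewrite mulrC divfK // gt_eqF.
  by rewrite ler_pM // ?hN ?leq_maxl // lerDr.
exists l => // n hn; apply/ler_addgt0Pr => e e0; have [N hN] := Hl e e0.
have := hN (maxn N n) (leq_maxl _ _); have := S' n (maxn N n) hn (leq_maxr _ _).
have := cmod_triB l (u n) (u (maxn N n)); rewrite [cmod (l - u (maxn N n))]cmodBC; lra.
Qed.

(** A total limit operator, with value 0 at divergent sequences. *)
Definition clim (u : nat -> Cx) : Cx := xget 0 [set l | ccvg u l].

Lemma climP u l : ccvg u l -> ccvg u (clim u).
Proof. by move=> h; apply: (@xgetPex _ 0 [set l | ccvg u l]); exists l. Qed.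

Lemma clim_eq u l : ccvg u l -> clim u = l.
Proof. by move=> h; apply: (ccvg_uniq (climP h) h). Qed.
End Convergence.

(** * Telescoping bounds for powers *)

Section PowerBounds.
Variable R : realType.

(** The integral of x^(-1-d) over [n, oo): its decrements dominate the terms (n + 1)^(-1-d). *)
Definition pbound (d : R) (n : nat) : R := expR (- (d * ln n%:R)) / d.

Lemma pbound_ge0 (d : R) n : 0 < d -> 0 <= pbound d n.
Proof. by move=> d0; rewrite divr_ge0 ?expR_ge0 // ltW. Qed.

Lemma ln_succ_ge n : (0 < n)%N -> n.+1%:R^-1 <= ln n.+1%:R - ln n%:R :> R.
Proof.
move=> n0; have n1 : 0 < n%:R :> R by rewrite ltr0n.
have n2 : 0 < n.+1%:R :> R by rewrite ltr0n.
have h : -1 < - n.+1%:R^-1 :> R by rewrite ltrN2 invf_lt1 // ltr1n.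
have := le_ln1Dx h; have -> : 1 + - n.+1%:R^-1 = n%:R / n.+1%:R :> R.
  by rewrite -natr1; field; rewrite natr1 gt_eqF.
rewrite ln_div ?posrE //; move: (ln n%:R) (ln n.+1%:R) (n.+1%:R^-1) => A B D; lra.
Qed.

Lemma pbound_step (d : R) n : 0 < d -> (0 < n)%N -> expR (- ((1 + d) * ln n.+1%:R)) <= pbound d n - pbound d n.+1.
Proof.
move=> d0 n0; have n2 : 0 < n.+1%:R :> R by rewrite ltr0n.
have hL := ln_succ_ge n0; set L := ln n.+1%:R - ln n%:R in hL.
rewrite /pbound -mulrBl ler_pdivlMr //.
have -> : expR (- (d * ln n%:R)) = expR (- (d * ln n.+1%:R)) * expR (d * L) by rewrite -expRD /L; congr expR; ring.
have -> : expR (- ((1 + d) * ln n.+1%:R)) = expR (- (d * ln n.+1%:R)) / n.+1%:R.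
  have -> : - ((1 + d) * ln n.+1%:R) = - (d * ln n.+1%:R) + - ln n.+1%:R :> R by ring.
  by rewrite (expR_subln _ n2).
set A := expR _; have A0 : 0 <= A by exact: expR_ge0.
have h1 := expR_ge1Dx (d * L).
have h2 : d * n.+1%:R^-1 <= d * L by rewrite ler_wpM2l // ltW.
have h3 : d * n.+1%:R^-1 <= expR (d * L) - 1.
  by rewrite lerBrDl; apply: le_trans h1; rewrite lerD2l.
have := ler_wpM2l A0 h3; by rewrite mulrBr mulr1 -mulrA [n.+1%:R^-1 * d]mulrC.
Qed.

Lemma pbound_small (d : R) : 0 < d -> forall e : R, 0 < e -> exists N, forall n, (N <= n)%N -> pbound d n <= e.
Proof.
move=> d0 e e0; have ed : 0 < e * d by rewrite mulr_gt0.
exists (Num.truncn (expR (- ln (e * d) / d))).+1 => n hn.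
have n0 : 0 < n%:R :> R by rewrite ltr0n; exact: leq_trans hn.
have h : expR (- ln (e * d) / d) <= n%:R.
  by apply/ltW/(lt_le_trans (truncnS_gt _)); rewrite ler_nat.
have h2 : - ln (e * d) / d <= ln n%:R by rewrite -ler_expR lnK.
rewrite /pbound ler_pdivrMr // -[leRHS]lnK ?posrE // ler_expR.
move: h2; rewrite ler_pdivrMr //; lra.
Qed.
End PowerBounds.

(** * The trapezoidal rule for complex powers *)

Section Trapezoid.
Variable R : realType.
Local Notation Cx := (C R).

Lemma cder_curve_real_comp (g : R -> Cx) (phi : R -> R) x l m : cder_curve g (phi x) l -> rder phi x m ->
  cder_curve (fun t => g (phi t)) x (l * rc m).
Proof.
move=> Hg Hp e e0; have K : 0 < 1 + `|m| by rewrite ltr_wpDr.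
have L : 0 < 1 + cmod l by rewrite ltr_wpDr ?cmod_ge0.
have [|d d0 Hd] := Hg (e / 2 / (1 + `|m|)); first by rewrite !divr_gt0.
have [|d' d'0 Hd'] := Hp (Num.min 1 (e / 2 / (1 + cmod l))); first by rewrite lt_min ltr01 !divr_gt0.
exists (Num.min d' (d / (1 + `|m|))); first by rewrite lt_min d'0 divr_gt0.
move=> h; rewrite lt_min => /andP[h1 h2].
set k := phi (x + h) - phi x.
have k1 : `|k - m * h| <= 1 * `|h|.
  by apply: le_trans (Hd' h h1) _; rewrite ler_wpM2r // ge_min lexx.
have k2 : `|k - m * h| <= e / 2 / (1 + cmod l) * `|h|.
  by apply: le_trans (Hd' h h1) _; rewrite ler_wpM2r // ge_min lexx orbT.
have k3 : `|k| <= (1 + `|m|) * `|h|.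
  have -> : k = (k - m * h) + m * h by ring.
  by apply: le_trans (ler_normD _ _) _; rewrite normrM mulrDl lerD.
have kd : `|k| < d by apply: le_lt_trans k3 _; rewrite mulrC -ltr_pdivlMr.
have -> : phi (x + h) = phi x + k by rewrite /k; ring.
have -> : g (phi x + k) - g (phi x) - l * rc m * rc h = (g (phi x + k) - g (phi x) - l * rc k) + l * rc (k - m * h).
  by rewrite (rcB k) (rcM m h); ring.
apply: le_trans (cmodD _ _) _; rewrite cmodM cmod_rc.
have a1 : cmod (g (phi x + k) - g (phi x) - l * rc k) <= e / 2 * `|h|.
  apply: le_trans (Hd k kd) _; apply: le_trans (ler_wpM2l _ k3) _; first by rewrite ltW // !divr_gt0.
  by rewrite mulrA divfK // gt_eqF.
have a2 : cmod l * `|k - m * h| <= e / 2 * `|h|.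
  apply: (@le_trans _ _ ((1 + cmod l) * (e / 2 / (1 + cmod l) * `|h|))).
    by rewrite ler_pM ?cmod_ge0 // lerDr.
  by rewrite mulrA mulrCA mulfV ?mulr1 // gt_eqF.
have -> : e * `|h| = e / 2 * `|h| + e / 2 * `|h| by field.
exact: lerD.
Qed.

Lemma cder_curve_mulx (g : R -> Cx) x l : cder_curve g x l -> cder_curve (fun t => rc t * g t) x (g x + rc x * l).
Proof.
move=> Hg e e0; have K : 0 < 1 + `|x| by rewrite ltr_wpDr.
have L : 0 < 1 + cmod l by rewrite ltr_wpDr ?cmod_ge0.
have [|d d0 Hd] := Hg (Num.min 1 (e / 2 / (1 + `|x|))); first by rewrite lt_min ltr01 !divr_gt0.
exists (Num.min d (e / 2 / (1 + cmod l))); first by rewrite lt_min d0 !divr_gt0.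
move=> h; rewrite lt_min => /andP[/Hd h1 h2].
set D := g (x + h) - g x - l * rc h in h1.
have k1 : cmod D <= 1 * `|h|.
  by apply: le_trans h1 _; rewrite ler_wpM2r // ge_min lexx.
have k2 : cmod D <= e / 2 / (1 + `|x|) * `|h|.
  by apply: le_trans h1 _; rewrite ler_wpM2r // ge_min lexx orbT.
have -> : rc (x + h) * g (x + h) - rc x * g x - (g x + rc x * l) * rc h = rc x * D + rc h * (D + l * rc h).
  by rewrite /D rcD; ring.
apply: le_trans (cmodD _ _) _; rewrite !cmodM !cmod_rc.
have a1 : `|x| * cmod D <= e / 2 * `|h|.
  apply: (@le_trans _ _ ((1 + `|x|) * (e / 2 / (1 + `|x|) * `|h|))).
    by rewrite ler_pM ?cmod_ge0 // lerDr.
  by rewrite mulrA mulrCA mulfV ?mulr1 // gt_eqF.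
have a2 : `|h| * cmod (D + l * rc h) <= e / 2 * `|h|.
  rewrite mulrC ler_wpM2r //; apply: (@le_trans _ _ ((1 + cmod l) * `|h|)).
    by apply: le_trans (cmodD _ _) _; rewrite cmodM cmod_rc mulrDl lerD.
  by rewrite ltW // mulrC -ltr_pdivlMr.
have -> : e * `|h| = e / 2 * `|h| + e / 2 * `|h| by field.
exact: lerD.
Qed.

Definition pw (s : Cx) (x : R) : Cx := cexp (s * rc (ln x)).

Lemma cmod_pw s x : cmod (pw s x) = expR (Re s * ln x).
Proof. by rewrite /pw cmod_cexp !ReImE mulr0 subr0. Qed.

Lemma pwD s t x : pw (s + t) x = pw s x * pw t x.
Proof. by rewrite /pw mulrDl cexpD. Qed.

Lemma pw_rc (s x : R) : pw (rc s) x = rc (expR (s * ln x)).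
Proof. by rewrite /pw -rcM cexp_rc. Qed.

Lemma cder_curve_pw s x : 0 < x -> cder_curve (pw s) x (s * pw (s - 1) x).
Proof.
move=> x0; have dl : rder (@ln R) x x^-1 by apply: is_derive_rder; exact: is_derive1_ln.
apply: cder_curve_eq (cder_curve_real_comp (cder_curve_cexp s (ln x)) dl) => [t|].
  by rewrite /pw mulrC.
have -> : s - 1 = s + rc (- 1) by rewrite rcN rc1.
by rewrite pwD pw_rc mulN1r expRN lnK ?posrE // /pw [rc (ln x) * s]mulrC; ring.
Qed.

(** The error of the trapezoidal rule for x^(-s) on [n, n + 1] is controlled by the second
    derivative s (s + 1) x^(-s-2). Mean value inequalities replace the integral remainder. *)
Lemma trapezoid_step (s : Cx) (n : R) : 0 < n -> s != 1 -> - 2 < Re s ->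
  cmod ((pw (- s) (n + 1) + pw (- s) n) / 2 - (pw (1 - s) (n + 1) - pw (1 - s) n) / (1 - s)) <=
  cmod s * cmod (s + 1) * expR (- ((Re s + 2) * ln n)).
Proof.
move=> n0 s1 hs; have s1' : 1 - s != 0 by rewrite subr_eq0 eq_sym.
set M := cmod s * cmod (s + 1) * expR (- ((Re s + 2) * ln n)).
have M0 : 0 <= M by rewrite !mulr_ge0 ?cmod_ge0 ?expR_ge0.
have nn : n <= n + 1 by rewrite lerDl.
have b2 x : n <= x <= n + 1 -> cmod (s * (s + 1) * pw (- s - 2) x) <= M.
  move=> /andP[h1 _]; rewrite !cmodM cmod_pw /M ler_wpM2l ?mulr_ge0 ?cmod_ge0 // ler_expR.
  have -> : Re (- s - 2) = - (Re s + 2) by rewrite !ReImE; ring.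
  rewrite mulNr lerN2 ler_wpM2l //; first lra.
  by rewrite ler_ln ?posrE // (lt_le_trans n0).
pose g x := pw (- s) x; pose g' x := - s * pw (- s - 1) x.
have dg x : n <= x <= n + 1 -> cder_curve g x (g' x).
  by move=> /andP[h _]; apply: cder_curve_pw; exact: lt_le_trans h.
have dg' x : n <= x <= n + 1 -> cder_curve g' x (s * (s + 1) * pw (- s - 2) x).
  move=> /andP[h _]; have x0 := lt_le_trans n0 h.
  apply: cder_curve_eq (cder_curve_affine (- s) 0 (cder_curve_pw (- s - 1) x0)) => [t|].
    by rewrite /g' mul0r addr0.
  have -> : - s - 1 - 1 = - s - 2 by ring.
  by rewrite addr0; ring.
have lipg' x y : n <= x -> x <= y -> y <= n + 1 -> cmod (g' y - g' x) <= M.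
  move=> h1 h2 h3; apply: (@le_trans _ _ (M * (y - x))); last by rewrite ler_piMr //; lra.
  by apply: mv_ineq h2 (fun t ht => dg' t _) _ => t ht; try apply: b2; lra.
(* Up to a constant, [G x] is the trapezoidal value on [n, x] minus a primitive of x^(-s), so its
   increment over [n, n + 1] is the error. *)
pose G (x : R) : Cx := (rc x * g x - rc n * g x + rc x * g n) / 2 - pw (1 - s) x / (1 - s).
pose G' (x : R) : Cx := (g x + rc x * g' x - rc n * g' x + g n) / 2 - g x.
have dG x : n <= x <= n + 1 -> cder_curve G x (G' x).
  move=> hx; have /andP[h _] := hx; have x0 := lt_le_trans n0 h.
  have d1 := cder_curve_mulx (dg x hx).
  have d2 := cder_curve_affine (- rc n) (g n) (dg x hx).
  have d3 := cder_curve_affine (- (1 - s)^-1) 0 (cder_curve_pw (1 - s) x0).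
  have d4 := cder_curve_affine 2^-1 0 (cder_curveD d1 d2).
  apply: cder_curve_eq (cder_curveD d4 d3) => [t|].
    by rewrite /G; ring.
  have -> : 1 - s - 1 = - s by ring.
  by rewrite /G' -/(g x); field.
have bG x : n <= x <= n + 1 -> cmod (G' x) <= M.
  move=> /andP[h1 h2].
  have xn : 0 <= x - n <= 1 by lra.
  have : cmod ((g x - g' x * rc x) - (g n - g' x * rc n)) <= M * (x - n).
    apply: (@mv_ineq R (fun t => g t - g' x * rc t) (fun t => g' t - g' x)) => // t /andP[t1 t2].
      have ht : n <= t <= n + 1 by lra.
      apply: cder_curve_eq (cder_curve_affine 1 (- g' x) (dg t ht)) => [v|]; ring.
    by rewrite cmodBC; apply: lipg' => //.
  have -> : (g x - g' x * rc x) - (g n - g' x * rc n) = - 2 * G' x.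
    by rewrite /G'; field.
  rewrite cmodM cmodN cmod_nat.
  have : M * (x - n) <= M by rewrite ler_piMr //; lra.
  have := cmod_ge0 (G' x); lra.
have := mv_ineq nn dG bG.
have -> : n + 1 - n = 1 by ring.
rewrite mulr1; congr (cmod _ <= _).
rewrite /G rcD rc1 -/(g n) -/(g (n + 1)); field.
by rewrite s1'.
Qed.
End Trapezoid.

(** * The Dirichlet series and its continuation to Re s > -1 *)

Section DirichletSeries.
Variable R : realType.
Local Notation Cx := (C R).

Definition dsum (w : Cx) (N : nat) : Cx := \sum_(0 <= k < N) natpow k.+1 (- w).
Definition dzeta (w : Cx) : Cx := clim (dsum w).
(** Euler-Maclaurin summation to first order: removing half the last term and the integral makes the
    partial sums converge for Re s > -1, s != 1. *)
Definition ztrap (s : Cx) (N : nat) : Cx := dsum s N - natpow N (- s) / 2 - natpow N (1 - s) / (1 - s).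
Definition tzeta (s : Cx) : Cx := clim (ztrap s).

Lemma ler_ln_nat m n : (0 < m)%N -> (m <= n)%N -> ln m%:R <= ln n%:R :> R.
Proof. by move=> m0 mn; rewrite ler_ln ?posrE ?ltr0n ?ler_nat // (leq_trans m0). Qed.

Lemma dsumS w N : dsum w N.+1 = dsum w N + natpow N.+1 (- w).
Proof. by rewrite /dsum big_nat_recr. Qed.

Lemma expR_ln_mono (a b : R) n : (0 < n)%N -> a <= b -> expR (a * ln n%:R) <= expR (b * ln n%:R).
Proof. by move=> n0 ab; rewrite ler_expR ler_wpM2r // ln_ge0 // ler1n. Qed.

Lemma dsum_step (d : R) (w : Cx) n : 0 < d -> 1 + d <= Re w -> (0 < n)%N ->
  cmod (dsum w n.+1 - dsum w n) <= 1 * (pbound d n - pbound d n.+1).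
Proof.
move=> d0 hw n0; rewrite mul1r dsumS addrC addKr cmod_natpow.
apply: le_trans (pbound_step d0 n0); rewrite -mulNr; apply: expR_ln_mono => //.
rewrite !ReImE; lra.
Qed.

Lemma dzeta_tail (d : R) (w : Cx) : 0 < d -> 1 + d <= Re w ->
  ccvg (dsum w) (dzeta w) /\ forall n, (0 < n)%N -> cmod (dzeta w - dsum w n) <= pbound d n.
Proof.
move=> d0 hw.
have [l Hl hb] := telescoping_cvg ler01 (fun n => pbound_ge0 n d0) (pbound_small d0) (fun n => dsum_step d0 hw (n := n)).
rewrite /dzeta (clim_eq Hl); split => // n n0; have := hb n n0; by rewrite mul1r.
Qed.

Lemma ztrap_step (s : Cx) n : (0 < n)%N -> s != 1 -> - 2 < Re s ->
  cmod (ztrap s n.+1 - ztrap s n) <= cmod s * cmod (s + 1) * expR (- ((Re s + 2) * ln n%:R)).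
Proof.
move=> n0 s1 hs; have nn : 0 < n%:R :> R by rewrite ltr0n.
have := trapezoid_step nn s1 hs; rewrite natr1; congr (cmod _ <= _).
rewrite /ztrap dsumS /natpow /pw; move: (cexp _) (cexp _) (cexp _) (cexp _) => c1 c2 c3 c4; have s1' : 1 - s != 0 by rewrite subr_eq0 eq_sym.
by field; rewrite s1'.
Qed.

Lemma pbound_pred_small (d : R) : 0 < d -> forall e : R, 0 < e -> exists N, forall n, (N <= n)%N -> pbound d n.-1 <= e.
Proof. by move=> d0 e e0; have [N hN] := pbound_small d0 e0; exists N.+1 => -[|n] // hn; exact: hN. Qed.

(** [s] enters the bound only through [d] and [B], which makes the truncations locally bounded, as
    [tzeta_holo] requires. *)
Lemma ztrap_tail (d B : R) (s : Cx) : 0 < d -> -1 + d <= Re s -> s != 1 -> cmod s <= B ->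
  ccvg (ztrap s) (tzeta s) /\ forall m n, (1 < n)%N -> (n <= m)%N -> cmod (ztrap s m - ztrap s n) <= 2 * (B * (B + 1) * pbound d n.-1).
Proof.
move=> d0 hs s1 sB; have B0 : 0 <= B := le_trans (cmod_ge0 _) sB.
have K0 : 0 <= B * (B + 1) by rewrite mulr_ge0 // addr_ge0.
(* The step at n is compared with the decrement of [pbound] from n - 1 to n; hence the predecessor
   and the start at 2. *)
have st n : (2 <= n)%N -> cmod (ztrap s n.+1 - ztrap s n) <= B * (B + 1) * (pbound d n.-1 - pbound d n.+1.-1).
  case: n => [|n] // n1; have n0 : (0 < n)%N by [].
  have s2 : - 2 < Re s by lra.
  apply: le_trans (ztrap_step (ltn0Sn n) s1 s2) _; rewrite succnK.
  have sb1 : cmod (s + 1) <= B + 1 by apply: le_trans (cmodD _ _) _; rewrite cmod1 lerD2r.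
  apply: ler_pM; rewrite ?mulr_ge0 ?cmod_ge0 ?expR_ge0 //; first by rewrite ler_pM ?cmod_ge0.
  apply: le_trans (pbound_step d0 n0); rewrite -!mulNr; apply: expR_ln_mono => //; lra.
have [l Hl hb] := telescoping_cvg K0 (fun n => pbound_ge0 n.-1 d0) (pbound_pred_small d0) st.
rewrite /tzeta (clim_eq Hl); split => // m n n1 nm.
have h1 := hb n n1; have h2 := hb m (leq_trans n1 nm).
have mono : pbound d m.-1 <= pbound d n.-1.
  rewrite /pbound ler_pM2r ?invr_gt0 // ler_expR lerN2 ler_wpM2l ?(ltW d0) //.
  have n0 : (0 < n.-1)%N by case: n n1 {nm h1} => [|[]].
  by apply: ler_ln_nat n0 _; rewrite -!subn1 leq_sub2r.
have := ler_wpM2l K0 mono; have := cmod_triB (ztrap s m) (ztrap s n) l.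
rewrite [cmod (ztrap s m - l)]cmodBC; lra.
Qed.

Lemma holo_dsum N (z : Cx) : holo (fun w => dsum w N) z.
Proof. by apply: holo_sum => k; prove_holo. Qed.

Lemma holo_ztrap N (z : Cx) : z != 1 -> holo (fun w => ztrap w N) z.
Proof.
move=> z1; have h := @holo_dsum N z; rewrite /ztrap; apply: holoB; first apply: holoB => //.
  by prove_holo.
by prove_holo; rewrite subr_eq0 eq_sym.
Qed.

Lemma tzeta_holo (z : Cx) : -1 < Re z -> z != 1 -> holo tzeta z.
Proof.
move=> hz z1; have c0 : 0 < cmod (z - 1) by rewrite cmod_gt0 subr_eq0.
pose rho := Num.min (Re z + 1) (cmod (z - 1)).
have rho0 : 0 < rho by rewrite lt_min c0 andbT; lra.
have rho1 : rho <= Re z + 1 by rewrite ge_min lexx.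
have rho2 : rho <= cmod (z - 1) by rewrite ge_min lexx orbT.
pose r := rho / 4; have r0 : 0 < r by rewrite divr_gt0.
have rE : rho = 4 * r by rewrite /r; field.
have near w : cmod (w - z) <= 3 * r -> [/\ -1 + r <= Re w, r <= cmod (w - 1) & cmod w <= cmod z + 3 * r].
  move=> hw; split.
  - have := Re_le (w - z); rewrite ReImE ler_norml; lra.
  - have -> : w - 1 = (z - 1) + (w - z) by ring.
    have := cmod_lowD (z - 1) (w - z); lra.
  - have -> : w = z + (w - z) by ring.
    have := cmodD z (w - z); lra.
have w1 w : cmod (w - z) <= 3 * r -> w != 1.
  by move=> /near[_ h _]; rewrite -subr_eq0 -cmod_eq0 gt_eqF //; lra.
set B := cmod z + 3 * r in near.
(* The first four summands bound [ztrap w 2] term by term for Re w >= -1; the last is the distance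
   to later truncations, given by [ztrap_tail]. *)
pose M := 1 + expR (ln 2) + expR (ln 2) + expR (2 * ln 2) / r + 2 * (B * (B + 1) * pbound r 1).
apply: (@holo_limit R (fun n w => ztrap w n.+2) tzeta z r M r0).
- by move=> n w /w1; exact: holo_ztrap.
- move=> n w hw; have hw' : cmod (w - z) <= 3 * r by lra.
  have [k1 k2 k3] := near w hw'; have [_ T] := ztrap_tail r0 k1 (w1 w hw') k3.
  have := T n.+2 2%N isT isT => /= T2.
  have := cmodD (ztrap w 2) (ztrap w n.+2 - ztrap w 2); rewrite subrKC => T3.
  suff : cmod (ztrap w 2) <= 1 + expR (ln 2) + expR (ln 2) + expR (2 * ln 2) / r by rewrite /M; lra.
  rewrite /ztrap /dsum !big_nat_recr //= big_geq // add0r natpow1.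
  have p1 : cmod (natpow 2 (- w)) <= expR (ln 2).
    rewrite cmod_natpow -[leRHS]mul1r -{2}[ln 2]mul1r; rewrite mul1r; apply: expR_ln_mono => //.
    rewrite !ReImE; lra.
  have p2 : cmod (natpow 2 (1 - w)) <= expR (2 * ln 2).
    rewrite cmod_natpow; apply: expR_ln_mono => //; rewrite !ReImE; lra.
  apply: le_trans (cmodB _ _) _; apply: lerD.
    apply: le_trans (cmodB _ _) _; apply: lerD.
      by apply: le_trans (cmodD _ _) _; rewrite cmod1 lerD2l.
    rewrite cmodM cmodV cmod_nat; apply: le_trans p1.
    by rewrite ler_piMr ?cmod_ge0 // invf_le1 // ler1n.
  rewrite cmodM cmodV; apply: ler_pM; rewrite ?invr_ge0 ?cmod_ge0 //.
  have k4 : r <= cmod (1 - w) by rewrite cmodBC.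
  by rewrite lef_pV2 ?posrE //; exact: lt_le_trans r0 k4.
- move=> w hw; have hw' : cmod (w - z) <= 3 * r by lra.
  have [k1 _ k3] := near w hw'; have [T _] := ztrap_tail r0 k1 (w1 w hw') k3.
  by apply: (@ccvg_subseq R (ztrap w) (fun n => n.+2)) T => N; exists N => n h; exact: leqW (leqW h).
Qed.

Lemma tzeta_dzeta (w : Cx) : 1 < Re w -> tzeta w = dzeta w.
Proof.
move=> hw; have d0 : 0 < Re w - 1 by lra.
have w1 : w != 1 by apply/negP => /eqP E; rewrite E Re1 in hw; lra.
have hw1 : 1 + (Re w - 1) <= Re w by lra.
have [T _] := dzeta_tail d0 hw1.
have [T2 _] := ztrap_tail (d := 1) ltr01 (ltac:(lra) : -1 + 1 <= Re w) w1 (lexx _).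
apply: (ccvg_uniq T2).
have small : ccvg (fun N => natpow N.+1 (1 - w)) 0.
  move=> e e0; have [N hN] := pbound_small d0 (e := e / (Re w - 1)) (divr_gt0 e0 d0).
  exists N => n hn; rewrite subr0 cmod_natpow.
  have := hN n.+1 (leq_trans hn (leqnSn _)); rewrite /pbound ler_pM2r ?invr_gt0 //.
  by rewrite -mulNr opprB !ReImE.
have small2 : ccvg (fun N => natpow N.+1 (- w)) 0.
  move=> e e0; have [N hN] := small e e0; exists N => n /hN; rewrite !subr0 !cmod_natpow.
  apply: le_trans; apply: expR_ln_mono => //; rewrite !ReImE; lra.
have S1 : ccvg (fun N => dsum w N.+1) (dzeta w).
  by apply: (@ccvg_subseq R (dsum w) (fun n => n.+1)) T => N; exists N => n h; exact: leqW.
have S2 : ccvg (fun N => ztrap w N.+1) (dzeta w).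
  have -> : dzeta w = dzeta w + - 2^-1 * 0 + - (1 - w)^-1 * 0 by ring.
  apply: (ccvg_eventually (N0 := 0%N) _ (ccvgD (ccvgD S1 (ccvg_scale _ small2)) (ccvg_scale _ small))) => n _.
  by rewrite /ztrap; ring.
move=> e e0; have [N hN] := S2 e e0; exists N.+1 => -[|n] // hn; exact: hN.
Qed.

Lemma dzeta_holo (w : Cx) : 1 < Re w -> holo dzeta w.
Proof.
move=> hw; have d0 : 0 < Re w - 1 by lra.
have w1 : w != 1 by apply/negP => /eqP E; rewrite E Re1 in hw; lra.
apply: (holo_local d0) (tzeta_holo _ w1); last lra.
move=> v hv; apply: tzeta_dzeta; have := Re_le (v - w); rewrite ReImE ler_norml; lra.
Qed.
End DirichletSeries.

(** * The gamma factor *)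

Section RatioProduct.
Variable R : realType.
Local Notation Cx := (C R).

(* rlim u = Gamma((1 + u)/2) / Gamma(1 - u/2), as a product. *)
Definition rfac (k : nat) (u : Cx) : Cx := (k%:R + 1 - u / 2) / (k%:R + (1 + u) / 2).
Definition rprod (u : Cx) (m : nat) : Cx := natpow m (u - 2^-1) * \prod_(0 <= k < m) rfac k u.
Definition rlim (u : Cx) : Cx := clim (rprod u).

Lemma half_rc : (2^-1 : Cx) = rc 2^-1. Proof. by rewrite rcV rc_nat. Qed.

Lemma Re_half (z : Cx) : Re (z / 2) = Re z / 2. Proof. by rewrite half_rc !ReImE; ring. Qed.
Lemma Im_half (z : Cx) : Im (z / 2) = Im z / 2. Proof. by rewrite half_rc !ReImE; ring. Qed.
Lemma Re_nat n : Re (n%:R : Cx) = n%:R. Proof. by rewrite -rc_nat Re_rc. Qed.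
Lemma Im_nat n : Im (n%:R : Cx) = 0. Proof. by rewrite -rc_nat Im_rc. Qed.

Lemma rprod_real (u : R) m : rprod (rc u) m = rc (ratio_prod u m).
Proof.
rewrite /rprod /ratio_prod rcM; congr (_ * _).
  by rewrite half_rc -rcB -[natpow _ _]/(pw _ _) pw_rc.
elim: m => [|m ih]; first by rewrite !big_geq // rc1.
rewrite !big_nat_recr //= rcM ih; congr (_ * _).
have rch (x : R) : rc (x / 2) = rc x / 2 :> Cx by rewrite rcM rcV rc_nat.
by rewrite /rfac [in RHS]rcM rcV rcB rcD rc_nat rc1 rch rcD rc_nat rch rcD rc1.
Qed.

Lemma rden_ge (k : nat) (u : Cx) : 0 <= Re u -> k%:R + 2^-1 <= cmod (k%:R + (1 + u) / 2).
Proof.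
move=> hu; apply: le_trans (le_trans (ler_norm _) (Re_le _)).
rewrite ReD Re_nat Re_half !ReImE; lra.
Qed.

Lemma rden_neq0 k (u : Cx) : 0 <= Re u -> k%:R + (1 + u) / 2 != 0.
Proof.
move=> hu; rewrite -cmod_eq0 gt_eqF //; apply: lt_le_trans (rden_ge k hu).
by rewrite ltr_wpDl ?ler0n // invr_gt0.
Qed.

Lemma ln_succ_le n : (0 < n)%N -> ln n.+1%:R - ln n%:R <= n%:R^-1 :> R.
Proof.
move=> n0; have n1 : 0 < n%:R :> R by rewrite ltr0n.
have n2 : 0 < n.+1%:R :> R by rewrite ltr0n.
have h : -1 < n%:R^-1 :> R by apply: (@lt_trans _ _ 0); rewrite ?invr_gt0 // ltrN10.
have := le_ln1Dx h; have -> : 1 + n%:R^-1 = n.+1%:R / n%:R :> R by rewrite -natr1; field; rewrite gt_eqF.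
by rewrite ln_div ?posrE.
Qed.

Lemma inv_sub_succ (x : R) : 0 < x -> x^-1 - (x + 1)^-1 = (x * (x + 1))^-1.
Proof. by move=> x0; field; rewrite !gt_eqF // addr_gt0. Qed.

(** The sum of the constants of the four error terms in [rprod_step]. *)
Definition rstep (b : R) := b ^+ 2 * expR b * (1 + b) + b + b ^+ 2 + b ^+ 2.

Lemma rstep_ge0 b : 0 <= b -> 0 <= rstep b.
Proof. by move=> b0; rewrite /rstep !addr_ge0 ?mulr_ge0 ?expR_ge0 ?exprn_ge0 // addr_ge0. Qed.

(** With a = u - 1/2 and D close to m, the new factor is 1 - a / D and the power contributes exp(a
    L), where L = ln((m + 1) / m) is close to 1 / m. The first order terms cancel, leaving an error
    of order 1 / m^2. *)
Lemma rprod_step (b : R) (u : Cx) m : (0 < m)%N -> 0 <= Re u -> 1 + cmod u <= b ->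
  cmod (rprod u m.+1 - rprod u m) <= cmod (rprod u m) * (rstep b / m%:R ^+ 2).
Proof.
move=> m0 hu ub; have m1 : 0 < m%:R :> R by rewrite ltr0n.
have u0 := cmod_ge0 u; have b1 : 1 <= b by lra.
have b0 : 0 <= b by lra.
pose a : Cx := u - 2^-1; pose L := ln m.+1%:R - ln m%:R :> R.
pose D : Cx := m%:R + (1 + u) / 2; have D0 : D != 0 := rden_neq0 m hu.
have hD : m%:R <= cmod D by apply: le_trans (rden_ge m hu); rewrite lerDl invr_ge0.
have cD : 0 < cmod D by apply: lt_le_trans hD.
have mi : m%:R^-1 <= 1 :> R by rewrite invf_le1 // ler1n.
have mi0 : 0 < m%:R^-1 :> R by rewrite invr_gt0.
have ha : cmod a <= b.
  apply: le_trans (cmodB _ _) _; rewrite cmodV cmod_nat.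
  have : 2^-1 <= 1 :> R by rewrite invf_le1 // ler1n.
  lra.
have hL1 : L <= m%:R^-1 by exact: ln_succ_le.
have hL2 := ln_succ_ge R m0; rewrite -/L in hL2.
have L0 : 0 <= L by apply: le_trans hL2; rewrite invr_ge0 ler0n.
have iD : cmod D^-1 <= m%:R^-1 by rewrite cmodV lef_pV2.
have E1 : rprod u m.+1 = rprod u m * (cexp (a * rc L) * (1 - a / D)).
  rewrite /rprod big_nat_recr //= /natpow -/(rc _) -/(rc _) -/a.
  have -> : ln m.+1%:R = ln m%:R + L :> R by rewrite /L; ring.
  rewrite rcD mulrDr cexpD; have -> : rfac m u = 1 - a / D; last by ring.
  rewrite /rfac -/D; have -> : m%:R + 1 - u / 2 = D - a by rewrite /D /a; field.
  by rewrite mulrBl divff.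
have -> : rprod u m.+1 - rprod u m = rprod u m * (cexp (a * rc L) * (1 - a / D) - 1) by rewrite E1; ring.
rewrite cmodM ler_wpM2l ?cmod_ge0 //.
set ep := cexp (a * rc L) - 1 - a * rc L.
have -> : cexp (a * rc L) * (1 - a / D) - 1 =
   ep * (1 - a / D) + a * rc (L - m%:R^-1) + a * (rc m%:R^-1 * (D - m%:R) * D^-1) + - (a * a * rc L * D^-1).
  rewrite /ep (rcB L); set e := cexp _; rewrite rcV rc_nat; field.
  by rewrite D0 -rc_nat rc_eq0 gt_eqF.
have aL : cmod (a * rc L) <= b * m%:R^-1 by rewrite cmodM cmod_rc ger0_norm // ler_pM ?cmod_ge0.
have aL1 : cmod (a * rc L) <= b by apply: le_trans aL _; rewrite ler_piMr.
have h1 : cmod (ep * (1 - a / D)) <= b ^+ 2 * expR b * (1 + b) / m%:R ^+ 2.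
  have k1 : cmod ep <= (b * m%:R^-1) ^+ 2 * expR b.
    apply: le_trans (cexp_bound2 _) _; apply: ler_pM; rewrite ?exprn_ge0 ?cmod_ge0 ?expR_ge0 //.
      by rewrite ler_pXn2r ?nnegrE ?cmod_ge0 // mulr_ge0 // ltW.
    by rewrite ler_expR.
  have k2 : cmod (1 - a / D) <= 1 + b.
    apply: le_trans (cmodB _ _) _; rewrite cmod1 lerD2l cmodM.
    apply: (@le_trans _ _ (b * 1)); last by rewrite mulr1.
    by apply: ler_pM; rewrite ?cmod_ge0 //; exact: le_trans iD mi.
  rewrite cmodM; apply: le_trans (ler_pM (cmod_ge0 _) (cmod_ge0 _) k1 k2) _.
  by rewrite exprMn exprVn; have -> : b ^+ 2 / m%:R ^+ 2 * expR b * (1 + b) = b ^+ 2 * expR b * (1 + b) / m%:R ^+ 2 by ring.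
have h2 : cmod (a * rc (L - m%:R^-1)) <= b / m%:R ^+ 2.
  rewrite cmodM cmod_rc; apply: ler_pM; rewrite ?cmod_ge0 //.
  rewrite distrC ger0_norm ?subr_ge0 //.
  have k : m%:R^-1 - m.+1%:R^-1 <= (m%:R ^+ 2)^-1 :> R.
    by rewrite -natr1 inv_sub_succ // natr1 lef_pV2 ?posrE ?mulr_gt0 ?exprn_gt0 // expr2 ler_wpM2l // ?ler_nat // ltW.
  move: hL2 k; move: (m%:R^-1) (m.+1%:R^-1) (m%:R ^- 2) => x y t; lra.
have h3 : cmod (a * (rc m%:R^-1 * (D - m%:R) * D^-1)) <= b ^+ 2 / m%:R ^+ 2.
  rewrite !cmodM cmod_rc ger0_norm ?(ltW mi0) //.
  have k : cmod (D - m%:R) <= b.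
    have -> : D - m%:R = (1 + u) / 2 by rewrite /D; ring.
    rewrite cmodM cmodV cmod_nat; have := cmodD 1 u; rewrite cmod1; lra.
  have -> : b ^+ 2 / m%:R ^+ 2 = b * (m%:R^-1 * b * m%:R^-1) by field; rewrite gt_eqF.
  have mi0' := ltW mi0.
  apply: ler_pM; rewrite ?cmod_ge0 ?mulr_ge0 ?cmod_ge0 //.
  by apply: ler_pM; rewrite ?mulr_ge0 ?cmod_ge0 // ler_wpM2l.
have h4 : cmod (- (a * a * rc L * D^-1)) <= b ^+ 2 / m%:R ^+ 2.
  rewrite cmodN !cmodM cmod_rc ger0_norm //.
  have -> : b ^+ 2 / m%:R ^+ 2 = b * b * m%:R^-1 * m%:R^-1 by field; rewrite gt_eqF.
  by rewrite !(ler_pM, mulr_ge0, cmod_ge0).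
have -> : rstep b / m%:R ^+ 2 = b ^+ 2 * expR b * (1 + b) / m%:R ^+ 2 + b / m%:R ^+ 2 + b ^+ 2 / m%:R ^+ 2 + b ^+ 2 / m%:R ^+ 2.
  by rewrite /rstep; ring.
apply: le_trans (cmodD _ _) (lerD _ h4); apply: le_trans (cmodD _ _) (lerD _ h3).
exact: le_trans (cmodD _ _) (lerD h1 h2).
Qed.

Lemma inv_sqr_telescope m : (0 < m)%N -> (m%:R ^+ 2)^-1 <= 2 * (m%:R^-1 - m.+1%:R^-1) :> R.
Proof.
move=> m0; have m1 : 0 < m%:R :> R by rewrite ltr0n.
have m2 : 0 < m.+1%:R :> R by rewrite ltr0n.
have -> : 2 * (m%:R^-1 - m.+1%:R^-1) = (m%:R * m.+1%:R / 2)^-1 :> R by rewrite -[m.+1%:R]natr1 inv_sub_succ // invf_div.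
rewrite lef_pV2 ?posrE ?divr_gt0 ?mulr_gt0 ?exprn_gt0 // -natr1.
have : 1 <= m%:R :> R by rewrite ler1n.
move=> h; have := ler_wpM2l (ltW m1) h; rewrite expr2; lra.
Qed.

Definition rbound (b : R) := 2 * b * expR (2 * rstep b).

Lemma rprod_bound (b : R) (u : Cx) m : 0 <= Re u -> 1 + cmod u <= b -> (0 < m)%N -> cmod (rprod u m) <= rbound b.
Proof.
move=> hu ub m0; have b0 : 0 <= b by have := cmod_ge0 u; lra.
have s0 := rstep_ge0 b0.
(* The factor 1 - 1 / m lets the induction absorb the relative error of each step through
   [inv_sqr_telescope]. *)
suff H : cmod (rprod u m) <= 2 * b * expR (2 * rstep b * (1 - m%:R^-1)).
  apply: le_trans H _; rewrite /rbound ler_wpM2l ?mulr_ge0 // ler_expR.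
  by rewrite ler_piMr ?mulr_ge0 // gerBl invr_ge0 ler0n.
elim: m m0 => [|[|m] ih] // _.
  rewrite /rprod natpow1 mul1r big_nat1 /rfac invr1 subrr mulr0 expR0 mulr1 add0r.
  rewrite cmodM cmodV mulrC; have d := rden_ge 0 hu; rewrite add0r in d.
  have h2 : 0 < 2^-1 :> R by rewrite invr_gt0.
  have k : cmod (1 - u / 2) <= b.
    apply: le_trans (cmodB _ _) _; rewrite cmodM cmodV cmod_nat cmod1; have := cmod_ge0 u; lra.
  apply: ler_pM; rewrite ?invr_ge0 ?cmod_ge0 //.
  by rewrite -[leRHS]invrK lef_pV2 ?posrE //; exact: lt_le_trans d.
have step := rprod_step (ltn0Sn m) hu ub; have := ih isT; set A := cmod (rprod u m.+1) in step *.
move=> hA; have := cmodD (rprod u m.+1) (rprod u m.+2 - rprod u m.+1); rewrite subrKC -/A => tri.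
apply: le_trans tri _; apply: (@le_trans _ _ (A * (1 + rstep b / m.+1%:R ^+ 2))).
  by rewrite mulrDr mulr1 lerD2l.
apply: (@le_trans _ _ (A * expR (2 * rstep b * (m.+1%:R^-1 - m.+2%:R^-1)))).
  rewrite ler_wpM2l ?cmod_ge0 //; apply: le_trans (expR_ge1Dx _); rewrite lerD2l.
  have := ler_wpM2l s0 (inv_sqr_telescope (ltn0Sn m)).
  by have -> : 2 * rstep b * (m.+1%:R^-1 - m.+2%:R^-1) = rstep b * (2 * (m.+1%:R^-1 - m.+2%:R^-1)) by ring.
apply: le_trans (ler_wpM2r (expR_ge0 _) hA) _.
rewrite -[X in X <= _]mulrA -expRD ler_wpM2l ?mulr_ge0 // ler_expR.
by have -> : 2 * rstep b * (1 - m.+1%:R^-1) + 2 * rstep b * (m.+1%:R^-1 - m.+2%:R^-1) = 2 * rstep b * (1 - m.+2%:R^-1) by ring.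
Qed.

Lemma rlim_cvg (u : Cx) : 0 <= Re u -> ccvg (rprod u) (rlim u).
Proof.
move=> hu; set b := 1 + cmod u; have b0 : 0 <= b by rewrite addr_ge0 ?cmod_ge0.
have s0 := rstep_ge0 b0.
have M0 : 0 <= rbound b by rewrite !mulr_ge0 ?expR_ge0.
have st m : (1 <= m)%N -> cmod (rprod u m.+1 - rprod u m) <= rbound b * rstep b * 2 * (m%:R^-1 - m.+1%:R^-1).
  move=> m0; apply: le_trans (rprod_step m0 hu (lexx b)) _.
  have -> : rbound b * rstep b * 2 * (m%:R^-1 - m.+1%:R^-1) = rbound b * (rstep b * (2 * (m%:R^-1 - m.+1%:R^-1))) by ring.
  apply: ler_pM; rewrite ?cmod_ge0 ?divr_ge0 ?exprn_ge0 ?ler0n //; first exact: rprod_bound.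
  by rewrite ler_wpM2l // inv_sqr_telescope.
have K0 : 0 <= rbound b * rstep b * 2 by rewrite !mulr_ge0.
have small (e : R) : 0 < e -> exists N, forall n, (N <= n)%N -> n%:R^-1 <= e.
  move=> e0; exists (Num.truncn e^-1).+1 => n hn.
  have n0 : 0 < n%:R :> R by rewrite ltr0n; exact: leq_trans hn.
  rewrite -[leRHS]invrK lef_pV2 ?posrE ?invr_gt0 //.
  by apply/ltW/(lt_le_trans (truncnS_gt _)); rewrite ler_nat.
have inv0 (n : nat) : 0 <= n%:R^-1 :> R by rewrite invr_ge0 ler0n.
have [l Hl _] := telescoping_cvg K0 inv0 small st.
by rewrite /rlim (clim_eq Hl).
Qed.

Lemma rlim_holo (z : Cx) : 0 < Re z -> holo rlim z.
Proof.
move=> hz; pose r := Re z / 3; have r0 : 0 < r by rewrite divr_gt0.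
have near (w : Cx) : cmod (w - z) <= 3 * r -> 0 <= Re w.
  move=> hw; have := Re_le (w - z); rewrite ReImE ler_norml.
  have : 3 * r = Re z by rewrite /r; field.
  lra.
apply: (@holo_limit R (fun n w => rprod w n.+1) rlim z r (rbound (1 + (cmod z + 3 * r))) r0).
- move=> n w /near hw; apply: holoM; first by prove_holo.
  apply: holo_prod => k; rewrite /rfac; apply: holoM; first by prove_holo.
  by apply: holoV; [exact: rden_neq0|prove_holo].
- move=> n w hw; apply: rprod_bound => //; first by apply: near; lra.
  rewrite lerD2l; have -> : w = z + (w - z) by ring.
  have := cmodD z (w - z); lra.
- move=> w hw; have hw' : cmod (w - z) <= 3 * r by lra.
  by apply: (@ccvg_subseq R (rprod w) (fun n => n.+1)) (rlim_cvg (near w hw')) => N; exists N => n h; exact: leqW.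
Qed.
End RatioProduct.

(** * The modulus of one factor of the gamma quotient *)

Section RatioSize.
Variable R : realType.
Local Notation Cx := (C R).

(** The logarithm of the squared modulus of a factor: k + 3/4 is the midpoint of the real parts k +
    1 - Re u / 2 and k + (1 + Re u) / 2, and d is half their difference. *)
Definition rphi (c d w : R) := ln ((c - d) ^+ 2 + w ^+ 2) - ln ((c + d) ^+ 2 + w ^+ 2).

Lemma ln1D_bound (v : R) : `|v| <= 2^-1 -> v - 2 * v ^+ 2 <= ln (1 + v) <= v.
Proof.
rewrite ler_norml => /andP[h1 h2].
have h0 : 2^-1 = 1 / 2 :> R by rewrite mul1r.
have p : 0 < 1 + v by lra.
apply/andP; split; last by apply: le_ln1Dx; lra.
have q : -1 < - (v / (1 + v)).
  have -> : - (v / (1 + v)) = (1 + v)^-1 - 1 by field; rewrite gt_eqF.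
  by rewrite ltrBrDr subrr addrC addNr invr_gt0 || (have := p; rewrite -invr_gt0; lra).
have := le_ln1Dx q; have -> : 1 + - (v / (1 + v)) = (1 + v)^-1 by field; rewrite gt_eqF.
rewrite lnV ?posrE // => h.
have k : v / (1 + v) = v - v ^+ 2 / (1 + v) by field; rewrite gt_eqF.
have k2 : v ^+ 2 / (1 + v) <= 2 * v ^+ 2.
  rewrite ler_pdivrMr // -mulrA -subr_ge0.
  have -> : 2 * (v ^+ 2 * (1 + v)) - v ^+ 2 = v ^+ 2 * (1 + 2 * v) by ring.
  by rewrite mulr_ge0 ?sqr_ge0 //; lra.
lra.
Qed.

(** To leading order [rphi] is linear in d, which permits comparison with 2 d times its value at d =
    1/2; the errors are summable over c = k + 3/4. *)
Lemma rphi_bound (c d w De : R) : 0 <= c -> `|d| <= De -> 2 * De <= `|w| -> 0 < `|w| ->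
  `|rphi c d w + 4 * c * d / (c ^+ 2 + w ^+ 2)| <= 17 * De ^+ 2 / (c ^+ 2 + w ^+ 2).
Proof.
move=> c0 hd hw w0; set B := c ^+ 2 + w ^+ 2.
have w2 : 0 < w ^+ 2 by rewrite -[w ^+ 2]real_normK ?num_real // exprn_gt0.
have c2 : 0 <= c ^+ 2 by exact: sqr_ge0.
have d2 : d ^+ 2 <= De ^+ 2.
  rewrite -[d ^+ 2]real_normK ?num_real // ler_pXn2r ?nnegrE //; exact: le_trans hd.
have d20 : 0 <= d ^+ 2 by exact: sqr_ge0.
have B0 : 0 < B by rewrite /B; lra.
pose A := B + d ^+ 2; have A0 : 0 < A by rewrite /A; lra.
have BA : B <= A by rewrite /A; lra.
have cd : 4 * c * `|d| <= B.
  have h1 : c * (2 * `|d|) <= c * `|w| by rewrite ler_wpM2l //; lra.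
  have h2 := sqr_ge0 (c - `|w|); rewrite sqrrB real_normK ?num_real // in h2.
  rewrite /B; lra.
(* The two quadratics are A (1 - v) and A (1 + v). The logarithms cost at most 4 v^2 <= 16 De^2 / B
   and replacing A by B costs De^2 / B; hence the 17. *)
pose v := 2 * c * d / A.
have hv : `|v| <= 2^-1.
  rewrite /v normrM [`|A^-1|]ger0_norm ?invr_ge0 ?(ltW A0) // ler_pdivrMr // !normrM.
  by rewrite (ger0_norm c0) (ger0_norm (ler0n _ 2)); lra.
have v2 : v ^+ 2 <= 4 * De ^+ 2 / B.
  have -> : v ^+ 2 = 4 * (d ^+ 2 * (c ^+ 2 / A) / A) by rewrite /v; field; rewrite gt_eqF.
  rewrite -[4 * De ^+ 2 / B]mulrA ler_wpM2l //; apply: ler_pM.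
  - by rewrite mulr_ge0 // divr_ge0 // ltW.
  - by rewrite invr_ge0 ltW.
  - rewrite -[leRHS]mulr1; apply: ler_pM => //; first by rewrite divr_ge0 // ltW.
    by rewrite ler_pdivrMr // mul1r /A /B; lra.
  - by rewrite lef_pV2.
have hv' : `|- v| <= 2^-1 by rewrite normrN.
have /andP[l1 l2] := ln1D_bound hv; have /andP[l3 l4] := ln1D_bound hv'.
have vv : -2^-1 <= v <= 2^-1 by rewrite -ler_norml.
have h0 : 2^-1 = 1 / 2 :> R by rewrite mul1r.
have E : rphi c d w = ln (1 + - v) - ln (1 + v).
  rewrite /rphi.
  have -> : (c - d) ^+ 2 + w ^+ 2 = A * (1 + - v) by rewrite /v /A /B; field; rewrite -/B -/A gt_eqF.
  have -> : (c + d) ^+ 2 + w ^+ 2 = A * (1 + v) by rewrite /v /A /B; field; rewrite -/B -/A gt_eqF.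
  by rewrite !lnM ?posrE //; [ring|lra|lra].
have F : `|2 * v - 4 * c * d / B| <= De ^+ 2 / B.
  have -> : 2 * v - 4 * c * d / B = - ((4 * c * d / A) * (d ^+ 2 / B)) by rewrite /v /A; field; rewrite -/A !gt_eqF.
  rewrite normrN normrM [`|d ^+ 2 / B|]ger0_norm ?divr_ge0 ?(ltW B0) //.
  rewrite -[leRHS]mul1r; apply: ler_pM; rewrite ?normr_ge0 ?divr_ge0 ?(ltW B0) //.
    rewrite normrM [`|A^-1|]ger0_norm ?invr_ge0 ?(ltW A0) // ler_pdivrMr // mul1r !normrM.
    by rewrite (ger0_norm c0) (ger0_norm (ler0n _ 4)); apply: le_trans cd BA.
  by rewrite ler_pM2r ?invr_gt0.
have sN : (- v) ^+ 2 = v ^+ 2 by rewrite sqrrN.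
rewrite sN in l3; move: F; rewrite E !ler_norml => /andP[f1 f2].
have -> : 17 * De ^+ 2 / B = 4 * (4 * De ^+ 2 / B) + De ^+ 2 / B by ring.
apply/andP; split; lra.
Qed.

Lemma rfac_sqr (k : nat) (u : Cx) : 0 <= Re u -> Im u != 0 ->
  cmod (rfac k u) ^+ 2 = expR (rphi (k%:R + 3 / 4) ((Re u - 2^-1) / 2) (Im u / 2)).
Proof.
move=> hu hy; have w2 : 0 < (Im u / 2) ^+ 2.
  by rewrite lt_neqAle sqr_ge0 andbT eq_sym expf_neq0 // mulf_neq0 // invr_neq0.
have p x : 0 < x ^+ 2 + (Im u / 2) ^+ 2 :> R by rewrite ltr_wpDl ?sqr_ge0.
rewrite /rfac cmodM cmodV exprMn exprVn !cmod_sqr /rphi expRB !lnK ?posrE //.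
rewrite !(ReD, ReB, ImD, ImB, ReN, ImN, Re_half, Im_half, Re_nat, Im_nat, Re1, Im1).
by congr (_ / _); field.
Qed.

Lemma rsum_inv (w : R) m : 1 <= `|w| -> \sum_(0 <= k < m) ((k%:R + 3 / 4) ^+ 2 + w ^+ 2)^-1 <= 2.
Proof.
move=> hw; have w2 : 1 <= w ^+ 2.
  by rewrite -[w ^+ 2]real_normK ?num_real // -[1](expr1n _ 2) ler_pXn2r ?nnegrE.
suff : \sum_(0 <= k < m) ((k%:R + 3 / 4) ^+ 2 + w ^+ 2)^-1 <= 2 - 2 * m.+1%:R^-1.
  have : 0 <= m.+1%:R^-1 :> R by rewrite invr_ge0 ler0n.
  move: (m.+1%:R^-1) => x; lra.
elim: m => [|m ih]; first by rewrite big_geq // invr1; lra.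
rewrite big_nat_recr //=; have m0 : 0 <= m%:R :> R by rewrite ler0n.
have m1 : 0 < m.+1%:R :> R by rewrite ltr0n.
have m2 : 0 < m.+2%:R :> R by rewrite ltr0n.
have h : ((m%:R + 3 / 4) ^+ 2 + w ^+ 2)^-1 <= 2 * m.+1%:R^-1 - 2 * m.+2%:R^-1.
  have -> : 2 * m.+1%:R^-1 - 2 * m.+2%:R^-1 = (m.+1%:R * m.+2%:R / 2)^-1 :> R.
    by rewrite -mulrBr -[m.+2%:R]natr1 inv_sub_succ // invf_div.
  rewrite lef_pV2 ?posrE ?divr_gt0 ?mulr_gt0 //; last by rewrite ltr_wpDl ?sqr_ge0 //; lra.
  rewrite -[m.+2%:R]natr1 -[m.+1%:R]natr1; have := mulr_ge0 m0 m0; move: (m%:R : R) m0 => x; lra.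
apply: le_trans (lerD ih h) _; move: (m.+1%:R^-1) (m.+2%:R^-1) => x y; lra.
Qed.

Lemma rprod_sqr (u : Cx) m : 0 <= Re u -> Im u != 0 ->
  cmod (rprod u m) ^+ 2 = expR (2 * (Re u - 2^-1) * ln m%:R +
     \sum_(0 <= k < m) rphi (k%:R + 3 / 4) ((Re u - 2^-1) / 2) (Im u / 2)).
Proof.
move=> hu hy; rewrite /rprod cmodM exprMn expRD; congr (_ * _).
  rewrite cmod_natpow half_rc !ReImE -expRM_natl; congr expR; ring.
rewrite cmod_prod expR_sum -prodrXl; apply: eq_bigr => k _; exact: rfac_sqr.
Qed.

(** At d = 1/2 the upper shift of one term is the lower shift of the next, so the sum telescopes. *)
Lemma rphi_half_sum (w : R) m : \sum_(0 <= k < m) rphi (k%:R + 3 / 4) 2^-1 w =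
  ln ((1 / 4) ^+ 2 + w ^+ 2) - ln ((m%:R + 1 / 4) ^+ 2 + w ^+ 2).
Proof.
elim: m => [|m ih]; first by rewrite big_geq // add0r subrr.
rewrite big_nat_recr //= ih /rphi -[m.+1%:R]natr1.
have -> : m%:R + 3 / 4 - 2^-1 = m%:R + 1 / 4 :> R by field.
have -> : m%:R + 3 / 4 + 2^-1 = m%:R + 1 + 1 / 4 :> R by field.
ring.
Qed.
End RatioSize.

(** * The order of growth of the gamma quotient *)

Section RatioAsymptotics.
Variable R : realType.
Local Notation Cx := (C R).

(** Shows that the growth in m of the telescoped sum is cancelled by the power of m in [rprod], up
    to a bounded amount. *)
Lemma log_gap (m w : R) : 1 <= m -> `|w| <= m -> 0 <= ln ((m + 1 / 4) ^+ 2 + w ^+ 2) - 2 * ln m <= 2.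
Proof.
move=> m1 wm; have m0 : 0 < m by lra.
have w2 : w ^+ 2 <= m ^+ 2 by rewrite -[w ^+ 2]real_normK ?num_real // ler_pXn2r ?nnegrE // ltW.
have w20 := sqr_ge0 w; have mm : 1 <= m ^+ 2 by rewrite -[1](expr1n _ 2) ler_pXn2r ?nnegrE // ltW.
have E : 2 * ln m = ln (m ^+ 2) by rewrite lnXn // mulr_natl.
have mm' : m <= m ^+ 2 by rewrite expr2 ler_peMl // ltW.
have h1 : m ^+ 2 <= (m + 1 / 4) ^+ 2 + w ^+ 2.
  have -> : (m + 1 / 4) ^+ 2 = m ^+ 2 + m / 2 + 1 / 16 by field.
  lra.
have h2 : (m + 1 / 4) ^+ 2 + w ^+ 2 <= m ^+ 2 * 3.
  have -> : (m + 1 / 4) ^+ 2 = m ^+ 2 + m / 2 + 1 / 16 by field.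
  lra.
have p : 0 < (m + 1 / 4) ^+ 2 + w ^+ 2 by lra.
rewrite E; apply/andP; split; first by rewrite subr_ge0 ler_ln ?posrE //; lra.
have : ln ((m + 1 / 4) ^+ 2 + w ^+ 2) <= ln (m ^+ 2 * 3) by rewrite ler_ln ?posrE //; lra.
rewrite lnM ?posrE //; last by lra.
have : ln 3 <= 2 :> R.
  have := @le_ln1Dx R 2; rewrite (_ : 1 + 2 = 3 :> R); last by ring.
  by apply; lra.
lra.
Qed.

Lemma log_height (y : R) : 1 <= `|y| -> `|ln ((1 / 4) ^+ 2 + (y / 2) ^+ 2) - 2 * ln `|y| | <= 3.
Proof.
move=> y1; have E : 2 * ln `|y| = ln (y ^+ 2) by rewrite -[y ^+ 2]real_normK ?num_real // lnXn ?mulr_natl //; lra.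
have y2 : 1 <= y ^+ 2.
  by rewrite -[y ^+ 2]real_normK ?num_real // -[1](expr1n _ 2) ler_pXn2r ?nnegrE.
have -> : (1 / 4) ^+ 2 + (y / 2) ^+ 2 = 1 / 16 + y ^+ 2 / 4 by field.
have a1 : ln (1 / 16 + y ^+ 2 / 4) <= ln (y ^+ 2) by rewrite ler_ln ?posrE //; lra.
have a2 : ln (y ^+ 2) <= ln (4 * (1 / 16 + y ^+ 2 / 4)) by rewrite ler_ln ?posrE //; lra.
have p1 : 0 < 4 :> R by rewrite ltr0n.
have p2 : 0 < 1 / 16 + y ^+ 2 / 4 by lra.
rewrite (lnM p1 p2) in a2.
have a3 : ln 4 <= 3 :> R.
  have := @le_ln1Dx R 3; rewrite (_ : 1 + 3 = 4 :> R); last by ring.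
  by apply; lra.
rewrite E ler_norml; lra.
Qed.

Lemma rphi_sum_bound (d w De : R) m : `|d| <= De -> 1 <= De -> 2 * De <= `|w| ->
  `|\sum_(0 <= k < m) rphi (k%:R + 3 / 4) d w - 2 * d * \sum_(0 <= k < m) rphi (k%:R + 3 / 4) 2^-1 w| <=
  34 * De ^+ 2 * (1 + 2 * De).
Proof.
move=> hd De1 hw; have w1 : 1 <= `|w| by lra.
have w0 : 0 < `|w| by lra.
rewrite mulr_sumr -sumrB.
set K := 17 * De ^+ 2 * (1 + 2 * De).
have De2 : 0 <= 17 * De ^+ 2 by rewrite mulr_ge0 // sqr_ge0.
have K0 : 0 <= K by rewrite mulr_ge0 //; lra.
have D0 : 0 <= De by lra.
have one k : `|rphi (k%:R + 3 / 4) d w - 2 * d * rphi (k%:R + 3 / 4) 2^-1 w| <= K * ((k%:R + 3 / 4) ^+ 2 + w ^+ 2)^-1.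
  set c : R := k%:R + 3 / 4; have c0 : 0 <= c by rewrite addr_ge0.
  set B := c ^+ 2 + w ^+ 2.
  have hh : `|2^-1 : R| <= De by rewrite ger0_norm ?invr_ge0 //; apply: le_trans De1; rewrite invf_le1 ?ler1n.
  have h1 := rphi_bound c0 hd hw w0; have h2 := rphi_bound c0 hh hw w0.
  rewrite -/B in h1 h2.
  have -> : rphi c d w - 2 * d * rphi c 2^-1 w =
    (rphi c d w + 4 * c * d / B) - 2 * d * (rphi c 2^-1 w + 4 * c * 2^-1 / B).
    by move: (rphi _ _ _) (rphi _ _ _) (B^-1) => p q t; field.
  apply: le_trans (ler_normB _ _) _; rewrite normrM.
  have d2 : `|2 * d| <= 2 * De by rewrite normrM (ger0_norm (ler0n _ 2)) ler_wpM2l.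
  have h3 := ler_pM (normr_ge0 _) (normr_ge0 _) d2 h2.
  have -> : K / B = 17 * De ^+ 2 / B + 2 * De * (17 * De ^+ 2 / B) by rewrite /K; ring.
  lra.
apply: le_trans (ler_norm_sum _ _ _) _.
apply: (@le_trans _ _ (K * \sum_(0 <= k < m) ((k%:R + 3 / 4) ^+ 2 + w ^+ 2)^-1)).
  by rewrite mulr_sumr; apply: ler_sum => k _; exact: one.
apply: (@le_trans _ _ (K * 2)); first by rewrite ler_wpM2l // rsum_inv.
rewrite /K; lra.
Qed.

(* With d = (Re u - 1/2)/2 and w = Im u / 2, the k-th factor has squared modulus
   ((c-d)^2 + w^2) / ((c+d)^2 + w^2) for c = k + 3/4; comparison with the case
   d = 1/2, where the product telescopes, gives the order of growth. *)
Lemma rlim_size (B : R) : exists K T : R, [/\ 0 < K, 1 <= T & forall u : Cx, 0 <= Re u -> Re u <= B -> T <= `|Im u| ->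
  expR (- K + (Re u - 2^-1) * ln `|Im u|) <= cmod (rlim u) <= expR (K + (Re u - 2^-1) * ln `|Im u|)].
Proof.
pose De := 1 + `|B|; have De1 : 1 <= De by rewrite lerDl.
pose K := 17 * De ^+ 2 * (1 + 2 * De) + 5 * De.
have K0 : 0 < K by rewrite ltr_wpDl ?mulr_ge0 ?sqr_ge0 //; lra.
exists K, (4 * De); split => //; first lra.
move=> u hu uB hT; have y1 : 1 <= `|Im u| by lra.
have y0 : Im u != 0 by rewrite -normr_gt0; lra.
pose d := (Re u - 2^-1) / 2; pose w := Im u / 2.
have h0 : 2^-1 = 1 / 2 :> R by rewrite mul1r.
have hB := ler_norm B.
have hd : `|d| <= De by rewrite /d ler_norml /De h0; lra.
have hw : 2 * De <= `|w| by rewrite /w normrM [`|2^-1|]ger0_norm ?invr_ge0 //; lra.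
have H := rlim_cvg hu.
(* From here on |w| <= m, as [log_gap] requires. *)
pose N0 := (Num.truncn `|w|).+1.
have main m : (N0 <= m)%N -> expR (2 * (- K + (Re u - 2^-1) * ln `|Im u|)) <= cmod (rprod u m) ^+ 2 <=
    expR (2 * (K + (Re u - 2^-1) * ln `|Im u|)).
  move=> hm; have m1 : 1 <= m%:R :> R by rewrite ler1n; exact: leq_trans hm.
  have wm : `|w| <= m%:R by apply/ltW/(lt_le_trans (truncnS_gt _)); rewrite ler_nat.
  have /andP[g1 g2] := log_gap m1 wm; have lh := log_height y1; rewrite -/w in lh.
  have S := rphi_sum_bound m hd De1 hw; rewrite rphi_half_sum in S.
  rewrite (rprod_sqr m hu y0) -/d -/w !ler_expR.
  move: S lh g1 g2; set S1 := \sum_(_ <= _ < _) _; set L1 := ln (_ + _); set L2 := ln (_ + w ^+ 2).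
  set L3 := ln `|_|; set L4 := ln m%:R => S lh g1 g2.
  have e1 : `|2 * d * (L2 - 2 * L4)| <= 2 * De * 2.
    rewrite normrM; apply: ler_pM => //; first by rewrite normrM (ger0_norm (ler0n _ 2)) ler_wpM2l.
    by rewrite ger0_norm.
  have e2 : `|2 * d * (L1 - 2 * L3)| <= 2 * De * 3.
    by rewrite normrM; apply: ler_pM => //; rewrite normrM (ger0_norm (ler0n _ 2)) ler_wpM2l.
  have ud : Re u - 2^-1 = 2 * d by rewrite /d; field.
  (* Three bounded differences are split off: the sum against its comparison case, the upper end
     against ln m, and the lower end against ln |Im u|. What is left is the asserted order. *)
  have -> : 2 * (Re u - 2^-1) * L4 + S1 =
     (S1 - 2 * d * (L1 - L2)) - 2 * d * (L2 - 2 * L4) + 2 * d * (L1 - 2 * L3) + 2 * (2 * d * L3) by rewrite ud; ring.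
  rewrite ud; move: S e1 e2; rewrite !ler_norml => /andP[s1 s2] /andP[t1 t2] /andP[r1 r2].
  have KE : 2 * K = 34 * De ^+ 2 * (1 + 2 * De) + 10 * De by rewrite /K; ring.
  apply/andP; split; lra.
have fold x : expR (2 * x) = expR x ^+ 2 :> R by rewrite expRM_natl.
apply/andP; split.
  apply: (ccvg_ge (N0 := N0) H) => m /main /andP[h _]; move: h.
  by rewrite fold ler_pXn2r ?nnegrE ?expR_ge0 ?cmod_ge0.
apply: (ccvg_le_eventually (N0 := N0) H) => m /main /andP[_ h]; move: h.
by rewrite fold ler_pXn2r ?nnegrE ?expR_ge0 ?cmod_ge0.
Qed.
End RatioAsymptotics.

(** * The Riemann zeta function in vertical strips *)

Section Sieve.
Variable R : realType.
Local Notation Cx := (C R).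

(** Recursion on [k], so that passing from k to k + 1 is one step of the sieve. *)
Fixpoint rough (k n : nat) : bool :=
  if k is k'.+1 then rough k' n && ~~ (prime k'.+1 && (k'.+1 %| n)%N) else true.

Lemma rough_mul k p m : prime p -> (k < p)%N -> rough k (p * m) = rough k m.
Proof.
move=> pp; elim: k => [|k ih] // kp /=; rewrite ih; last exact: ltnW.
congr (_ && ~~ _); case: (boolP (prime k.+1)) => //= pk.
rewrite Euclid_dvdM // dvdn_prime2 //.
by case: eqP kp => [->|_] //; rewrite ltnn.
Qed.

Lemma rough_false k q n : prime q -> (q <= k)%N -> (q %| n)%N -> rough k n = false.
Proof.
move=> pq; elim: k => [|k ih] /=; first by rewrite leqn0 => /eqP E; rewrite E in pq.
rewrite leq_eqVlt => /orP[/eqP E|qk] qn; first by rewrite -E pq qn andbF.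
by rewrite ih.
Qed.

Lemma rough_small k n : (1 < n)%N -> (n <= k)%N -> rough k n = false.
Proof.
move=> n1 nk; apply: (@rough_false k (pdiv n)); rewrite ?pdiv_prime ?pdiv_dvd //.
by apply: leq_trans nk; apply: pdiv_leq; exact: ltnW.
Qed.

Lemma rough1 k : rough k 1.
Proof. by elim: k => [|k ih] //=; rewrite ih dvdn1; case: k {ih} => [|k] //=; rewrite andbF. Qed.

Definition asum k (w : Cx) N : Cx := \sum_(1 <= n < N.+1 | rough k n) natpow n (- w).

Lemma asumS k w N : asum k w N.+1 = asum k w N + (if rough k N.+1 then natpow N.+1 (- w) else 0).
Proof. by rewrite /asum big_mkcond [in RHS]big_mkcond big_nat_recr. Qed.

Lemma asum_dsum w N : asum 0 w N = dsum w N.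
Proof. by rewrite /asum big_add1. Qed.

(** The integers discarded at a prime p = k + 1 are the p m with m <= N / p, where m is rough
    exactly when p m is, because p exceeds k. *)
Lemma asum_sieve k w N : prime k.+1 ->
  asum k.+1 w N = asum k w N - natpow k.+1 (- w) * asum k w (N %/ k.+1)%N.
Proof.
move=> pk; elim: N => [|N ih].
  by rewrite div0n /asum !big_geq // mulr0 subr0.
rewrite !asumS ih divnS // /= pk /=; case: (boolP (k.+1 %| N.+1)%N) => [/dvdnP[m Em]|nd].
  rewrite andbF add1n asumS.
  have -> : (N %/ k.+1).+1 = m.
    by have := divnS N (ltn0Sn k); rewrite Em dvdn_mull // add1n mulnK.
  have m0 : (0 < m)%N by case: m Em.
  rewrite Em mulnC rough_mul //; case: ifP => _; last by ring.
  by rewrite natpowM //; ring.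
by rewrite andbT add0n; ring.
Qed.

Lemma asum_cvg k (w : Cx) : 1 < Re w -> exists2 a, ccvg (asum k w) a & cmod a <= 2 ^+ k * cmod (dzeta w).
Proof.
move=> hw; elim: k => [|k [a Ha ba]].
  exists (dzeta w); last by rewrite expr0 mul1r.
  have d0 : 0 < Re w - 1 by lra.
  have [H _] := @dzeta_tail R (Re w - 1) w d0 ltac:(lra).
  by apply: (ccvg_eventually (N0 := 0%N)) H => n _; rewrite asum_dsum.
case: (boolP (prime k.+1)) => pk; last first.
  exists a.
    apply: (ccvg_eventually (N0 := 0%N)) Ha => n _; rewrite /asum; apply: eq_bigl => i /=.
    by rewrite (negbTE pk) /= andbT.
  apply: le_trans ba _; rewrite exprS ler_wpM2r ?cmod_ge0 // ler_peMl ?exprn_ge0 //.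
  by rewrite ler1n.
exists (a + - natpow k.+1 (- w) * a).
  apply: (ccvg_eventually (N0 := 0%N)) (ccvgD Ha (ccvg_scale (- natpow k.+1 (- w)) (ccvg_subseq (phi := fun N => (N %/ k.+1)%N) _ Ha))) => [n _|M].
    by rewrite asum_sieve // mulNr.
  by exists (M * k.+1)%N => n hn; rewrite leq_divRL.
apply: le_trans (cmodD _ _) _; rewrite cmodM cmodN cmod_natpow exprS.
have : expR (Re (- w) * ln k.+1%:R) <= 1.
  rewrite -[X in _ <= X]expR0 ler_expR ReImE mulNr oppr_le0; apply: mulr_ge0; first lra.
  by rewrite ln_ge0 // ler1n.
move=> h; have := ler_wpM2r (cmod_ge0 a) h; lra.
Qed.

(** Up to k only n = 1 survives the sieve, so the bound is 0 while N <= k; beyond k it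
    telescopes. *)
Lemma asum_tail k (w : Cx) (e : R) N : 0 < e -> 1 + e <= Re w -> (0 < k)%N -> (0 < N)%N ->
  cmod (asum k w N - 1) <= pbound e k - pbound e (maxn k N).
Proof.
move=> e0 hw k0; elim: N => [|[|N] ih] // _.
  rewrite asumS {1}/asum big_geq // add0r.
  rewrite rough1 natpow1 subrr cmod0 (maxn_idPl k0) subrr //.
rewrite asumS; case: (leqP N.+2 k) => hk.
  rewrite rough_small // addr0; apply: le_trans (ih isT) _.
  have h2 : maxn k N.+1 = k by apply/maxn_idPl; exact: ltnW.
  by rewrite h2.
have hk' : (k <= N.+1)%N by [].
have := ih isT; rewrite (maxn_idPr hk') => h.
have hs : cmod (if rough k N.+2 then natpow N.+2 (- w) else 0) <= pbound e N.+1 - pbound e N.+2.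
  apply: le_trans (pbound_step e0 (ltn0Sn N)).
  case: ifP => _; last by rewrite cmod0 expR_ge0.
  rewrite cmod_natpow -mulNr; apply: expR_ln_mono => //; rewrite ReImE; lra.
have -> : asum k w N.+1 + (if rough k N.+2 then natpow N.+2 (- w) else 0) - 1 =
  (asum k w N.+1 - 1) + (if rough k N.+2 then natpow N.+2 (- w) else 0) by ring.
apply: le_trans (cmodD _ _) _; lra.
Qed.

(* Removing from the series the integers divisible by a prime at most k amounts to
   multiplying it by the factors 1 - p^(-w), each of modulus at most 2, and leaves
   1 plus a tail. *)
Lemma dzeta_lower (e : R) : 0 < e -> exists2 c : R, 0 < c & forall w : Cx, 1 + e <= Re w -> c <= cmod (dzeta w).
Proof.
move=> e0; have [k hk] := pbound_small e0 (ltac:(lra) : 0 < 1 / 2 :> R).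
have p2 : 0 < 2 ^+ k.+1 :> R by rewrite exprn_gt0.
exists (1 / 2 / 2 ^+ k.+1); first by rewrite !divr_gt0.
move=> w hw; have w1 : 1 < Re w by lra.
have [a Ha ba] := asum_cvg k.+1 w1.
have pk := hk k.+1 (leqnSn k).
have ha : 1 / 2 <= cmod a.
  apply: (ccvg_ge (N0 := 1%N) Ha) => n n1.
  have := asum_tail e0 hw (ltn0Sn k) n1; have := pbound_ge0 (maxn k.+1 n) e0.
  have := cmod_lowD 1 (asum k.+1 w n - 1); rewrite subrKC cmod1; lra.
rewrite ler_pdivrMr // [X in _ <= X]mulrC; exact: le_trans ha ba.
Qed.

Lemma dzeta_upper (e : R) (w : Cx) : 0 < e -> 1 + e <= Re w -> cmod (dzeta w) <= 1 + e^-1.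
Proof.
move=> e0 hw; have [_ H] := dzeta_tail e0 hw; have := H 1%N isT.
rewrite /dsum big_nat1 natpow1 /pbound ln1 mulr0 oppr0 expR0 mul1r => h.
have := cmodD 1 (dzeta w - 1); rewrite subrKC cmod1; lra.
Qed.
End Sieve.

(** * The functional equation for complex s and the size of zeta *)

Section ZetaFunction.
Variable R : realType.
Local Notation Cx := (C R).

Lemma rcvg_ccvg (u : nat -> R) (l : R) : u n @[n --> \oo] --> l -> ccvg (fun n => rc (u n)) (rc l).
Proof.
move=> /cvgrPdist_le H e e0; have [N _ hN] := H e e0; exists N => n hn.
by rewrite -rcB cmod_rc distrC; exact: hN.
Qed.

Lemma ccvg_rcvg (u : nat -> Cx) (l : Cx) : ccvg u l -> Re (u n) @[n --> \oo] --> Re l.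
Proof.
move=> H; apply/cvgrPdist_le => e e0; have [N hN] := H e e0; exists N => // n /= hn.
rewrite distrC -ReB; exact: le_trans (Re_le _) (hN n hn).
Qed.

Lemma natpow_real n (x : R) : natpow n (rc x) = rc (expR (x * ln n%:R)).
Proof. by rewrite -[natpow _ _]/(pw _ _) pw_rc. Qed.

Lemma dsum_real (x : R) N : dsum (rc x) N = rc (\sum_(0 <= k < N) expR (- (x * ln k.+1%:R))).
Proof.
rewrite /dsum rc_sum; apply: eq_bigr => k _.
by rewrite -rcN natpow_real mulNr.
Qed.

Lemma ztrap_real (u : R) N : 0 < u -> (0 < N)%N -> ztrap (rc (- u)) N = - rc (trap_sum u N).
Proof.
move=> u0 N0; have h : 1 + u != 0 by rewrite gt_eqF //; lra.
rewrite /ztrap dsum_real /trap_sum.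
have -> : \sum_(0 <= k < N) expR (- (- u * ln k.+1%:R)) = \sum_(1 <= n < N) expR (u * ln n%:R) + expR (u * ln N%:R).
  rewrite -(big_nat_recr N 1 (fun n => expR (u * ln n%:R))) //= big_add1; apply: eq_bigr => k _.
  by rewrite mulNr opprK.
have -> : - rc (- u) = rc u by rewrite rcN opprK.
have -> : 1 + rc u = rc (1 + u) by rewrite rcD rc1.
rewrite !natpow_real half_rc -rcV -!rcM -!rcB -rcN; congr rc.
by field.
Qed.

(** The functional equation read as a definition of zeta(s) for Re s < 0, with u = - s. *)
Definition nzeta (kap : R) (s : Cx) : Cx :=
  - (rc kap * - s * cexp (s * rc (ln pi)) * rlim (- s) * dzeta (1 - s)).

Lemma nzeta_holo kap (s : Cx) : Re s < 0 -> holo (nzeta kap) s.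
Proof.
move=> hs; apply: holoN; apply: holoM; first apply: holoM; first apply: holoM.
- by prove_holo.
- by apply: holo_cexp; prove_holo.
- apply: (@holo_comp R (fun s => - s) (@rlim R)); first by prove_holo.
  by apply: rlim_holo; rewrite ReImE; lra.
- apply: (@holo_comp R (fun s => 1 - s) (@dzeta R)); first by prove_holo.
  by apply: dzeta_holo; rewrite !ReImE; lra.
Qed.

Lemma tzeta_nzeta_real (kap : R) : (forall u z : R, 0 < u -> u < 1 ->
  \sum_(0 <= k < M) expR (- ((1 + u) * ln k.+1%:R)) @[M --> \oo] --> z ->
  exists2 rho : R, ratio_prod u m @[m --> \oo] --> rho &
    trap_sum u N @[N --> \oo] --> kap * u * expR (- (u * ln pi)) * rho * z) ->
  forall u : R, 0 < u -> u < 1 -> tzeta (rc (- u)) = nzeta kap (rc (- u)).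
Proof.
move=> FE u u0 u1.
have hw : 1 + u <= Re (rc (1 + u)) by rewrite Re_rc.
have [Hd _] := dzeta_tail u0 hw.
have Hd' : ccvg (fun N => rc (\sum_(0 <= k < N) expR (- ((1 + u) * ln k.+1%:R)))) (dzeta (rc (1 + u))).
  by apply: (ccvg_eventually (N0 := 0%N)) Hd => n _; rewrite dsum_real.
have Hz := ccvg_rcvg Hd'.
have [rho Hr Ht] := FE u _ u0 u1 Hz.
have zE : dzeta (rc (1 + u)) = rc (Re (dzeta (rc (1 + u)))).
  apply: (ccvg_uniq Hd'); exact: rcvg_ccvg Hz.
have rE : rlim (rc u) = rc rho.
  have h0 : 0 <= Re (rc u) by rewrite Re_rc ltW.
  apply: (ccvg_uniq (rlim_cvg h0)); apply: (ccvg_eventually (N0 := 0%N)) (rcvg_ccvg Hr) => n _.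
  by rewrite rprod_real.
have s1 : rc (- u) != 1.
  by rewrite -rc1 -subr_eq0 -rcB rc_eq0 lt_eqF //; lra.
have d0 : 0 < 1 - u by rewrite subr_gt0.
have hs : -1 + (1 - u) <= Re (rc (- u)) by rewrite Re_rc; lra.
have [T _] := ztrap_tail d0 hs s1 (lexx _).
apply: (ccvg_uniq T).
have := ccvg_scale (- 1) (rcvg_ccvg Ht).
have -> : -1 * rc (kap * u * expR (- (u * ln pi)) * rho * Re (dzeta (rc (1 + u)))) = nzeta kap (rc (- u)).
  have e1 : - rc (- u) = rc u by rewrite rcN opprK.
  have e2 : 1 + rc u = rc (1 + u) by rewrite rcD rc1.
  have e3 : cexp (rc (- u) * rc (ln pi)) = rc (expR (- (u * ln pi))) by rewrite -rcM cexp_rc mulNr.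
  by rewrite /nzeta e3 e1 e2 rE [in RHS]zE !rcM; ring.
move=> H; apply: (ccvg_eventually (N0 := 1%N)) H => n n0.
by rewrite mulN1r ztrap_real.
Qed.

(** The difference vanishes on the real segment (-1, 0), hence near -1/2 by [holo_zero_real], and
    then along the segment from -1/2 to s inside the strip. *)
Lemma tzeta_nzeta (kap : R) : (forall u : R, 0 < u -> u < 1 -> tzeta (rc (- u)) = nzeta kap (rc (- u))) ->
  forall s : Cx, -1 < Re s -> Re s < 0 -> tzeta s = nzeta kap s.
Proof.
move=> Hr s s1 s2; pose f (w : Cx) := tzeta w - nzeta kap w.
have hf (w : Cx) : -1 < Re w -> Re w < 0 -> holo f w.
  move=> h1 h2; apply: holoB; last exact: nzeta_holo.
  by apply: tzeta_holo => //; apply/negP => /eqP E; rewrite E Re1 in h2; lra.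
have near (p w : Cx) (r : R) : r <= Re p + 1 -> r <= - Re p -> cmod (w - p) < r -> holo f w.
  move=> r1 r2 hw; have := Re_le (w - p); rewrite ReImE ler_norml => /andP[h1 h2].
  by apply: hf; lra.
have r2 : 0 < 1 / 2 :> R by lra.
have [d d0 Hd] : exists2 d : R, 0 < d & forall w, cmod (w - rc (- (1 / 2))) < d -> f w = 0.
  apply: (@holo_zero_real R f (- (1 / 2)) (1 / 2) r2) => [w hw|x hx].
    by apply: near hw; rewrite Re_rc; lra.
  move: hx; rewrite ltr_norml => /andP[h1 h2].
  have := Hr (- x); rewrite opprK /f => -> //; [by rewrite subrr|lra|lra].
have [d' d'0 Hd'] : exists2 d' : R, 0 < d' & forall w, cmod (w - s) < d' -> f w = 0.
  apply: (@holo_zero_segment R f (rc (- (1 / 2))) s d d0) => // x /andP[x0 x1].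
  set p := _ + _; have E : Re p = (1 - x) * - (1 / 2) + x * Re s by rewrite /p !ReImE; ring.
  have h1 : x * Re s <= 0 by rewrite mulr_ge0_le0 //; lra.
  have h2 : x * -1 <= x * Re s by rewrite ler_wpM2l //; lra.
  have p1 : -1 < Re p /\ Re p < 0.
    case: (eqVneq x 0) => [x00|xn0]; first by rewrite E x00; lra.
    have xp : 0 < x by rewrite lt_neqAle eq_sym xn0.
    have h3 : x * -1 < x * Re s by rewrite ltr_pM2l.
    have h4 : x * Re s < 0 by rewrite pmulr_rlt0.
    by rewrite E; lra.
  exists (Num.min (Re p + 1) (- Re p)); first by rewrite lt_min; lra.
  by move=> w; apply: near; rewrite ge_min lexx ?orbT.
apply/eqP; rewrite -subr_eq0 -/(f s) Hd' // subrr cmod0 //.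
Qed.

(** Says |ln x - E| <= K in a form that also forces x > 0; products add both parameters. *)
Definition near_exp (K E x : R) := expR (- K + E) <= x <= expR (K + E).

Lemma near_expM K E x K' E' y : near_exp K E x -> near_exp K' E' y -> near_exp (K + K') (E + E') (x * y).
Proof.
move=> /andP[a b] /andP[c d]; apply/andP; split.
  have -> : - (K + K') + (E + E') = (- K + E) + (- K' + E') by ring.
  by rewrite expRD ler_pM ?expR_ge0.
have -> : K + K' + (E + E') = (K + E) + (K' + E') by ring.
rewrite expRD ler_pM //; [exact: le_trans (expR_ge0 _) a|exact: le_trans (expR_ge0 _) c].
Qed.

Lemma near_exp_bounded (a b : R) : 0 < a -> exists K, forall x, a <= x -> x <= b -> near_exp K 0 x.
Proof.
move=> a0; exists (`|ln a| + `|ln (Num.max a b)|) => x ax xb; rewrite /near_exp !addr0.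
have x0 : 0 < x by lra.
have m0 : 0 < Num.max a b by rewrite lt_max a0.
have xm : x <= Num.max a b by rewrite le_max xb orbT.
have l1 : ln a <= ln x by rewrite ler_ln.
have l2 : ln x <= ln (Num.max a b) by rewrite ler_ln.
have n1 := ler_norm (- ln a); rewrite normrN in n1; have n2 := ler_norm (ln (Num.max a b)).
have n3 := normr_ge0 (ln a); have n4 := normr_ge0 (ln (Num.max a b)).
by apply/andP; split; [rewrite -[X in _ <= X](lnK x0)|rewrite -[X in X <= _](lnK x0)]; rewrite ler_expR; lra.
Qed.

(* zeta is written for the meromorphic continuation of the Riemann zeta function. *)
Lemma zeta_continuation : exists zeta : Cx -> Cx, [/\
  forall s, s != 1 -> holo zeta s,
  forall s, 1 < Re s -> ccvg (dsum s) (zeta s) &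
  forall B eta : R, 0 < eta -> exists K T : R, 1 <= T /\ forall s : Cx, - B <= Re s -> Re s <= - eta -> T <= `|Im s| ->
    near_exp K ((2^-1 - Re s) * ln `|Im s|) (cmod (zeta s))].
Proof.
have [kap k0 FE] := @real_functional_equation R.
have TN := tzeta_nzeta (tzeta_nzeta_real FE).
(* The two expressions agree for -1 < Re s < 0, and the cut is made inside this strip, so each point
   has a neighbourhood where one of them represents zeta. *)
pose zeta (s : Cx) := if Re s <= - (1 / 2) then nzeta kap s else tzeta s.
have zN (s : Cx) : Re s < 0 -> zeta s = nzeta kap s.
  by move=> hs; rewrite /zeta; case: leP => // h; apply: TN => //; lra.
exists zeta; split.
- move=> s s1; case: (ltP (Re s) 0) => hs.
    have r0 : 0 < - Re s by lra.
    apply: (holo_local r0) (nzeta_holo kap hs) => w hw; rewrite zN //.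
    by have := Re_le (w - s); rewrite ReImE ler_norml => /andP[h1 h2]; lra.
  have r0 : 0 < 1 / 2 :> R by lra.
  apply: (holo_local r0) (tzeta_holo _ s1); last lra.
  move=> w hw; rewrite /zeta; case: leP => // h.
  have := Re_le (w - s); rewrite ReImE ler_norml => /andP[h1 h2]; exfalso; lra.
- move=> s hs; have -> : zeta s = dzeta s.
    rewrite /zeta; case: leP => h; first by exfalso; lra.
    exact: tzeta_dzeta.
  have d0 : 0 < Re s - 1 by lra.
  by have [H _] := @dzeta_tail R (Re s - 1) s d0 ltac:(lra).
- move=> B eta eta0.
  have [K1 [T1 [_ T11 H1]]] := @rlim_size R (Num.max B 0).
  have [c c0 Hc] := @dzeta_lower R eta eta0.
  have [K2 H2] := @near_exp_bounded c (1 + eta^-1) c0.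
  have [K3 H3] := @near_exp_bounded kap kap k0.
  have [K4 H4] := @near_exp_bounded (expR (- (`|B| * ln pi))) 1 (expR_gt0 _).
  have [K5 H5] := @near_exp_bounded 1 (1 + `|B|) ltr01.
  have lp : 0 <= ln pi :> R by rewrite ln_ge0 //; have := @pi_ge2 R; lra.
  exists (K3 + K5 + K4 + K1 + K2), T1; split => // s sB se hT.
  have s0 : Re s < 0 by lra.
  have t1 : 1 <= `|Im s| by lra.
  have t0 : 0 < `|Im s| by lra.
  have hB := ler_norm B.
  rewrite (zN s s0) /nzeta cmodN !cmodM cmodN cmod_cexp cmod_rc (gtr0_norm k0).
  have -> : Re (s * rc (ln pi)) = Re s * ln pi by rewrite !ReImE; ring.
  have a1 : near_exp K3 0 kap by exact: H3.
  have a2 : near_exp K5 (ln `|Im s|) (cmod s).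
    have -> : cmod s = cmod s / `|Im s| * expR (ln `|Im s|) by rewrite lnK ?posrE // divfK // gt_eqF.
    have -> : ln `|Im s| = 0 + ln `|Im s| by rewrite add0r.
    have -> : K5 = K5 + 0 by rewrite addr0.
    rewrite {2}add0r; apply: near_expM; last by rewrite /near_exp oppr0 !add0r lexx.
    apply: H5; first by rewrite ler_pdivlMr // mul1r Im_le.
    rewrite ler_pdivrMr //; apply: le_trans (cmod_le_ReIm s) _.
    rewrite mulrDl mul1r addrC lerD2l; apply: (@le_trans _ _ (`|B| * 1)); last by rewrite ler_wpM2l.
    rewrite mulr1 ler0_norm; lra.
  have a3 : near_exp K4 0 (expR (Re s * ln pi)).
    apply: H4; rewrite ?ler_expR -?expR0 ?ler_expR; last by rewrite mulr_le0_ge0 // ltW.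
    rewrite -mulNr ler_wpM2r //; lra.
  have a4 : near_exp K1 ((- Re s - 2^-1) * ln `|Im s|) (cmod (rlim (- s))).
    have := H1 (- s); rewrite !ReImE normrN; apply => //; first lra.
    by rewrite le_max; apply/orP; left; lra.
  have a5 : near_exp K2 0 (cmod (dzeta (1 - s))).
    have hw : 1 + eta <= Re (1 - s) by rewrite !ReImE; lra.
    by apply: H2; [exact: Hc|exact: dzeta_upper].
  (* The factor s contributes order 1 and the gamma quotient - Re s - 1/2; the remaining factors are
     bounded above and below. *)
  have := near_expM (near_expM (near_expM (near_expM a1 a2) a3) a4) a5.
  rewrite add0r !addr0; have -> // : ln `|Im s| + (- Re s - 2^-1) * ln `|Im s| = (2^-1 - Re s) * ln `|Im s|.
  by move: (ln _) => x; field.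
Qed.
End ZetaFunction.

(** * Symmetric sums *)

Section InjectiveSums.
Variable R : realType.
Local Notation Cx := (C R).

Definition bump_at (b : R) (A : seq R) (i : nat) : seq R := set_nth 0 A i (nth 0 A i + b).

Lemma size_bump_at b A i : (i < size A)%N -> size (bump_at b A i) = size A.
Proof. by move=> h; rewrite size_set_nth (maxn_idPr h). Qed.

Section FixN.
Variables (N : nat) (s : Cx).

Definition dterm (b : R) (n : 'I_N) : Cx := natpow n.+1 (- (rc b * s)).

Lemma dtermD b c n : dterm (b + c) n = dterm b n * dterm c n.
Proof. by rewrite /dterm -natpowD rcD; congr natpow; ring. Qed.

(* The sum of prod_i (n_i + 1)^(- b_i s) over injective tuples n avoiding U, where A = (b_i). *)
Fixpoint jsum (A : seq R) (U : {set 'I_N}) : Cx :=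
  if A is b :: A' then \sum_(n | n \notin U) dterm b n * jsum A' (n |: U) else 1.

(* jsum A U - jsum A (n |: U) is the sum over the tuples that take the value n once; merging
   the new exponent b into that place gives bump_at. *)
Lemma jsum_defect (A : seq R) (U : {set 'I_N}) (b : R) :
  \sum_(n | n \notin U) dterm b n * (jsum A U - jsum A (n |: U)) =
  \sum_(0 <= i < size A) jsum (bump_at b A i) U.
Proof.
elim: A U => [|c A ih] U.
  by rewrite big_geq //; apply: big1 => n _; rewrite /= subrr mulr0.
rewrite [RHS]big_nat_recl //=.
have E n : n \notin U -> jsum (c :: A) U - jsum (c :: A) (n |: U) =
    dterm c n * jsum A (n |: U) +
    \sum_(m | (m \notin U) && (m != n)) dterm c m * (jsum A (m |: U) - jsum A (n |: (m |: U))).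
  move=> nU; rewrite /= (bigD1 n) //= -addrA; congr (_ + _).
  rewrite (eq_bigl (fun m => (m \notin U) && (m != n))) //.
  rewrite [X in _ - X](eq_bigl (fun m => (m \notin U) && (m != n))); last first.
    by move=> m; rewrite !inE negb_or andbC.
  by rewrite -sumrB; apply: eq_bigr => m _; rewrite finset.setUCA mulrBr.
rewrite (eq_bigr (fun n => dterm (c + b) n * jsum A (n |: U) +
   \sum_(m | (m \notin U) && (m != n)) dterm b n * (dterm c m * (jsum A (m |: U) - jsum A (n |: (m |: U)))))); last first.
  by move=> n nU; rewrite (E n nU) mulrDr dtermD mulr_sumr; congr (_ + _); ring.
rewrite big_split /=; congr (_ + _).
rewrite (exchange_big_dep (fun m => m \notin U)) /=; last by move=> n m _ /andP[].
rewrite exchange_big /=; apply: eq_bigr => m mU.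
rewrite -mulr_sumr -(ih (m |: U)) mulr_sumr.
rewrite (eq_bigl (fun n => n \notin m |: U)); last first.
  by move=> n; rewrite !inE negb_or mU /= eq_sym andbC.
by apply: eq_bigr => n _; ring.
Qed.

(** Exact for every N: dropping the condition that the first entry avoids the others gives a
    product, and [jsum_defect] counts the excess. [symz_cons] is its limit. *)
Lemma jsum_cons (A : seq R) (b : R) : jsum (b :: A) finset.set0 =
  dsum (rc b * s) N * jsum A finset.set0 - \sum_(0 <= i < size A) jsum (bump_at b A i) finset.set0.
Proof.
rewrite -jsum_defect /= /dsum big_mkord mulr_suml.
rewrite (eq_bigl predT); last by move=> n; rewrite inE.
rewrite [X in _ - X](eq_bigl predT); last by move=> n; rewrite inE.
by rewrite -sumrB; apply: eq_bigr => n _; rewrite /dterm; ring.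
Qed.

Definition injU k (U : {set 'I_N}) (m : {ffun 'I_k -> 'I_N}) :=
  injectiveb m && [forall i, m i \notin U].

Definition ffcons k (p : 'I_N * {ffun 'I_k -> 'I_N}) : {ffun 'I_k.+1 -> 'I_N} :=
  [ffun i => if unlift ord0 i is Some j then p.2 j else p.1].

Lemma ffcons0 k (p : 'I_N * {ffun 'I_k -> 'I_N}) : ffcons p ord0 = p.1.
Proof. by rewrite ffunE unlift_none. Qed.
Lemma ffconsS k (p : 'I_N * {ffun 'I_k -> 'I_N}) j : ffcons p (lift ord0 j) = p.2 j.
Proof. by rewrite ffunE liftK. Qed.

Lemma injU_cons k U (p : 'I_N * {ffun 'I_k -> 'I_N}) :
  injU U (ffcons p) = (p.1 \notin U) && injU (p.1 |: U) p.2.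
Proof.
apply/andP/andP => [[/injectiveP h1 /forallP h2]|[h1 /andP[/injectiveP h2 /forallP h3]]].
  split; first by have := h2 ord0; rewrite ffcons0.
  apply/andP; split.
    by apply/injectiveP => i j e; apply: (@lift_inj _ ord0); apply: h1; rewrite !ffconsS.
  apply/forallP => i; rewrite !inE negb_or; have := h2 (lift ord0 i); rewrite ffconsS => ->.
  rewrite andbT; apply/eqP => e; have := h1 (lift ord0 i) ord0.
  by rewrite ffconsS ffcons0 e => /(_ erefl) /(congr1 val).
split.
  apply/injectiveP => i j; case: (unliftP ord0 i) => [i'|] ->; case: (unliftP ord0 j) => [j'|] ->;
    rewrite ?ffconsS ?ffcons0 //.
  - by move=> /h2 ->.
  - by move=> e; have := h3 i'; rewrite e !inE eqxx.
  - by move=> e; have := h3 j'; rewrite -e !inE eqxx.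
apply/forallP => i; case: (unliftP ord0 i) => [j|] ->; rewrite ?ffconsS ?ffcons0 //.
by have := h3 j; rewrite !inE negb_or => /andP[].
Qed.

Lemma jsum_injective k (a : 'I_k -> R) U :
  \sum_(m : {ffun 'I_k -> 'I_N} | injU U m) \prod_i dterm (a i) (m i) = jsum [seq a i | i <- enum 'I_k] U.
Proof.
elim: k a U => [|k ih] a U.
  have -> : enum 'I_0 = [::] by apply: size0nil; rewrite size_enum_ord.
  rewrite (big_pred1 [ffun i : 'I_0 => False_rect _ (ltac:(by case: i))]) /=; first by rewrite big_ord0.
  move=> m; have -> : injU U m by apply/andP; split; [apply/injectiveP => -[]|apply/forallP => -[]].
  by apply/esym/eqP/ffunP => -[].
rewrite enum_ordSl /= -map_comp.
have bij : {on [pred m | injU U m], bijective (@ffcons k)}.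
  exists (fun m => (m ord0, [ffun j => m (lift ord0 j)])) => [[n m]|m] _ /=.
    rewrite ffcons0; congr (_, _); apply/ffunP => j; by rewrite ffunE ffconsS.
  apply/ffunP => i; case: (unliftP ord0 i) => [j|] ->; rewrite ?ffconsS ?ffcons0 //=.
  by rewrite ffunE.
rewrite (reindex _ bij) /=.
rewrite (eq_bigl (fun p => (p.1 \notin U) && injU (p.1 |: U) p.2)); last by move=> p; rewrite injU_cons.
rewrite -(pair_big_dep (fun n => n \notin U) (fun n m => injU (n |: U) m) (fun n m => \prod_i dterm (a i) (ffcons (n, m) i))) /=.
apply: eq_bigr => n nU; rewrite -(ih (fun i => a (lift ord0 i)) (n |: U)) mulr_sumr; apply: eq_bigr => m _.
rewrite big_ord_recl ffcons0; congr (_ * _); apply: eq_bigr => i _; by rewrite ffconsS.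
Qed.

Definition incr k (m : 'I_k -> 'I_N) := [forall i : 'I_k, forall j : 'I_k, (i < j)%N ==> (m i < m j)%N].

Lemma incrP k (m : 'I_k -> 'I_N) : reflect (forall i j : 'I_k, (i < j)%N -> (m i < m j)%N) (incr m).
Proof.
apply: (iffP forallP) => [h i j ij|h i]; first by have /forallP/(_ j)/implyP := h i; exact.
by apply/forallP => j; apply/implyP; exact: h.
Qed.

Lemma card_ord_lt k (l : 'I_k) : #|[pred j : 'I_k | (j < l)%N]| = l.
Proof. by rewrite -sum1_card -(big_ord_widen k (fun=> 1%N) (ltnW (ltn_ord l))) sum1_card card_ord. Qed.

(* An injective tuple is increasing along exactly one permutation: the inverse of
   the one that sends each index to its rank. *)
Lemma incr_perm k (m : {ffun 'I_k -> 'I_N}) : injectiveb m ->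
  exists t0 : 'S_k, forall t : 'S_k, incr (fun l => m (t l)) = (t == t0).
Proof.
move=> /injectiveP mi.
pose rk (i : 'I_k) := #|[pred j : 'I_k | (m j < m i)%N]|.
have rlt i : (rk i < k)%N.
  rewrite -[X in (_ < X)%N](card_ord k); apply: proper_card; apply/properP; split; first by apply/fintype.subsetP.
  by exists i; rewrite !inE // ltnn.
have rmono i j : (m i < m j)%N -> (rk i < rk j)%N.
  move=> h; apply: proper_card; apply/properP; split.
    by apply/fintype.subsetP => l; rewrite !inE => hl; exact: ltn_trans h.
  by exists i; rewrite !inE ?ltnn.
pose rho i : 'I_k := Ordinal (rlt i).
have rinj : injective rho.
  move=> i j /(congr1 val) /= e; apply: mi; apply: val_inj.
  by case: (ltngtP (m i) (m j)) => // /rmono; rewrite e ltnn.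
(* If m is increasing along t, the rank of t l is l, and this determines t. *)
exists (perm rinj)^-1%g => t; apply/incrP/eqP => [h|-> i j ij].
  apply/permP => l; apply: (@perm_inj _ (perm rinj)); rewrite permKV permE; apply: val_inj => /=.
  have strict i j : (m (t i) < m (t j))%N = (i < j)%N.
    apply/idP/idP => [|/h //]; case: (ltngtP i j) => // [/h h1 h2|/val_inj ->]; last by rewrite ltnn.
    by have := ltn_trans h1 h2; rewrite ltnn.
  rewrite /rk -[RHS](card_ord_lt l) -!sum1_card (reindex_inj (@perm_inj _ t)) /=.
  by apply: eq_bigl => j; rewrite !inE strict.
have e i' : rho ((perm rinj)^-1%g i') = i' by rewrite -[in RHS](permKV (perm rinj) i') permE.
case: (ltnP (m ((perm rinj)^-1%g i)) (m ((perm rinj)^-1%g j))) => // hle.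
have : (rk ((perm rinj)^-1%g j) <= rk ((perm rinj)^-1%g i))%N.
  by apply: subset_leq_card; apply/fintype.subsetP => l; rewrite !inE => hl; exact: leq_trans hle.
have := congr1 val (e i); have := congr1 val (e j) => /= -> ->.
by rewrite leqNgt ij.
Qed.

(** Substituting n = m o t turns the left side into a sum over pairs with m increasing along t; by
    [incr_perm] each injective m occurs once and every other m not at all. *)
Lemma sum_perm_incr k (F : 'I_k -> 'I_N -> Cx) :
  \sum_(t : 'S_k) \sum_(n : {ffun 'I_k -> 'I_N} | incr n) \prod_l F (t l) (n l) =
  \sum_(m : {ffun 'I_k -> 'I_N} | injectiveb m) \prod_i F i (m i).
Proof.
have H (t : 'S_k) : \sum_(n : {ffun 'I_k -> 'I_N} | incr n) \prod_l F (t l) (n l) =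
   \sum_(m : {ffun 'I_k -> 'I_N} | incr (fun l => m (t l))) \prod_i F i (m i).
  have bij : bijective (fun m : {ffun 'I_k -> 'I_N} => [ffun l => m (t l)]).
    exists (fun m : {ffun 'I_k -> 'I_N} => [ffun l => m (t^-1%g l)]) => m; apply/ffunP => l; rewrite !ffunE.
      by rewrite permKV.
    by rewrite permK.
  rewrite (reindex _ (onW_bij _ bij)) /=; apply: eq_big => [m|m _].
    by apply: eq_forallb => i; apply: eq_forallb => j; rewrite !ffunE.
  rewrite [RHS](reindex_inj (@perm_inj _ t)) /=; apply: eq_bigr => l _; by rewrite ffunE.
under eq_bigr do rewrite H.
rewrite (exchange_big_dep predT) //= [RHS]big_mkcond /=; apply: eq_bigr => m _.
case: ifP => hm.
  by have [t0 h0] := incr_perm hm; rewrite (big_pred1 t0).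
apply: big_pred0 => t; apply/negP => /incrP h; move/negP: hm; apply; apply/injectiveP => i j e.
rewrite -(permKV t i) -(permKV t j) in e *.
case: (ltngtP (t^-1%g i) (t^-1%g j)) => [/h|/h|/val_inj -> //]; by rewrite e ltnn.
Qed.
End FixN.

Lemma sum_mzeta_partial r (a : 'I_r -> R) (s : Cx) N :
  \sum_(t : 'S_r) mzeta_partial (permuted_arg a s t) N = jsum s [seq a i | i <- enum 'I_r] (finset.set0 : {set 'I_N}).
Proof.
rewrite -jsum_injective (eq_bigl (fun m : {ffun 'I_r -> 'I_N} => injectiveb m)); last first.
  by move=> m; rewrite /injU; case: injectiveb => //=; apply/forallP => i; rewrite inE.
rewrite -(sum_perm_incr (fun i n => dterm s (a i) n)); apply: eq_bigr => t _.
apply: eq_bigr => n _; apply: eq_bigr => l _; by rewrite mxE.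
Qed.
End InjectiveSums.

(** * The symmetric sum as a polynomial in zeta values *)

Section SymmetricSum.
Variable R : realType.
Local Notation Cx := (C R).
Variable zeta : Cx -> Cx.
Hypothesis zeta_holo : forall s, s != 1 -> holo zeta s.
Hypothesis zeta_series : forall s, 1 < Re s -> ccvg (dsum s) (zeta s).
Hypothesis zeta_size : forall B eta : R, 0 < eta -> exists K T : R, 1 <= T /\ forall s : Cx, - B <= Re s -> Re s <= - eta -> T <= `|Im s| ->
    near_exp K ((2^-1 - Re s) * ln `|Im s|) (cmod (zeta s)).

(** The recursive calls on bumped lists are not structural, so [n] serves as fuel; [symz] supplies
    the length of the list, which is exactly enough. *)
Fixpoint symzn (n : nat) (A : seq R) (s : Cx) : Cx :=
  if n is n'.+1 then
    if A is b :: A' then zeta (rc b * s) * symzn n' A' s - \sum_(0 <= i < size A') symzn n' (bump_at b A' i) s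
    else 1
  else 1.
Definition symz (A : seq R) := symzn (size A) A.

Lemma symz_nil s : symz [::] s = 1. Proof. by []. Qed.
Lemma symz_cons b A s : symz (b :: A) s = zeta (rc b * s) * symz A s - \sum_(0 <= i < size A) symz (bump_at b A i) s.
Proof.
rewrite /symz /=; congr (_ - _); rewrite big_nat [RHS]big_nat; apply: eq_bigr => i /andP[_ hi].
by rewrite size_bump_at.
Qed.

Definition all_ge (d : R) (A : seq R) := all (fun b => d <= b) A.

Lemma all_ge_bump d b A i : 0 <= d -> d <= b -> all_ge d A -> (i < size A)%N -> all_ge d (bump_at b A i).
Proof.
move=> d0 db hA hi; apply/(all_nthP 0) => j; rewrite size_bump_at // => hj.
rewrite /bump_at nth_set_nth /=; have hn k : (k < size A)%N -> d <= nth 0 A k by move/(all_nthP 0): hA; exact.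
case: eqP => [_|_]; last exact: hn.
have := hn i hi; lra.
Qed.

(** Induction on the length: A and its bumps are one entry shorter than b :: A. Merging exponents
    preserves the lower bound d because b is nonnegative. *)
Lemma symz_ind (P : seq R -> Prop) (d : R) : 0 <= d -> P [::] ->
  (forall b A, d <= b -> all_ge d A -> P A -> (forall i, (i < size A)%N -> P (bump_at b A i)) -> P (b :: A)) ->
  forall A, all_ge d A -> P A.
Proof.
move=> d0 P0 PS A; move: {2}(size A) (erefl (size A)) => n; elim: n A => [|n ih] [|b A] //= [hn] /andP[hb hA].
apply: PS => //; first exact: ih.
by move=> i hi; apply: ih; [rewrite size_bump_at|exact: all_ge_bump].
Qed.

Lemma symz_holo (d : R) (s : Cx) : 0 < d -> Im s != 0 -> forall A, all_ge d A -> holo (symz A) s.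
Proof.
move=> d0 hs; apply: (@symz_ind _ d (ltW d0)) => [|b A hb _ ihA ihB].
  by apply: holo_eq (holo_cst 1 s) => w; rewrite symz_nil.
apply: (@holo_eq _ (fun w => zeta (rc b * w) * symz A w - \sum_(i < size A) symz (bump_at b A i) w)).
  by move=> w; rewrite symz_cons big_mkord.
apply: holoB; last by apply: holo_sum => i; exact: ihB.
apply: holoM => //; apply: (@holo_comp R (fun w => rc b * w) zeta); first by prove_holo.
apply: zeta_holo; apply/negP => /eqP /(congr1 (@complex.Im R)); rewrite !ReImE => /eqP.
have b0 : 0 < b by exact: lt_le_trans hb.
by rewrite mul0r addr0 mulf_eq0 (gt_eqF b0) (negbTE hs).
Qed.

Lemma symz_series (d : R) (s : Cx) : 0 < d -> 1 < d * Re s -> forall A, all_ge d A ->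
  ccvg (fun N => jsum s A (finset.set0 : {set 'I_N})) (symz A s).
Proof.
move=> d0 hs; apply: (@symz_ind _ d (ltW d0)) => [|b A hb _ ihA ihB].
  exact: ccvg_cst.
rewrite symz_cons.
have s0 : 0 < Re s by rewrite -(pmulr_rgt0 _ d0); lra.
have hz : ccvg (dsum (rc b * s)) (zeta (rc b * s)).
  apply: zeta_series; rewrite !ReImE mul0r subr0; apply: lt_le_trans hs _.
  by rewrite ler_wpM2r // ltW.
have hsum : ccvg (fun N => \sum_(i < size A) jsum s (bump_at b A i) (finset.set0 : {set 'I_N})) (\sum_(i < size A) symz (bump_at b A i) s).
  have gen (I : seq 'I_(size A)) : ccvg (fun N => \sum_(i <- I) jsum s (bump_at b A i) (finset.set0 : {set 'I_N})) (\sum_(i <- I) symz (bump_at b A i) s).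
    elim: I => [|i I ih]; first by rewrite big_nil; apply: (ccvg_eventually (N0 := 0%N)) (ccvg_cst 0) => n _; rewrite big_nil.
    rewrite big_cons; apply: (ccvg_eventually (N0 := 0%N)) (ccvgD (ihB i (ltn_ord i)) ih) => n _.
    by rewrite big_cons.
  exact: gen.
rewrite big_mkord -mulN1r.
apply: (ccvg_eventually (N0 := 0%N)) (ccvgD (ccvgM hz ihA) (ccvg_scale (- 1) hsum)) => n _.
by rewrite jsum_cons big_mkord mulN1r.
Qed.

Lemma sum_bump_at (b : R) A i : (i < size A)%N -> \sum_(x <- bump_at b A i) x = b + \sum_(x <- A) x.
Proof.
move=> hi; rewrite /bump_at set_nthE hi big_cat big_cons /=.
rewrite -[in RHS](cat_take_drop i A) big_cat (drop_nth 0 hi) big_cons /=; ring.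
Qed.

(** The gap [L] makes |w| at most the lower bound of |z| divided by e; as e >= 2, at least half of
    that bound survives the subtraction. *)
Lemma near_exp_perturb (K E K' E' L : R) (z w : Cx) : near_exp K E (cmod z) -> cmod w <= expR (K' + E') ->
  E' + L <= E -> K + K' + 1 <= L -> near_exp (K + 1) E (cmod (z - w)).
Proof.
move=> /andP[h1 h2] hw hE hL.
have K0 : 0 <= K by have := le_trans h1 h2; rewrite ler_expR; lra.
have e2 : 2 <= expR 1 :> R by have := @expR_ge1Dx R 1; lra.
have w1 : cmod w <= expR (- (K + 1) + E) by apply: le_trans hw _; rewrite ler_expR; lra.
have w2 : expR (- (K + 1) + E) <= expR (K + E) by rewrite ler_expR; lra.
have l1 : expR (- K + E) = expR 1 * expR (- (K + 1) + E) by rewrite -expRD; congr expR; ring.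
have l2 : expR (K + 1 + E) = expR 1 * expR (K + E) by rewrite -expRD; congr expR; ring.
have p1 := ler_wpM2r (expR_ge0 (- (K + 1) + E)) e2; have p2 := ler_wpM2r (expR_ge0 (K + E)) e2.
have t1 := cmod_lowB z w; have t2 := cmodB z w.
by apply/andP; split; lra.
Qed.

Lemma near_exp_shift (K E E' M x : R) : near_exp K E x -> `|E - E'| <= M -> near_exp (K + M) E' x.
Proof.
move=> /andP[h1 h2]; rewrite ler_norml => /andP[m1 m2]; apply/andP; split.
  by apply: le_trans h1; rewrite ler_expR; lra.
by apply: le_trans h2 _; rewrite ler_expR; lra.
Qed.

Section Strip.
Variables y1 y2 : R.
Hypothesis y20 : 0 < y2.

Definition strip_size (E : R -> R) (f : Cx -> Cx) := exists K T : R, 1 <= T /\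
  forall s : Cx, - y1 <= Re s -> Re s <= - y2 -> T <= `|Im s| -> near_exp K (E (Re s) * ln `|Im s|) (cmod (f s)).

(** Scaling by b replaces ln |Im s| by ln |Im s| + ln b, and the exponent is bounded on the strip,
    so the change goes into the constant. *)
Lemma zeta_strip_size b : 0 < b -> strip_size (fun x => 2^-1 - b * x) (fun s => zeta (rc b * s)).
Proof.
move=> b0; have [K [T [T1 H]]] := @zeta_size (b * y1) (b * y2) (mulr_gt0 b0 y20).
exists (K + (2^-1 + b * y1) * `|ln b|), (T / b + 1); split.
  by rewrite lerDr divr_ge0 // ?(ltW b0) //; lra.
move=> s s1 s2 hT; have t1 : T / b <= `|Im s| by lra.
have tb : T <= b * `|Im s| by move: t1; rewrite ler_pdivrMr // mulrC.
have t0 : 0 < `|Im s| by rewrite -(pmulr_rgt0 _ b0); lra.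
have bs : Re (rc b * s) = b * Re s /\ Im (rc b * s) = b * Im s by rewrite !ReImE; split; ring.
have := H (rc b * s); rewrite !bs.1 !bs.2 normrM (gtr0_norm b0) lnM ?posrE // => h.
apply: near_exp_shift (h _ _ tb) _.
- by rewrite -mulrN ler_wpM2l // ltW.
- by rewrite -mulrN ler_wpM2l // ltW.
have -> : (2^-1 - b * Re s) * (ln b + ln `|Im s|) - (2^-1 - b * Re s) * ln `|Im s| = (2^-1 - b * Re s) * ln b by ring.
rewrite normrM ler_wpM2r //.
have k1 : b * (- y1) <= b * Re s by rewrite ler_wpM2l // ltW.
have k2 : b * Re s <= b * (- y2) by rewrite ler_wpM2l // ltW.
have k3 : 0 < b * y2 by exact: mulr_gt0.
have h0 : 0 < 2^-1 :> R by rewrite invr_gt0.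
rewrite ger0_norm; lra.
Qed.

Lemma strip_sum_upper (E : R -> R) (n : nat) (f : nat -> Cx -> Cx) : (forall i, (i < n)%N -> strip_size E (f i)) ->
  exists K T : R, forall s : Cx, - y1 <= Re s -> Re s <= - y2 -> T <= `|Im s| ->
    cmod (\sum_(0 <= i < n) f i s) <= expR (K + E (Re s) * ln `|Im s|).
Proof.
elim: n => [|n ih] H.
  by exists 0, 0 => s _ _ _; rewrite big_geq // cmod0 expR_ge0.
have [K [T h]] := ih (fun i hi => H i (ltnW hi)); have [K' [T' [_ h']]] := H n (ltnSn n).
exists (Num.max K K' + 1), (Num.max T T') => s s1 s2; rewrite ge_max => /andP[t1 t2].
rewrite big_nat_recr //=; apply: le_trans (cmodD _ _) _.
have k1 : K <= Num.max K K' by rewrite le_max lexx.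
have k2 : K' <= Num.max K K' by rewrite le_max lexx orbT.
have a1 := h s s1 s2 t1; have /andP[_ a2] := h' s s1 s2 t2.
set X := E (Re s) * _ in a1 a2 *; set M := Num.max K K' in k1 k2 *.
have b1 : expR (K + X) <= expR (M + X) by rewrite ler_expR; lra.
have b2 : expR (K' + X) <= expR (M + X) by rewrite ler_expR; lra.
have e2 : 2 <= expR 1 :> R by have := @expR_ge1Dx R 1; lra.
have -> : expR (M + 1 + X) = expR 1 * expR (M + X) by rewrite -expRD; congr expR; ring.
have := ler_wpM2r (expR_ge0 (M + X)) e2; lra.
Qed.

(** A bumped list has the same sum of exponents as b :: A but one entry fewer, so in the recursion
    the product gains 1/2 in the exponent over every subtracted term. *)
Lemma symz_size (d : R) : 0 < d -> forall A, all_ge d A ->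
  strip_size (fun x => (size A)%:R / 2 - (\sum_(b <- A) b) * x) (symz A).
Proof.
move=> d0; apply: (@symz_ind _ d (ltW d0)) => [|b A hb _ [K [T [T1 ihA]]] ihB].
  exists 0, 1; split => // s _ _ _; rewrite symz_nil cmod1 big_nil mul0r mul0r subr0 mul0r.
  by rewrite /near_exp oppr0 addr0 expR0 lexx.
have b0 : 0 < b by exact: lt_le_trans hb.
have [K1 [T2 [T21 hz]]] := zeta_strip_size b0.
have [K2 [T3 hw]] : exists K T : R, forall s : Cx, - y1 <= Re s -> Re s <= - y2 -> T <= `|Im s| ->
    cmod (\sum_(0 <= i < size A) symz (bump_at b A i) s) <=
    expR (K + ((size A)%:R / 2 - (b + \sum_(b <- A) b) * Re s) * ln `|Im s|).
  apply: (@strip_sum_upper (fun x => (size A)%:R / 2 - (b + \sum_(b <- A) b) * x)) => i hi.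
  by have := ihB i hi; rewrite size_bump_at // sum_bump_at.
(* Beyond T4 half of ln |Im s| exceeds K1 + K + K2 + 1, the gap that [near_exp_perturb] asks for. *)
pose T4 := expR (2 * (K1 + K + K2 + 1)).
exists (K1 + K + 1), (Num.max (Num.max T T2) (Num.max T3 T4)); split; first by rewrite !le_max T1.
move=> s s1 s2; rewrite !ge_max => /andP[/andP[t1 t2] /andP[t3 t4]].
have sE : (size (b :: A))%:R = (size A)%:R + 1 :> R by rewrite natr1.
rewrite symz_cons big_cons sE.
have t0 : 0 < `|Im s| by lra.
apply: (near_exp_perturb (K' := K2) (L := ln `|Im s| / 2)) (hw s s1 s2 t3) _ _.
- rewrite cmodM; have := near_expM (hz s s1 s2 t2) (ihA s s1 s2 t1).
  set X := (_ - _) * _ + _ => h.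
  by have <- : X = (((size A)%:R + 1) / 2 - (b + \sum_(j <- A) j) * Re s) * ln `|Im s| by rewrite /X; field.
- move: (ln _) (size A)%:R => x n.
  have -> : ((n + 1) / 2 - (b + \sum_(j <- A) j) * Re s) * x = (n / 2 - (b + \sum_(j <- A) j) * Re s) * x + x / 2 by field.
  exact: lexx.
- have : ln T4 <= ln `|Im s| by rewrite ler_ln ?posrE // expR_gt0.
  rewrite expRK; lra.
Qed.
End Strip.
End SymmetricSum.

(** * Differentiability of multiple zeta functions *)

Section Bridges.
Variable R : realType.
Local Notation Cx := (C R).

(** The norm of a module over [C R] is itself an element of [C R], with zero imaginary part; [vmod]
    is the real number behind it. *)
Definition vmod (V : normedModType Cx) (v : V) : R := Re `|v|.

Lemma normr_vmod (V : normedModType Cx) (v : V) : `|v| = rc (vmod v).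
Proof.
have := normr_ge0 v; rewrite /vmod; case: `|v| => x y.
by rewrite lecE /= => /andP[/eqP -> _].
Qed.

Lemma vmod_ge0 (V : normedModType Cx) (v : V) : 0 <= vmod v.
Proof. by have := normr_ge0 v; rewrite normr_vmod -rc0 lecR. Qed.

Lemma vmod_cmod (z : Cx) : vmod (z : Cx) = cmod z.
Proof. by rewrite /vmod normC_cmod Re_rc. Qed.

Lemma gtC0_rc (e : Cx) : 0 < e -> exists2 d : R, 0 < d & e = rc d.
Proof.
case: e => x y; rewrite ltcE /= => /andP[/eqP y0 x0]; exists x => //; by rewrite y0.
Qed.

Lemma near_vmod (V : normedModType Cx) (p : V) (P : V -> Prop) :
  (\forall q \near p, P q) <-> exists2 d : R, 0 < d & forall q, vmod (q - p) < d -> P q.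
Proof.
rewrite nbhs_normP; split => [[e e0 H]|[d d0 H]].
  have [d d0 E] := gtC0_rc e0; exists d => // q hq; apply: H.
  by rewrite /ball_ /= distrC normr_vmod E ltcR.
exists (rc d); first by rewrite -rc0 /= ltcR.
by move=> q; rewrite /ball_ /= distrC normr_vmod ltcR; exact: H.
Qed.

Lemma dnear_cmod (p : Cx) (P : Cx -> Prop) :
  (\forall q \near p^', P q) -> exists2 d : R, 0 < d & forall q, cmod (q - p) < d -> q != p -> P q.
Proof.
rewrite near_withinE => /near_vmod[d d0 H]; exists d => // q hq.
Qed.

Lemma near_cmod (p : Cx) (P : Cx -> Prop) :
  (\forall q \near p, P q) <-> exists2 d : R, 0 < d & forall q, cmod (q - p) < d -> P q.
Proof.
rewrite near_vmod; split => -[d d0 H]; exists d => // q; have := H q; by rewrite vmod_cmod.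
Qed.

Lemma cvg_ccvg (u : nat -> Cx) (l : Cx) : u n @[n --> \oo] --> l -> ccvg u l.
Proof.
move=> /cvgrPdist_le H e e0; have e0' : 0 < rc e :> Cx by rewrite -rc0 ltcR.
have [N _ hN] := H _ e0'; exists N => n hn.
by have := hN n hn; rewrite /= normC_cmod lecR cmodBC.
Qed.

Lemma differentiable_holo (f : Cx -> Cx) (q : Cx) : differentiable f q -> holo f q.
Proof.
move=> /diff_locallyP[_ H]; exists ('d f q 1) => e e0.
have e0' : 0 < rc e :> Cx by rewrite -rc0 ltcR.
move: H => /eqaddoP /(_ (rc e) e0') /near_cmod[d d0 Hd].
exists d => // h hd; have := Hd h; rewrite subr0 => /(_ hd).
rewrite !normC_cmod -rcM lecR; congr (cmod _ <= _).
have -> : (f \o shift q - (cst (f q) + 'd f q)) h = f (h + q) - (f q + 'd f q h) by [].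
rewrite [h + q]addrC.
have -> : 'd f q h = 'd f q 1 * h.
  by rewrite -{1}[h]mulr1 -[h * 1]/(h *: (1 : Cx)) linearZ /= mulrC.
by rewrite opprD addrA.
Qed.

Lemma quadratic_differentiable (V : normedModType Cx) (f : V -> Cx) (q : V) (df : {linear V -> Cx}) (K d : R) :
  0 <= K -> 0 < d -> (forall v, cmod (df v) <= K * vmod v) ->
  (forall h, vmod h < d -> cmod (f (q + h) - f q - df h) <= K * vmod h ^+ 2) -> differentiable f q.
Proof.
move=> K0 d0 hdf H.
have cdf : continuous df.
  apply: bounded_linear_continuous; apply/ex_bound; exists (rc K); apply/near_vmod; exists 1 => // v.
  rewrite subr0 => hv; rewrite /= normC_cmod lecR; apply: le_trans (hdf v) _.
  by rewrite ler_piMr // ltW.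
have E : f \o shift q = cst (f q) + df +o_ (0 : V) id.
  apply/eqaddoP => e e0; have [e' e'0 ->] := gtC0_rc e0.
  apply/near_vmod; have K1 : 0 < K + 1 by lra.
  exists (Num.min d (e' / (K + 1))); first by rewrite lt_min d0 divr_gt0.
  move=> h; rewrite subr0 lt_min => /andP[/H h1 h2].
  rewrite normC_cmod normr_vmod -rcM lecR.
  have -> : (f \o shift q - (cst (f q) + df)) h = f (q + h) - f q - df h.
    by rewrite /= !fctE /= opprD addrA [h + q]addrC.
  apply: le_trans h1 _; rewrite expr2 mulrA ler_wpM2r ?vmod_ge0 //.
  move: h2; rewrite ltr_pdivlMr // => h2; have := vmod_ge0 h; lra.
apply/diff_locallyP; rewrite (diff_unique cdf E); split => //.
Qed.
End Bridges.

Section RowForms.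
Variables (R : realType) (r : nat).
Local Notation Cx := (C R).
Local Notation V := 'rV[C R]_r.

Lemma cmod_coord (v : V) (l : 'I_r) : cmod (v ord0 l) <= vmod v.
Proof.
have : `|v ord0 l| <= `|v|.
  have H (ij : 'I_1 * 'I_r) : `|v ij.1 ij.2| <= mx_norm v.
    by rewrite mx_normE -[leLHS]nngE num_le; exact: le_bigmax.
  exact: (H (ord0, l)).
by rewrite normC_cmod normr_vmod lecR.
Qed.

Definition rowform (c : 'I_r -> Cx) (v : V) : Cx := \sum_(l < r) v ord0 l * c l.

Lemma rowform_linear (c : 'I_r -> Cx) : linear (rowform c : V -> (Cx : normedModType Cx)).
Proof.
move=> a u v; rewrite /rowform scaler_sumr -big_split; apply: eq_bigr => l _.
by rewrite !mxE /= mulrDl -[a *: _]/(a * _) mulrA.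
Qed.

HB.instance Definition _ (c : 'I_r -> Cx) :=
  GRing.isLinear.Build Cx V (Cx : normedModType Cx) _ (rowform c) (rowform_linear c).

Lemma cmod_rowform (c : 'I_r -> Cx) (v : V) : cmod (rowform c v) <= (\sum_(l < r) cmod (c l)) * vmod v.
Proof.
apply: le_trans (cmod_sum _ _ _) _; rewrite mulr_suml; apply: ler_sum => l _.
by rewrite cmodM mulrC ler_wpM2l ?cmod_ge0 // cmod_coord.
Qed.
End RowForms.

(** * Differentiability of the multiple zeta series *)

Section MultipleZetaDifferentiable.
Variables (R : realType) (r : nat).
Local Notation Cx := (C R).
Local Notation V := 'rV[C R]_r.

Lemma inv_sqr_sum N : \sum_(k < N) expR (- (2 * ln k.+1%:R)) <= 2 :> R.
Proof.
case: N => [|N]; first by rewrite big_ord0.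
suff : \sum_(0 <= k < N.+1) expR (- (2 * ln k.+1%:R)) <= 2 - pbound 1 N.+1 :> R.
  by rewrite big_mkord; have := @pbound_ge0 R 1 N.+1 ltr01; lra.
elim: N => [|N ih].
  rewrite big_nat1 /pbound ln1 !mulr0 oppr0 expR0 divr1; lra.
rewrite big_nat_recr //=; have := @pbound_step R 1 N.+1 ltr01 isT.
have -> : 1 + 1 = 2 :> R by ring.
lra.
Qed.

(** Dropping the ordering of the indices majorizes the sum by a product of r single series,
    uniformly in N. *)
Lemma mzeta_partial_bound (s : V) N : (forall l, 2 <= Re (s ord0 l)) -> cmod (mzeta_partial s N) <= 2 ^+ r.
Proof.
move=> hs; apply: le_trans (cmod_sum _ _ _) _.
apply: (@le_trans _ _ (\sum_(n : {ffun 'I_r -> 'I_N}) \prod_(l < r) expR (- (2 * ln (n l).+1%:R)))).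
  rewrite big_mkcond; apply: ler_sum => n _; case: ifP => _.
    rewrite cmod_prod; apply: ler_prod => l _; rewrite cmod_ge0 cmod_natpow /= ler_expR ReN.
    by rewrite mulNr lerN2 ler_wpM2r ?ln_ge0 // ler1n.
  by apply: prodr_ge0 => l _; exact: expR_ge0.
rewrite -(bigA_distr_bigA (fun (l : 'I_r) (k : 'I_N) => expR (- (2 * ln k.+1%:R)))) /=.
rewrite -[X in _ <= 2 ^+ X](card_ord r) -prodr_const; apply: ler_prod => l _.
rewrite inv_sqr_sum andbT; apply: sumr_ge0 => k _; exact: expR_ge0.
Qed.

Definition pterm N (q : V) (n : {ffun 'I_r -> 'I_N}) : Cx := \prod_(l < r) natpow (n l).+1 (- q ord0 l).
(** The partial derivative of the truncated sum in the l-th variable. *)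
Definition pcoef N (q : V) (l : 'I_r) : Cx :=
  \sum_(n : {ffun 'I_r -> 'I_N} | [forall i : 'I_r, forall j : 'I_r, (i < j)%N ==> (n i < n j)%N])
    pterm q n * - rc (ln (n l).+1%:R).

Lemma cexp_sum (I : Type) (s : seq I) (F : I -> Cx) : \prod_(i <- s) cexp (F i) = cexp (\sum_(i <- s) F i).
Proof. by rewrite (big_morph (@cexp R) (@cexpD R) (@cexp0 R)). Qed.

Lemma pterm_line N (q h : V) (t : Cx) (n : {ffun 'I_r -> 'I_N}) :
  pterm (q + t *: h) n = pterm q n * cexp (t * \sum_(l < r) h ord0 l * - rc (ln (n l).+1%:R)).
Proof.
rewrite mulr_sumr -cexp_sum -big_split; apply: eq_bigr => l _ /=.
by rewrite /natpow -cexpD !mxE; congr cexp; rewrite -/(rc _); ring.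
Qed.

Lemma cder_sum (I : Type) (s : seq I) (P : pred I) (f : I -> Cx -> Cx) z (l : I -> Cx) : (forall i, cder (f i) z (l i)) ->
  cder (fun w => \sum_(i <- s | P i) f i w) z (\sum_(i <- s | P i) l i).
Proof.
move=> H; elim: s => [|i s ih].
  by rewrite big_nil; apply: cder_eq (cder_cst 0 z) => w; rewrite big_nil.
rewrite big_cons; case: ifP => Pi.
  by apply: cder_eq (cderD (H i) ih) => w; rewrite big_cons Pi.
by apply: cder_eq ih => w; rewrite big_cons Pi.
Qed.

Lemma cder_partial_line N (q h : V) (t : Cx) : cder (fun t => mzeta_partial (q + t *: h) N) t
  (rowform (pcoef N (q + t *: h)) h).
Proof.
pose w (n : {ffun 'I_r -> 'I_N}) : Cx := \sum_(l < r) h ord0 l * - rc (ln (n l).+1%:R).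
have -> : rowform (pcoef N (q + t *: h)) h = \sum_(n : {ffun 'I_r -> 'I_N} | [forall i : 'I_r, forall j : 'I_r, (i < j)%N ==> (n i < n j)%N])
    pterm q n * (cexp (t * w n) * w n).
  rewrite /rowform; under eq_bigr => l _ do rewrite mulr_sumr.
  rewrite exchange_big /=; apply: eq_bigr => n _.
  rewrite mulrA -pterm_line mulr_sumr; apply: eq_bigr => l _; ring.
apply: (@cder_eq _ (fun t => \sum_(n : {ffun 'I_r -> 'I_N} | [forall i : 'I_r, forall j : 'I_r, (i < j)%N ==> (n i < n j)%N])
    pterm q n * cexp (t * w n))).
  by move=> v; rewrite /mzeta_partial; apply: eq_bigr => n _; rewrite -pterm_line.
apply: cder_sum => n; apply: cder_scale.
apply: (@cder_comp _ (fun v => v * w n) (@cexp R)); last exact: cder_cexp.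
by have := cderM (cder_id t) (cder_cst (w n) t); rewrite mulr0 addr0 mul1r.
Qed.

(** One variable suffices: for |t| < 2 rho = 1 / (3 eta) the entries of t h stay below 1/3, so q + t
    h keeps real parts above 2 and the sum is bounded by 2^r. [holo_schwarz] at t = 1 gives 4 2^r /
    rho^2, uniformly in N; rho >= 1 needs eta <= 1/6. *)
Lemma partial_second_order N (q h : V) (eta : R) : (forall l, 5 / 2 <= Re (q ord0 l)) -> 0 < eta -> eta <= 1 / 6 ->
  (forall l, cmod (h ord0 l) <= eta) ->
  cmod (mzeta_partial (q + h) N - mzeta_partial q N - rowform (pcoef N q) h) <= 144 * 2 ^+ r * eta ^+ 2.
Proof.
move=> hq e0 e1 hh; pose rho := (6 * eta)^-1; have e6 : 0 < 6 * eta by rewrite mulr_gt0.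
have rho0 : 0 < rho by rewrite invr_gt0.
have rho1 : 1 <= rho by rewrite /rho -[leLHS]invr1 lef_pV2 ?posrE //; lra.
pose f (t : Cx) := mzeta_partial (q + t *: h) N.
have hf t : holo f t by eexists; exact: cder_partial_line.
have bf (t : Cx) : cmod (t - 0) < 2 * rho -> cmod (f t) <= 2 ^+ r.
  rewrite subr0 => ht; apply: mzeta_partial_bound => l; rewrite !mxE ReD.
  have h1 : cmod (t * h ord0 l) <= 2 * rho * eta by rewrite cmodM ler_pM ?cmod_ge0 // ltW.
  have h2 : 2 * rho * eta = 1 / 3 by rewrite /rho; field; rewrite gt_eqF.
  have := Re_le (t * h ord0 l); rewrite ler_norml => /andP[h3 _]; have := hq l; lra.
have := cder_partial_line N q h 0; rewrite scale0r addr0 => hd.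
have [_ /(_ 1)] := holo_schwarz rho0 (fun w _ => hf w) bf hd.
rewrite !subr0 cmod1 => /(_ rho1); rewrite mulr1 /f scale1r scale0r addr0 expr1n mulr1 => h1.
apply: le_trans h1 _; have -> : 4 * 2 ^+ r / rho ^+ 2 = 144 * 2 ^+ r * eta ^+ 2; last exact: lexx.
by rewrite /rho; move: (2 ^+ r) => M; field; rewrite gt_eqF.
Qed.

Variable Z : V -> Cx.
Hypothesis Z_series : forall s : V, mzeta_abscvg s -> ccvg (mzeta_partial s) (Z s).

Lemma abscvg_large (s : V) : (forall l, 1 < Re (s ord0 l)) -> mzeta_abscvg s.
Proof.
move=> hs l.
have -> : r%:R - l%:R = \sum_(j < r | (l <= j)%N) 1 :> R.
  have h := cardC [pred j : 'I_r | (j < l)%N]; rewrite card_ord_lt card_ord in h.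
  have -> : r%:R = l%:R + #|[predC [pred j : 'I_r | (j < l)%N]]|%:R :> R by rewrite -natrD h.
  rewrite addrC addKr -sumr_const; apply: eq_bigl => j; by rewrite !inE -leqNgt.
apply: ltr_sum; last by move=> j _; exact: hs.
by apply/hasP; exists l; rewrite ?mem_index_enum.
Qed.

Lemma rowform_delta (c : 'I_r -> Cx) (t : Cx) l : rowform c (t *: delta_mx ord0 l) = t * c l.
Proof.
rewrite /rowform (bigD1 l) //= big1 => [|j jl]; first by rewrite !mxE !eqxx mulr1 addr0.
by rewrite !mxE eqxx (negbTE jl) mulr0 mul0r.
Qed.

(** The truncated sums converge at q and at q shifted by t in one coordinate; the uniform second
    order bound then makes the derivatives a Cauchy sequence once t is small. *)
Lemma pcoef_cvg (q : V) (l : 'I_r) : (forall l, 5 / 2 <= Re (q ord0 l)) -> exists c, ccvg (fun N => pcoef N q l) c.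
Proof.
move=> hq; apply: complex_cauchy => e e0; set M : R := 144 * 2 ^+ r.
have M0 : 0 < M by rewrite mulr_gt0 // exprn_gt0.
pose t := Num.min (1 / 6) (e / (4 * M)).
have t0 : 0 < t by rewrite lt_min divr_gt0 //= divr_gt0 // mulr_gt0.
have t1 : t <= 1 / 6 by rewrite ge_min lexx.
have t2 : 4 * M * t <= e by rewrite mulrC -ler_pdivlMr ?mulr_gt0 // ge_min lexx orbT.
pose h : V := rc t *: delta_mx ord0 l.
have hh j : cmod (h ord0 j) <= t.
  rewrite !mxE eqxx /= cmodM cmod_rc (gtr0_norm t0) cmod_nat; case: (_ == _) => /=; lra.
have cv1 : ccvg (mzeta_partial q) (Z q) by apply: Z_series; apply: abscvg_large => j; have := hq j; lra.
have cv2 : ccvg (mzeta_partial (q + h)) (Z (q + h)).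
  apply: Z_series; apply: abscvg_large => j; rewrite mxE ReD.
  by have := le_trans (Re_le _) (hh j); rewrite ler_norml => /andP[h1 _]; have := hq j; lra.
have te : 0 < t * e / 8 by rewrite divr_gt0 // mulr_gt0.
have [N1 H1] := cv1 _ te; have [N2 H2] := cv2 _ te.
exists (maxn N1 N2) => n hn; set N0 := maxn N1 N2 in hn *.
have S k := partial_second_order k hq t0 t1 hh.
have E k : rowform (pcoef k q) h = rc t * pcoef k q l by rewrite rowform_delta.
have a1 := H1 n (leq_trans (leq_maxl _ _) hn); have a2 := H1 N0 (leq_maxl _ _).
have b1 := H2 n (leq_trans (leq_maxr _ _) hn); have b2 := H2 N0 (leq_maxr _ _).
have c1 := S n; have c2 := S N0; rewrite !E in c1 c2.
rewrite -(ler_pM2l t0) -{1}(gtr0_norm t0) -cmod_rc -cmodM.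
set x1 := mzeta_partial (q + h) n in b1 c1; set x2 := mzeta_partial (q + h) N0 in b2 c2.
set z1 := mzeta_partial q n in a1 c1; set z2 := mzeta_partial q N0 in a2 c2.
set p1 := pcoef n q l in c1 *; set p2 := pcoef N0 q l in c2 *.
have -> : rc t * (p1 - p2) = - (x1 - z1 - rc t * p1) + (x2 - z2 - rc t * p2) + (x1 - Z (q + h)) - (x2 - Z (q + h)) - (z1 - Z q) + (z2 - Z q) by ring.
have tt : 144 * 2 ^+ r * t ^+ 2 <= t * e / 4.
  by rewrite expr2 mulrA -/M; have := ler_wpM2r (ltW t0) t2; lra.
apply: le_trans (cmodD _ _) _; apply: le_trans (lerD (cmodB _ _) a2) _.
apply: le_trans (lerD (lerD (cmodB _ _) a1) (lexx _)) _.
apply: le_trans (lerD (lerD (lerD (cmodD _ _) b2) (lexx _)) (lexx _)) _.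
apply: le_trans (lerD (lerD (lerD (lerD (cmodD _ _) b1) (lexx _)) (lexx _)) (lexx _)) _.
rewrite cmodN; lra.
Qed.

(** The quadratic remainder is uniform in N, so it survives the limit with the limits of the partial
    derivatives as coefficients. *)
Lemma mzeta_differentiable (q : V) : (forall l, 5 / 2 <= Re (q ord0 l)) -> differentiable Z q.
Proof.
move=> hq; have [c Hc] := choice (fun l => pcoef_cvg l hq).
set M : R := 144 * 2 ^+ r; have M0 : 0 <= M by rewrite mulr_ge0 ?exprn_ge0.
pose K := M + \sum_(l < r) cmod (c l).
have S0 : 0 <= \sum_(l < r) cmod (c l) by apply: sumr_ge0 => l _; exact: cmod_ge0.
have cq : ccvg (mzeta_partial q) (Z q) by apply: Z_series; apply: abscvg_large => j; have := hq j; lra.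
have key (h : V) (eta : R) : 0 < eta -> eta <= 1 / 6 -> vmod h <= eta ->
    cmod (Z (q + h) - Z q - rowform c h) <= M * eta ^+ 2.
  move=> e0 e1 he; have hh j : cmod (h ord0 j) <= eta by apply: le_trans he; exact: cmod_coord.
  have ch : ccvg (mzeta_partial (q + h)) (Z (q + h)).
    apply: Z_series; apply: abscvg_large => j; rewrite mxE ReD.
    by have := le_trans (Re_le _) (hh j); rewrite ler_norml => /andP[h1 _]; have := hq j; lra.
  have cr : ccvg (fun N => rowform (pcoef N q) h) (rowform c h).
    have gen (I : seq 'I_r) : ccvg (fun N => \sum_(l <- I) h ord0 l * pcoef N q l) (\sum_(l <- I) h ord0 l * c l).
      elim: I => [|i I ih].
        by rewrite big_nil; apply: (ccvg_eventually (N0 := 0%N)) (ccvg_cst 0) => n _; rewrite big_nil.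
      rewrite big_cons; apply: (ccvg_eventually (N0 := 0%N)) (ccvgD (ccvg_scale (h ord0 i) (Hc i)) ih) => n _.
      by rewrite big_cons.
    exact: gen.
  have C : ccvg (fun N => mzeta_partial (q + h) N - mzeta_partial q N - rowform (pcoef N q) h) (Z (q + h) - Z q - rowform c h).
    rewrite -[X in _ - _ - X]mul1r -[X in _ - X - _]mul1r -!mulNr.
    apply: (ccvg_eventually (N0 := 0%N)) (ccvgD (ccvgD ch (ccvg_scale (- 1) cq)) (ccvg_scale (- 1) cr)) => n _; ring.
  by apply: (ccvg_le C) => N; exact: partial_second_order.
apply: (@quadratic_differentiable R V Z q (rowform c) K (1 / 6)) => //.
- by rewrite addr_ge0.
- by move=> v; apply: le_trans (cmod_rowform c v) _; rewrite ler_wpM2r ?vmod_ge0 // lerDr.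
move=> h hd; have [v0|v0] := eqVneq (vmod h) 0.
  have -> : h = 0 by apply/eqP; rewrite -normr_eq0 normr_vmod v0 rc0.
  by rewrite addr0 subrr sub0r linear0 cmodN cmod0 mulr_ge0 ?sqr_ge0 // addr_ge0.
apply: le_trans (key h (vmod h) _ (ltW hd) (lexx _)) _; first by rewrite lt_neqAle eq_sym v0 vmod_ge0.
by rewrite ler_wpM2r ?sqr_ge0 // lerDl.
Qed.

(** Supplies the regularity under which [is_sym_mzeta] prescribes the value of [F]. *)
Lemma mzeta_holomorphic (p : V) : (forall l, 3 <= Re (p ord0 l)) -> holomorphic_at Z p.
Proof.
move=> hp; apply/near_vmod; exists (1 / 2) => [|q hq]; first by rewrite divr_gt0.
apply: mzeta_differentiable => l; have := cmod_coord (q - p) l; rewrite !mxE => h.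
have := le_trans (Re_le _) h; rewrite ReB ler_norml => /andP[h1 _]; have := hp l; lra.
Qed.
End MultipleZetaDifferentiable.

(** * Unique continuation and conclusion *)

Section Continuation.
Variable R : realType.
Local Notation Cx := (C R).

Lemma cts_nonzero (f : Cx -> Cx) z : cts f z -> f z != 0 -> exists2 d : R, 0 < d & forall w, cmod (w - z) < d -> f w != 0.
Proof.
move=> cf fz; have m0 : 0 < cmod (f z) by rewrite cmod_gt0.
have [|d d0 H] := cf (cmod (f z) / 2); first by rewrite divr_gt0.
exists d => // w hw; have := H (w - z) hw; rewrite subrKC => h; rewrite -cmod_gt0.
have := cmod_lowB (f z) (f w); rewrite cmodBC; lra.
Qed.

Definition locally_nonzero (h : Cx -> Cx) z := ~ exists2 d : R, 0 < d & forall w, cmod (w - z) < d -> h w = 0.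

Lemma locally_nonzero_point (h : Cx -> Cx) z (d : R) : holo h z -> locally_nonzero h z -> 0 < d ->
  exists w, [/\ cmod (w - z) < d, w != z & h w != 0].
Proof.
move=> hh nz d0; apply: contrapT => H; apply: nz.
have hw w : cmod (w - z) < d -> w != z -> h w = 0.
  by move=> h1 h2; apply: contrapT => h3; apply: H; exists w; split => //; apply/eqP.
exists d => // w hwd; have [->|] := eqVneq w z; last exact: hw.
apply: contrapT => /eqP hz; have [d' d'0 H'] := cts_nonzero (holo_cts hh) hz.
pose e := Num.min d d' / 2; have e0 : 0 < e by rewrite divr_gt0 // lt_min d0.
have ed : e < d by rewrite ltr_pdivrMr // gt_min; apply/orP; left; lra.
have ed' : e < d' by rewrite ltr_pdivrMr // gt_min; apply/orP; right; lra.
have ce : cmod (z + rc e - z) = e by rewrite addrC addKr cmod_rc gtr0_norm.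
have := H' (z + rc e); rewrite ce => /(_ ed') /eqP; apply.
by apply: hw; rewrite ?ce // -subr_eq0 addrC addKr rc_eq0 gt_eqF.
Qed.

(** Otherwise [h] vanishes near some point close to z at which [f] does not, and hence near z. *)
Lemma holo_locally_nonzero_mul (f h : Cx -> Cx) z (r : R) : 0 < r ->
  (forall w, cmod (w - z) < r -> holo f w) -> (forall w, cmod (w - z) < r -> holo h w) ->
  locally_nonzero f z -> locally_nonzero h z -> locally_nonzero (fun w => f w * h w) z.
Proof.
move=> r0 hf hh nf nh [d d0 H].
pose e := Num.min (r / 8) d; have e0 : 0 < e by rewrite lt_min divr_gt0.
have er : e <= r / 8 by rewrite ge_min lexx.
have ed : e <= d by rewrite ge_min lexx orbT.
have zr : cmod (z - z) < r by rewrite subrr cmod0.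
have [w [wz _ fw]] := locally_nonzero_point (hf z zr) nf e0.
have wr : cmod (w - z) < r by lra.
have [d' d'0 H'] := cts_nonzero (holo_cts (hf w wr)) fw.
apply: nh; exists (r / 8); first by rewrite divr_gt0.
have ew0 : 0 < Num.min d' (d - cmod (w - z)) by rewrite lt_min d'0; lra.
apply: (holo_zero_near r0 ew0 _ hh) => [|v]; first lra.
rewrite lt_min => /andP[v1 v2]; have vz : cmod (v - z) < d by have := cmod_triB v z w; lra.
have /eqP := H v vz; rewrite mulf_eq0 (negbTE (H' v v1)) => /eqP //.
Qed.

(* F and G coincide near z wherever the denominator h does not vanish. *)
Definition agree (F G : Cx -> Cx) (z : Cx) := exists (rho : R) (h : Cx -> Cx), [/\ 0 < rho,
  forall w, cmod (w - z) < rho -> holo h w, locally_nonzero h z &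
  forall w, cmod (w - z) < rho -> h w != 0 -> F w = G w].

Definition quotient_at (F : Cx -> Cx) (z : Cx) := exists (rho : R) (g h : Cx -> Cx), [/\ 0 < rho,
  forall w, cmod (w - z) < rho -> holo g w /\ holo h w, locally_nonzero h z &
  forall w, cmod (w - z) < rho -> h w != 0 -> F w = g w / h w].

Lemma meromorphic_quotient (F : Cx -> Cx) z : meromorphic F -> quotient_at F z.
Proof.
move=> /(_ z) [g [h [/near_cmod[d1 d10 H1] /near_cmod[d2 d20 H2] nz /near_cmod[d3 d30 H3]]]].
exists (Num.min d1 (Num.min d2 d3)), g, h; split.
- by rewrite !lt_min d10 d20.
- by move=> w; rewrite !lt_min => /and3P[/H1 a /H2 b _]; split; exact: differentiable_holo.
- by move=> [d d0 H]; apply: nz; apply/near_cmod; exists d.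
- by move=> w; rewrite !lt_min => /and3P[_ _]; exact: H3.
Qed.

(* With F = g / h near z, agreement at any nearby point means that g - h G vanishes. *)
Lemma agree_locally_constant (F G : Cx -> Cx) z (r : R) : 0 < r -> quotient_at F z ->
  (forall w, cmod (w - z) < r -> holo G w) ->
  exists2 d : R, 0 < d & exists P : Prop, forall y, cmod (y - z) < d -> agree F G y <-> P.
Proof.
move=> r0 [rho0 [g [h [rho00 hgh nh Fgh]]]] hG.
pose rho := Num.min rho0 r; have rho_gt0 : 0 < rho by rewrite lt_min rho00.
have rr0 : rho <= rho0 by rewrite ge_min lexx.
have rr1 : rho <= r by rewrite ge_min lexx orbT.
have hg w : cmod (w - z) < rho -> holo g w by move=> hw; have [] := hgh w (lt_le_trans hw rr0).
have hh w : cmod (w - z) < rho -> holo h w by move=> hw; have [] := hgh w (lt_le_trans hw rr0).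
have hG' w : cmod (w - z) < rho -> holo G w by move=> hw; apply: hG; exact: lt_le_trans rr1.
have hF w : cmod (w - z) < rho -> h w != 0 -> F w = g w / h w by move=> hw; apply: Fgh; exact: lt_le_trans rr0.
pose phi w := g w - h w * G w.
have hphi w : cmod (w - z) < rho -> holo phi w.
  by move=> hw; apply: holoB; [exact: hg|apply: holoM; [exact: hh|exact: hG']].
exists (rho / 16); first by rewrite divr_gt0.
(* This proposition does not mention [y], which is what makes agreement locally constant. *)
exists (forall w, cmod (w - z) < rho / 8 -> phi w = 0) => y hy; split.
- move=> [rho' [h' [r'0 hh' nh' FG]]].
  have y8 : cmod (y - z) < rho / 8 by lra.
  pose e := Num.min (rho / 16) rho'; have e0 : 0 < e by rewrite lt_min divr_gt0.
  have e1 : e <= rho / 16 by rewrite ge_min lexx.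
  have e2 : e <= rho' by rewrite ge_min lexx orbT.
  have near w : cmod (w - y) < e -> cmod (w - z) < rho / 8 by move=> hw; have := cmod_triB w z y; lra.
  have near' w : cmod (w - y) < e -> cmod (w - z) < rho by move=> /near; lra.
  have he w : cmod (w - y) < e -> holo h w by move=> /near'; exact: hh.
  have he' w : cmod (w - y) < e -> holo h' w by move=> hw; apply: hh'; exact: lt_le_trans e2.
  have nhy : locally_nonzero h y.
    move=> [d d0 H]; apply: nh; exists (rho / 8); first by rewrite divr_gt0.
    exact: (holo_zero_near rho_gt0 d0 y8 hh H).
  have nm := holo_locally_nonzero_mul e0 he he' nhy nh'.
  have yy : cmod (y - y) < e by rewrite subrr cmod0.
  have [w [wy _ hw]] := locally_nonzero_point (holoM (he y yy) (he' y yy)) nm e0.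
  have [d d0 H] := cts_nonzero (holo_cts (holoM (he w wy) (he' w wy))) hw.
  have ew0 : 0 < Num.min d (e - cmod (w - y)) by rewrite lt_min d0; lra.
  apply: (holo_zero_near rho_gt0 ew0 (near w wy) hphi) => v; rewrite lt_min => /andP[v1 v2].
  have vy : cmod (v - y) < e by have := cmod_triB v y w; lra.
  have := H v v1; rewrite mulf_eq0 negb_or => /andP[n1 n2].
  have := hF v (near' v vy) n1; rewrite (FG v (lt_le_trans vy e2) n2) => E.
  by rewrite /phi E mulrC divfK // subrr.
- move=> H0; exists (rho / 16), h; split.
  + by rewrite divr_gt0.
  + by move=> w hw; apply: hh; have := cmod_triB w z y; lra.
  + move=> [d d0 H]; apply: nh; exists (rho / 8); first by rewrite divr_gt0.
    by apply: (holo_zero_near rho_gt0 d0 _ hh H); lra.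
  + move=> w hw hw0; have wz : cmod (w - z) < rho / 8 by have := cmod_triB w z y; lra.
    rewrite hF //; last lra.
    have /eqP := H0 w wz; rewrite subr_eq0 => /eqP ->; by rewrite mulrC mulKf.
Qed.

Lemma agree_segment (F G : Cx -> Cx) (p s : Cx) : meromorphic F ->
  (forall x : R, 0 <= x <= 1 -> exists2 r : R, 0 < r & forall w, cmod (w - (p + rc x * (s - p))) < r -> holo G w) ->
  agree F G p -> agree F G s.
Proof.
move=> mF hG Ep; pose pt (x : R) := p + rc x * (s - p).
have := @segment_connected R (fun x => agree F G (pt x)).
have -> : pt 1 = s by rewrite /pt rc1 mul1r subrKC.
have -> : pt 0 = p by rewrite /pt rc0 mul0r addr0.
apply=> // x hx; have [r r0 Hr] := hG x hx.
have [d d0 [P HP]] := agree_locally_constant r0 (meromorphic_quotient (pt x) mF) Hr.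
have K : 0 < 1 + cmod (s - p) by rewrite ltr_wpDr ?cmod_ge0.
exists (d / (1 + cmod (s - p))); first by rewrite divr_gt0.
move=> y hy; rewrite ltr_pdivlMr // => yx.
have e1 : cmod (pt x - pt x) < d by rewrite subrr cmod0.
have e2 : cmod (pt y - pt x) < d.
  have -> : pt y - pt x = rc (y - x) * (s - p) by rewrite /pt rcB; ring.
  rewrite cmodM cmod_rc; apply: le_lt_trans yx; by rewrite ler_wpM2l // lerDr.
by rewrite (HP _ e1) (HP _ e2).
Qed.

(** Arbitrarily close to s there are points w != s off the zeros of the denominator, where G w = F w
    = g w; both G and g are continuous at s. *)
Lemma agree_apoint (F G : Cx -> Cx) (alpha s : Cx) : agree F G s -> holo G s -> is_apoint F alpha s -> G s = alpha.
Proof.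
move=> [rho [h [r0 hh nh FG]]] hG [g [/near_cmod[d1 d10 Hg] /dnear_cmod[d2 d20 H2] gs]].
have gh : holo g s by apply: differentiable_holo; apply: Hg; rewrite subrr cmod0.
rewrite -gs; apply/eqP; rewrite -subr_eq0; apply/eqP; apply: cmod_eps0 => e e0.
have e2 : 0 < e / 2 by rewrite divr_gt0.
have [d3 d30 H3] := holo_cts hG e2; have [d4 d40 H4] := holo_cts gh e2.
pose d := Num.min (Num.min rho d2) (Num.min d3 d4).
have d0 : 0 < d by rewrite !lt_min r0 d20 d30.
have ss : cmod (s - s) < rho by rewrite subrr cmod0.
have [w [wd ws hw]] := locally_nonzero_point (hh s ss) nh d0.
move: wd; rewrite !lt_min => /andP[/andP[w1 w2] /andP[w3 w4]].
have E : G w = g w by rewrite -(FG w w1 hw) (H2 w w2 ws).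
have := H3 (w - s) w3; have := H4 (w - s) w4; rewrite !subrKC E => a b.
have -> : G s - g s = (g w - g s) - (g w - G s) by ring.
have := cmodB (g w - g s) (g w - G s); lra.
Qed.
End Continuation.

(** * Identification of F with G and the final estimate *)

Section Conclusion.
Variable R : realType.
Local Notation Cx := (C R).

Lemma ccvg_sum (I : Type) (s : seq I) (u : I -> nat -> Cx) (l : I -> Cx) : (forall i, ccvg (u i) (l i)) ->
  ccvg (fun n => \sum_(i <- s) u i n) (\sum_(i <- s) l i).
Proof.
move=> H; elim: s => [|i s ih].
  by rewrite big_nil; apply: (ccvg_eventually (N0 := 0%N)) (ccvg_cst 0) => n _; rewrite big_nil.
rewrite big_cons; apply: (ccvg_eventually (N0 := 0%N)) (ccvgD (H i) ih) => n _.
by rewrite big_cons.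
Qed.

(** Both sides are limits of the same truncated sums ([sum_mzeta_partial]). The bound 3 puts every
    coordinate in the region of [mzeta_holomorphic]. *)
Lemma sym_mzeta_symz (r : nat) (a : 'I_r -> R) (F zeta : Cx -> Cx) (d : R) : is_sym_mzeta a F ->
  (forall s, 1 < Re s -> ccvg (dsum s) (zeta s)) -> 0 < d -> (forall i, d <= a i) ->
  forall s : Cx, 3 <= d * Re s -> F s = symz zeta [seq a i | i <- enum 'I_r] s.
Proof.
move=> [Z [[_ HZ] _ HF]] hz d0 ha s hs.
have HZ' (v : 'rV[C R]_r) : mzeta_abscvg v -> ccvg (mzeta_partial v) (Z v).
  by move=> /HZ /cvg_ccvg.
have s0 : 0 <= Re s by rewrite -(pmulr_rge0 _ d0); lra.
have hp (t : 'S_r) (l : 'I_r) : 3 <= Re (permuted_arg a s t ord0 l).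
  rewrite mxE -/(rc _) !ReImE mul0r subr0; apply: le_trans hs _; by rewrite ler_wpM2r.
rewrite HF => [|t]; last exact: (mzeta_holomorphic HZ' (hp t)).
have L : ccvg (fun N => \sum_(t : 'S_r) mzeta_partial (permuted_arg a s t) N) (\sum_(t : 'S_r) Z (permuted_arg a s t)).
  apply: ccvg_sum => t; apply: HZ'; apply: abscvg_large => l; have := hp t l; lra.
have hA : all_ge d [seq a i | i <- enum 'I_r] by apply/allP => x /mapP[i _ ->].
apply: (ccvg_uniq L); apply: (ccvg_eventually (N0 := 0%N)) (symz_series hz d0 _ hA (s := s)) => [n _|].
  by rewrite sum_mzeta_partial.
lra.
Qed.
End Conclusion.

Theorem theorem1p3 (R : realType) (r : nat) (hr : (2 <= r)%N)
    (a : 'I_r -> R)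
    (a_gt0 : forall i : 'I_r, 0 < a i)
    (a_decr : forall i j : 'I_r, (i <= j)%N -> a j <= a i)
    (F : C R -> C R) (hF : is_sym_mzeta a F)
    (alpha : C R) (y1 y2 : R) (hy2 : 0 < y2) (hy12 : y2 < y1) :
  exists C3 : R, 0 < C3 /\
    forall s : C R,
      - y1 <= complex.Re s -> complex.Re s <= - y2 ->
      C3 < `|complex.Im s| ->
      ~ is_apoint F alpha s.
Proof.
have [zeta [zh zs zz]] := zeta_continuation R.
have [d d0 hd] : exists2 d : R, 0 < d & forall i, d <= a i.
  case: r hr a a_gt0 a_decr {F hF} => // r _ a a_gt0 a_decr.
  (* The last exponent is the smallest, since [a] is nonincreasing. *)
  by exists (a ord_max) => // i; apply: a_decr; rewrite -ltnS.
set A := [seq a i | i <- enum 'I_r].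
have hA : all_ge d A by apply/allP => x /mapP[i _ ->].
have [K [T [T1 HK]]] := symz_size zz y1 hy2 d0 hA.
(* On the strip |G| is at least exp(- K) |Im s|, the exponent being at least r / 2 >= 1; beyond
   exp(K) (|alpha| + 1) this exceeds |alpha|. *)
pose C3 := Num.max T (expR K * (cmod alpha + 1)).
exists C3; split; first by rewrite lt_max; apply/orP; left; lra.
move=> s s1 s2 hs ap; move: hs; rewrite gt_max => /andP[t1 t2].
have im0 : Im s != 0 by rewrite -normr_gt0; lra.
have lt0 : 0 <= ln `|Im s| by apply: ln_ge0; lra.
have mF : meromorphic F by case: hF => Z [].
(* Same height as s, and far enough right for the unit disc about [p] to lie in Re w >= 3 / d, where
   F and G are equal. *)
pose p : C R := (3 / d + 1) +i* Im s.
have hG (w : C R) : Im w != 0 -> holo (symz zeta A) w by move=> hw; exact: (symz_holo zh d0 hw hA).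
have Ep : agree F (symz zeta A) p.
  exists 1, (fun=> 1); split => //.
  - by move=> w _; exact: holo_cst.
  - move=> [e e0 /(_ p)]; rewrite subrr cmod0 => /(_ e0) /eqP; by rewrite oner_eq0.
  - move=> w hw _; apply: (sym_mzeta_symz hF zs d0 hd).
    have := Re_le (w - p); rewrite ReB ler_norml => /andP[h1 _].
    have h2 : 3 / d <= Re w by move: h1; rewrite /p /=; lra.
    by rewrite mulrC -ler_pdivrMr.
have Es : agree F (symz zeta A) s.
  (* The segment from p to s is horizontal at height Im s != 0, so discs of radius |Im s| about its
     points avoid the real axis, where the poles of G lie. *)
  apply: (agree_segment mF _ Ep) => x _; exists `|Im s|; first by rewrite normr_gt0.
  pose q := p + rc x * (s - p); move=> w; rewrite -/q => hw; apply: hG.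
  have pI : Im p = Im s by [].
  have qI : Im q = Im s by rewrite /q !ReImE pI; ring.
  have := le_lt_trans (Im_le (w - q)) hw; rewrite ImB qI => h; rewrite -normr_gt0.
  have := ler_distD 0 (Im w) (Im s); rewrite distrC; rewrite !subr0 => h'.
  have := ler_normB (Im w) (Im w - Im s); rewrite opprB addrC subrK; lra.
have E := agree_apoint Es (hG s im0) ap.
have /andP[h1 _] := HK s s1 s2 (ltW t1).
have sz : size A = r by rewrite size_map size_enum_ord.
have S0 : 0 <= \sum_(b <- A) b.
  by rewrite big_map; apply: sumr_ge0 => i _; exact: ltW.
have ex : 1 <= (size A)%:R / 2 - (\sum_(b <- A) b) * Re s.
  have h2 : (\sum_(b <- A) b) * Re s <= 0 by rewrite mulr_ge0_le0 //; lra.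
  have h3 : 2 <= r%:R :> R by rewrite ler_nat.
  by rewrite sz; lra.
have t0 : 0 < `|Im s| by lra.
have : expR (- K + ln `|Im s|) <= cmod alpha.
  rewrite -E; apply: le_trans h1; rewrite ler_expR lerD2l.
  by rewrite -[leLHS]mul1r ler_wpM2r.
rewrite expRD expRN lnK ?posrE // mulrC ler_pdivrMr ?expR_gt0 // mulrC.
have := expR_gt0 K; move: t2; rewrite mulrDr; lra.
Qed.
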